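(* Let $A=\sum_{j+k\le 2}(-1)^{j+k}a_{kj}(\alpha D_y-\beta M_x)^j(\gamma D_x-\delta M_y)^k$ be a twisted differential operator of order $2$, with source $\tilde A=\sum_{j+k\le 2}a_{kj}M^jD^k$. The following are equivalent: (1) $A$ is globally regular on $\mathcal S'(\mathbb R^2)$; (2) $\ker\tilde A=0$ and $\tilde A$ is globally regular; (3) $\ker\tilde A=0$ and $(\tilde A)'$ is globally regular; (4) $\ker\tilde A=0$ and $\ker(\tilde A)'\subset\mathcal S(\mathbb R)$.
   Context: On $\mathcal S'(\mathbb R)$: $D=-\mathrm i\,\frac{d}{dx}$ and $M$ is multiplication by $x$. On $\mathcal S'(\mathbb R^2)$ with variables $(x,y)$: $D_x=-\mathrm i\partial_x$, $D_y=-\mathrm i\partial_y$, and $M_x,M_y$ are multiplication by $x$, $y$. A linear operator $P$ on $\mathcal S'(\mathbb R^n)$ is globally regular if for every $u\in\mathcal S'(\mathbb R^n)$, $Pu\in\mathcal S(\mathbb R^n)$ implies $u\in\mathcal S(\mathbb R^n)$. A twisted differential operator of order $m$ is an operator $A=\sum_{j+k\le m}(-1)^{j+k}a_{kj}(\alpha D_y-\beta M_x)^j(\gamma D_x-\delta M_y)^k$ on $\mathcal S'(\mathbb R^2)$, where $\alpha,\beta,\gamma,\delta\in\mathbb R$ satisfy $\alpha\delta-\beta\gamma=1$ and $\beta\delta\ne0$, and $a_{kj}\in\mathbb C$ with $\sum_{j+k=m}|a_{kj}|\ne0$. Its source is the ordinary differential operator $\tilde A=\sum_{j+k\le m}a_{kj}M^jD^k$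 on $\mathcal S'(\mathbb R)$, and $(\tilde A)'=\sum_{j+k\le m}(-1)^ka_{kj}D^kM^j$ is its transpose. Kernels are taken in $\mathcal S'(\mathbb R)$, e.g. $\ker\tilde A=\{u\in\mathcal S'(\mathbb R):\tilde Au=0\}$. *)

(* Defs.v *)
From Stdlib Require Import Reals.
Open Scope R_scope.

Record Cx := mkC { re : R ; im : R }.
Definition C0 : Cx := mkC 0 0.
Definition C1 : Cx := mkC 1 0.
Definition Ci : Cx := mkC 0 1.
Definition RtoC (r : R) : Cx := mkC r 0.
Definition Cadd (z w : Cx) : Cx := mkC (re z + re w) (im z + im w).
Definition Copp (z : Cx) : Cx := mkC (- re z) (- im z).
Definition Csub (z w : Cx) : Cx := Cadd z (Copp w).
Definition Cmul (z w : Cx) : Cx :=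
  mkC (re z * re w - im z * im w) (re z * im w + im z * re w).
Definition Cmod (z : Cx) : R := sqrt (re z ^ 2 + im z ^ 2).
Definition Csign (k : nat) : Cx := if Nat.even k then C1 else Copp C1.
Fixpoint csum (n : nat) (f : nat -> Cx) : Cx :=
  match n with O => C0 | S n' => Cadd (csum n' f) (f n') end.

Definition int1 (h : R -> R) (l : R) : Prop :=
  forall eps, 0 < eps -> exists A, 0 < A /\
    forall a b, a <= - A -> A <= b ->
      exists pr : Riemann_integrable h a b, Rabs (RiemannInt pr - l) < eps.
Definition cint1 (h : R -> Cx) (l : Cx) : Prop :=
  int1 (fun x => re (h x)) (re l) /\ int1 (fun x => im (h x)) (im l).
Definition cint2 (h : R -> R -> Cx) (l : Cx) : Prop :=
  exists g : R -> Cx, (forall y, cint1 (fun x => h x y) (g y)) /\ cint1 g l.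

(* ---------- Schwartz functions on R ----------
   A test function phi is represented together with the family of all its
   derivatives: F n = phi^(n) (F 0 = phi).  This family is uniquely
   determined by phi. *)
Definition fam1 := nat -> R -> Cx.
Definition schwartz1 (F : fam1) : Prop :=
  (forall n x, derivable_pt_lim (fun t => re (F n t)) x (re (F (S n) x)) /\
               derivable_pt_lim (fun t => im (F n t)) x (im (F (S n) x))) /\
  (forall j n, exists C, forall x, Rabs x ^ j * Cmod (F n x) <= C).

Definition fam1_add (F G : fam1) : fam1 := fun n x => Cadd (F n x) (G n x).
Definition fam1_scal (c : Cx) (F : fam1) : fam1 := fun n x => Cmul c (F n x).

(* D = -i d/dx and M = multiplication by x, acting on test functions
   (with their derivative families, via the Leibniz rule). *)
Definition tD1 (F : fam1) : fam1 := fun n x => Cmul (Copp Ci) (F (S n) x).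
Definition tM1 (F : fam1) : fam1 :=
  fun n x => Cadd (Cmul (RtoC x) (F n x)) (Cmul (RtoC (INR n)) (F (pred n) x)).

Definition distR := fam1 -> Cx.
Definition tempered1 (u : distR) : Prop :=
  (forall F G, schwartz1 F -> schwartz1 G -> u (fam1_add F G) = Cadd (u F) (u G)) /\
  (forall c F, schwartz1 F -> u (fam1_scal c F) = Cmul c (u F)) /\
  (exists N C, forall F Mb, schwartz1 F ->
      (forall j k x, (j <= N)%nat -> (k <= N)%nat -> Rabs x ^ j * Cmod (F k x) <= Mb) ->
      Cmod (u F) <= C * Mb).
Definition inS1 (u : distR) : Prop :=
  exists G, schwartz1 G /\
    forall F, schwartz1 F -> cint1 (fun x => Cmul (G 0%nat x) (F 0%nat x)) (u F).

Definition DD (u : distR) : distR := fun F => Copp (u (tD1 F)).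
Definition MM (u : distR) : distR := fun F => u (tM1 F).

Definition source (m : nat) (a : nat -> nat -> Cx) (u : distR) : distR :=
  fun F => csum (S m) (fun j => csum (S m) (fun k =>
    if (j + k <=? m)%nat
    then Cmul (a k j) (Nat.iter j MM (Nat.iter k DD u) F) else C0)).
Definition source_t (m : nat) (a : nat -> nat -> Cx) (u : distR) : distR :=
  fun F => csum (S m) (fun j => csum (S m) (fun k =>
    if (j + k <=? m)%nat
    then Cmul (Cmul (Csign k) (a k j)) (Nat.iter k DD (Nat.iter j MM u) F) else C0)).

Definition glob_reg1 (P : distR -> distR) : Prop :=
  forall u, tempered1 u -> inS1 (P u) -> inS1 u.
Definition ker_zero1 (P : distR -> distR) : Prop :=
  forall u, tempered1 u -> (forall F, schwartz1 F -> P u F = C0) ->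
    forall F, schwartz1 F -> u F = C0.
Definition ker_in_S1 (P : distR -> distR) : Prop :=
  forall u, tempered1 u -> (forall F, schwartz1 F -> P u F = C0) -> inS1 u.

(* ---------- Schwartz functions on R^2 ----------
   F a b = d_x^a d_y^b phi. *)
Definition fam2 := nat -> nat -> R -> R -> Cx.
Definition schwartz2 (F : fam2) : Prop :=
  (forall a b x y,
     derivable_pt_lim (fun t => re (F a b t y)) x (re (F (S a) b x y)) /\
     derivable_pt_lim (fun t => im (F a b t y)) x (im (F (S a) b x y)) /\
     derivable_pt_lim (fun t => re (F a b x t)) y (re (F a (S b) x y)) /\
     derivable_pt_lim (fun t => im (F a b x t)) y (im (F a (S b) x y))) /\
  (forall j1 j2 a b, exists C, forall x y,
     Rabs x ^ j1 * Rabs y ^ j2 * Cmod (F a b x y) <= C).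

Definition fam2_add (F G : fam2) : fam2 := fun a b x y => Cadd (F a b x y) (G a b x y).
Definition fam2_scal (c : Cx) (F : fam2) : fam2 := fun a b x y => Cmul c (F a b x y).

Definition tDx (F : fam2) : fam2 := fun a b x y => Cmul (Copp Ci) (F (S a) b x y).
Definition tDy (F : fam2) : fam2 := fun a b x y => Cmul (Copp Ci) (F a (S b) x y).
Definition tMx (F : fam2) : fam2 := fun a b x y =>
  Cadd (Cmul (RtoC x) (F a b x y)) (Cmul (RtoC (INR a)) (F (pred a) b x y)).
Definition tMy (F : fam2) : fam2 := fun a b x y =>
  Cadd (Cmul (RtoC y) (F a b x y)) (Cmul (RtoC (INR b)) (F a (pred b) x y)).

Definition distR2 := fam2 -> Cx.
Definition tempered2 (u : distR2) : Prop :=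
  (forall F G, schwartz2 F -> schwartz2 G -> u (fam2_add F G) = Cadd (u F) (u G)) /\
  (forall c F, schwartz2 F -> u (fam2_scal c F) = Cmul c (u F)) /\
  (exists N C, forall F Mb, schwartz2 F ->
      (forall j1 j2 a b x y, (j1 <= N)%nat -> (j2 <= N)%nat -> (a <= N)%nat -> (b <= N)%nat ->
         Rabs x ^ j1 * Rabs y ^ j2 * Cmod (F a b x y) <= Mb) ->
      Cmod (u F) <= C * Mb).
Definition inS2 (u : distR2) : Prop :=
  exists G, schwartz2 G /\
    forall F, schwartz2 F ->
      cint2 (fun x y => Cmul (G 0%nat 0%nat x y) (F 0%nat 0%nat x y)) (u F).

Definition DDx (u : distR2) : distR2 := fun F => Copp (u (tDx F)).
Definition DDy (u : distR2) : distR2 := fun F => Copp (u (tDy F)).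
Definition MMx (u : distR2) : distR2 := fun F => u (tMx F).
Definition MMy (u : distR2) : distR2 := fun F => u (tMy F).

Definition L1 (al be : R) (u : distR2) : distR2 :=
  fun F => Csub (Cmul (RtoC al) (DDy u F)) (Cmul (RtoC be) (MMx u F)).
Definition L2 (ga de : R) (u : distR2) : distR2 :=
  fun F => Csub (Cmul (RtoC ga) (DDx u F)) (Cmul (RtoC de) (MMy u F)).

Definition twisted (m : nat) (a : nat -> nat -> Cx) (al be ga de : R)
    (u : distR2) : distR2 :=
  fun F => csum (S m) (fun j => csum (S m) (fun k =>
    if (j + k <=? m)%nat
    then Cmul (Cmul (Csign (j + k)) (a k j))
              (Nat.iter j (L1 al be) (Nat.iter k (L2 ga de) u) F)
    else C0)).

Definition glob_reg2 (P : distR2 -> distR2) : Prop :=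
  forall u, tempered2 u -> inS2 (P u) -> inS2 u.

(* Main.v *)
(** Tempered distributions and Schwartz functions are handled through their Hermite coefficients: polynomially bounded and
    rapidly decreasing (double) sequences, on which [M] and [D] act by the creation and annihilation shifts. A partial Fourier
    transform and shears carry the twisted operator to its source acting in the first of two variables, so (1) says that the
    source is regular uniformly in a parameter; this is equivalent to injectivity plus regularity by a gliding hump argument.
    What remains is a dichotomy for an injective second order ordinary operator: either it and its transpose are both regular,
    or it is not regular and the transpose has a kernel element outside the Schwartz space. Rotations of the phase plane
    preserve the dichotomy. If the principal symbol has no real zero the operator is elliptic and gains regularity. Otherwise a
    rotation makes it of first order in [D]. If its leading coefficient has no real zero, everything is decided by the growth of
    the explicit solutions at the two ends; at a real zero, solutions of finite smoothness there give the second alternative. *)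
From Stdlib Require Import Reals Arith Lra Lia FunctionalExtensionality ClassicalEpsilon.
From Coquelicot Require Import Rcomplements Rbar Lim_seq Hierarchy Continuity Derive RInt RInt_analysis Series AutoDerive.
Require Import Defs.
Open Scope R_scope.
Set Bullet Behavior "Strict Subproofs".

(** * Complex numbers *)

(* Regularity uniform in a parameter contains injectivity: a kernel element times a fixed tempered
   factor in the second variable would be a counterexample. In (4) the kernel of the transpose has
   to be Schwartz, not zero, because an injective regular operator can miss a line: when all its
   solutions grow at both ends, its range on Schwartz functions is the orthogonal of an explicit
   Schwartz function, and this function spans the kernel of the transpose. Once the dichotomy is
   known, the equivalence of (2), (3) and (4) is propositional, since regularity of the transpose
   puts its kernel in the Schwartz space. At a real zero c of the leading coefficient, solutions
   behave like a complex power of x - c and are continuous functions only for a half plane of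
   exponents. The other exponents are reached by a first order operator that shifts the exponent by
   one; the delta function at c starts the chain for those that the shift cannot reach from the half
   plane. *)
Declare Scope cx_scope.
Delimit Scope cx_scope with cx.
Bind Scope cx_scope with Cx.
Infix "+" := Cadd : cx_scope.
Infix "*" := Cmul : cx_scope.
Infix "-" := Csub : cx_scope.
Notation "- z" := (Copp z) : cx_scope.

Lemma Cx_ext (z w : Cx) : re z = re w -> im z = im w -> z = w.
Proof. destruct z, w; simpl; intros; subst; reflexivity. Qed.

Ltac cxsimpl := cbn [re im Cadd Cmul Copp Csub RtoC C0 C1 Ci].
Ltac cxring := apply Cx_ext; cxsimpl; ring.

Definition Cinv (z : Cx) : Cx :=
  mkC (re z / (re z ^ 2 + im z ^ 2)) (- im z / (re z ^ 2 + im z ^ 2)).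
Definition Cdiv (z w : Cx) : Cx := Cmul z (Cinv w).
Definition Cconj (z : Cx) : Cx := mkC (re z) (- im z).

Lemma Cnorm2_pos (z : Cx) : z <> C0 -> 0 < re z ^ 2 + im z ^ 2.
Proof.
  intros H. destruct z as [a b]; simpl.
  destruct (Req_dec a 0) as [Ha|Ha]; [destruct (Req_dec b 0) as [Hb|Hb]|].
  - subst. easy.
  - nra.
  - nra.
Qed.

Lemma Cinv_l (z : Cx) : z <> C0 -> (Cinv z * z)%cx = C1.
Proof.
  intros H. pose proof (Cnorm2_pos z H). apply Cx_ext; unfold Cinv; cxsimpl; field; lra.
Qed.

Lemma Cx_ring_th : ring_theory C0 C1 Cadd Cmul Csub Copp (@eq Cx).
Proof. constructor; intros; cxring. Qed.

Lemma C1_neq_C0 : C1 <> C0.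
Proof. intros H. apply (f_equal re) in H. cbn in H. lra. Qed.

Lemma Cx_field_th : field_theory C0 C1 Cadd Cmul Csub Copp Cdiv Cinv (@eq Cx).
Proof.
  constructor.
  - exact Cx_ring_th.
  - exact C1_neq_C0.
  - auto.
  - exact Cinv_l.
Qed.
Add Field Cx_field : Cx_field_th.

Lemma RtoC_add (x y : R) : RtoC (x + y) = (RtoC x + RtoC y)%cx.
Proof. cxring. Qed.
Lemma RtoC_mul (x y : R) : RtoC (x * y) = (RtoC x * RtoC y)%cx.
Proof. cxring. Qed.
Lemma Ci2 : (Ci * Ci)%cx = (- C1)%cx.
Proof. cxring. Qed.

Lemma Cmod_ge0 (z : Cx) : 0 <= Cmod z.
Proof. apply sqrt_pos. Qed.

Create HintDb nn.
#[global] Hint Resolve Rmult_le_pos Rplus_le_le_0_compat pow_le pow2_ge_0 Rabs_pos Cmod_ge0 pos_INR Rdiv_le_0_compat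
  Rmult_lt_0_compat Rdiv_lt_0_compat Rinv_0_lt_compat exp_pos pow_lt Rlt_le Rle_ge : nn.
#[global] Hint Extern 3 (_ <= _) => lra : nn.
#[global] Hint Extern 3 (_ < _) => lra : nn.
Ltac nn := auto 6 with nn.

Lemma Cmod_sq (z : Cx) : Cmod z ^ 2 = re z ^ 2 + im z ^ 2.
Proof. unfold Cmod. rewrite <- Rsqr_pow2, Rsqr_sqrt; [reflexivity|nra]. Qed.
Lemma Cmod_mul (z w : Cx) : Cmod (z * w) = Cmod z * Cmod w.
Proof.
  unfold Cmod. rewrite <- sqrt_mult; [|nra|nra]. f_equal. cxsimpl. ring.
Qed.
Lemma Cmod_RtoC (r : R) : Cmod (RtoC r) = Rabs r.
Proof.
  unfold Cmod; cxsimpl. replace (r ^ 2 + 0 ^ 2) with (Rsqr r) by (unfold Rsqr; ring).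
  apply sqrt_Rsqr_abs.
Qed.
Lemma Cmod_C0 : Cmod C0 = 0.
Proof. unfold C0. change (mkC 0 0) with (RtoC 0). rewrite Cmod_RtoC, Rabs_R0; reflexivity. Qed.
Lemma Cmod_C1 : Cmod C1 = 1.
Proof. change C1 with (RtoC 1). rewrite Cmod_RtoC, Rabs_R1; reflexivity. Qed.
Lemma Cmod_Ci : Cmod Ci = 1.
Proof. unfold Cmod; cxsimpl. replace (0 ^ 2 + 1 ^ 2) with 1 by ring. apply sqrt_1. Qed.
Lemma Cmod_opp (z : Cx) : Cmod (- z) = Cmod z.
Proof. unfold Cmod; cxsimpl; f_equal; ring. Qed.
Lemma re_le_Cmod (z : Cx) : Rabs (re z) <= Cmod z.
Proof. rewrite <- sqrt_Rsqr_abs. apply sqrt_le_1_alt. unfold Rsqr. nra.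
Qed.
Lemma im_le_Cmod (z : Cx) : Rabs (im z) <= Cmod z.
Proof. rewrite <- sqrt_Rsqr_abs. apply sqrt_le_1_alt. unfold Rsqr. nra.
Qed.
Lemma Cmod_le_re_im (z : Cx) : Cmod z <= Rabs (re z) + Rabs (im z).
Proof.
  pose proof (Rabs_pos (re z)). pose proof (Rabs_pos (im z)).
  apply Rsqr_incr_0_var; [|lra]. rewrite !Rsqr_pow2, Cmod_sq.
  rewrite <- (pow2_abs (re z)), <- (pow2_abs (im z)). nra.
Qed.
Lemma Cmod_tri (z w : Cx) : Cmod (z + w) <= Cmod z + Cmod w.
Proof.
  pose proof (Cmod_ge0 z). pose proof (Cmod_ge0 w).
  apply Rsqr_incr_0_var; [|lra]. rewrite !Rsqr_pow2.
  replace ((Cmod z + Cmod w) ^ 2) with (Cmod z ^ 2 + Cmod w ^ 2 + 2 * (Cmod z * Cmod w)) by ring.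
  rewrite !Cmod_sq. cxsimpl.
  assert (re z * re w + im z * im w <= Cmod z * Cmod w); [|nra].
  apply Rsqr_incr_0_var; [|nra]. rewrite !Rsqr_pow2, Rpow_mult_distr, !Cmod_sq.
  pose proof (pow2_ge_0 (re z * im w - im z * re w)). nra.
Qed.
Lemma Cmod_sub_le (z w : Cx) : Cmod (z - w) <= Cmod z + Cmod w.
Proof. rewrite <- (Cmod_opp w). apply Cmod_tri. Qed.
Lemma Cmod_eq0 (z : Cx) : Cmod z = 0 -> z = C0.
Proof.
  intros H. pose proof (Cmod_sq z) as E.
  apply Cx_ext; cxsimpl; nra.
Qed.
Lemma Cmod_pos (z : Cx) : z <> C0 -> 0 < Cmod z.
Proof.
  intros H. destruct (Cmod_ge0 z) as [h|h]; [exact h|]. exfalso. apply H, Cmod_eq0; auto.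
Qed.
Lemma Cmod_inv (z : Cx) : z <> C0 -> Cmod (Cinv z) = / Cmod z.
Proof.
  intros H. pose proof (Cmod_pos z H).
  apply Rmult_eq_reg_r with (Cmod z); [|lra].
  rewrite <- Cmod_mul, Cinv_l, Cmod_C1 by assumption. field. lra.
Qed.
Lemma Cmul_eq0 (z w : Cx) : (z * w)%cx = C0 -> z = C0 \/ w = C0.
Proof.
  intros H. apply (f_equal Cmod) in H. rewrite Cmod_mul, Cmod_C0 in H.
  apply Rmult_integral in H. destruct H as [H|H]; [left|right]; apply Cmod_eq0; exact H.
Qed.
Lemma Cmul_conj (z : Cx) : (z * Cconj z)%cx = RtoC (Cmod z ^ 2).
Proof. rewrite Cmod_sq. apply Cx_ext; unfold Cconj; cxsimpl; ring. Qed.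
Lemma Cmod_sub_lower (z w : Cx) : Cmod z - Cmod w <= Cmod (z - w).
Proof.
  assert (E : z = ((z - w) + w)%cx) by cxring.
  pose proof (Cmod_tri (z - w) w). rewrite <- E in H. lra.
Qed.

(** The half-angle formulas give the absolute values of the two parts of a root, and the sign of
    [im z] decides their relative sign. *)
Lemma Cx_sqrt_ex (z : Cx) : exists w, (w * w)%cx = z.
Proof.
  pose proof (re_le_Cmod z) as H. pose proof (Cmod_sq z) as E.
  destruct (Rabs_le_between (re z) (Cmod z)) as [h _].
  set (u := sqrt ((Cmod z + re z) / 2)). set (v := sqrt ((Cmod z - re z) / 2)).
  assert (Hu : u * u = (Cmod z + re z) / 2) by (apply sqrt_sqrt; lra).
  assert (Hv : v * v = (Cmod z - re z) / 2) by (apply sqrt_sqrt; lra).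
  assert (u0 : 0 <= u) by apply sqrt_pos. assert (v0 : 0 <= v) by apply sqrt_pos.
  assert (Hp : 0 <= u * v) by nra.
  destruct (Rle_or_lt 0 (im z)) as [hi|hi].
  - exists (mkC u v). apply Cx_ext; cxsimpl; [lra|].
    nra.
  - exists (mkC u (- v)). apply Cx_ext; cxsimpl; [lra|].
    nra.
Qed.

(** * Integration over the line *)

Definition cder (f : R -> Cx) (x : R) (l : Cx) : Prop :=
  is_derive (fun t => re (f t)) x (re l) /\ is_derive (fun t => im (f t)) x (im l).
Definition ccont (f : R -> Cx) (x : R) : Prop :=
  continuous (fun t => re (f t)) x /\ continuous (fun t => im (f t)) x.

Lemma is_derive_continuous (f : R -> R) x l : is_derive f x l -> continuous f x.
Proof. intros H. apply (ex_derive_continuous f x). exists l. auto. Qed.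

Lemma cder_ccont f x l : cder f x l -> ccont f x.
Proof. intros [H1 H2]. split; eapply is_derive_continuous; eassumption. Qed.

Lemma cder_eq f x l l' : cder f x l -> l = l' -> cder f x l'.
Proof. intros H <-. auto. Qed.
Lemma cder_ext f g x l : (forall t, f t = g t) -> cder f x l -> cder g x l.
Proof.
  intros E. replace g with f; [auto|]. apply functional_extensionality; auto.
Qed.
Lemma cder_ext_loc f g x l d :
  0 < d -> (forall t, Rabs (t - x) < d -> f t = g t) -> cder f x l -> cder g x l.
Proof.
  intros hd E [H1 H2].
  split; (eapply is_derive_ext_loc; [|eassumption]); exists (mkposreal d hd);
    intros t Ht; cbn; rewrite (E t Ht); reflexivity.
Qed.
Lemma cder_unique f x l l' : cder f x l -> cder f x l' -> l = l'.
Proof.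
  intros [H1 H2] [K1 K2]. apply Cx_ext.
  - rewrite <- (is_derive_unique _ _ _ H1). apply is_derive_unique. auto.
  - rewrite <- (is_derive_unique _ _ _ H2). apply is_derive_unique. auto.
Qed.
Lemma cder_const c x : cder (fun _ => c) x C0.
Proof. split; cbn; apply (is_derive_const (V := R_NormedModule)). Qed.
Lemma cder_add f g x l k : cder f x l -> cder g x k -> cder (fun t => f t + g t)%cx x (l + k)%cx.
Proof. intros [H1 H2] [K1 K2]. split; cbn; apply (is_derive_plus (V := R_NormedModule)); assumption. Qed.
Lemma cder_opp f x l : cder f x l -> cder (fun t => - f t)%cx x (- l)%cx.
Proof. intros [H1 H2]. split; cbn; apply (is_derive_opp (V := R_NormedModule)); assumption. Qed.
Lemma cder_sub f g x l k : cder f x l -> cder g x k -> cder (fun t => f t - g t)%cx x (l - k)%cx.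
Proof. intros H K. apply cder_add; [|apply cder_opp]; assumption. Qed.
Lemma is_derive_mult_R (f g : R -> R) x l k :
  is_derive f x l -> is_derive g x k -> is_derive (fun t => f t * g t) x (l * g x + f x * k).
Proof. intros H K. apply (is_derive_mult f g x l k); auto. Qed.
Lemma is_derive_eq (f : R -> R) x l l' : is_derive f x l -> l = l' -> is_derive f x l'.
Proof. intros H <-; exact H. Qed.
Lemma cder_mul f g x l k :
  cder f x l -> cder g x k -> cder (fun t => f t * g t)%cx x (l * g x + f x * k)%cx.
Proof.
  intros [H1 H2] [K1 K2]. split; cbn.
  - eapply is_derive_eq. { apply (is_derive_minus (V := R_NormedModule)); apply is_derive_mult_R; eassumption. }
    unfold minus, plus, opp; cbn. ring.
  - eapply is_derive_eq. { apply (is_derive_plus (V := R_NormedModule)); apply is_derive_mult_R; eassumption. }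
    unfold minus, plus, opp; cbn. ring.
Qed.
Lemma cder_scal c f x l : cder f x l -> cder (fun t => c * f t)%cx x (c * l)%cx.
Proof. intros H. eapply cder_eq; [apply cder_mul; [apply cder_const|exact H]|]. cbv beta. ring. Qed.
Lemma cder_RtoC (f : R -> R) x l : is_derive f x l -> cder (fun t => RtoC (f t)) x (RtoC l).
Proof. intros H. split; cbn; [exact H|apply (is_derive_const (V := R_NormedModule))]. Qed.
Lemma cder_id x : cder RtoC x C1.
Proof. apply (cder_RtoC (fun t => t)). apply (is_derive_id (K := R_AbsRing)). Qed.
Lemma cder_comp f (g : R -> R) x l k :
  cder f (g x) l -> is_derive g x k -> cder (fun t => f (g t)) x (RtoC k * l)%cx.
Proof.
  intros [H1 H2] K. split; cbn.
  - eapply is_derive_eq. { exact (is_derive_comp (fun t => re (f t)) g x _ _ H1 K). } cbn; unfold scal; cbn; unfold mult; cbn. ring.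
  - eapply is_derive_eq. { exact (is_derive_comp (fun t => im (f t)) g x _ _ H2 K). } cbn; unfold scal; cbn; unfold mult; cbn. ring.
Qed.
Lemma is_derive_affine (s c x : R) : is_derive (fun t => s * t + c) x s.
Proof. auto_derive; [trivial|ring]. Qed.

Lemma ccont_const c x : ccont (fun _ => c) x.
Proof. eapply cder_ccont, cder_const. Qed.
Lemma ccont_add f g x : ccont f x -> ccont g x -> ccont (fun t => f t + g t)%cx x.
Proof. intros [H1 H2] [K1 K2]; split; cbn; apply (continuous_plus (V := R_NormedModule)); assumption. Qed.
Lemma ccont_opp f x : ccont f x -> ccont (fun t => - f t)%cx x.
Proof. intros [H1 H2]; split; cbn; apply (continuous_opp (V := R_NormedModule)); assumption. Qed.
Lemma ccont_mul f g x : ccont f x -> ccont g x -> ccont (fun t => f t * g t)%cx x.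
Proof.
  intros [H1 H2] [K1 K2]; split; cbn.
  - apply (continuous_minus (V := R_NormedModule)); apply (continuous_mult (K := R_AbsRing)); assumption.
  - apply (continuous_plus (V := R_NormedModule)); apply (continuous_mult (K := R_AbsRing)); assumption.
Qed.
Lemma ccont_RtoC (f : R -> R) x : continuous f x -> ccont (fun t => RtoC (f t)) x.
Proof. intros H; split; cbn; [exact H|apply continuous_const]. Qed.
Lemma ccont_ext f g x : (forall t, f t = g t) -> ccont f x -> ccont g x.
Proof. intros E. replace g with f; [auto|]. apply functional_extensionality; auto. Qed.
Lemma ccont_id x : ccont RtoC x.
Proof. eapply cder_ccont, cder_id. Qed.

Lemma MVT_ex (f df : R -> R) a b :
  a < b -> (forall x, a <= x <= b -> is_derive f x (df x)) ->
  exists c, a <= c <= b /\ f b - f a = df c * (b - a).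
Proof.
  intros ab H. destruct (MVT_gen f a b df) as (c & hc & e).
  - rewrite Rmin_left, Rmax_right by lra. nn.
  - rewrite Rmin_left, Rmax_right by lra. intros x hx.
    apply continuity_pt_filterlim. eapply is_derive_continuous, H; lra.
  - rewrite Rmin_left, Rmax_right in hc by lra. exists c; auto.
Qed.

Lemma derive_compare (f g df dg : R -> R) a b :
  a <= b -> (forall x, a <= x <= b -> is_derive f x (df x)) ->
  (forall x, a <= x <= b -> is_derive g x (dg x)) ->
  (forall x, a <= x <= b -> df x <= dg x) -> f b - f a <= g b - g a.
Proof.
  intros [ab|<-] Hf Hg Hl; [|lra].
  destruct (MVT_ex (fun x => g x - f x) (fun x => dg x - df x) a b ab) as (c & hc & e).
  - intros x hx. apply (is_derive_minus (V := R_NormedModule)); auto.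
  - specialize (Hl c hc). nra.
Qed.

Lemma derive_compare_abs (f g df dg : R -> R) a b :
  a <= b -> (forall x, a <= x <= b -> is_derive f x (df x)) ->
  (forall x, a <= x <= b -> is_derive g x (dg x)) ->
  (forall x, a <= x <= b -> Rabs (df x) <= dg x) -> Rabs (f b - f a) <= g b - g a.
Proof.
  intros ab Hf Hg Hl. apply Rabs_le. split.
  - pose proof (derive_compare (fun x => - f x) g (fun x => - df x) dg a b ab) as K.
    enough (- f b - - f a <= g b - g a) by lra. apply K; auto.
    + intros; apply (is_derive_opp (V := R_NormedModule)); auto.
    + intros x hx. specialize (Hl x hx). apply Rabs_le_between in Hl; lra.
  - apply derive_compare with df dg; auto. intros x hx. specialize (Hl x hx). apply Rabs_le_between in Hl; lra.
Qed.

Lemma lipschitz_of_derive (f df : R -> R) M :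
  (forall x : R, is_derive f x (df x)) -> (forall x, Rabs (df x) <= M) ->
  forall x y, Rabs (f y - f x) <= M * Rabs (y - x).
Proof.
  intros Hf Hb.
  assert (K : forall a b, a <= b -> Rabs (f b - f a) <= M * (b - a)).
  { intros a b ab.
    replace (M * (b - a)) with ((fun x => M * x + 0) b - (fun x => M * x + 0) a) by lra.
    apply (derive_compare_abs f (fun x => M * x + 0) df (fun _ => M)); auto.
    intros; apply is_derive_affine. }
  intros x y. destruct (Rle_or_lt x y) as [h|h].
  - rewrite (Rabs_right (y - x)) by lra. auto.
  - rewrite Rabs_minus_sym, (Rabs_left (y - x)) by lra. replace (- (y - x)) with (x - y) by ring. nn.
Qed.

(** The mean value theorem applied to [f t - f1 x * t], whose derivative is at most [M * Rabs h]
    between [x] and [x + h]; hence the constant [M] instead of the sharp [M / 2]. *)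
Lemma taylor2 (f f1 f2 : R -> R) M :
  (forall x : R, is_derive f x (f1 x)) -> (forall x : R, is_derive f1 x (f2 x)) ->
  (forall x, Rabs (f2 x) <= M) ->
  forall x h, Rabs (f (x + h) - f x - h * f1 x) <= M * h ^ 2.
Proof.
  intros H1 H2 Hb x h.
  assert (M0 : 0 <= M) by (specialize (Hb 0); pose proof (Rabs_pos (f2 0)); lra).
  pose proof (lipschitz_of_derive f1 f2 M H2 Hb) as L.
  assert (D : forall t, is_derive (fun t => f t - f1 x * t) t (f1 t - f1 x)).
  { intros t. apply (is_derive_minus (V := R_NormedModule)); auto. auto_derive; [trivial|ring]. }
  destruct (Rtotal_order h 0) as [hh|[hh|hh]].
  - destruct (MVT_ex (fun t => f t - f1 x * t) (fun t => f1 t - f1 x) (x + h) x) as (c & hc & e); [lra|auto|].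
    replace (f (x + h) - f x - h * f1 x) with ((f1 c - f1 x) * h) by lra.
    rewrite Rabs_mult. specialize (L x c).
    assert (Rabs (c - x) <= Rabs h) by (rewrite !Rabs_left1; lra).
    pose proof (Rabs_pos h). rewrite <- (pow2_abs h).
    assert (M * Rabs (c - x) <= M * Rabs h) by nra. nra.
  - subst. rewrite Rplus_0_r. replace (f x - f x - 0 * f1 x) with 0 by ring. rewrite Rabs_R0. nra.
  - destruct (MVT_ex (fun t => f t - f1 x * t) (fun t => f1 t - f1 x) x (x + h)) as (c & hc & e); [lra|auto|].
    replace (f (x + h) - f x - h * f1 x) with ((f1 c - f1 x) * h) by lra.
    rewrite Rabs_mult. specialize (L x c).
    assert (Rabs (c - x) <= Rabs h) by (rewrite !Rabs_right; lra).
    pose proof (Rabs_pos h). rewrite <- (pow2_abs h).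
    assert (M * Rabs (c - x) <= M * Rabs h) by nra. nra.
Qed.

(** Together with [taylor2] it replaces dominated convergence: to differentiate a series or an
    integral with a parameter, it suffices to sum or integrate a quadratic remainder. *)
Lemma derive_of_quadratic (f : R -> R) x l M :
  (forall h, Rabs h <= 1 -> Rabs (f (x + h) - f x - h * l) <= M * h ^ 2) -> is_derive f x l.
Proof.
  intros H. apply is_derive_Reals. intros eps heps.
  assert (M0 : 0 <= M).
  { specialize (H 1). rewrite Rabs_R1 in H.
    pose proof (Rabs_pos (f (x + 1) - f x - 1 * l)). lra. }
  assert (hd : 0 < Rmin 1 (eps / (M + 1))).
  { apply Rmin_pos; [lra|]. nn. }
  exists (mkposreal _ hd). cbn. intros h h0 hh.
  assert (h1 : Rabs h <= 1) by (pose proof (Rmin_l 1 (eps / (M + 1))); lra).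
  assert (h2 : Rabs h < eps / (M + 1)) by (pose proof (Rmin_r 1 (eps / (M + 1))); lra).
  specialize (H h h1). assert (hp : 0 < Rabs h) by (apply Rabs_pos_lt; auto).
  replace ((f (x + h) - f x) / h - l) with ((f (x + h) - f x - h * l) / h) by (field; lra).
  unfold Rdiv. rewrite Rabs_mult, Rabs_inv. apply Rmult_lt_reg_r with (Rabs h); auto.
  rewrite Rmult_assoc, Rinv_l, Rmult_1_r by lra. eapply Rle_lt_trans; [exact H|].
  rewrite <- (pow2_abs h).
  assert ((M + 1) * Rabs h < eps).
  { apply Rmult_lt_reg_r with (/ (M + 1)); [apply Rinv_0_lt_compat; lra|].
    replace ((M + 1) * Rabs h * / (M + 1)) with (Rabs h) by (field; lra). auto. }
  nra.
Qed.

Lemma ctaylor2 (f f1 f2 : R -> Cx) M :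
  (forall x, cder f x (f1 x)) -> (forall x, cder f1 x (f2 x)) ->
  (forall x, Cmod (f2 x) <= M) ->
  forall x h, Cmod (f (x + h)%R - f x - RtoC h * f1 x) <= 2 * M * h ^ 2.
Proof.
  intros H1 H2 Hb x h. eapply Rle_trans; [apply Cmod_le_re_im|].
  pose proof (taylor2 (fun t => re (f t)) (fun t => re (f1 t)) (fun t => re (f2 t)) M
    (fun x => proj1 (H1 x)) (fun x => proj1 (H2 x))
    (fun x => Rle_trans _ _ _ (re_le_Cmod _) (Hb x)) x h) as A.
  pose proof (taylor2 (fun t => im (f t)) (fun t => im (f1 t)) (fun t => im (f2 t)) M
    (fun x => proj2 (H1 x)) (fun x => proj2 (H2 x))
    (fun x => Rle_trans _ _ _ (im_le_Cmod _) (Hb x)) x h) as B. cxsimpl.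
  match goal with |- Rabs ?u + Rabs ?v <= _ =>
    replace u with (re (f (x + h)) - re (f x) - h * re (f1 x)) by ring;
    replace v with (im (f (x + h)) - im (f x) - h * im (f1 x)) by ring end.
  lra.
Qed.

Lemma cder_of_quadratic (f : R -> Cx) x l M :
  (forall h, Rabs h <= 1 -> Cmod (f (x + h)%R - f x - RtoC h * l) <= M * h ^ 2) -> cder f x l.
Proof.
  intros H. split; apply derive_of_quadratic with M; intros h hh; specialize (H h hh).
  - pose proof (re_le_Cmod (f (x + h)%R - f x - RtoC h * l)) as K. cbn in K.
    replace (re (f (x + h)) - re (f x) - h * re l) with
      (re (f (x + h)) + - re (f x) + - (h * re l - 0 * im l)) by ring. lra.
  - pose proof (im_le_Cmod (f (x + h)%R - f x - RtoC h * l)) as K. cbn in K.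
    replace (im (f (x + h)) - im (f x) - h * im l) with
      (im (f (x + h)) + - im (f x) + - (h * im l + 0 * re l)) by ring. lra.
Qed.

(** * Limits at infinity *)

Definition limp (H : R -> R) (l : R) : Prop :=
  forall eps, 0 < eps -> exists X, forall x, X <= x -> Rabs (H x - l) < eps.
Definition limm (H : R -> R) (l : R) : Prop := limp (fun x => H (- x)) l.

Lemma limp_is_lim H l : limp H l <-> is_lim H p_infty l.
Proof.
  rewrite <- is_lim_spec. split; intros A e.
  - destruct (A e (cond_pos e)) as (X & hX). exists X. nn.
  - intros he. destruct (A (mkposreal e he)) as (X & hX). exists (X + 1). nn.
Qed.
Lemma limp_unique H l l' : limp H l -> limp H l' -> l = l'.
Proof.
  intros A%limp_is_lim%is_lim_unique B%limp_is_lim%is_lim_unique. rewrite A in B. injection B; auto.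
Qed.
Lemma limp_add H K l k : limp H l -> limp K k -> limp (fun x => H x + K x) (l + k).
Proof. rewrite !limp_is_lim. apply is_lim_plus'. Qed.
Lemma limp_scal H l c : limp H l -> limp (fun x => c * H x) (c * l).
Proof. rewrite !limp_is_lim. apply (is_lim_scal_l H c p_infty l). Qed.
Lemma limp_ext H K l : (forall x, H x = K x) -> limp H l -> limp K l.
Proof. intros E. rewrite (functional_extensionality _ _ E). auto. Qed.

(** Comparison with [- k / s] shows that [q] is Cauchy at infinity and moves by at most [k / X]
    beyond [X], which [1 <= X] turns into [k]. *)
Lemma limp_tail (q dq : R -> R) X k :
  1 <= X -> (forall s, X <= s -> is_derive q s (dq s)) -> (forall s, X <= s -> Rabs (dq s) * s ^ 2 <= k) ->
  exists L, limp q L /\ Rabs (L - q X) <= k.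
Proof.
  intros h1 HD H.
  assert (k0 : 0 <= k) by (specialize (H X (Rle_refl _)); pose proof (Rabs_pos (dq X)); pose proof (pow2_ge_0 X); nra).
  assert (iv : forall s, X <= s -> 0 <= k * / s <= k).
  { intros s hs. assert (0 < / s) by nn. assert (/ s <= 1) by (rewrite <- Rinv_1; apply Rinv_le_contravar; lra). nra. }
  assert (Cau : forall t s, X <= t <= s -> Rabs (q s - q t) <= k * / t).
  { intros t s hts. apply Rle_trans with (- k * / s - - k * / t); [|pose proof (iv s ltac:(lra)); lra].
    apply (derive_compare_abs q (fun x => - k * / x) dq (fun x => k * / x ^ 2)); [lra|intros; apply HD; lra| |].
    - intros x hx. auto_derive; [lra|field; lra].
    - intros x hx. apply Rmult_le_reg_r with (x ^ 2); [nra|]. rewrite Rmult_assoc, Rinv_l, Rmult_1_r by nra. nn. }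
  destruct (proj1 (filterlim_locally_cauchy (U := R_CompleteSpace) (F := Rbar_locally p_infty) q)) as [L HL].
  { intros [e he]. set (Y := X + (2 * k + 1) / e). assert (0 < (2 * k + 1) / e) by nn.
    exists (fun x => Y < x). split; [exists Y; auto|]. intros u v hu hv. change (Rabs (q v - q u) < e).
    pose proof (Cau Y u ltac:(unfold Y in *; lra)). pose proof (Cau Y v ltac:(unfold Y in *; lra)).
    assert (k * / Y < e / 2).
    { apply Rmult_lt_reg_r with Y; [unfold Y; lra|]. rewrite Rmult_assoc, Rinv_l, Rmult_1_r by (unfold Y; lra).
      unfold Y. replace (e / 2 * (X + (2 * k + 1) / e)) with (e / 2 * X + k + / 2) by (field; lra). nra. }
    replace (q v - q u) with ((q v - q Y) - (q u - q Y)) by ring. eapply Rle_lt_trans; [apply Rabs_triang|]. rewrite Rabs_Ropp. lra. }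
  exists L. assert (lp : limp q L) by (apply limp_is_lim; exact HL). split; [exact lp|].
  apply le_epsilon. intros e he. destruct (lp e he) as (Y & HY). specialize (HY (Rmax X Y) (Rmax_r _ _)). pose proof (Rmax_l X Y).
  pose proof (Cau X (Rmax X Y) ltac:(lra)). pose proof (iv X (Rle_refl _)).
  replace (L - q X) with (q (Rmax X Y) - q X - (q (Rmax X Y) - L)) by ring. eapply Rle_trans; [apply Rabs_triang|]. rewrite Rabs_Ropp. lra.
Qed.
Lemma limp_ex (H h : R -> R) C :
  (forall x : R, is_derive H x (h x)) -> (forall x, Rabs (h x) * (1 + x ^ 2) <= C) ->
  exists l, limp H l /\ Rabs (l - H 0) <= 2 * C.
Proof.
  intros Hd Hb. assert (p : forall x, Rabs (h x) <= C /\ Rabs (h x) * x ^ 2 <= C).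
  { intros x. specialize (Hb x). pose proof (Rabs_pos (h x)). nra. }
  destruct (limp_tail H h 1 C) as (l & A & B); [lra|auto|intros; apply p|]. exists l. split; [exact A|].
  assert (D : Rabs (H 1 - H 0) <= (fun t => C * t + 0) 1 - (fun t => C * t + 0) 0).
  { apply (derive_compare_abs H (fun t => C * t + 0) h (fun _ => C)); auto; [lra|intros; apply is_derive_affine|intros; apply p]. }
  replace (l - H 0) with ((l - H 1) + (H 1 - H 0)) by ring. eapply Rle_trans; [apply Rabs_triang|]. lra.
Qed.

Lemma limp_zero (H : R -> R) C : (forall x, Rabs (H x) * (1 + x ^ 2) <= C) -> limp H 0.
Proof.
  intros Hb eps he.
  assert (C0 : 0 <= C) by (specialize (Hb 0); pose proof (Rabs_pos (H 0)); nra).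
  exists (C / eps + 1). intros x hx. rewrite Rminus_0_r.
  assert (q : 0 <= C / eps) by nn.
  specialize (Hb x).
  assert (C < eps * x). { apply Rmult_lt_reg_r with (/ eps); [apply Rinv_0_lt_compat; lra|].
    replace (eps * x * / eps) with x by (field; lra). lra. }
  nra.
Qed.

(** * Integrals of functions of order 1/(1 + x^2) *)

Definition nice (h : R -> R) : Prop :=
  (forall x, continuous h x) /\ exists C, forall x, Rabs (h x) * (1 + x ^ 2) <= C.
(** The integral as a total function: [epsilon] returns the value whenever there is one, so
    identities are rewritten without carrying existence proofs. *)
Definition I (h : R -> R) : R := epsilon (inhabits 0) (int1 h).

Lemma int1_unique h l l' : int1 h l -> int1 h l' -> l = l'.
Proof.
  intros A B. apply Rminus_diag_uniq. apply Rabs_eq_0. apply Rle_antisym; [|apply Rabs_pos].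
  apply le_epsilon. intros eps he. destruct (A (eps / 2)) as (X & x0 & hX); [lra|].
  destruct (B (eps / 2)) as (Y & y0 & hY); [lra|].
  set (Z := Rmax X Y). assert (X <= Z) by apply Rmax_l. assert (Y <= Z) by apply Rmax_r.
  destruct (hX (- Z) Z) as (p1 & h1); [lra|lra|]. destruct (hY (- Z) Z) as (p2 & h2); [lra|lra|].
  rewrite (RiemannInt_P5 p2 p1) in h2.
  replace (l - l') with ((RiemannInt p1 - l') - (RiemannInt p1 - l)) by ring.
  eapply Rle_trans; [apply Rabs_triang|]. rewrite Rabs_Ropp. lra.
Qed.
Lemma I_eq h l : int1 h l -> I h = l.
Proof.
  intros A. apply int1_unique with h; [|exact A].
  unfold I. apply epsilon_spec. exists l; exact A.
Qed.
Lemma int1_char (H h : R -> R) lp lm :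
  (forall x, continuous h x) -> (forall x : R, is_derive H x (h x)) ->
  limp H lp -> limm H lm -> int1 h (lp - lm).
Proof.
  intros Hc Hd A B eps he. destruct (A (eps / 2)) as (X & hX); [lra|].
  destruct (B (eps / 2)) as (Y & hY); [lra|].
  set (Z := Rmax 1 (Rmax X Y)). assert (X <= Z /\ Y <= Z /\ 1 <= Z) as (h1 & h2 & h3).
  { unfold Z. pose proof (Rmax_l X Y). pose proof (Rmax_r X Y).
    pose proof (Rmax_l 1 (Rmax X Y)). pose proof (Rmax_r 1 (Rmax X Y)). lra. }
  exists Z. split; [lra|]. intros a b ha hb.
  assert (E : is_RInt h a b (H b - H a)).
  { apply (is_RInt_derive (V := R_CompleteNormedModule) H h); auto. }
  assert (pr : Riemann_integrable h a b). { apply ex_RInt_Reals_0. exists (H b - H a). auto. }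
  exists pr. rewrite <- RInt_Reals. rewrite (is_RInt_unique _ _ _ _ E).
  specialize (hX b ltac:(lra)). specialize (hY (- a) ltac:(lra)). rewrite Ropp_involutive in hY.
  replace (H b - H a - (lp - lm)) with ((H b - lp) - (H a - lm)) by ring.
  eapply Rle_lt_trans; [apply Rabs_triang|]. rewrite Rabs_Ropp. lra.
Qed.

Definition Pr (h : R -> R) (x : R) : R := RInt h 0 x.
Lemma Pr_derive h : (forall x, continuous h x) -> forall x : R, is_derive (Pr h) x (h x).
Proof.
  intros Hc x. apply (is_derive_RInt (V := R_CompleteNormedModule) h (Pr h) 0 x); [|auto].
  exists (mkposreal 1 Rlt_0_1). intros y _.
  apply (RInt_correct (V := R_CompleteNormedModule)). apply (ex_RInt_continuous (V := R_CompleteNormedModule)).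
  auto.
Qed.

Lemma nice_prim h C :
  (forall x, continuous h x) -> (forall x, Rabs (h x) * (1 + x ^ 2) <= C) ->
  exists lp lm, limp (Pr h) lp /\ limm (Pr h) lm /\ Rabs (lp - lm) <= 4 * C.
Proof.
  intros Hc Hb. pose proof (Pr_derive h Hc) as D.
  destruct (limp_ex (Pr h) h C D Hb) as (lp & A & A').
  destruct (limp_ex (fun x => Pr h (- x)) (fun x => - h (- x)) C) as (lm & B & B').
  - intros x. eapply is_derive_eq.
    + apply (is_derive_comp (Pr h) (fun t => - t) x (h (- x)) (-1) (D (- x))).
      auto_derive; [trivial|ring].
    + unfold scal; cbn; unfold mult; cbn. ring.
  - intros x. rewrite Rabs_Ropp. specialize (Hb (- x)). lra.
  - exists lp, lm. split; [exact A|]. split; [exact B|].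
    rewrite Ropp_0 in B'. replace (lp - lm) with ((lp - Pr h 0) - (lm - Pr h 0)) by ring.
    eapply Rle_trans; [apply Rabs_triang|]. rewrite Rabs_Ropp. lra.
Qed.

Lemma nice_int1 h : nice h -> int1 h (I h).
Proof.
  intros [Hc [C Hb]]. destruct (nice_prim h C Hc Hb) as (lp & lm & A & B & _).
  pose proof (int1_char (Pr h) h lp lm Hc (Pr_derive h Hc) A B) as E. rewrite (I_eq _ _ E). auto.
Qed.
Lemma I_char H h lp lm :
  (forall x, continuous h x) -> (forall x : R, is_derive H x (h x)) ->
  limp H lp -> limm H lm -> I h = lp - lm.
Proof. intros. apply I_eq. apply int1_char with H; auto. Qed.
Lemma I_bound h C : nice h -> (forall x, Rabs (h x) * (1 + x ^ 2) <= C) -> Rabs (I h) <= 4 * C.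
Proof.
  intros [Hc _] Hb. destruct (nice_prim h C Hc Hb) as (lp & lm & A & B & E).
  rewrite (I_char (Pr h) h lp lm); auto using Pr_derive.
Qed.
Lemma nice_add f g : nice f -> nice g -> nice (fun x => f x + g x).
Proof.
  intros [F [C HC]] [G [D HD]]. split.
  - intros; apply (continuous_plus (V := R_NormedModule)); auto.
  - exists (C + D). intros x. specialize (HC x). specialize (HD x).
    pose proof (Rabs_triang (f x) (g x)). nra.
Qed.
Lemma nice_scal c f : nice f -> nice (fun x => c * f x).
Proof.
  intros [F [C HC]]. split.
  - intros; apply (continuous_scal_r (V := R_NormedModule)); auto.
  - exists (Rabs c * C). intros x. rewrite Rabs_mult. specialize (HC x). pose proof (Rabs_pos c). nra.
Qed.
Lemma nice_ext f g : (forall x, f x = g x) -> nice f -> nice g.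
Proof. intros E. replace g with f; [auto|]. apply functional_extensionality; auto. Qed.
Lemma I_add f g : nice f -> nice g -> I (fun x => f x + g x) = I f + I g.
Proof.
  intros [F [C HC]] [G [D HD]].
  destruct (nice_prim f C F HC) as (fp & fm & A1 & A2 & _).
  destruct (nice_prim g D G HD) as (gp & gm & B1 & B2 & _).
  rewrite (I_char (Pr f) f fp fm), (I_char (Pr g) g gp gm); auto using Pr_derive.
  rewrite (I_char (fun x => Pr f x + Pr g x) _ (fp + gp) (fm + gm)).
  - ring.
  - intros; apply (continuous_plus (V := R_NormedModule)); auto.
  - intros; apply (is_derive_plus (V := R_NormedModule)); apply Pr_derive; auto.
  - apply limp_add; auto.
  - apply limp_add; auto.
Qed.
Lemma I_scal c f : nice f -> I (fun x => c * f x) = c * I f.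
Proof.
  intros [F [C HC]].
  destruct (nice_prim f C F HC) as (fp & fm & A1 & A2 & _).
  rewrite (I_char (Pr f) f fp fm); auto using Pr_derive.
  rewrite (I_char (fun x => c * Pr f x) _ (c * fp) (c * fm)).
  - ring.
  - intros; apply (continuous_scal_r (V := R_NormedModule)); auto.
  - intros; apply is_derive_scal; apply Pr_derive; auto.
  - apply limp_scal; auto.
  - apply (limp_scal (fun x => Pr f (- x))); auto.
Qed.
(** The primitive is monotone, so its two limits bracket every increment; the increment just after
    [z] is positive because the derivative there is [h z]. *)
Lemma I_pos h z : nice h -> (forall x, 0 <= h x) -> 0 < h z -> 0 < I h.
Proof.
  intros [Hc [C HC]] Hp H0.
  destruct (nice_prim h C Hc HC) as (lp & lm & A & B & _).
  rewrite (I_char (Pr h) h lp lm); auto using Pr_derive.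
  assert (Mon : forall a b, a <= b -> Pr h a <= Pr h b).
  { intros a b ab. pose proof (derive_compare (fun _ => 0) (Pr h) (fun _ => 0) h a b ab) as K. enough (0 - 0 <= Pr h b - Pr h a) by lra. apply K; auto.
    - intros; apply (is_derive_const (V := R_NormedModule)).
    - intros; apply Pr_derive; auto. }
  assert (L1 : forall x, Pr h x <= lp).
  { intros x. apply le_epsilon. intros e he. destruct (A e he) as (X & hX).
    specialize (hX (Rmax x X) (Rmax_r _ _)). pose proof (Mon x (Rmax x X) (Rmax_l _ _)).
    apply Rabs_def2 in hX. lra. }
  assert (L2 : lm <= Pr h z).
  { apply le_epsilon. intros e he. destruct (B e he) as (X & hX). specialize (hX (Rmax (- z) X) (Rmax_r _ _)).
    pose proof (Rmax_l (- z) X). pose proof (Mon (- Rmax (- z) X) z ltac:(lra)). apply Rabs_def2 in hX. lra. }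
  destruct (proj1 (is_derive_Reals (Pr h) z (h z)) (Pr_derive h Hc z) (h z) H0) as ([d dp] & hd).
  specialize (hd (d / 2) ltac:(lra)). cbn [pos] in hd. rewrite (Rabs_right (d / 2)) in hd by lra. specialize (hd ltac:(lra)).
  apply Rabs_def2 in hd.
  assert (0 < Pr h (z + d / 2) - Pr h z).
  { replace (Pr h (z + d / 2) - Pr h z) with ((Pr h (z + d / 2) - Pr h z) / (d / 2) * (d / 2)) by (field; lra).
    nra. }
  specialize (L1 (z + d / 2)). lra.
Qed.

Definition cnice (f : R -> Cx) : Prop :=
  (forall x, ccont f x) /\ exists C, forall x, Cmod (f x) * (1 + x ^ 2) <= C.
Definition CI (f : R -> Cx) : Cx := mkC (I (fun x => re (f x))) (I (fun x => im (f x))).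

Lemma cnice_re f : cnice f -> nice (fun x => re (f x)).
Proof.
  intros [F [C HC]]. split; [intros x; apply F|]. exists C. intros x.
  pose proof (re_le_Cmod (f x)). specialize (HC x). nra.
Qed.
Lemma cnice_im f : cnice f -> nice (fun x => im (f x)).
Proof.
  intros [F [C HC]]. split; [intros x; apply F|]. exists C. intros x.
  pose proof (im_le_Cmod (f x)). specialize (HC x). nra.
Qed.
Lemma CI_cint1 f : cnice f -> cint1 f (CI f).
Proof. intros H. split; cbn; apply nice_int1; [apply cnice_re|apply cnice_im]; auto. Qed.
Lemma CI_eq f l : cint1 f l -> CI f = l.
Proof. intros [A B]. apply Cx_ext; cbn; apply I_eq; auto. Qed.
Lemma CI_ext f g : (forall x, f x = g x) -> CI f = CI g.
Proof. intros E. replace g with f; [auto|]. apply functional_extensionality; auto. Qed.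
Lemma cnice_ext f g : (forall x, f x = g x) -> cnice f -> cnice g.
Proof. intros E. replace g with f; [auto|]. apply functional_extensionality; auto. Qed.
Lemma cnice_add f g : cnice f -> cnice g -> cnice (fun x => f x + g x)%cx.
Proof.
  intros [F [C HC]] [G [D HD]]. split; [intros; apply ccont_add; auto|].
  exists (C + D). intros x. specialize (HC x). specialize (HD x).
  pose proof (Cmod_tri (f x) (g x)). nra.
Qed.
Lemma cnice_scal c f : cnice f -> cnice (fun x => c * f x)%cx.
Proof.
  intros [F [C HC]]. split; [intros; apply ccont_mul; [apply ccont_const|auto]|].
  exists (Cmod c * C). intros x. rewrite Cmod_mul. specialize (HC x). pose proof (Cmod_ge0 c). nra.
Qed.
Lemma CI_add f g : cnice f -> cnice g -> CI (fun x => f x + g x)%cx = (CI f + CI g)%cx.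
Proof.
  intros F G. apply Cx_ext; cbn.
  - apply (I_add (fun x => re (f x)) (fun x => re (g x))); apply cnice_re; auto.
  - apply (I_add (fun x => im (f x)) (fun x => im (g x))); apply cnice_im; auto.
Qed.
Lemma CI_scal c f : cnice f -> CI (fun x => c * f x)%cx = (c * CI f)%cx.
Proof.
  intros F. pose proof (cnice_re f F). pose proof (cnice_im f F). apply Cx_ext; cbn.
  - transitivity (I (fun x => re c * re (f x) + - im c * im (f x))).
    { f_equal. apply functional_extensionality; intros; ring. }
    rewrite I_add, !I_scal; auto using nice_scal. ring.
  - transitivity (I (fun x => re c * im (f x) + im c * re (f x))).
    { auto. }
    rewrite I_add, !I_scal; auto using nice_scal.
Qed.
Lemma CI_opp f : cnice f -> CI (fun x => - f x)%cx = (- CI f)%cx.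
Proof.
  intros F. transitivity (CI (fun x => (- C1) * f x)%cx).
  - apply CI_ext; intros; ring.
  - rewrite CI_scal by auto. ring.
Qed.
Lemma cnice_opp f : cnice f -> cnice (fun x => - f x)%cx.
Proof. intros F. apply cnice_ext with (fun x => (- C1) * f x)%cx; [intros; ring|apply cnice_scal; auto]. Qed.
Lemma cnice_sub f g : cnice f -> cnice g -> cnice (fun x => f x - g x)%cx.
Proof. intros. apply cnice_add; [|apply cnice_opp]; auto. Qed.
Lemma CI_sub f g : cnice f -> cnice g -> CI (fun x => f x - g x)%cx = (CI f - CI g)%cx.
Proof.
  intros F G. unfold Csub. rewrite <- CI_opp by auto. apply (CI_add f (fun x => - g x)%cx); auto using cnice_opp.
Qed.
Lemma CI_bound f C : cnice f -> (forall x, Cmod (f x) * (1 + x ^ 2) <= C) -> Cmod (CI f) <= 8 * C.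
Proof.
  intros F HC. eapply Rle_trans; [apply Cmod_le_re_im|]. cbn.
  pose proof (I_bound (fun x => re (f x)) C (cnice_re f F)) as A.
  pose proof (I_bound (fun x => im (f x)) C (cnice_im f F)) as B.
  assert (Rabs (I (fun x => re (f x))) <= 4 * C).
  { apply A. intros x. specialize (HC x). pose proof (re_le_Cmod (f x)). nra. }
  assert (Rabs (I (fun x => im (f x))) <= 4 * C).
  { apply B. intros x. specialize (HC x). pose proof (im_le_Cmod (f x)). nra. }
  lra.
Qed.
Lemma limm_zero (H : R -> R) C : (forall x, Rabs (H x) * (1 + x ^ 2) <= C) -> limm H 0.
Proof.
  intros Hb. apply limp_zero with C. intros x. specialize (Hb (- x)).
  lra.
Qed.
Lemma I_deriv (H h : R -> R) C :
  (forall x : R, is_derive H x (h x)) -> (forall x, continuous h x) ->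
  (forall x, Rabs (H x) * (1 + x ^ 2) <= C) -> I h = 0.
Proof.
  intros A B D. rewrite (I_char H h 0 0); auto; [ring| |].
  - apply limp_zero with C; auto.
  - apply limm_zero with C; auto.
Qed.
Lemma CI_deriv (F f : R -> Cx) C :
  (forall x, cder F x (f x)) -> (forall x, ccont f x) ->
  (forall x, Cmod (F x) * (1 + x ^ 2) <= C) -> CI f = C0.
Proof.
  intros A B D. apply Cx_ext; cbn.
  - apply (I_deriv (fun x => re (F x)) _ C); [apply A|apply B|].
    intros x. specialize (D x). pose proof (re_le_Cmod (F x)). nra.
  - apply (I_deriv (fun x => im (F x)) _ C); [apply A|apply B|].
    intros x. specialize (D x). pose proof (im_le_Cmod (F x)). nra.
Qed.
Lemma I_affine (h : R -> R) s c : 0 < s -> nice h -> I (fun x => h (s * x + c)) = / s * I h.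
Proof.
  intros hs [Hc [C HC]].
  destruct (nice_prim h C Hc HC) as (lp & lm & A & B & _).
  rewrite (I_char (Pr h) h lp lm); auto using Pr_derive.
  rewrite (I_char (fun x => / s * Pr h (s * x + c)) _ (/ s * lp) (/ s * lm)); [ring| | | |].
  - intros x. apply (continuous_comp (fun x => s * x + c) h); [|auto].
    eapply is_derive_continuous, is_derive_affine.
  - intros x. eapply is_derive_eq.
    + apply is_derive_scal. apply (is_derive_comp (Pr h) (fun x => s * x + c)); [apply Pr_derive; auto|apply is_derive_affine].
    + unfold scal; cbn; unfold mult; cbn. field. lra.
  - apply (limp_scal (fun x => Pr h (s * x + c))). intros e he. destruct (A e he) as (X & hX).
    exists ((X - c) / s). intros x hx. apply hX.
    assert (X - c <= s * x); [|lra]. apply Rmult_le_reg_r with (/ s); [apply Rinv_0_lt_compat; auto|].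
    replace (s * x * / s) with x by (field; lra). auto.
  - apply (limp_scal (fun x => Pr h (s * - x + c))). intros e he. destruct (B e he) as (X & hX).
    exists ((X + c) / s). intros x hx. replace (s * - x + c) with (- (s * x - c)) by ring. apply hX.
    assert (X + c <= s * x); [|lra]. apply Rmult_le_reg_r with (/ s); [apply Rinv_0_lt_compat; auto|].
    replace (s * x * / s) with x by (field; lra). auto.
Qed.
Lemma CI_shift f c : cnice f -> CI (fun x => f (x + c)%R) = CI f.
Proof.
  intros F. apply Cx_ext; cbn.
  - pose proof (I_affine (fun x => re (f x)) 1 c Rlt_0_1 (cnice_re f F)) as K.
    rewrite Rinv_1, Rmult_1_l in K. rewrite <- K. f_equal. apply functional_extensionality; intros.
    rewrite Rmult_1_l; reflexivity.
  - pose proof (I_affine (fun x => im (f x)) 1 c Rlt_0_1 (cnice_im f F)) as K.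
    rewrite Rinv_1, Rmult_1_l in K. rewrite <- K. f_equal. apply functional_extensionality; intros.
    rewrite Rmult_1_l; reflexivity.
Qed.

(** * Sequences of Hermite coefficients *)

(** The weight starts at 1, so its inverse powers make sense at every index; it is comparable with
    the eigenvalue [2 * INR n + 1] of [number_op]. *)
Definition wt (n : nat) : R := INR (S n).
Lemma wt_ge1 n : 1 <= wt n.
Proof. unfold wt. rewrite S_INR. pose proof (pos_INR n). lra. Qed.
Lemma wt_S n : wt (S n) = wt n + 1.
Proof. auto. Qed.
Lemma wt_pow_ge1 n K : 1 <= wt n ^ K.
Proof. apply pow_R1_Rle, wt_ge1. Qed.
Lemma wt_pow_le n K L : (K <= L)%nat -> wt n ^ K <= wt n ^ L.
Proof. intros. apply Rle_pow; [apply wt_ge1|assumption]. Qed.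
Lemma wt_mono n m : (n <= m)%nat -> wt n <= wt m.
Proof. intros. apply le_INR. lia. Qed.
Lemma wt_inv n : 0 < / wt n <= 1.
Proof.
  pose proof (wt_ge1 n). split; [apply Rinv_0_lt_compat; lra|].
  rewrite <- Rinv_1. apply Rinv_le_contravar; lra.
Qed.

(** * Series with terms of order 1/n^2 *)

Definition CSeries (a : nat -> Cx) : Cx :=
  mkC (Series (fun n => re (a n))) (Series (fun n => im (a n))).
Definition sm (a : nat -> Cx) : Prop := exists B, forall n, Cmod (a n) * wt n ^ 2 <= B.

Lemma is_series_telescope : is_series (fun n => / wt n - / wt (S n)) 1.
Proof.
  change (is_lim_seq (sum_n (fun n => / wt n - / wt (S n))) 1).
  apply (is_lim_seq_ext (fun n => 1 - / wt (S n))).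
  - intros n. induction n as [|n IH].
    + cbn. field.
    + rewrite sum_Sn, <- IH. unfold plus; cbn. ring.
  - replace (Finite 1) with (Finite (1 - 0)) by (f_equal; ring).
    apply is_lim_seq_minus'; [apply is_lim_seq_const|].
    apply (is_lim_seq_ext (fun n => / INR (n + 2))).
    { intros n. unfold wt. do 2 f_equal. lia. }
    apply (is_lim_seq_incr_n (fun n => / INR n) 2 0).
    apply (is_lim_seq_inv INR p_infty); [apply is_lim_seq_INR|discriminate].
Qed.

Lemma inv_wt_sq_le n : / wt n ^ 2 <= 2 * (/ wt n - / wt (S n)).
Proof.
  rewrite wt_S. pose proof (wt_ge1 n) as H. set (x := wt n) in *.
  replace (2 * (/ x - / (x + 1))) with (/ x ^ 2 * (2 * x / (x + 1))) by (field; lra).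
  rewrite <- (Rmult_1_r (/ x ^ 2)) at 1. apply Rmult_le_compat_l.
  - nn.
  - apply Rmult_le_reg_r with (x + 1); [lra|]. replace (2 * x / (x + 1) * (x + 1)) with (2 * x) by (field; lra). lra.
Qed.

(** The comparison series telescopes to 1, whence the factor 2 here, 4 in [CSeries_bound] and 16 in
    [pair2_bound]. *)
Lemma series_sq_bound (a : nat -> R) B :
  (forall n, Rabs (a n) * wt n ^ 2 <= B) -> ex_series (fun n => Rabs (a n)) /\ Rabs (Series a) <= 2 * B.
Proof.
  intros H.
  assert (B0 : 0 <= B). { specialize (H 0%nat). pose proof (Rabs_pos (a 0%nat)). nra. }
  assert (E : is_series (fun n => (2 * B) * (/ wt n - / wt (S n))) (2 * B)).
  { pose proof (is_series_scal (2 * B) _ _ is_series_telescope) as K. rewrite Rmult_1_r in K. auto. }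
  assert (L : forall n, Rabs (a n) <= (2 * B) * (/ wt n - / wt (S n))).
  { intros n. apply Rle_trans with (B * / wt n ^ 2).
    - pose proof (wt_pow_ge1 n 2). apply Rmult_le_reg_r with (wt n ^ 2); [lra|].
      rewrite Rmult_assoc, Rinv_l, Rmult_1_r by lra. auto.
    - pose proof (inv_wt_sq_le n). nra. }
  assert (X : ex_series (fun n => Rabs (a n))).
  { apply (ex_series_le (K := R_AbsRing) (V := R_CompleteNormedModule)) with (fun n => (2 * B) * (/ wt n - / wt (S n))).
    - intros n. rewrite Rabs_Rabsolu. auto.
    - exists (2 * B). auto. }
  split; [exact X|]. eapply Rle_trans; [apply Series_Rabs; exact X|].
  rewrite <- (is_series_unique _ _ E). apply Series_le; [|exists (2 * B); exact E].
  nn.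
Qed.

Lemma sm_re a : sm a -> ex_series (fun n => re (a n)).
Proof.
  intros [B H]. apply ex_series_Rabs. apply series_sq_bound with B.
  intros n. specialize (H n). pose proof (re_le_Cmod (a n)). nra.
Qed.
Lemma sm_im a : sm a -> ex_series (fun n => im (a n)).
Proof.
  intros [B H]. apply ex_series_Rabs. apply series_sq_bound with B.
  intros n. specialize (H n). pose proof (im_le_Cmod (a n)). nra.
Qed.
Lemma CSeries_bound a B : (forall n, Cmod (a n) * wt n ^ 2 <= B) -> Cmod (CSeries a) <= 4 * B.
Proof.
  intros H. eapply Rle_trans; [apply Cmod_le_re_im|]. cbn.
  assert (Rabs (Series (fun n => re (a n))) <= 2 * B).
  { apply series_sq_bound. intros n. specialize (H n). pose proof (re_le_Cmod (a n)). nra. }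
  assert (Rabs (Series (fun n => im (a n))) <= 2 * B).
  { apply series_sq_bound. intros n. specialize (H n). pose proof (im_le_Cmod (a n)). nra. }
  lra.
Qed.
Lemma CSeries_ext a b : (forall n, a n = b n) -> CSeries a = CSeries b.
Proof. intros E. replace b with a; [auto|]. apply functional_extensionality; auto. Qed.
Lemma sm_ext a b : (forall n, a n = b n) -> sm a -> sm b.
Proof. intros E. replace b with a; [auto|]. apply functional_extensionality; auto. Qed.
Lemma sm_add a b : sm a -> sm b -> sm (fun n => a n + b n)%cx.
Proof.
  intros [A HA] [B HB]. exists (A + B). intros n. specialize (HA n). specialize (HB n).
  pose proof (Cmod_tri (a n) (b n)). nra.
Qed.
Lemma sm_scal c a : sm a -> sm (fun n => c * a n)%cx.
Proof.
  intros [A HA]. exists (Cmod c * A). intros n. specialize (HA n). rewrite Cmod_mul.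
  pose proof (Cmod_ge0 c). nra.
Qed.
Lemma CSeries_add a b : sm a -> sm b -> CSeries (fun n => a n + b n)%cx = (CSeries a + CSeries b)%cx.
Proof. intros A B. apply Cx_ext; cbn; apply Series_plus; auto using sm_re, sm_im. Qed.
Lemma ex_series_scal_R c (a : nat -> R) : ex_series a -> ex_series (fun n => c * a n).
Proof. exact (ex_series_scal_l (K := R_AbsRing) (V := R_NormedModule) c a). Qed.
Lemma CSeries_scal c a : sm a -> CSeries (fun n => c * a n)%cx = (c * CSeries a)%cx.
Proof.
  intros A. pose proof (sm_re a A) as R1. pose proof (sm_im a A) as R2. apply Cx_ext; cbn.
  - rewrite <- !Series_scal_l. rewrite <- Series_minus; auto;
    apply ex_series_scal_R; auto.
  - rewrite <- !Series_scal_l. rewrite <- Series_plus; auto;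
    apply ex_series_scal_R; auto.
Qed.
Lemma CSeries_opp a : sm a -> CSeries (fun n => - a n)%cx = (- CSeries a)%cx.
Proof.
  intros A. transitivity (CSeries (fun n => (- C1) * a n)%cx); [apply CSeries_ext; intros; ring|].
  rewrite CSeries_scal by auto. ring.
Qed.
Lemma sm_opp a : sm a -> sm (fun n => - a n)%cx.
Proof. intros A. apply sm_ext with (fun n => (- C1) * a n)%cx; [intros; ring|apply sm_scal; auto]. Qed.
Lemma sm_sub a b : sm a -> sm b -> sm (fun n => a n - b n)%cx.
Proof. intros. apply sm_add; [|apply sm_opp]; auto. Qed.
Lemma CSeries_sub a b : sm a -> sm b -> CSeries (fun n => a n - b n)%cx = (CSeries a - CSeries b)%cx.
Proof.
  intros A B. unfold Csub. rewrite <- CSeries_opp by auto. apply (CSeries_add a (fun n => - b n)%cx); auto using sm_opp.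
Qed.
Lemma sm_S a : sm a -> sm (fun n => a (S n)).
Proof.
  intros [A HA]. exists A. intros n. specialize (HA (S n)).
  pose proof (wt_ge1 n). rewrite wt_S in HA. pose proof (Cmod_ge0 (a (S n))). nra.
Qed.
Lemma CSeries_incr a : sm a -> CSeries a = (a 0%nat + CSeries (fun n => a (S n)))%cx.
Proof. intros A. apply Cx_ext; cbn; rewrite Series_incr_1; auto using sm_re, sm_im. Qed.
Lemma CSeries_zero a : (forall n, a n = C0) -> CSeries a = C0.
Proof.
  intros H. apply Cmod_eq0. apply Rle_antisym; [|apply Cmod_ge0].
  replace 0 with (4 * 0) by ring. apply CSeries_bound. intros n. rewrite H, Cmod_C0. lra.
Qed.
Lemma sm_delta k (z : nat -> Cx) : sm (fun n => if Nat.eqb n k then z n else C0).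
Proof.
  exists (Cmod (z k) * wt k ^ 2). intros n. destruct (Nat.eqb_spec n k) as [->|_]; [lra|].
  rewrite Cmod_C0, Rmult_0_l. nn.
Qed.
Lemma CSeries_delta k (z : nat -> Cx) : CSeries (fun n => if Nat.eqb n k then z n else C0) = z k.
Proof.
  revert z. induction k as [|k IH]; intros z; rewrite CSeries_incr by apply sm_delta; cbn [Nat.eqb].
  - rewrite CSeries_zero; [ring|reflexivity].
  - rewrite (IH (fun n => z (S n))). ring.
Qed.

(** * Tempered and rapidly decreasing sequences, ladder operators *)

Definition tmp (w : nat -> Cx) : Prop := exists K B, forall n, Cmod (w n) <= B * wt n ^ K.
Definition sb (K : nat) (w : nat -> Cx) (B : R) : Prop := forall n, wt n ^ K * Cmod (w n) <= B.
Definition rap (w : nat -> Cx) : Prop := forall K, exists B, sb K w B.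

(** Creation and, below, annihilation on coefficients. At [n = 0] the default [pred 0 = 0] is
    harmless, since its factor is [sqrt 0]. *)
Definition sA (w : nat -> Cx) (n : nat) : Cx := (RtoC (sqrt (INR n)) * w (pred n))%cx.
Definition sB (w : nat -> Cx) (n : nat) : Cx := (RtoC (sqrt (INR (S n))) * w (S n))%cx.
(** With [sD]: the matrices of multiplication by x and of D in the Hermite basis. *)
Definition sM (w : nat -> Cx) (n : nat) : Cx := (RtoC (/ sqrt 2) * (sA w n + sB w n))%cx.
Definition sD (w : nat -> Cx) (n : nat) : Cx := (Ci * RtoC (/ sqrt 2) * (sA w n - sB w n))%cx.

Lemma sqrt_INR_sq n : (RtoC (sqrt (INR n)) * RtoC (sqrt (INR n)))%cx = RtoC (INR n).
Proof. rewrite <- RtoC_mul, sqrt_sqrt; [reflexivity|apply pos_INR]. Qed.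
Lemma inv_sqrt2_sq : (/ sqrt 2) * (/ sqrt 2) = / 2.
Proof. rewrite <- Rinv_mult, sqrt_sqrt; lra. Qed.
Lemma inv_sqrt2_bounds : 0 < / sqrt 2 <= 1.
Proof.
  assert (1 <= sqrt 2). { rewrite <- sqrt_1 at 1. apply sqrt_le_1_alt. lra. }
  split; [apply Rinv_0_lt_compat; lra|]. rewrite <- Rinv_1. apply Rinv_le_contravar; lra.
Qed.
Lemma sqrt_INR_le n : 0 <= sqrt (INR n) <= wt n.
Proof.
  split; [apply sqrt_pos|]. pose proof (wt_ge1 n).
  rewrite <- (sqrt_Rsqr (wt n)) by lra. apply sqrt_le_1_alt. unfold Rsqr.
  unfold wt in *. rewrite S_INR in *. nra.
Qed.
Lemma sqrt_INRS_le n : 0 <= sqrt (INR (S n)) <= wt n.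
Proof.
  split; [apply sqrt_pos|]. pose proof (wt_ge1 n).
  rewrite <- (sqrt_Rsqr (wt n)) by lra. apply sqrt_le_1_alt. unfold Rsqr. unfold wt in *. nra.
Qed.
Lemma sA_sB w n : sA (sB w) n = (RtoC (INR n) * w n)%cx.
Proof.
  unfold sA, sB. destruct n; [|cbn [pred]; rewrite <- sqrt_INR_sq; ring].
  cbn [INR]. rewrite sqrt_0. cxring.
Qed.
Lemma sB_sA w n : sB (sA w) n = (RtoC (INR (S n)) * w n)%cx.
Proof. unfold sA, sB. cbn [pred]. rewrite <- sqrt_INR_sq; ring. Qed.
Lemma sA_lin c d v w n : sA (fun n => c * v n + d * w n)%cx n = (c * sA v n + d * sA w n)%cx.
Proof. unfold sA; ring. Qed.
Lemma sB_lin c d v w n : sB (fun n => c * v n + d * w n)%cx n = (c * sB v n + d * sB w n)%cx.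
Proof. unfold sB; ring. Qed.
Lemma sM_lin c d v w n : sM (fun n => c * v n + d * w n)%cx n = (c * sM v n + d * sM w n)%cx.
Proof. unfold sM. rewrite sA_lin, sB_lin. ring. Qed.
Lemma sD_lin c d v w n : sD (fun n => c * v n + d * w n)%cx n = (c * sD v n + d * sD w n)%cx.
Proof. unfold sD. rewrite sA_lin, sB_lin. ring. Qed.
Lemma sA_sD w n : sA (sD w) n = (Ci * RtoC (/ sqrt 2) * (sA (sA w) n - RtoC (INR n) * w n))%cx.
Proof. rewrite <- (sA_sB w n). unfold sD, sA. ring. Qed.
Lemma sB_sD w n : sB (sD w) n = (Ci * RtoC (/ sqrt 2) * (RtoC (INR (S n)) * w n - sB (sB w) n))%cx.
Proof. rewrite <- (sB_sA w n). unfold sD, sB. ring. Qed.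
Lemma sA_sM w n : sA (sM w) n = (RtoC (/ sqrt 2) * (sA (sA w) n + RtoC (INR n) * w n))%cx.
Proof. rewrite <- (sA_sB w n). unfold sM, sA. ring. Qed.
Lemma sB_sM w n : sB (sM w) n = (RtoC (/ sqrt 2) * (RtoC (INR (S n)) * w n + sB (sB w) n))%cx.
Proof. rewrite <- (sB_sA w n). unfold sM, sB. ring. Qed.

Lemma sD_sM_comm w n : sD (sM w) n = (sM (sD w) n - Ci * w n)%cx.
Proof.
  unfold sD at 1, sM at 3. rewrite sA_sM, sB_sM, sA_sD, sB_sD. rewrite S_INR.
  set (a := sA (sA w) n). set (b := sB (sB w) n). set (z := w n). set (x := INR n).
  replace (Ci * RtoC (/ sqrt 2) * (RtoC (/ sqrt 2) * (a + RtoC x * z) - RtoC (/ sqrt 2) * (RtoC (x + 1) * z + b)))%cx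
    with (RtoC (/ sqrt 2 * / sqrt 2) * (Ci * (a - b - z)))%cx by (rewrite RtoC_mul, RtoC_add; change (RtoC 1) with C1; ring).
  replace (RtoC (/ sqrt 2) * (Ci * RtoC (/ sqrt 2) * (a - RtoC x * z) + Ci * RtoC (/ sqrt 2) * (RtoC (x + 1) * z - b)))%cx
    with (RtoC (/ sqrt 2 * / sqrt 2) * (Ci * (a - b + z)))%cx by (rewrite RtoC_mul, RtoC_add; change (RtoC 1) with C1; ring).
  rewrite inv_sqrt2_sq. apply Cx_ext; cxsimpl; field.
Qed.
(** The harmonic oscillator is diagonal. This identity is what turns smoothness and decay of a
    function into decay of its coefficients ([cf_decay_aux]). *)
Lemma number_op w n : (sM (sM w) n + sD (sD w) n)%cx = (RtoC (2 * INR n + 1) * w n)%cx.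
Proof.
  unfold sM at 1, sD at 1. rewrite sA_sM, sB_sM, sA_sD, sB_sD. rewrite S_INR.
  set (a := sA (sA w) n). set (b := sB (sB w) n). set (z := w n). set (x := INR n).
  replace (Ci * RtoC (/ sqrt 2) * (Ci * RtoC (/ sqrt 2) * (a - RtoC x * z) - Ci * RtoC (/ sqrt 2) * (RtoC (x + 1) * z - b)))%cx
    with (RtoC (/ sqrt 2 * / sqrt 2) * ((Ci * Ci) * (a + b - RtoC (2 * x + 1) * z)))%cx
    by (rewrite RtoC_mul; apply Cx_ext; cxsimpl; ring).
  replace (RtoC (/ sqrt 2) * (RtoC (/ sqrt 2) * (a + RtoC x * z) + RtoC (/ sqrt 2) * (RtoC (x + 1) * z + b)))%cx
    with (RtoC (/ sqrt 2 * / sqrt 2) * (a + b + RtoC (2 * x + 1) * z))%cx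
    by (rewrite RtoC_mul; apply Cx_ext; cxsimpl; ring).
  rewrite inv_sqrt2_sq, Ci2. apply Cx_ext; cxsimpl; field.
Qed.

Lemma sb_le K L w B : (L <= K)%nat -> sb K w B -> sb L w B.
Proof.
  intros h H n. eapply Rle_trans; [|apply H]. apply Rmult_le_compat_r; [apply Cmod_ge0|].
  apply wt_pow_le; auto.
Qed.
Lemma sb_nonneg K w B : sb K w B -> 0 <= B.
Proof. intros H. specialize (H 0%nat). pose proof (Cmod_ge0 (w 0%nat)). pose proof (wt_pow_ge1 0 K). nra. Qed.
Lemma sb_weaken K w B B' : B <= B' -> sb K w B -> sb K w B'.
Proof. intros h H n. specialize (H n). lra. Qed.
Lemma sb_add K v w A B : sb K v A -> sb K w B -> sb K (fun n => v n + w n)%cx (A + B).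
Proof. intros H1 H2 n. specialize (H1 n). specialize (H2 n). pose proof (Cmod_tri (v n) (w n)). pose proof (wt_pow_ge1 n K). nra. Qed.
Lemma sb_scal K c w B : sb K w B -> sb K (fun n => c * w n)%cx (Cmod c * B).
Proof. intros H n. specialize (H n). rewrite Cmod_mul. pose proof (Cmod_ge0 c). nra. Qed.
Lemma sb_sA K w B : sb (S K) w B -> sb K (sA w) (2 ^ S K * B).
Proof.
  intros H n. unfold sA. rewrite Cmod_mul, Cmod_RtoC. destruct (sqrt_INR_le n) as [h1 h2].
  rewrite Rabs_right by lra. pose proof (sb_nonneg _ _ _ H).
  destruct n as [|n].
  - cbn [INR]. rewrite sqrt_0, Rmult_0_l, Rmult_0_r. nn.
  - cbn [pred]. pose proof (Cmod_ge0 (w n)).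
    apply Rle_trans with (wt (S n) ^ S K * Cmod (w n)).
    + cbn [pow]. pose proof (wt_pow_ge1 (S n) K).
      replace (wt (S n) * wt (S n) ^ K * Cmod (w n)) with (wt (S n) ^ K * (wt (S n) * Cmod (w n))) by ring.
      apply Rmult_le_compat_l; [lra|]. nra.
    + apply Rle_trans with ((2 * wt n) ^ S K * Cmod (w n)).
      * apply Rmult_le_compat_r; [auto|]. apply pow_incr. rewrite wt_S. pose proof (wt_ge1 n). lra.
      * rewrite Rpow_mult_distr, Rmult_assoc. apply Rmult_le_compat_l; [apply pow_le; lra|auto].
Qed.
Lemma sb_sB K w B : sb (S K) w B -> sb K (sB w) B.
Proof.
  intros H n. unfold sB. rewrite Cmod_mul, Cmod_RtoC. destruct (sqrt_INRS_le n) as [h1 h2].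
  rewrite Rabs_right by lra. specialize (H (S n)). pose proof (Cmod_ge0 (w (S n))).
  eapply Rle_trans; [|exact H]. cbn [pow]. pose proof (wt_mono n (S n) ltac:(lia)).
  assert (wt n ^ K <= wt (S n) ^ K) by (apply pow_incr; lra). pose proof (wt_pow_ge1 n K).
  replace (wt n ^ K * (sqrt (INR (S n)) * Cmod (w (S n)))) with ((sqrt (INR (S n)) * wt n ^ K) * Cmod (w (S n))) by ring.
  apply Rmult_le_compat_r; [auto|]. nra.
Qed.
Lemma sb_half K v w A B c : Cmod c <= 1 -> sb K v A -> sb K w B ->
  sb K (fun n => c * (v n + w n))%cx (A + B).
Proof.
  intros hc H1 H2 n. pose proof (sb_add K v w A B H1 H2 n) as H.
  rewrite Cmod_mul. pose proof (Cmod_ge0 (v n + w n)). pose proof (wt_pow_ge1 n K).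
  eapply Rle_trans; [|exact H]. apply Rmult_le_compat_l; [lra|]. nra.
Qed.
Lemma sb_opp K w B : sb K w B -> sb K (fun n => - w n)%cx B.
Proof. intros H n. rewrite Cmod_opp. auto. Qed.
Lemma Cmod_inv_sqrt2 : Cmod (RtoC (/ sqrt 2)) <= 1.
Proof. rewrite Cmod_RtoC. pose proof inv_sqrt2_bounds. rewrite Rabs_right; lra. Qed.
Lemma sb_sM K w B : sb (S K) w B -> sb K (sM w) ((2 ^ S K + 1) * B).
Proof.
  intros H. apply sb_weaken with (2 ^ S K * B + B); [lra|].
  apply (sb_half K (sA w) (sB w)); auto using Cmod_inv_sqrt2, sb_sA, sb_sB.
Qed.
Lemma sb_sD K w B : sb (S K) w B -> sb K (sD w) ((2 ^ S K + 1) * B).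
Proof.
  intros H. apply sb_weaken with (2 ^ S K * B + B); [lra|].
  apply (sb_half K (sA w) (fun n => - sB w n)%cx); auto using sb_sA, sb_sB, sb_opp.
  rewrite Cmod_mul, Cmod_Ci. pose proof Cmod_inv_sqrt2. lra.
Qed.
Lemma rap_sM w : rap w -> rap (sM w).
Proof. intros H K. destruct (H (S K)) as [B HB]. eexists. apply sb_sM; eauto. Qed.
Lemma rap_sD w : rap w -> rap (sD w).
Proof. intros H K. destruct (H (S K)) as [B HB]. eexists. apply sb_sD; eauto. Qed.
Lemma rap_sB w : rap w -> rap (sB w).
Proof. intros H K. destruct (H (S K)) as [B HB]. eexists. apply sb_sB; eauto. Qed.
Lemma rap_sA w : rap w -> rap (sA w).
Proof. intros H K. destruct (H (S K)) as [B HB]. eexists. apply sb_sA; eauto. Qed.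
Lemma rap_add v w : rap v -> rap w -> rap (fun n => v n + w n)%cx.
Proof. intros H1 H2 K. destruct (H1 K) as [A HA], (H2 K) as [B HB]. eexists. apply sb_add; eauto. Qed.
Lemma rap_scal c w : rap w -> rap (fun n => c * w n)%cx.
Proof. intros H K. destruct (H K) as [B HB]. eexists. apply sb_scal; eauto. Qed.
Lemma rap_ext v w : (forall n, v n = w n) -> rap v -> rap w.
Proof. intros E. replace w with v; [auto|]. apply functional_extensionality; auto. Qed.
Lemma rap_tmp w : rap w -> tmp w.
Proof. intros H. destruct (H 0%nat) as [B HB]. exists 0%nat, B. intros n. specialize (HB n). lra. Qed.

Lemma tmp_ext v w : (forall n, v n = w n) -> tmp v -> tmp w.
Proof. intros E. replace w with v; [auto|]. apply functional_extensionality; auto. Qed.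
Lemma tmp_nonneg w : tmp w -> exists K B, 0 <= B /\ forall n, Cmod (w n) <= B * wt n ^ K.
Proof.
  intros (K & B & H). exists K, B. split; [|exact H]. specialize (H 0%nat).
  pose proof (Cmod_ge0 (w 0%nat)). pose proof (wt_pow_ge1 0 K). nra.
Qed.
Lemma tmp_add v w : tmp v -> tmp w -> tmp (fun n => v n + w n)%cx.
Proof.
  intros (K & A & A0 & HA)%tmp_nonneg (L & B & B0 & HB)%tmp_nonneg. exists (K + L)%nat, (A + B). intros n.
  specialize (HA n). specialize (HB n). pose proof (Cmod_tri (v n) (w n)).
  pose proof (wt_pow_le n K (K + L) ltac:(lia)). pose proof (wt_pow_le n L (K + L) ltac:(lia)). nra.
Qed.
Lemma tmp_scal c w : tmp w -> tmp (fun n => c * w n)%cx.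
Proof.
  intros (K & A & A0 & HA)%tmp_nonneg. exists K, (Cmod c * A). intros n.
  rewrite Cmod_mul, Rmult_assoc. apply Rmult_le_compat_l; [apply Cmod_ge0|auto].
Qed.
Lemma tmp_sA w : tmp w -> tmp (sA w).
Proof.
  intros (K & A & A0 & HA)%tmp_nonneg. exists (S K), A. intros n. unfold sA.
  rewrite Cmod_mul, Cmod_RtoC. destruct (sqrt_INR_le n) as [h1 h2]. rewrite Rabs_right by lra.
  specialize (HA (pred n)). assert (wt (pred n) <= wt n) by (apply wt_mono; lia).
  pose proof (wt_ge1 (pred n)). assert (wt (pred n) ^ K <= wt n ^ K) by (apply pow_incr; lra).
  cbn [pow]. replace (A * (wt n * wt n ^ K)) with (wt n * (A * wt n ^ K)) by ring.
  apply Rmult_le_compat; auto using Cmod_ge0. nra.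
Qed.
Lemma tmp_sB w : tmp w -> tmp (sB w).
Proof.
  intros (K & A & A0 & HA)%tmp_nonneg. exists (S K), (A * 2 ^ K). intros n. unfold sB.
  rewrite Cmod_mul, Cmod_RtoC. destruct (sqrt_INRS_le n) as [h1 h2]. rewrite Rabs_right by lra.
  specialize (HA (S n)). assert (wt (S n) <= 2 * wt n) by (rewrite wt_S; pose proof (wt_ge1 n); lra).
  pose proof (wt_ge1 (S n)). assert (wt (S n) ^ K <= (2 * wt n) ^ K) by (apply pow_incr; lra).
  rewrite Rpow_mult_distr in *.
  cbn [pow]. replace (A * 2 ^ K * (wt n * wt n ^ K)) with (wt n * (A * (2 ^ K * wt n ^ K))) by ring.
  apply Rmult_le_compat; auto using Cmod_ge0. nra.
Qed.
Lemma tmp_sM w : tmp w -> tmp (sM w).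
Proof. intros. apply tmp_scal. apply tmp_add; auto using tmp_sA, tmp_sB. Qed.
Lemma tmp_sD w : tmp w -> tmp (sD w).
Proof.
  intros. apply tmp_scal. apply tmp_add; auto using tmp_sA.
  apply tmp_ext with (fun n => (- C1) * sB w n)%cx; [intros; ring|]. auto using tmp_scal, tmp_sB.
Qed.

(** Bilinear, without conjugation, to match the action of a distribution on a test function; so [sM]
    is symmetric and [sD] antisymmetric for it. *)
Definition pair (w k : nat -> Cx) : Cx := CSeries (fun n => w n * k n)%cx.
Lemma pair_terms w k p A B :
  (forall n, Cmod (w n) <= A * wt n ^ p) -> sb (p + 2) k B ->
  forall n, Cmod (w n * k n) * wt n ^ 2 <= A * B.
Proof.
  intros HA HB n. specialize (HA n). specialize (HB n). rewrite Cmod_mul. rewrite pow_add in HB.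
  pose proof (Cmod_ge0 (w n)). pose proof (Cmod_ge0 (k n)). pose proof (wt_pow_ge1 n p).
  apply Rle_trans with (A * wt n ^ p * (Cmod (k n) * wt n ^ 2)).
  - rewrite Rmult_assoc. apply Rmult_le_compat_r; [nra|auto].
  - nra.
Qed.
Lemma pair_bound w k p A B :
  (forall n, Cmod (w n) <= A * wt n ^ p) -> sb (p + 2) k B -> Cmod (pair w k) <= 4 * (A * B).
Proof. intros HA HB. apply CSeries_bound. apply pair_terms with p; auto. Qed.
Lemma pair_sm w k : tmp w -> rap k -> sm (fun n => w n * k n)%cx.
Proof.
  intros (p & A & HA) Hk. destruct (Hk (p + 2)%nat) as [B HB]. exists (A * B). apply pair_terms with p; auto.
Qed.
Lemma pair_lin_r w k l c d : tmp w -> rap k -> rap l ->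
  pair w (fun n => c * k n + d * l n)%cx = (c * pair w k + d * pair w l)%cx.
Proof.
  intros. unfold pair.
  rewrite <- !CSeries_scal, <- CSeries_add by auto using pair_sm, sm_scal. apply CSeries_ext; intros; ring.
Qed.
Lemma pair_lin_l w v k c d : tmp w -> tmp v -> rap k ->
  pair (fun n => c * w n + d * v n)%cx k = (c * pair w k + d * pair v k)%cx.
Proof.
  intros. unfold pair.
  rewrite <- !CSeries_scal, <- CSeries_add by auto using pair_sm, sm_scal. apply CSeries_ext; intros; ring.
Qed.
Lemma pair_sA w k : tmp w -> rap k -> pair (sA w) k = pair w (sB k).
Proof.
  intros Hw Hk. unfold pair. rewrite CSeries_incr by (apply pair_sm; auto using tmp_sA).
  replace (sA w 0 * k 0%nat)%cx with C0. 2:{ unfold sA. cbn [INR]. rewrite sqrt_0. cxring. }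
  replace (C0 + CSeries (fun n => sA w (S n) * k (S n)))%cx with (CSeries (fun n => sA w (S n) * k (S n))%cx) by ring.
  apply CSeries_ext. intros n. unfold sA, sB. cbn [pred]. ring.
Qed.
Lemma pair_sB w k : tmp w -> rap k -> pair (sB w) k = pair w (sA k).
Proof.
  intros Hw Hk. unfold pair. rewrite (CSeries_incr (fun n => w n * sA k n)%cx) by (apply pair_sm; auto using rap_sA).
  replace (w 0%nat * sA k 0)%cx with C0. 2:{ unfold sA. cbn [INR]. rewrite sqrt_0. cxring. }
  replace (C0 + CSeries (fun n => w (S n) * sA k (S n)))%cx with (CSeries (fun n => w (S n) * sA k (S n))%cx) by ring.
  apply CSeries_ext. intros n. unfold sA, sB. cbn [pred]. ring.
Qed.
Lemma pair_sM w k : tmp w -> rap k -> pair (sM w) k = pair w (sM k).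
Proof.
  intros Hw Hk.
  transitivity (RtoC (/ sqrt 2) * pair (sA w) k + RtoC (/ sqrt 2) * pair (sB w) k)%cx.
  - rewrite <- pair_lin_l; auto using tmp_sA, tmp_sB. f_equal. apply functional_extensionality; intros; unfold sM; ring.
  - rewrite pair_sA, pair_sB by auto. rewrite <- pair_lin_r; auto using rap_sA, rap_sB.
    f_equal. apply functional_extensionality; intros; unfold sM; ring.
Qed.
Lemma pair_sD w k : tmp w -> rap k -> pair (sD w) k = (- pair w (sD k))%cx.
Proof.
  intros Hw Hk.
  transitivity ((Ci * RtoC (/ sqrt 2)) * pair (sA w) k + (- (Ci * RtoC (/ sqrt 2))) * pair (sB w) k)%cx.
  - rewrite <- pair_lin_l; auto using tmp_sA, tmp_sB. f_equal. apply functional_extensionality; intros; unfold sD; ring.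
  - rewrite pair_sA, pair_sB by auto.
    transitivity (- ((Ci * RtoC (/ sqrt 2)) * pair w (sA k) + (- (Ci * RtoC (/ sqrt 2))) * pair w (sB k)))%cx; [ring|].
    rewrite <- pair_lin_r; auto using rap_sA, rap_sB.
    f_equal. f_equal. apply functional_extensionality; intros; unfold sD; ring.
Qed.

(** * Schwartz families *)

Lemma schwartz1_cder F : schwartz1 F -> forall n x, cder (F n) x (F (S n) x).
Proof. intros [H _] n x. destruct (H n x) as [A B]. split; apply is_derive_Reals; assumption. Qed.
Lemma schwartz1_mk F :
  (forall n x, cder (F n) x (F (S n) x)) ->
  (forall j n, exists C, forall x, Rabs x ^ j * Cmod (F n x) <= C) -> schwartz1 F.
Proof. intros H K. split; [|exact K]. intros n x. destruct (H n x) as [A B]. split; apply is_derive_Reals; assumption. Qed.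
Lemma schwartz1_ccont F : schwartz1 F -> forall n x, ccont (F n) x.
Proof. intros H n x. eapply cder_ccont. apply schwartz1_cder; auto. Qed.

(** An identity between families thus needs checking at order 0 only, where the Leibniz terms
    disappear. *)
Lemma fam_unique (F G : fam1) :
  (forall n x, cder (F n) x (F (S n) x)) -> (forall n x, cder (G n) x (G (S n) x)) ->
  (forall x, F 0%nat x = G 0%nat x) -> F = G.
Proof.
  intros HF HG H0. apply functional_extensionality. intros n. induction n as [|n IH].
  - apply functional_extensionality; auto.
  - apply functional_extensionality. intros x. apply cder_unique with (F n) x; [auto|]. rewrite IH. auto.
Qed.
Lemma schwartz1_unique F G : schwartz1 F -> schwartz1 G -> (forall x, F 0%nat x = G 0%nat x) -> F = G.
Proof. intros HF HG. apply fam_unique; apply schwartz1_cder; auto. Qed.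

Definition bd1 (N : nat) (F : fam1) (B : R) : Prop :=
  forall j k x, (j <= N)%nat -> (k <= N)%nat -> Rabs x ^ j * Cmod (F k x) <= B.
Definition td1 (F : fam1) : fam1 := fun n => F (S n).

Lemma fin_max (P : nat -> R -> Prop) N :
  (forall i B B', B <= B' -> P i B -> P i B') -> (forall i, exists B, P i B) ->
  exists B, forall i, (i <= N)%nat -> P i B.
Proof.
  intros mono H. induction N as [|N [B IH]].
  - destruct (H 0%nat) as [B HB]. exists B. intros i hi. replace i with 0%nat by lia. auto.
  - destruct (H (S N)) as [B' HB']. exists (Rmax B B'). intros i hi.
    destruct (Nat.eq_dec i (S N)) as [->|].
    + apply mono with B'; [apply Rmax_r|auto].
    + apply mono with B; [apply Rmax_l|apply IH; lia].
Qed.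

Lemma schwartz1_bd F : schwartz1 F -> forall N, exists B, bd1 N F B.
Proof.
  intros [_ H] N.
  destruct (fin_max (fun j B => forall k x, (k <= N)%nat -> Rabs x ^ j * Cmod (F k x) <= B) N) as [B HB].
  - intros i B B' h K k x hk. specialize (K k x hk). lra.
  - intros j. destruct (fin_max (fun k B => forall x, Rabs x ^ j * Cmod (F k x) <= B) N) as [B HB].
    + intros i B B' h K x. specialize (K x). lra.
    + auto.
    + exists B. auto.
  - exists B. intros j k x hj hk. auto.
Qed.
Lemma bd1_nonneg N F B : bd1 N F B -> 0 <= B.
Proof. intros H. specialize (H 0%nat 0%nat 0 ltac:(lia) ltac:(lia)). pose proof (Cmod_ge0 (F 0%nat 0)). lra. Qed.
Lemma bd1_tD N F B : bd1 (S N) F B -> bd1 N (tD1 F) B.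
Proof.
  intros H j k x hj hk. unfold tD1. rewrite Cmod_mul, Cmod_opp, Cmod_Ci, Rmult_1_l. apply H; lia.
Qed.
Lemma bd1_tM N F B : bd1 (S N) F B -> bd1 N (tM1 F) ((1 + INR N) * B).
Proof.
  intros H j k x hj hk. unfold tM1. pose proof (bd1_nonneg _ _ _ H).
  pose proof (H (S j) k x ltac:(lia) ltac:(lia)) as H1. pose proof (H j (pred k) x ltac:(lia) ltac:(lia)) as H2.
  apply Rle_trans with (Rabs x ^ S j * Cmod (F k x) + INR k * (Rabs x ^ j * Cmod (F (pred k) x))).
  - pose proof (Cmod_tri (RtoC x * F k x) (RtoC (INR k) * F (pred k) x)) as T.
    rewrite !Cmod_mul, !Cmod_RtoC, (Rabs_right (INR k)) in T by nn.
    assert (0 <= Rabs x ^ j) by nn. cbn [pow]. nra.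
  - assert (INR k <= INR N) by (auto with real). pose proof (pos_INR k).
    nra.
Qed.

Lemma schwartz1_add F G : schwartz1 F -> schwartz1 G -> schwartz1 (fam1_add F G).
Proof.
  intros HF HG. apply schwartz1_mk.
  - intros n x. apply cder_add; apply schwartz1_cder; auto.
  - intros j n. destruct HF as [_ HF], HG as [_ HG]. destruct (HF j n) as [A HA], (HG j n) as [B HB].
    exists (A + B). intros x. specialize (HA x). specialize (HB x). unfold fam1_add.
    pose proof (Cmod_tri (F n x) (G n x)). assert (0 <= Rabs x ^ j) by nn. nra.
Qed.
Lemma schwartz1_scal c F : schwartz1 F -> schwartz1 (fam1_scal c F).
Proof.
  intros HF. apply schwartz1_mk.
  - intros n x. apply cder_scal; apply schwartz1_cder; auto.
  - intros j n. destruct HF as [_ HF]. destruct (HF j n) as [A HA].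
    exists (Cmod c * A). intros x. specialize (HA x). unfold fam1_scal. rewrite Cmod_mul.
    pose proof (Cmod_ge0 c). nra.
Qed.
Lemma schwartz1_td F : schwartz1 F -> schwartz1 (td1 F).
Proof. intros [A B]. split; intros; unfold td1; auto. Qed.
Lemma tD1_eq F : tD1 F = fam1_scal (Copp Ci) (td1 F).
Proof. auto. Qed.
Lemma schwartz1_tD F : schwartz1 F -> schwartz1 (tD1 F).
Proof. intros. apply schwartz1_scal, schwartz1_td; auto. Qed.
Lemma tM1_cder (F : fam1) n x :
  (forall k, (k <= n)%nat -> cder (F k) x (F (S k) x)) -> cder (tM1 F n) x (tM1 F (S n) x).
Proof.
  intros H. unfold tM1. eapply cder_eq.
  - apply cder_add; [apply cder_mul; [apply cder_id|apply H; lia]|].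
    apply cder_scal. apply (H (pred n)). lia.
  - rewrite S_INR, RtoC_add. change (RtoC 1) with C1. destruct n as [|n]; cbn [pred INR].
    + change (RtoC 0) with C0. ring.
    + ring.
Qed.
Lemma schwartz1_tM F : schwartz1 F -> schwartz1 (tM1 F).
Proof.
  intros HF. apply schwartz1_mk.
  - intros n x. apply tM1_cder. intros; apply schwartz1_cder; auto.
  - intros j n. destruct (schwartz1_bd F HF (S (j + n))) as [B HB]. eexists. intros x.
    apply (bd1_tM _ _ _ HB); lia.
Qed.
Definition fam1_zero : fam1 := fun _ _ => C0.
Lemma schwartz1_zero : schwartz1 fam1_zero.
Proof.
  apply schwartz1_mk.
  - intros n x. apply cder_const.
  - intros j n. exists 0. intros x. unfold fam1_zero. rewrite Cmod_C0. lra.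
Qed.

Lemma one_sq_pow_le x K : (1 + x ^ 2) ^ K <= 2 ^ K * (1 + Rabs x ^ (2 * K)).
Proof.
  rewrite pow_mult, pow2_abs. set (y := x ^ 2). assert (y0 : 0 <= y) by (unfold y; nra).
  destruct (Rle_or_lt y 1).
  - apply Rle_trans with (2 ^ K); [apply pow_incr; lra|].
    assert (0 <= y ^ K) by nn. assert (0 < 2 ^ K) by nn. nra.
  - apply Rle_trans with ((2 * y) ^ K); [apply pow_incr; lra|]. rewrite Rpow_mult_distr.
    assert (0 < 2 ^ K) by nn. nra.
Qed.
Lemma schwartz1_weight F : schwartz1 F -> forall n K, exists C, 0 <= C /\ forall x, Cmod (F n x) * (1 + x ^ 2) ^ K <= C.
Proof.
  intros HF n K. destruct (schwartz1_bd F HF (2 * K + n)) as [B HB]. exists (2 ^ K * (B + B)).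
  assert (P : 0 < 2 ^ K) by nn. split.
  - pose proof (bd1_nonneg _ _ _ HB). nra.
  - intros x. pose proof (HB 0%nat n x ltac:(lia) ltac:(lia)) as h0. pose proof (HB (2 * K)%nat n x ltac:(lia) ltac:(lia)) as h1.
    pose proof (one_sq_pow_le x K). pose proof (Cmod_ge0 (F n x)). nra.
Qed.
Lemma schwartz1_mul_nice (g : R -> Cx) F n K A :
  (forall x, ccont g x) -> (forall x, Cmod (g x) <= A * (1 + x ^ 2) ^ K) -> schwartz1 F ->
  cnice (fun x => g x * F n x)%cx.
Proof.
  intros Hc Hb HF. split; [intros; apply ccont_mul; auto; apply schwartz1_ccont; auto|].
  destruct (schwartz1_weight F HF n (S K)) as (C & C0 & HC). exists (A * C).
  intros x. rewrite Cmod_mul. specialize (HC x). specialize (Hb x). change ((1 + x ^ 2) ^ S K) with ((1 + x ^ 2) * (1 + x ^ 2) ^ K) in HC.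
  pose proof (Cmod_ge0 (g x)). assert (P : 1 <= 1 + x ^ 2) by nra.
  pose proof (pow_R1_Rle _ K P). nra.
Qed.
Lemma schwartz1_nice F n : schwartz1 F -> cnice (F n).
Proof.
  intros HF. apply cnice_ext with (fun x => C1 * F n x)%cx; [intros; ring|].
  apply (schwartz1_mul_nice (fun _ => C1) F n 0 1); auto.
  - intros; apply ccont_const.
  - intros. rewrite Cmod_C1. lra.
Qed.
Lemma schwartz1_mul2_nice F G n m : schwartz1 F -> schwartz1 G -> cnice (fun x => G m x * F n x)%cx.
Proof.
  intros HF HG. destruct (schwartz1_weight G HG m 0) as (C & _ & HC).
  apply schwartz1_mul_nice with 0%nat C; auto.
  - intros; apply schwartz1_ccont; auto.
  - intros. specialize (HC x). lra.
Qed.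

(** Induction by halving the argument: [exp y] is the square of [exp (y / 2)], of which one factor
    dominates [y / 2] and the other the previous power. *)
Lemma pow_le_exp m : exists C, 0 <= C /\ forall y, 0 <= y -> y ^ m <= C * exp y.
Proof.
  induction m as [|m (C & C0 & IH)].
  - exists 1. split; [lra|]. intros y y0. pose proof (exp_ineq1_le y). lra.
  - exists (2 ^ S m * C). split; [apply Rmult_le_pos; [apply pow_le; lra|auto]|]. intros y y0.
    specialize (IH (y / 2) ltac:(lra)). pose proof (exp_ineq1_le (y / 2)). set (e := exp (y / 2)) in *.
    replace (exp y) with (e * e) by (unfold e; rewrite <- exp_plus; f_equal; lra).
    replace y with (2 * (y / 2)) by lra. rewrite Rpow_mult_distr.
    replace (2 ^ S m * C * (e * e)) with (2 ^ S m * (e * (C * e))) by ring.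
    apply Rmult_le_compat_l; [apply pow_le; lra|].
    apply Rmult_le_compat; [lra|apply pow_le; lra|lra|auto].
Qed.
Lemma gauss_decay j : exists C, forall x, Rabs x ^ j * exp (- x ^ 2 / 2) <= C.
Proof.
  destruct (pow_le_exp j) as (C & C0 & H). exists (1 + 2 ^ j * C). intros x.
  pose proof (exp_pos (- x ^ 2 / 2)) as P.
  assert (E : exp (- x ^ 2 / 2) <= 1). { rewrite <- exp_0. 
    destruct (Req_dec x 0) as [->|h]; [right; f_equal; lra|]. left. apply exp_increasing. nra. }
  destruct (Rle_or_lt (Rabs x) 1) as [h|h].
  - assert (Rabs x ^ j <= 1) by (rewrite <- (pow1 j); apply pow_incr; split; [apply Rabs_pos|auto]). assert (0 <= 2 ^ j * C) by nn. nra.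
  - assert (Rabs x ^ j <= (x ^ 2) ^ j). { rewrite <- (pow2_abs x). apply pow_incr. nra. }
    specialize (H (x ^ 2 / 2) ltac:(nra)).
    assert ((x ^ 2) ^ j <= 2 ^ j * (C * exp (x ^ 2 / 2))).
    { replace ((x ^ 2) ^ j) with ((2 * (x ^ 2 / 2)) ^ j) by (f_equal; lra). rewrite Rpow_mult_distr.
      apply Rmult_le_compat_l; [apply pow_le; lra|auto]. }
    assert (EE : exp (x ^ 2 / 2) * exp (- x ^ 2 / 2) = 1) by (rewrite <- exp_plus, <- exp_0; f_equal; lra).
    apply Rle_trans with (2 ^ j * (C * exp (x ^ 2 / 2)) * exp (- x ^ 2 / 2)).
    + nra.
    + replace (2 ^ j * (C * exp (x ^ 2 / 2)) * exp (- x ^ 2 / 2)) with (2 ^ j * C * (exp (x ^ 2 / 2) * exp (- x ^ 2 / 2))) by ring.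
      rewrite EE. lra.
Qed.

(** * Hermite functions with all their derivatives *)

Definition gauss_const : R := / sqrt (I (fun x => exp (- x ^ 2 / 2) ^ 2)).
(** Derivatives of the Gaussian obey a two-step recurrence, so the recursion carries two consecutive
    ones; the dummy [0] that accompanies [k = 0] is multiplied by [INR 0]. *)
Fixpoint gauss_pair (k : nat) : (R -> R) * (R -> R) :=
  match k with
  | O => (fun x => gauss_const * exp (- x ^ 2 / 2), fun _ => 0)
  | S k => let (g, g') := gauss_pair k in (fun x => - (x * g x + INR k * g' x), g)
  end.
(** [hr n k] is the [k]-th derivative of the [n]-th normalised Hermite function. *)
Fixpoint hr (n k : nat) (x : R) : R :=
  match n with
  | O => fst (gauss_pair k) x
  | S n' => / sqrt 2 * / sqrt (INR (S n')) *
            (x * hr n' k x + INR k * hr n' (pred k) x - hr n' (S k) x)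
  end.

Definition rX (f : nat -> R -> R) : nat -> R -> R := fun k x => x * f k x + INR k * f (pred k) x.
Definition rd (f : nat -> R -> R) : nat -> R -> R := fun k => f (S k).
Lemma rd_rX f k x : rX f (S k) x = rX (rd f) k x + f k x.
Proof. unfold rX, rd. destruct k; cbn [pred INR]; ring. Qed.

Lemma hr0_S k x : hr 0 (S k) x = - rX (hr 0) k x.
Proof.
  unfold rX. cbn [hr gauss_pair]. destruct (gauss_pair k) as [g g'] eqn:E.
  destruct k; cbn [pred].
  - cbn. ring.
  - cbn [gauss_pair] in E. destruct (gauss_pair k). inversion E; subst. auto.
Qed.
Lemma sqrtS_pos n : 0 < sqrt (INR (S n)).
Proof. apply sqrt_lt_R0. apply lt_0_INR. lia. Qed.
Lemma sqrt2_pos : 0 < sqrt 2.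
Proof. apply sqrt_lt_R0; lra. Qed.
Lemma hr_raise n k x : rX (hr n) k x - hr n (S k) x = sqrt 2 * sqrt (INR (S n)) * hr (S n) k x.
Proof.
  unfold rX. cbn [hr]. pose proof (sqrtS_pos n). pose proof sqrt2_pos. field. lra.
Qed.
Lemma sq_sqrt2 : sqrt 2 * sqrt 2 = 2.
Proof. apply sqrt_sqrt; lra. Qed.
Lemma hr_lower n : forall k x, rX (hr n) k x + hr n (S k) x = sqrt 2 * sqrt (INR n) * hr (pred n) k x.
Proof.
  induction n as [|n IH]; intros k x.
  - rewrite hr0_S. cbn [INR]. rewrite sqrt_0. ring.
  - cbn [pred]. pose proof (sqrtS_pos n) as P.
    assert (S2 : sqrt (INR (S n)) * sqrt (INR (S n)) = INR n + 1) by (rewrite sqrt_sqrt by apply pos_INR; apply S_INR).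
    pose proof sq_sqrt2 as Q2.
    apply Rmult_eq_reg_l with (sqrt 2 * sqrt (INR (S n))); [|nra].
    transitivity (2 * (INR n + 1) * hr n k x).
    2:{ replace (sqrt 2 * sqrt (INR (S n)) * (sqrt 2 * sqrt (INR (S n)) * hr n k x))
        with ((sqrt 2 * sqrt 2) * (sqrt (INR (S n)) * sqrt (INR (S n))) * hr n k x) by ring. rewrite Q2, S2. ring. }
    (* [a a* = a* a + 2] for [a = rX + rd], [a* = rX - rd]. *)
    assert (E : forall j, sqrt 2 * sqrt (INR (S n)) * hr (S n) j x = rX (hr n) j x - hr n (S j) x).
    { intros; symmetry; apply hr_raise. }
    assert (low : x * (sqrt 2 * sqrt (INR n) * hr (pred n) k x) + INR k * (sqrt 2 * sqrt (INR n) * hr (pred n) (pred k) x)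
       - sqrt 2 * sqrt (INR n) * hr (pred n) (S k) x = 2 * INR n * hr n k x).
    { destruct n as [|m]; [cbn [INR]; rewrite sqrt_0; ring|]. cbn [pred].
      pose proof (hr_raise m k x) as R1. unfold rX in R1.
      transitivity ((sqrt 2 * sqrt (INR (S m))) * (x * hr m k x + INR k * hr m (pred k) x - hr m (S k) x)); [ring|].
      rewrite R1. replace (sqrt 2 * sqrt (INR (S m)) * (sqrt 2 * sqrt (INR (S m)) * hr (S m) k x)) with
       ((sqrt 2 * sqrt 2) * (sqrt (INR (S m)) * sqrt (INR (S m))) * hr (S m) k x) by ring.
      rewrite Q2, sqrt_sqrt by apply pos_INR. ring. }
    rewrite <- !IH in low.
    unfold rX at 1. 
    replace (sqrt 2 * sqrt (INR (S n)) * (x * hr (S n) k x + INR k * hr (S n) (pred k) x + hr (S n) (S k) x))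
     with (x * (sqrt 2 * sqrt (INR (S n)) * hr (S n) k x) + INR k * (sqrt 2 * sqrt (INR (S n)) * hr (S n) (pred k) x)
       + (sqrt 2 * sqrt (INR (S n)) * hr (S n) (S k) x)) by ring.
    rewrite !E. rewrite !rd_rX in *. unfold rX, rd in *.
    lra.
Qed.
Lemma hr_M n k x : rX (hr n) k x = / sqrt 2 * (sqrt (INR n) * hr (pred n) k x + sqrt (INR (S n)) * hr (S n) k x).
Proof.
  pose proof (hr_lower n k x) as A. pose proof (hr_raise n k x) as B. pose proof sqrt2_pos.
  apply Rmult_eq_reg_l with 2; [|lra]. transitivity (sqrt 2 * (sqrt (INR n) * hr (pred n) k x + sqrt (INR (S n)) * hr (S n) k x)); [lra|].
  pose proof sq_sqrt2 as Q. set (s := sqrt 2) in *. rewrite <- Q. field. lra.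
Qed.
Lemma hr_D n k x : hr n (S k) x = / sqrt 2 * (sqrt (INR n) * hr (pred n) k x - sqrt (INR (S n)) * hr (S n) k x).
Proof.
  pose proof (hr_lower n k x) as A. pose proof (hr_raise n k x) as B. pose proof sqrt2_pos.
  apply Rmult_eq_reg_l with 2; [|lra]. transitivity (sqrt 2 * (sqrt (INR n) * hr (pred n) k x - sqrt (INR (S n)) * hr (S n) k x)); [lra|].
  pose proof sq_sqrt2 as Q. set (s := sqrt 2) in *. rewrite <- Q. field. lra.
Qed.

Lemma hr_derive n : forall (k : nat) (x : R), is_derive (hr n k) x (hr n (S k) x).
Proof.
  induction n as [|n IH].
  - intros k. induction k as [k IHk] using lt_wf_ind. intros x. destruct k as [|k].
    + cbn [INR pred hr gauss_pair fst]. auto_derive; [trivial|]. 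
      replace (- (x * (x * 1)) * / 2) with (- x ^ 2 / 2) by auto. field.
    + apply (is_derive_ext (fun x => - (x * hr 0 k x + INR k * hr 0 (pred k) x))).
      { intros t. rewrite hr0_S. auto. }
      rewrite hr0_S. unfold rX. eapply is_derive_eq.
      * apply (is_derive_opp (V := R_NormedModule)). apply (is_derive_plus (V := R_NormedModule)).
        -- apply is_derive_mult_R; [apply (is_derive_id (K := R_AbsRing))|apply IHk; lia].
        -- apply is_derive_scal. apply (IHk (pred k)). lia.
      * unfold opp, plus, one; cbn -[hr INR]. destruct k as [|k]; cbn [pred]; rewrite ?S_INR; [cbn [INR]|]; ring.
  - intros k x. apply (is_derive_ext (fun x => / sqrt 2 * / sqrt (INR (S n)) * (x * hr n k x + INR k * hr n (pred k) x - hr n (S k) x))).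
    { auto. }
    cbn [hr]. eapply is_derive_eq.
    + apply is_derive_scal. apply (is_derive_minus (V := R_NormedModule)); [|apply IH].
      apply (is_derive_plus (V := R_NormedModule)).
      * apply is_derive_mult_R; [apply (is_derive_id (K := R_AbsRing))|apply IH].
      * apply is_derive_scal. auto.
    + unfold minus, opp, plus, one; cbn -[hr INR]. destruct k as [|k]; cbn [pred]; rewrite ?S_INR; [cbn [INR]|]; ring.
Qed.

(** * Hermite functions *)

Lemma hr_decay n : forall j k, exists C, forall x, Rabs x ^ j * Rabs (hr n k x) <= C.
Proof.
  assert (step : forall (f g : R -> R) (c : R) j, (exists C, forall x, Rabs x ^ S j * Rabs (f x) <= C) ->
    (exists C, forall x, Rabs x ^ j * Rabs (g x) <= C) ->
    exists C, forall x, Rabs x ^ j * Rabs (x * f x + c * g x) <= C).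
  { intros f g c j [A HA] [B HB]. exists (A + Rabs c * B). intros x. specialize (HA x). specialize (HB x).
    assert (P : 0 <= Rabs x ^ j) by nn.
    pose proof (Rabs_triang (x * f x) (c * g x)) as T. rewrite !Rabs_mult in T. cbn [pow] in HA.
    pose proof (Rabs_pos c).
    nra. }
  induction n as [|n IH]; intros j k.
  - revert j. induction k as [k IHk] using lt_wf_ind. intros j. destruct k as [|k].
    + destruct (gauss_decay j) as [C HC]. exists (Rabs gauss_const * C). intros x. cbn [hr gauss_pair fst].
      rewrite Rabs_mult, (Rabs_right (exp _)) by nn.
      specialize (HC x). pose proof (Rabs_pos gauss_const). nra.
    + destruct (step (hr 0 k) (hr 0 (pred k)) (INR k) j) as [C HC]; [apply IHk; lia|apply IHk; lia|].
      exists C. intros x. rewrite hr0_S, Rabs_Ropp. auto.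
  - destruct (step (hr n k) (hr n (pred k)) (INR k) j (IH _ _) (IH _ _)) as [A HA].
    destruct (IH j (S k)) as [B HB]. set (r := / sqrt 2 * / sqrt (INR (S n))).
    exists (Rabs r * (A + B)). intros x. cbn [hr]. fold r. rewrite Rabs_mult.
    specialize (HA x). specialize (HB x). assert (P : 0 <= Rabs x ^ j) by nn.
    pose proof (Rabs_triang (x * hr n k x + INR k * hr n (pred k) x) (- hr n (S k) x)) as T. rewrite Rabs_Ropp in T.
    pose proof (Rabs_pos r). unfold Rminus. 
    replace (Rabs x ^ j * (Rabs r * Rabs (x * hr n k x + INR k * hr n (pred k) x + - hr n (S k) x))) with
      (Rabs r * (Rabs x ^ j * Rabs (x * hr n k x + INR k * hr n (pred k) x + - hr n (S k) x))) by ring.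
    apply Rmult_le_compat_l; [auto|]. nra.
Qed.

Definition hfam (n k : nat) (x : R) : Cx := RtoC (hr n k x).
Lemma schwartz1_hfam n : schwartz1 (hfam n).
Proof.
  apply schwartz1_mk.
  - intros k x. apply cder_RtoC, hr_derive.
  - intros j k. destruct (hr_decay n j k) as [C HC]. exists C. intros x. unfold hfam. rewrite Cmod_RtoC. auto.
Qed.
Lemma tM_hfam n k x : tM1 (hfam n) k x = sM (fun n => hfam n k x) n.
Proof.
  pose proof (hr_M n k x) as E. unfold tM1, sM, sA, sB, hfam.
  rewrite <- !RtoC_mul, <- !RtoC_add, <- RtoC_mul. f_equal. auto.
Qed.
Lemma hfam_S n k x : hfam n (S k) x = (- Ci * sD (fun n => hfam n k x) n)%cx.
Proof.
  unfold sD, sA, sB, hfam. rewrite hr_D.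
  apply Cx_ext; cxsimpl; ring.
Qed.
Lemma tD_hfam n k x : tD1 (hfam n) k x = (- sD (fun n => hfam n k x) n)%cx.
Proof.
  unfold tD1. rewrite hfam_S. apply Cx_ext; cxsimpl; ring.
Qed.

(** * Hermite coefficients and orthonormality *)

Definition cf (F : fam1) (n : nat) : Cx := CI (fun x => hfam n 0 x * F 0%nat x)%cx.

Lemma hfam_mul_nice n k F l : schwartz1 F -> cnice (fun x => hfam n k x * F l x)%cx.
Proof. intros. apply schwartz1_mul2_nice; auto using schwartz1_hfam. Qed.
Lemma cf_add F G n : schwartz1 F -> schwartz1 G -> cf (fam1_add F G) n = (cf F n + cf G n)%cx.
Proof.
  intros. unfold cf. rewrite <- CI_add by (apply hfam_mul_nice; auto). apply CI_ext; intros; unfold fam1_add; ring.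
Qed.
Lemma cf_scal z F n : schwartz1 F -> cf (fam1_scal z F) n = (z * cf F n)%cx.
Proof.
  intros. unfold cf. rewrite <- CI_scal by (apply hfam_mul_nice; auto). apply CI_ext; intros; unfold fam1_scal; ring.
Qed.
Lemma cf_sM_aux F n : schwartz1 F -> CI (fun x => sM (fun n => hfam n 0 x) n * F 0%nat x)%cx = sM (cf F) n.
Proof.
  intros HF. unfold sM, sA, sB, cf. pose proof (fun n => hfam_mul_nice n 0 F 0 HF) as N.
  rewrite <- !(CI_scal (RtoC (sqrt _))), <- CI_add, <- CI_scal by auto using cnice_scal, cnice_add.
  apply CI_ext; intros; ring.
Qed.
Lemma cf_sD_aux F n : schwartz1 F -> CI (fun x => sD (fun n => hfam n 0 x) n * F 0%nat x)%cx = sD (cf F) n.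
Proof.
  intros HF. unfold sD, sA, sB, cf. pose proof (fun n => hfam_mul_nice n 0 F 0 HF) as N.
  rewrite <- !(CI_scal (RtoC (sqrt _))), <- CI_sub, <- CI_scal by auto using cnice_scal, cnice_sub.
  apply CI_ext; intros; ring.
Qed.
Lemma cf_tM F n : schwartz1 F -> cf (tM1 F) n = sM (cf F) n.
Proof.
  intros HF. rewrite <- cf_sM_aux by auto. apply CI_ext. intros x. rewrite <- tM_hfam.
  unfold tM1. cbn [INR pred]. ring.
Qed.
Lemma CI_by_parts F G n m : schwartz1 F -> schwartz1 G ->
  CI (fun x => G (S m) x * F n x)%cx = (- CI (fun x => G m x * F (S n) x))%cx.
Proof.
  intros HF HG.
  assert (E : (CI (fun x => G (S m) x * F n x) + CI (fun x => G m x * F (S n) x))%cx = C0).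
  - rewrite <- CI_add by (apply schwartz1_mul2_nice; auto).
    destruct (schwartz1_mul2_nice F G n m HF HG) as [_ [C HC]].
    apply CI_deriv with (fun x => G m x * F n x)%cx C.
    + intros x. apply cder_mul; apply schwartz1_cder; auto.
    + intros x. apply ccont_add; apply ccont_mul; apply schwartz1_ccont; auto.
    + auto.
  - set (a := CI _) in *. set (b := CI _) in E |- *. transitivity (a + b - b)%cx; [ring|rewrite E; ring].
Qed.
Lemma cf_td F n : schwartz1 F -> cf (td1 F) n = (Ci * sD (cf F) n)%cx.
Proof.
  intros HF. rewrite <- cf_sD_aux by auto. unfold cf, td1.
  pose proof (CI_by_parts F (hfam n) 0 0 HF (schwartz1_hfam n)) as E.
  transitivity (- CI (fun x => hfam n 1 x * F 0%nat x))%cx; [rewrite E; ring|].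
  rewrite <- CI_opp by (apply hfam_mul_nice; auto).
  rewrite <- CI_scal. 2:{ apply cnice_ext with (fun x => Ci * (hfam n 1 x * F 0%nat x))%cx.
     - intros x. rewrite hfam_S. apply Cx_ext; cxsimpl; ring.
     - apply cnice_scal, hfam_mul_nice; auto. }
  apply CI_ext; intros. rewrite hfam_S. ring.
Qed.
Lemma cf_tD F n : schwartz1 F -> cf (tD1 F) n = sD (cf F) n.
Proof.
  intros HF. rewrite tD1_eq, cf_scal by (apply schwartz1_td; auto). rewrite cf_td by auto. apply Cx_ext; cxsimpl; ring.
Qed.

(** The hypothesis says that the lowering operator kills [F]; on coefficients that operator is a
    nonzero multiple of [sB]. *)
Lemma cf_hfam_lower F : schwartz1 F -> (forall x, F 1%nat x = (- (RtoC x * F 0%nat x))%cx) ->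
  forall n, cf F (S n) = C0.
Proof.
  intros HF E n.
  assert (Z : (sM (cf F) n + Ci * sD (cf F) n)%cx = C0).
  { rewrite <- cf_tM, <- cf_td by auto. unfold cf.
    rewrite <- CI_add by (apply hfam_mul_nice; auto using schwartz1_tM, schwartz1_td).
    rewrite (CI_ext _ (fun x => C0 * (hfam n 0 x * F 0%nat x))%cx).
    - rewrite CI_scal by (apply hfam_mul_nice; auto). ring.
    - intros x. unfold tM1, td1. rewrite E. cbn [INR]. change (RtoC 0) with C0. ring. }
  assert (K : (sM (cf F) n + Ci * sD (cf F) n)%cx = (RtoC (2 * / sqrt 2) * sB (cf F) n)%cx).
  { unfold sM, sD. apply Cx_ext; cxsimpl; ring. }
  rewrite K in Z. pose proof sqrt2_pos. pose proof (sqrtS_pos n).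
  apply Cmul_eq0 in Z. destruct Z as [Z|Z].
  - apply (f_equal re) in Z. cbn in Z. assert (0 < / sqrt 2) by nn. lra.
  - apply Cmul_eq0 in Z. destruct Z as [Z|Z]; [|exact Z]. apply (f_equal re) in Z. cbn [re RtoC C0] in Z. lra.
Qed.
Lemma gauss_const_pos : 0 < gauss_const /\ gauss_const ^ 2 * I (fun x => exp (- x ^ 2 / 2) ^ 2) = 1.
Proof.
  assert (N : nice (fun x => exp (- x ^ 2 / 2) ^ 2)).
  { destruct (gauss_decay 0) as [C0 H0], (gauss_decay 1) as [C1 H1]. split.
    - intros x. eapply is_derive_continuous. auto_derive; [trivial|reflexivity].
    - exists (C0 * C0 + C1 * C1). intros x. specialize (H0 x). specialize (H1 x).
      pose proof (exp_pos (- x ^ 2 / 2)). set (e := exp _) in *.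
      rewrite Rabs_right by nra. pose proof (Rabs_pos x). rewrite <- (pow2_abs x).
      assert (0 <= Rabs x * e) by nra.
      nra. }
  assert (P : 0 < I (fun x => exp (- x ^ 2 / 2) ^ 2)).
  { apply (I_pos _ 0); [exact N| |].
    - nn.
    - nn. }
  unfold gauss_const. set (J := I _) in *. assert (Q : 0 < sqrt J) by (apply sqrt_lt_R0; auto).
  split; [apply Rinv_0_lt_compat; auto|]. rewrite <- (sqrt_sqrt J) at 2 by lra. field. lra.
Qed.
Lemma cf_hfam0 n : cf (hfam 0) n = if Nat.eqb n 0 then C1 else C0.
Proof.
  destruct n as [|n]; cbn [Nat.eqb].
  - destruct gauss_const_pos as [P E]. unfold cf, CI.
    assert (N : nice (fun x => exp (- x ^ 2 / 2) ^ 2)).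
    { apply nice_ext with (fun x => (/ gauss_const) ^ 2 * re (hfam 0 0 x * hfam 0 0 x)).
      - intros x. unfold hfam. cbn [re Cmul RtoC hr gauss_pair fst im]. field. lra.
      - apply nice_scal. apply (cnice_re (fun x => hfam 0 0 x * hfam 0 0 x)%cx). apply hfam_mul_nice, schwartz1_hfam. }
    apply Cx_ext; cbn [re im C1].
    + rewrite <- E, <- I_scal by exact N. f_equal. apply functional_extensionality. intros x.
      unfold hfam. cbn [re Cmul RtoC hr gauss_pair fst im]. ring.
    + transitivity (I (fun x => 0 * exp (- x ^ 2 / 2) ^ 2)).
      * f_equal. apply functional_extensionality. intros x. unfold hfam. cbn [re Cmul RtoC im]. ring.
      * rewrite I_scal by exact N. ring.
  - apply cf_hfam_lower; [apply schwartz1_hfam|]. intros x. unfold hfam. rewrite hr0_S. unfold rX.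
    cbn [INR pred]. apply Cx_ext; cxsimpl; ring.
Qed.
(** The only integral computed is that of the Gaussian: raising [hfam m] gives a multiple of
    [hfam (S m)], and on coefficients raising is [sqrt 2] times [sA]. *)
Lemma cf_hfam m : forall n, cf (hfam m) n = if Nat.eqb n m then C1 else C0.
Proof.
  induction m as [|m IH]; intros n; [apply cf_hfam0|].
  assert (E : (RtoC (sqrt 2 * sqrt (INR (S m))) * cf (hfam (S m)) n)%cx = (RtoC (sqrt 2) * sA (cf (hfam m)) n)%cx).
  { transitivity (sM (cf (hfam m)) n - Ci * sD (cf (hfam m)) n)%cx.
    - rewrite <- cf_tM, <- cf_td by apply schwartz1_hfam. rewrite <- cf_scal by apply schwartz1_hfam.
      unfold cf. rewrite <- CI_sub by (apply hfam_mul_nice; auto using schwartz1_tM, schwartz1_td, schwartz1_hfam).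
      apply CI_ext. intros x. unfold fam1_scal, td1, tM1, hfam. rewrite <- (RtoC_mul _ (hr (S m) 0 x)), <- hr_raise. unfold rX. apply Cx_ext; cxsimpl; ring.
    - unfold sM, sD.
      assert (E2 : sqrt 2 = 2 * / sqrt 2).
      { pose proof sqrt2_pos as P. pose proof sq_sqrt2 as Q. set (s := sqrt 2) in *. rewrite <- Q. field. lra. }
      set (r := / sqrt 2) in *. rewrite E2.
      apply Cx_ext; cxsimpl; ring. }
  pose proof sqrt2_pos as P. pose proof (sqrtS_pos m) as Q.
  assert (R1 : forall z w, (RtoC (sqrt 2 * sqrt (INR (S m))) * z)%cx = (RtoC (sqrt 2 * sqrt (INR (S m))) * w)%cx -> z = w).
  { intros z w H. assert (X : sqrt 2 * sqrt (INR (S m)) <> 0) by nra. apply Cx_ext.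
    - apply (f_equal re) in H. cbn [re Cmul RtoC im] in H. nra.
    - apply (f_equal im) in H. cbn [re Cmul RtoC im] in H. nra. }
  apply R1. rewrite E. unfold sA. rewrite IH. destruct n as [|n]; cbn [pred Nat.eqb].
  - cbn [INR]. rewrite sqrt_0. change (RtoC 0) with C0. ring.
  - destruct (Nat.eqb_spec n m) as [->|h]; rewrite RtoC_mul; ring.
Qed.

(** * Bounds on Hermite functions, polynomial in the index *)

Lemma square_le_integral (f df s : R -> R) :
  (forall x : R, is_derive f x (df x)) -> nice s -> (forall x, Rabs (2 * f x * df x) <= s x) ->
  (exists C, forall x, Rabs (f x ^ 2) * (1 + x ^ 2) <= C) -> forall x, f x ^ 2 <= I s.
Proof.
  intros Hd [Hc [C HC]] Hs [B HB] x.
  destruct (nice_prim s C Hc HC) as (lp & lm & L1 & L2 & _).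
  rewrite (I_char (Pr s) s lp lm); auto using Pr_derive.
  assert (D : forall t, is_derive (fun t => f t ^ 2) t (2 * f t * df t)).
  { intros t. apply (is_derive_ext (fun t => f t * f t)); [intros; cbn; ring|].
    eapply is_derive_eq; [apply is_derive_mult_R; apply Hd|cbn; ring]. }
  assert (Mon : forall a b, a <= b -> Pr s a <= Pr s b).
  { intros a b ab. pose proof (derive_compare (fun _ => 0) (Pr s) (fun _ => 0) s a b ab) as K. enough (0 - 0 <= Pr s b - Pr s a) by lra. apply K; auto.
    - intros; apply (is_derive_const (V := R_NormedModule)).
    - intros; apply Pr_derive; auto.
    - intros y _. specialize (Hs y). pose proof (Rabs_pos (2 * f y * df y)). lra. }
  apply le_epsilon. intros e he. destruct (L1 (e / 3)) as (X1 & h1); [lra|].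
  destruct (L2 (e / 3)) as (X2 & h2); [lra|]. destruct (limm_zero _ B HB (e / 3)) as (X3 & h3); [lra|].
  set (b := Rmax x X1). set (a := Rmin x (Rmin (- X2) (- X3))).
  assert (x <= b /\ X1 <= b) as [b1 b2] by (split; [apply Rmax_l|apply Rmax_r]).
  assert (a <= x /\ a <= - X2 /\ a <= - X3) as (a1 & a2 & a3).
  { unfold a. pose proof (Rmin_l x (Rmin (- X2) (- X3))). pose proof (Rmin_r x (Rmin (- X2) (- X3))).
    pose proof (Rmin_l (- X2) (- X3)). pose proof (Rmin_r (- X2) (- X3)). lra. }
  specialize (h1 b b2). specialize (h2 (- a) ltac:(lra)). specialize (h3 (- a) ltac:(lra)).
  rewrite Ropp_involutive in *. apply Rabs_def2 in h1. apply Rabs_def2 in h2. apply Rabs_def2 in h3.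
  pose proof (derive_compare (fun t => f t ^ 2) (Pr s) (fun t => 2 * f t * df t) s a x a1) as K.
  assert (f x ^ 2 - f a ^ 2 <= Pr s x - Pr s a).
  { apply K; auto.
    - intros; apply Pr_derive; auto.
    - intros y _. eapply Rle_trans; [apply Rle_abs|apply Hs]. }
  pose proof (Mon x b b1). lra.
Qed.
Lemma nice_hh n k m l : nice (fun x => hr n k x * hr m l x).
Proof.
  apply nice_ext with (fun x => re (hfam n k x * hfam m l x)).
  - intros x. unfold hfam. cbn [re Cmul RtoC im]. ring.
  - apply (cnice_re (fun x => hfam n k x * hfam m l x)%cx). apply hfam_mul_nice, schwartz1_hfam.
Qed.
Lemma I_hh n : I (fun x => hr n 0 x * hr n 0 x) = 1.
Proof.
  pose proof (cf_hfam n n) as E. rewrite Nat.eqb_refl in E. apply (f_equal re) in E. cbn [re C1] in E.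
  rewrite <- E. unfold cf, CI. cbn [re]. f_equal. apply functional_extensionality. intros x.
  unfold hfam. cbn [re Cmul RtoC im]. ring.
Qed.
Lemma hr_sup n x : Rabs (hr n 0 x) <= 2 * wt n.
Proof.
  assert (H : hr n 0 x ^ 2 <= 2 * INR n + 2).
  (* [s] dominates the sum of the squares of the function and of its derivative, hence twice their
     product; by orthonormality its integral is [n + (n + 1) + 1]. *)
  { set (s := fun x => (INR n * (hr (pred n) 0 x * hr (pred n) 0 x) + (INR n + 1) * (hr (S n) 0 x * hr (S n) 0 x)) + hr n 0 x * hr n 0 x).
    apply Rle_trans with (I s).
    - apply square_le_integral with (hr n 1).
      + intros; apply hr_derive.
      + unfold s. auto using nice_add, nice_scal, nice_hh.
      + intros t. unfold s. rewrite hr_D. set (a := hr (pred n) 0 t). set (b := hr (S n) 0 t). set (h := hr n 0 t).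
        pose proof inv_sqrt2_sq as Q. set (r := / sqrt 2) in *.
        pose proof (sqrt_sqrt (INR n) (pos_INR n)) as S1. pose proof (sqrt_sqrt (INR (S n)) (pos_INR (S n))) as S2.
        set (u := sqrt (INR n)) in *. set (v := sqrt (INR (S n))) in *. rewrite S_INR in S2. rewrite <- S1 at 1. rewrite <- S2.
        set (p := u * a). set (q := v * b).
        replace (u * u * (a * a) + v * v * (b * b) + h * h) with (p ^ 2 + q ^ 2 + h ^ 2) by (unfold p, q; ring).
        assert (X : (r * (p - q)) ^ 2 <= p ^ 2 + q ^ 2).
        { pose proof (pow2_ge_0 (p + q)). nra. }
        set (w := r * (p - q)) in *. apply Rabs_le. pose proof (pow2_ge_0 (h - w)). pose proof (pow2_ge_0 (h + w)). nra.
      + destruct (nice_hh n 0 n 0) as [_ [C HC]]. exists C. intros t. 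
        replace (hr n 0 t ^ 2) with (hr n 0 t * hr n 0 t) by ring. auto.
    - unfold s. rewrite !I_add, !I_scal by auto using nice_add, nice_scal, nice_hh. rewrite !I_hh. lra. }
  rewrite <- (pow2_abs (hr n 0 x)) in H. unfold wt. rewrite S_INR.
  pose proof (pos_INR n). nra.
Qed.

Lemma poly_shift_bound (f : nat -> R -> R) C p :
  0 <= C -> (forall n x, Rabs (f n x) <= C * wt n ^ p) ->
  forall (e : R) n x, Rabs e <= 1 ->
   Rabs (/ sqrt 2 * (sqrt (INR n) * f (pred n) x + e * (sqrt (INR (S n)) * f (S n) x))) <= (C + C * 2 ^ p) * wt n ^ S p.
Proof.
  intros C0 H e n x he. pose proof inv_sqrt2_bounds. destruct (sqrt_INR_le n) as [a1 a2]. destruct (sqrt_INRS_le n) as [b1 b2].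
  pose proof (H (pred n) x) as H1. pose proof (H (S n) x) as H2. pose proof (wt_ge1 n).
  assert (wt (pred n) ^ p <= wt n ^ p) by (apply pow_incr; pose proof (wt_ge1 (pred n)); split; [lra|apply wt_mono; lia]).
  assert (wt (S n) ^ p <= 2 ^ p * wt n ^ p) by (rewrite <- Rpow_mult_distr; apply pow_incr; rewrite wt_S; lra).
  rewrite Rabs_mult, (Rabs_right (/ sqrt 2)) by lra.
  pose proof (Rabs_triang (sqrt (INR n) * f (pred n) x) (e * (sqrt (INR (S n)) * f (S n) x))) as T.
  rewrite !Rabs_mult, (Rabs_right (sqrt (INR n))), (Rabs_right (sqrt (INR (S n)))) in T by lra.
  set (A := Rabs (f (pred n) x)) in *. set (B := Rabs (f (S n) x)) in *.
  assert (0 <= A) by apply Rabs_pos. assert (0 <= B) by apply Rabs_pos.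
  assert (U : A <= C * wt n ^ p) by nra. assert (V : B <= C * 2 ^ p * wt n ^ p) by nra.
  set (W := Rabs (sqrt (INR n) * f (pred n) x + e * (sqrt (INR (S n)) * f (S n) x))) in *.
  assert (0 <= W) by apply Rabs_pos.
  apply Rle_trans with W; [nra|]. eapply Rle_trans; [exact T|]. cbn [pow].
  assert (0 <= sqrt (INR (S n)) * B) by nra. nra.
Qed.
(** A derivative or a factor x yields a combination of neighbouring Hermite functions with
    coefficients of size at most [wt n], so polynomial growth in [n] survives. *)
Lemma hr_poly_bound : forall j k, exists C p, 0 <= C /\ forall n x, Rabs x ^ j * Rabs (hr n k x) <= C * wt n ^ p.
Proof.
  induction j as [|j IHj].
  - induction k as [|k (C & p & C0 & H)].
    + exists 2, 1%nat. split; [lra|]. intros n x. cbn [pow]. rewrite Rmult_1_l, Rmult_1_r. apply hr_sup.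
    + exists (C + C * 2 ^ p), (S p). split.
      { nn. }
      intros n x. rewrite Rmult_1_l, hr_D.
      replace (sqrt (INR n) * hr (pred n) k x - sqrt (INR (S n)) * hr (S n) k x) with
        (sqrt (INR n) * hr (pred n) k x + (-1) * (sqrt (INR (S n)) * hr (S n) k x)) by ring.
      apply (poly_shift_bound (fun n => hr n k)); auto.
      * intros m y. specialize (H m y). lra.
      * rewrite Rabs_left; lra.
  - intros k. destruct (IHj k) as (C & p & C0 & H). destruct (IHj (pred k)) as (C' & p' & C0' & H').
    exists ((C + C * 2 ^ p) + INR k * C'), (S p + p')%nat. pose proof (pos_INR k). split.
    { nn. }
    intros n x.
    assert (E : Rabs x ^ S j * Rabs (hr n k x) <= Rabs (Rabs x ^ j * rX (hr n) k x) + INR k * (Rabs x ^ j * Rabs (hr n (pred k) x))).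
    { unfold rX. assert (P : 0 <= Rabs x ^ j) by nn.
      rewrite Rabs_mult, (Rabs_right (Rabs x ^ j)) by lra. cbn [pow].
      assert (T : Rabs (x * hr n k x) <= Rabs (x * hr n k x + INR k * hr n (pred k) x) + INR k * Rabs (hr n (pred k) x)).
      { replace (x * hr n k x) with ((x * hr n k x + INR k * hr n (pred k) x) + - (INR k * hr n (pred k) x)) at 1 by ring.
        eapply Rle_trans; [apply Rabs_triang|]. rewrite Rabs_Ropp, (Rabs_mult (INR k)), (Rabs_right (INR k)) by lra. lra. }
      rewrite Rabs_mult in T. nra. }
    eapply Rle_trans; [exact E|].
    assert (A : Rabs (Rabs x ^ j * rX (hr n) k x) <= (C + C * 2 ^ p) * wt n ^ S p).
    { rewrite hr_M.
      replace (Rabs x ^ j * (/ sqrt 2 * (sqrt (INR n) * hr (pred n) k x + sqrt (INR (S n)) * hr (S n) k x))) with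
        (/ sqrt 2 * (sqrt (INR n) * (Rabs x ^ j * hr (pred n) k x) + 1 * (sqrt (INR (S n)) * (Rabs x ^ j * hr (S n) k x)))) by ring.
      apply (poly_shift_bound (fun n x => Rabs x ^ j * hr n k x)); auto.
      - intros m y. rewrite Rabs_mult, (Rabs_right (Rabs y ^ j)) by nn. auto.
      - rewrite Rabs_R1; lra. }
    specialize (H' n x).
    pose proof (wt_pow_le n (S p) (S p + p') ltac:(lia)). pose proof (wt_pow_le n p' (S p + p') ltac:(lia)).
    assert (0 <= C + C * 2 ^ p) by nn.
    assert (INR k * (Rabs x ^ j * Rabs (hr n (pred k) x)) <= INR k * (C' * wt n ^ (S p + p'))).
    { apply Rmult_le_compat_l; auto. nra. }
    nra.
Qed.
Lemma hfam_bd1 N : exists C p, 0 <= C /\ forall n, bd1 N (hfam n) (C * wt n ^ p).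
Proof.
  destruct (fin_max (fun j C => 0 <= C /\ exists q, forall n k x, (k <= N)%nat -> Rabs x ^ j * Rabs (hr n k x) <= C * wt n ^ q) N) as [C HC].
  - intros j B B' h [h0 (q & H)]. split; [lra|]. exists q. intros n k x hk. specialize (H n k x hk).
    pose proof (wt_pow_ge1 n q). nra.
  - intros j. destruct (fin_max (fun k C => 0 <= C /\ exists q, forall n x, Rabs x ^ j * Rabs (hr n k x) <= C * wt n ^ q) N) as [C HC].
    + intros k B B' h [h0 (q & H)]. split; [lra|]. exists q. intros n x. specialize (H n x).
      pose proof (wt_pow_ge1 n q). nra.
    + intros k. destruct (hr_poly_bound j k) as (C & p & C0 & H). exists C. split; eauto.
    + exists C. split; [apply (HC 0%nat); lia|].
      assert (Q : exists q, forall k, (k <= N)%nat -> forall n x, Rabs x ^ j * Rabs (hr n k x) <= C * wt n ^ q).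
      { induction N as [|N IH].
        - destruct (HC 0%nat) as (c0 & q & H); [lia|]. exists q. intros k hk. replace k with 0%nat by lia. auto.
        - destruct IH as [q1 H1]; [intros; apply HC; lia|]. destruct (HC (S N)) as (c0 & q & H); [lia|].
          exists (q1 + q)%nat. intros k hk n x. destruct (Nat.eq_dec k (S N)) as [->|].
          + eapply Rle_trans; [apply H|]. apply Rmult_le_compat_l; auto. apply wt_pow_le; lia.
          + eapply Rle_trans; [apply H1; lia|]. apply Rmult_le_compat_l; auto. apply wt_pow_le; lia. }
      destruct Q as [q H]. exists q. auto.
  - assert (Q : exists q, forall j, (j <= N)%nat -> forall n k x, (k <= N)%nat -> Rabs x ^ j * Rabs (hr n k x) <= C * wt n ^ q).
    { revert HC. generalize N at 1 3. intros M HC. induction M as [|M IH].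
      - destruct (HC 0%nat) as (c0 & q & H); [lia|]. exists q. intros j hj. replace j with 0%nat by lia. auto.
      - destruct IH as [q1 H1]; [intros; apply HC; lia|]. destruct (HC (S M)) as (c0 & q & H); [lia|].
        exists (q1 + q)%nat. intros j hj n k x hk. destruct (Nat.eq_dec j (S M)) as [->|].
        + eapply Rle_trans; [apply H; auto|]. apply Rmult_le_compat_l; auto. apply wt_pow_le; lia.
        + eapply Rle_trans; [apply H1; auto; lia|]. apply Rmult_le_compat_l; auto. apply wt_pow_le; lia. }
    destruct Q as [q H]. exists C, q. split; [apply (HC 0%nat); lia|].
    intros n j k x hj hk. unfold hfam. rewrite Cmod_RtoC. auto.
Qed.

(** * Decay of Hermite coefficients and completeness *)

Lemma cf_bound0 F n B : schwartz1 F -> bd1 2 F B -> Cmod (cf F n) <= 32 * B * wt n.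
Proof.
  intros HF HB. replace (32 * B * wt n) with (8 * (4 * B * wt n)) by ring. apply CI_bound; [apply hfam_mul_nice; auto|].
  intros x. rewrite Cmod_mul. unfold hfam. rewrite Cmod_RtoC. pose proof (hr_sup n x).
  pose proof (HB 0%nat 0%nat x ltac:(lia) ltac:(lia)) as h0. pose proof (HB 2%nat 0%nat x ltac:(lia) ltac:(lia)) as h2. rewrite pow2_abs in h2.
  pose proof (Rabs_pos (hr n 0 x)). pose proof (Cmod_ge0 (F 0%nat x)).
  nra.
Qed.
(** By [number_op], [2 n + 1] times a coefficient of [F] is a coefficient of [M^2 F + D^2 F]: each
    power of [wt n] costs two more orders of the seminorm. *)
Lemma cf_decay_aux K : exists N C, 0 <= C /\
  forall F B, schwartz1 F -> bd1 N F B -> forall n, wt n ^ K * Cmod (cf F n) <= C * B * wt n.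
Proof.
  induction K as [|K (N & C & C0 & IH)].
      - exists 2%nat, 32. split; [lra|]. intros F B HF HB n. rewrite Rmult_1_l. apply cf_bound0; auto.
      - exists (S (S N)), (C * ((1 + INR N) * (1 + INR (S N)) + 1)). pose proof (pos_INR N). pose proof (pos_INR (S N)). split; [apply Rmult_le_pos; [auto|nra]|].
        intros F B HF HB n.
        pose proof (number_op (cf F) n) as E.
        pose proof (IH (tM1 (tM1 F)) _ (schwartz1_tM _ (schwartz1_tM _ HF)) (bd1_tM _ _ _ (bd1_tM _ _ _ HB)) n) as A.
        pose proof (IH (tD1 (tD1 F)) _ (schwartz1_tD _ (schwartz1_tD _ HF)) (bd1_tD _ _ _ (bd1_tD _ _ _ HB)) n) as D.
        rewrite cf_tM in A by auto using schwartz1_tM. rewrite cf_tD in D by auto using schwartz1_tD.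
        replace (cf (tM1 F)) with (sM (cf F)) in A by (apply functional_extensionality; intros; symmetry; apply cf_tM; auto).
        replace (cf (tD1 F)) with (sD (cf F)) in D by (apply functional_extensionality; intros; symmetry; apply cf_tD; auto).
        pose proof (Cmod_tri (sM (sM (cf F)) n) (sD (sD (cf F)) n)) as T. rewrite E, Cmod_mul, Cmod_RtoC in T.
        pose proof (pos_INR n). rewrite Rabs_right in T by lra. pose proof (wt_pow_ge1 n K). pose proof (Cmod_ge0 (cf F n)).
        cbn [pow].
        assert (wt n * Cmod (cf F n) <= (2 * INR n + 1) * Cmod (cf F n)) by (unfold wt; rewrite S_INR; nra).
        nra.
Qed.
Lemma cf_decay K : exists N C, 0 <= C /\ forall F B, schwartz1 F -> bd1 N F B -> sb K (cf F) (C * B).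
Proof.
    destruct (cf_decay_aux (S K)) as (N & C & C0 & H). exists N, C. split; [auto|]. intros F B HF HB n.
    specialize (H F B HF HB n). cbn [pow] in H. pose proof (wt_ge1 n).
    nra.
Qed.

(** The quotient is the average of the derivative of [f] along the segment from [x0], so its
    derivatives are explicit integrals. Integration by parts relates them to those of [f] ([rec]),
    and this transfers the decay of [f] to the quotient. *)
Lemma hadamard_real (f : nat -> R -> R) x0 :
  (forall n (x : R), is_derive (f n) x (f (S n) x)) ->
  (forall j n, exists C, forall x, Rabs x ^ j * Rabs (f n x) <= C) -> f 0%nat x0 = 0 ->
  exists g : nat -> R -> R,
    (forall n (x : R), is_derive (g n) x (g (S n) x)) /\
    (forall n j, exists C, forall x, Rabs x ^ j * Rabs (g n x) <= C) /\
    forall x, f 0%nat x = (x - x0) * g 0%nat x.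
Proof.
  intros Hd Hb H0.
  assert (Hb0 : forall n, exists C, 0 <= C /\ forall x, Rabs (f n x) <= C).
  { intros n. destruct (Hb 0%nat n) as [C HC]. exists C. split.
    - specialize (HC 0). pose proof (Rabs_pos (f n 0)). lra.
    - intros x. specialize (HC x). lra. }
  assert (Hc : forall n x, continuous (f n) x) by (intros; eapply is_derive_continuous, Hd).
  set (k := fun n x t => t ^ n * f (S n) (x0 + t * (x - x0))).
  assert (kc : forall n x t, continuous (k n x) t).
  { intros n x t. apply (continuous_mult (K := R_AbsRing)).
    - eapply is_derive_continuous. auto_derive; [trivial|reflexivity].
    - apply (continuous_comp (fun t => x0 + t * (x - x0)) (f (S n))); [|apply Hc].
      eapply is_derive_continuous. auto_derive; [trivial|reflexivity]. }
  assert (ke : forall n x, ex_RInt (k n x) 0 1).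
  { intros. apply (ex_RInt_continuous (V := R_CompleteNormedModule)). auto. }
  set (g := fun n x => RInt (k n x) 0 1).
  assert (gI : forall n x, is_RInt (k n x) 0 1 (g n x)).
  { intros. apply (RInt_correct (V := R_CompleteNormedModule)), ke. }
  assert (gB : forall n, exists C, 0 <= C /\ forall x, Rabs (g n x) <= C).
  { intros n. destruct (Hb0 (S n)) as (C & C0 & HC). exists C. split; [auto|]. intros x.
    replace C with ((1 - 0) * C) by ring. apply abs_RInt_le_const; [lra|apply ke|].
    intros t ht. unfold k. rewrite Rabs_mult. specialize (HC (x0 + t * (x - x0))).
    assert (Rabs (t ^ n) <= 1). { rewrite <- RPow_abs, Rabs_right by lra. rewrite <- (pow1 n). apply pow_incr; lra. }
    pose proof (Rabs_pos (t ^ n)). nra. }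
  assert (rec : forall n x, f n x = (x - x0) * g n x + INR n * g (pred n) x).
  { intros n x.
    assert (D : is_RInt (fun t => (x - x0) * k n x t + INR n * k (pred n) x t) 0 1
       ((fun t => t ^ n * f n (x0 + t * (x - x0))) 1 - (fun t => t ^ n * f n (x0 + t * (x - x0))) 0)).
    { apply (is_RInt_derive (V := R_CompleteNormedModule) (fun t => t ^ n * f n (x0 + t * (x - x0)))).
      - intros t _. eapply is_derive_eq.
        + apply is_derive_mult_R.
          * apply (is_derive_pow (fun t => t) n t 1). apply (is_derive_id (K := R_AbsRing)).
          * apply (is_derive_comp (f n) (fun t => x0 + t * (x - x0))); [apply Hd|].
            instantiate (1 := x - x0). auto_derive; [trivial|ring].
        + unfold k, scal; cbn; unfold mult; cbn. destruct n as [|n]; [cbn; ring|]. cbn [pred]. ring.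
      - intros t _. apply (continuous_plus (V := R_NormedModule)); apply (continuous_scal_r (V := R_NormedModule)); apply kc. }
    cbv beta in D. replace (x0 + 1 * (x - x0)) with x in D by ring. replace (x0 + 0 * (x - x0)) with x0 in D by ring.
    rewrite pow1, Rmult_1_l in D.
    assert (E : is_RInt (fun t => (x - x0) * k n x t + INR n * k (pred n) x t) 0 1 ((x - x0) * g n x + INR n * g (pred n) x)).
    { apply (is_RInt_plus (V := R_NormedModule)); apply (is_RInt_scal (V := R_NormedModule)); apply gI. }
    apply (is_RInt_unique (V := R_CompleteNormedModule)) in D. apply (is_RInt_unique (V := R_CompleteNormedModule)) in E.
    rewrite <- E, D. destruct n; [cbn; rewrite H0; ring|]. rewrite pow_i by lia. ring. }
  exists g. split; [|split].
  - intros n x. destruct (Hb0 (S (S (S n)))) as (M & M0 & HM).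
    apply derive_of_quadratic with M. intros h hh.
    assert (E : is_RInt (fun t => k n (x + h) t - k n x t - h * k (S n) x t) 0 1 (g n (x + h) - g n x - h * g (S n) x)).
    { apply (is_RInt_minus (V := R_NormedModule)); [apply (is_RInt_minus (V := R_NormedModule))|apply (is_RInt_scal (V := R_NormedModule))]; apply gI. }
    rewrite <- (is_RInt_unique (V := R_CompleteNormedModule) _ _ _ _ E). replace (M * h ^ 2) with ((1 - 0) * (M * h ^ 2)) by ring.
    apply abs_RInt_le_const; [lra|eexists; exact E|]. intros t ht. unfold k.
    replace (x0 + t * (x + h - x0)) with ((x0 + t * (x - x0)) + t * h) by ring.
    pose proof (taylor2 (f (S n)) (f (S (S n))) (f (S (S (S n)))) M (Hd _) (Hd _) HM (x0 + t * (x - x0)) (t * h)) as T.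
    replace (t ^ n * f (S n) (x0 + t * (x - x0) + t * h) - t ^ n * f (S n) (x0 + t * (x - x0)) - h * (t ^ S n * f (S (S n)) (x0 + t * (x - x0))))
      with (t ^ n * (f (S n) (x0 + t * (x - x0) + t * h) - f (S n) (x0 + t * (x - x0)) - t * h * f (S (S n)) (x0 + t * (x - x0)))) by (cbn [pow]; ring).
    rewrite Rabs_mult. set (A := Rabs (f _ _ - _ - _)) in *.
    assert (Rabs (t ^ n) <= 1). { rewrite <- RPow_abs, Rabs_right by lra. rewrite <- (pow1 n). apply pow_incr; lra. } assert (0 <= A) by apply Rabs_pos.
    assert ((t * h) ^ 2 <= h ^ 2). { assert (t ^ 2 <= 1) by nra. nra. }
    nra.
  - induction n as [n IH] using lt_wf_ind. intros j. destruct (gB n) as (M & M0 & HM). destruct (Hb j n) as [A HA].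
    assert (Q : exists B, 0 <= B /\ forall x, INR n * (Rabs x ^ j * Rabs (g (pred n) x)) <= B).
    { destruct n as [|n]; [exists 0; split; [lra|]; intros; cbn; lra|]. destruct (IH n (Nat.lt_succ_diag_r n) j) as [B HB].
      exists (INR (S n) * B). pose proof (pos_INR (S n)). split.
      - specialize (HB 0). assert (0 <= Rabs 0 ^ j * Rabs (g n 0)) by nn. nra.
      - intros. apply Rmult_le_compat_l; auto. }
    destruct Q as (B & B0 & HB).
    assert (A0 : 0 <= A). { specialize (HA 0). assert (0 <= Rabs 0 ^ j * Rabs (f n 0)) by nn. lra. }
    exists ((Rabs x0 + 1) ^ j * M + (A + B)). intros x.
    assert (P0 : 0 <= Rabs x ^ j) by nn. pose proof (Rabs_pos (g n x)) as G0.
    (* Near [x0] the quotient is merely bounded; beyond [Rabs x0 + 1] the factor [x - x0] is at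
       least 1 in modulus and [rec] can be solved for [g n]. *)
    destruct (Rle_or_lt (Rabs x) (Rabs x0 + 1)) as [h|h].
    + assert (Rabs x ^ j <= (Rabs x0 + 1) ^ j) by (apply pow_incr; split; [apply Rabs_pos|auto]). specialize (HM x).
      nra.
    + specialize (HA x). specialize (HB x). pose proof (rec n x) as E.
      assert (1 <= Rabs (x - x0)) by (pose proof (Rabs_triang_inv x x0); lra).
      assert (Rabs (g n x) <= Rabs (f n x) + INR n * Rabs (g (pred n) x)).
      { apply Rle_trans with (Rabs (x - x0) * Rabs (g n x)); [nra|]. rewrite <- Rabs_mult.
        replace ((x - x0) * g n x) with (f n x + - (INR n * g (pred n) x)) by lra.
        eapply Rle_trans; [apply Rabs_triang|]. rewrite Rabs_Ropp, Rabs_mult, (Rabs_right (INR n)) by nn. lra. }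
      assert (0 <= (Rabs x0 + 1) ^ j * M) by nn.
      nra.
  - intros x. rewrite (rec 0%nat x). cbn [INR]. ring.
Qed.

Lemma hadamard F x0 : schwartz1 F -> F 0%nat x0 = C0 ->
  exists G, schwartz1 G /\ forall x, F 0%nat x = (RtoC (x - x0) * G 0%nat x)%cx.
Proof.
  intros HF H0. pose proof (schwartz1_cder F HF) as D.
  destruct (hadamard_real (fun n x => re (F n x)) x0) as (g1 & D1 & B1 & E1).
  - intros; apply D.
  - intros j n. destruct HF as [_ HF]. destruct (HF j n) as [C HC]. exists C. intros x. specialize (HC x).
    pose proof (re_le_Cmod (F n x)). assert (0 <= Rabs x ^ j) by nn. nra.
  - rewrite H0; reflexivity.
  - destruct (hadamard_real (fun n x => im (F n x)) x0) as (g2 & D2 & B2 & E2).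
    + intros; apply D.
    + intros j n. destruct HF as [_ HF]. destruct (HF j n) as [C HC]. exists C. intros x. specialize (HC x).
      pose proof (im_le_Cmod (F n x)). assert (0 <= Rabs x ^ j) by nn. nra.
    + rewrite H0; reflexivity.
    + exists (fun n x => mkC (g1 n x) (g2 n x)). split.
      * apply schwartz1_mk.
        -- intros n x; split; cbn; auto.
        -- intros j n. destruct (B1 n j) as [A HA], (B2 n j) as [B HB]. exists (A + B). intros x.
           specialize (HA x). specialize (HB x). pose proof (Cmod_le_re_im (mkC (g1 n x) (g2 n x))) as K. cbn [re im] in K.
           assert (0 <= Rabs x ^ j) by nn. nra.
      * intros x. apply Cx_ext; cxsimpl; rewrite ?E1, ?E2; ring.
Qed.

Definition hx (k : nat) (x : R) : nat -> Cx := fun n => hfam n k x.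
Lemma tmp_hx k x : tmp (hx k x).
Proof.
  destruct (hr_poly_bound 0 k) as (C & p & _ & H). exists p, C. intros n. specialize (H n x).
  unfold hx, hfam. rewrite Cmod_RtoC. lra.
Qed.
Lemma rap_cf F : schwartz1 F -> rap (cf F).
Proof.
  intros HF K. destruct (cf_decay K) as (N & C & _ & H). destruct (schwartz1_bd F HF N) as [B HB].
  exists (C * B). auto.
Qed.
Lemma sM_hx0 x n : sM (hx 0 x) n = (RtoC x * hx 0 x n)%cx.
Proof.
  unfold hx at 1. rewrite <- tM_hfam. unfold tM1, hx. cbn [INR]. change (RtoC 0) with C0. ring.
Qed.
Lemma hr00_pos x : 0 < hr 0 0 x.
Proof. apply Rmult_lt_0_compat; [apply gauss_const_pos|apply exp_pos]. Qed.

(* The partial isometry onto the closed span of the Hermite functions commutes with multiplication by x, so it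
   preserves the functions vanishing at x0; as it fixes the Gaussian it is the identity at x0. *)
Lemma cf_complete0 F x0 : schwartz1 F -> pair (hx 0 x0) (cf F) = F 0%nat x0.
Proof.
  intros HF. pose proof (hr00_pos x0) as P.
  set (l := (F 0%nat x0 * Cinv (RtoC (hr 0 0 x0)))%cx).
  set (F1 := fam1_add F (fam1_scal (- l)%cx (hfam 0))).
  assert (HF1 : schwartz1 F1) by (apply schwartz1_add; auto; apply schwartz1_scal, schwartz1_hfam).
  assert (NZ : RtoC (hr 0 0 x0) <> C0). { intros E. apply (f_equal re) in E. cbn [re RtoC C0] in E. lra. }
  destruct (hadamard F1 x0 HF1) as (G & HG & E).
  { unfold F1, fam1_add, fam1_scal, hfam, l. field. auto. }
  assert (Ec : forall n, cf F n = (C1 * (sM (cf G) n + (- RtoC x0) * cf G n) + l * cf (hfam 0) n)%cx).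
  { intros n. assert (E1 : cf F1 n = (sM (cf G) n + (- RtoC x0) * cf G n)%cx).
    - rewrite <- cf_tM, <- cf_scal, <- cf_add by auto using schwartz1_tM, schwartz1_scal. apply CI_ext. intros x. rewrite E.
      unfold fam1_add, fam1_scal, tM1. cbn [INR].
      apply Cx_ext; cxsimpl; ring.
    - rewrite <- E1. unfold F1. rewrite cf_add, cf_scal by auto using schwartz1_scal, schwartz1_hfam. ring. }
  rewrite (functional_extensionality _ _ Ec).
  rewrite pair_lin_r; auto using tmp_hx, rap_cf, schwartz1_hfam.
  2:{ apply rap_add; [apply rap_sM|apply rap_scal]; auto using rap_cf. }
  assert (Z : pair (hx 0 x0) (fun n => sM (cf G) n + (- RtoC x0) * cf G n)%cx = C0).
  { transitivity (C1 * pair (hx 0 x0) (sM (cf G)) + (- RtoC x0) * pair (hx 0 x0) (cf G))%cx.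
    - rewrite <- pair_lin_r by auto using tmp_hx, rap_cf, rap_sM. f_equal. apply functional_extensionality; intros; ring.
    - rewrite <- pair_sM by auto using tmp_hx, rap_cf.
      rewrite (functional_extensionality _ _ (sM_hx0 x0)). unfold pair.
      rewrite <- (CSeries_scal (- RtoC x0)%cx), <- CSeries_scal, <- CSeries_add by (repeat (apply sm_scal || apply pair_sm); auto using tmp_hx, rap_cf, tmp_scal).
      apply CSeries_zero. intros; ring. }
  rewrite Z. unfold pair.
  rewrite (CSeries_ext _ (fun n => if Nat.eqb n 0 then hx 0 x0 n else C0)).
  - rewrite CSeries_delta. unfold hx, hfam, l. field. auto.
  - intros n. rewrite cf_hfam. destruct (Nat.eqb n 0); ring.
Qed.
Lemma cf_complete k : forall F x, schwartz1 F -> pair (hx k x) (cf F) = F k x.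
Proof.
  induction k as [|k IH]; intros F x HF; [apply cf_complete0; auto|].
  change (F (S k) x) with (td1 F k x). rewrite <- IH by (apply schwartz1_td; auto).
  rewrite (functional_extensionality _ _ (fun n => cf_td F n HF)).
  transitivity (Ci * pair (hx k x) (sD (cf F)) + C0 * pair (hx k x) (sD (cf F)))%cx.
  - transitivity ((- Ci) * pair (sD (hx k x)) (cf F) + C0 * pair (sD (hx k x)) (cf F))%cx.
    + rewrite <- pair_lin_l by auto using tmp_sD, tmp_hx, rap_cf. f_equal. apply functional_extensionality. intros n.
      unfold hx at 1. rewrite hfam_S. unfold hx. ring.
    + rewrite pair_sD by auto using tmp_hx, rap_cf. ring.
  - rewrite <- pair_lin_r by auto using tmp_hx, rap_sD, rap_cf. f_equal. apply functional_extensionality. intros; ring.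
Qed.
(** Converse of [cf_decay]: together they identify the Schwartz topology with that of rapidly
    decreasing sequences. *)
Lemma rec_bound N : exists K C, 0 <= C /\ forall F B, schwartz1 F -> sb K (cf F) B -> bd1 N F (C * B).
Proof.
  destruct (hfam_bd1 N) as (C & p & C0 & H). exists (p + 2)%nat, (4 * C). split; [lra|].
  intros F B HF HB j k x hj hk. rewrite <- cf_complete by auto.
  assert (P : 0 <= Rabs x ^ j) by nn.
  rewrite <- (Rabs_right (Rabs x ^ j)) by lra. rewrite <- Cmod_RtoC, <- Cmod_mul.
  unfold pair. rewrite <- CSeries_scal by (apply pair_sm; auto using tmp_hx, rap_cf).
  replace (4 * C * B) with (4 * (C * B)) by ring.
  rewrite (CSeries_ext _ (fun n => (RtoC (Rabs x ^ j) * hx k x n) * cf F n)%cx) by (intros; ring).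
  apply pair_bound with p; auto. intros n. rewrite Cmod_mul, Cmod_RtoC, Rabs_right by lra. apply H; auto.
Qed.

(** * Series under integrals and derivatives *)

Lemma CSeries_split N a : sm a -> CSeries a = (csum N a + CSeries (fun n => a (N + n)%nat))%cx.
Proof.
  revert a. induction N as [|N IH]; intros a A.
  - change (CSeries a = (C0 + CSeries a)%cx). ring.
  - rewrite (IH a A). cbn [csum].
    assert (A' : sm (fun n => a (N + n)%nat)).
    { clear IH. induction N as [|N IHN]; [exact A|]. apply sm_ext with (fun n => a (N + S n)%nat); [intros; f_equal; lia|].
      apply (sm_S _ IHN). }
    rewrite (CSeries_incr _ A'). rewrite Nat.add_0_r.
    rewrite (CSeries_ext (fun n => a (N + S n)%nat) (fun n => a (S N + n)%nat)) by (intros; f_equal; lia). ring.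
Qed.
Lemma CSeries_tail N a B : (forall n, Cmod (a n) * wt n ^ 3 <= B) ->
  Cmod (CSeries (fun n => a (N + n)%nat)) <= 4 * (B * / wt N).
Proof.
  intros H. apply CSeries_bound. intros n. specialize (H (N + n)%nat).
  pose proof (wt_mono N (N + n) ltac:(lia)). pose proof (wt_mono n (N + n) ltac:(lia)).
  pose proof (wt_ge1 N). pose proof (wt_ge1 n). pose proof (Cmod_ge0 (a (N + n)%nat)).
  apply Rmult_le_reg_r with (wt N); [lra|]. rewrite !Rmult_assoc, Rinv_l, Rmult_1_r by lra.
  eapply Rle_trans; [|exact H]. apply Rmult_le_compat_l; auto.
  assert (wt n ^ 2 <= wt (N + n) ^ 2) by nra. nra.
Qed.
Lemma sm3 a B : (forall n, Cmod (a n) * wt n ^ 3 <= B) -> sm a.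
Proof.
  intros H. exists B. intros n. eapply Rle_trans; [|apply H]. apply Rmult_le_compat_l; [apply Cmod_ge0|].
  apply wt_pow_le. lia.
Qed.
Lemma small_eq0 (z : Cx) B : (forall N, Cmod z <= B * / wt N) -> z = C0.
Proof.
  intros H. apply Cmod_eq0. apply Rle_antisym; [|apply Cmod_ge0]. apply le_epsilon. intros e he.
  destruct (INR_unbounded (B / e)) as [N HN]. eapply Rle_trans; [apply (H N)|].
  assert (B <= e * wt N). { unfold wt. rewrite S_INR. apply Rmult_le_reg_r with (/ e); [apply Rinv_0_lt_compat; auto|].
    replace (e * (INR N + 1) * / e) with (INR N + 1) by (field; lra). lra. }
  pose proof (wt_ge1 N). apply Rmult_le_reg_r with (wt N); [lra|]. rewrite Rmult_assoc, Rinv_l by lra. lra.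
Qed.
Lemma csum_cnice N (phi : nat -> R -> Cx) : (forall n, cnice (phi n)) ->
  cnice (fun x => csum N (fun n => phi n x)) /\ CI (fun x => csum N (fun n => phi n x)) = csum N (fun n => CI (phi n)).
Proof.
  intros H. induction N as [|N [A B]]; cbn [csum].
  - assert (Z : cnice (fun _ => C0)).
    { split; [intros; apply ccont_const|]. exists 0. intros. rewrite Cmod_C0. lra. }
    split; [exact Z|]. apply CI_deriv with (fun _ => C0) 0.
    + intros; apply cder_const. + intros; apply ccont_const. + intros. rewrite Cmod_C0. lra.
  - split; [apply cnice_add; auto|]. rewrite CI_add, B; auto.
Qed.
(** Both sides agree up to the tails beyond [N]; the third power of [wt n], one more than summation
    needs, makes these tails of order [/ wt N]. *)
Lemma CI_CSeries (phi : nat -> R -> Cx) B :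
  (forall n, cnice (phi n)) -> (forall n x, Cmod (phi n x) * (1 + x ^ 2) * wt n ^ 3 <= B) ->
  cnice (fun x => CSeries (fun n => phi n x)) ->
  CI (fun x => CSeries (fun n => phi n x)) = CSeries (fun n => CI (phi n)).
Proof.
  intros Hn Hb Hs.
  assert (S1 : forall x n, Cmod (phi n x) * wt n ^ 3 <= B * / (1 + x ^ 2)).
  { intros x n. assert (0 < 1 + x ^ 2) by nra. apply Rmult_le_reg_r with (1 + x ^ 2); auto.
    rewrite (Rmult_assoc B), Rinv_l, Rmult_1_r by lra. specialize (Hb n x). lra. }
  assert (S2 : forall n, Cmod (CI (phi n)) * wt n ^ 3 <= 8 * B).
  { intros n. pose proof (wt_pow_ge1 n 3). apply Rmult_le_reg_r with (/ wt n ^ 3); [apply Rinv_0_lt_compat; lra|].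
    rewrite Rmult_assoc, Rinv_r, Rmult_1_r by lra. rewrite Rmult_assoc. apply CI_bound; auto.
    intros x. apply Rmult_le_reg_r with (wt n ^ 3); [lra|]. rewrite (Rmult_assoc B), Rinv_l, Rmult_1_r by lra. auto. }
  set (d := (CI (fun x => CSeries (fun n => phi n x)) - CSeries (fun n => CI (phi n)))%cx).
  enough (d = C0) as E.
  { unfold d in E. set (a := CI _) in *. set (b := CSeries _) in E |- *. transitivity (a - b + b)%cx; [ring|rewrite E; ring]. }
  apply small_eq0 with (32 * B + 32 * B). intros N.
  destruct (csum_cnice N phi Hn) as [c1 c2].
  assert (E : d = (CI (fun x => CSeries (fun n => phi n x) - csum N (fun n => phi n x)) - CSeries (fun n => CI (phi (N + n)%nat)))%cx).
  { unfold d. rewrite CI_sub by auto. rewrite c2. rewrite (CSeries_split N (fun n => CI (phi n))) by (eapply sm3; eauto). ring. }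
  rewrite E. eapply Rle_trans; [apply Cmod_sub_le|]. rewrite Rmult_plus_distr_r. apply Rplus_le_compat.
  - replace (32 * B * / wt N) with (8 * (4 * (B * / wt N))) by ring. apply CI_bound; [apply cnice_sub; auto|].
    intros x. rewrite (CSeries_split N) by (eapply sm3; apply S1).
    replace (csum N (fun n => phi n x) + CSeries (fun n => phi (N + n)%nat x) - csum N (fun n => phi n x))%cx
      with (CSeries (fun n => phi (N + n)%nat x)) by ring.
    pose proof (CSeries_tail N (fun n => phi n x) _ (S1 x)) as T.
    assert (0 < 1 + x ^ 2) by nra. apply Rle_trans with (4 * (B * / (1 + x ^ 2) * / wt N) * (1 + x ^ 2)).
    + nra.
    + right. field. pose proof (wt_ge1 N). lra.
  - pose proof (CSeries_tail N (fun n => CI (phi n)) _ S2) as T. lra.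
Qed.
Lemma CSeries_cder (f f1 f2 : nat -> R -> Cx) B :
  (forall n x, cder (f n) x (f1 n x)) -> (forall n x, cder (f1 n) x (f2 n x)) ->
  (forall x, sm (fun n => f n x)) -> (forall x, sm (fun n => f1 n x)) ->
  (forall n x, Cmod (f2 n x) * wt n ^ 2 <= B) ->
  forall x, cder (fun x => CSeries (fun n => f n x)) x (CSeries (fun n => f1 n x)).
Proof.
  intros H1 H2 S0 S1 Hb x. apply cder_of_quadratic with (4 * (2 * B)). intros h _.
  rewrite <- CSeries_scal, <- !CSeries_sub by auto using sm_scal, sm_sub.
  replace (4 * (2 * B) * h ^ 2) with (4 * (2 * B * h ^ 2)) by ring. apply CSeries_bound. intros n.
  pose proof (wt_pow_ge1 n 2).
  assert (T : forall y, Cmod (f2 n y) <= B * / wt n ^ 2).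
  { intros y. apply Rmult_le_reg_r with (wt n ^ 2); [lra|]. rewrite Rmult_assoc, Rinv_l, Rmult_1_r by lra. auto. }
  pose proof (ctaylor2 (f n) (f1 n) (f2 n) _ (H1 n) (H2 n) T x h) as K.
  apply Rle_trans with (2 * (B * / wt n ^ 2) * h ^ 2 * wt n ^ 2); [apply Rmult_le_compat_r; lra|].
  right. field. nra.
Qed.

Definition recon (w : nat -> Cx) : fam1 := fun k x => pair (hx k x) w.
Lemma schwartz1_recon w : rap w -> schwartz1 (recon w).
Proof.
  intros Hw. apply schwartz1_mk.
  - intros k x. destruct (hr_poly_bound 0 (S (S k))) as (C & p & C0 & H). destruct (Hw (p + 2)%nat) as [B HB].
    apply (CSeries_cder (fun n x => hx k x n * w n)%cx (fun n x => hx (S k) x n * w n)%cx (fun n x => hx (S (S k)) x n * w n)%cx (C * B)).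
    + intros n y. eapply cder_eq; [apply cder_mul; [apply (schwartz1_cder (hfam n) (schwartz1_hfam n) k)|apply cder_const]|unfold hx; ring].
    + intros n y. eapply cder_eq; [apply cder_mul; [apply (schwartz1_cder (hfam n) (schwartz1_hfam n) (S k))|apply cder_const]|unfold hx; ring].
    + intros y. apply pair_sm; auto using tmp_hx.
    + intros y. apply pair_sm; auto using tmp_hx.
    + intros n y. apply pair_terms with p; auto. intros m. specialize (H m y).
      unfold hx, hfam. rewrite Cmod_RtoC. lra.
  - intros j k. destruct (hr_poly_bound j k) as (C & p & C0 & H). destruct (Hw (p + 2)%nat) as [B HB].
    exists (4 * (C * B)). intros x. unfold recon.
    assert (P : 0 <= Rabs x ^ j) by nn.
    rewrite <- (Rabs_right (Rabs x ^ j)) by lra. rewrite <- Cmod_RtoC, <- Cmod_mul.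
    unfold pair. rewrite <- CSeries_scal by (apply pair_sm; auto using tmp_hx).
    rewrite (CSeries_ext _ (fun n => (RtoC (Rabs x ^ j) * hx k x n) * w n)%cx) by (intros; ring).
    apply pair_bound with p; auto. intros n. rewrite Cmod_mul, Cmod_RtoC, Rabs_right by lra.
    unfold hx, hfam. rewrite Cmod_RtoC. auto.
Qed.
Lemma CI_recon w F : rap w -> schwartz1 F -> CI (fun x => recon w 0%nat x * F 0%nat x)%cx = pair w (cf F).
Proof.
  intros Hw HF. destruct (Hw 4%nat) as [B HB]. destruct (schwartz1_weight F HF 0 1) as (C & C0 & HC).
  transitivity (CI (fun x => CSeries (fun n => w n * (hfam n 0 x * F 0%nat x))%cx)).
  - apply CI_ext. intros x. unfold recon, pair. 
    transitivity (F 0%nat x * CSeries (fun n => hx 0 x n * w n))%cx; [ring|].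
    rewrite <- CSeries_scal by (apply pair_sm; auto using tmp_hx). apply CSeries_ext; intros; unfold hx; ring.
  - rewrite (CI_CSeries (fun n x => w n * (hfam n 0 x * F 0%nat x))%cx (2 * B * C)).
    + apply CSeries_ext. intros n. apply CI_scal. apply hfam_mul_nice; auto.
    + intros n. apply cnice_scal, hfam_mul_nice; auto.
    + intros n x. rewrite !Cmod_mul. unfold hfam. rewrite Cmod_RtoC. pose proof (hr_sup n x) as h1. specialize (HC x). rewrite pow_1 in HC.
      specialize (HB n). pose proof (Cmod_ge0 (F 0%nat x)).
      pose proof (Rabs_pos (hr n 0 x)).
      replace (Cmod (w n) * (Rabs (hr n 0 x) * Cmod (F 0%nat x)) * (1 + x ^ 2) * wt n ^ 3) with
       ((Cmod (w n) * wt n ^ 3 * Rabs (hr n 0 x)) * (Cmod (F 0%nat x) * (1 + x ^ 2))) by ring.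
      apply Rmult_le_compat; auto.
      * nn.
      * nra.
      * apply Rle_trans with (Cmod (w n) * wt n ^ 3 * (2 * wt n)).
        -- apply Rmult_le_compat_l; auto. nn.
        -- lra.
    + apply cnice_ext with (fun x => recon w 0%nat x * F 0%nat x)%cx.
      * intros x. unfold recon, pair. 
        transitivity (F 0%nat x * CSeries (fun n => hx 0 x n * w n))%cx; [ring|].
        rewrite <- CSeries_scal by (apply pair_sm; auto using tmp_hx). apply CSeries_ext; intros; unfold hx; ring.
      * apply schwartz1_mul2_nice; auto using schwartz1_recon.
Qed.
Lemma cf_recon w n : rap w -> cf (recon w) n = w n.
Proof.
  intros Hw. unfold cf. rewrite (CI_ext _ (fun x => recon w 0%nat x * hfam n 0 x)%cx) by (intros; ring). rewrite (CI_recon w (hfam n)) by auto using schwartz1_hfam.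
  unfold pair. rewrite (CSeries_ext _ (fun m => if Nat.eqb m n then w m else C0)).
  - apply CSeries_delta.
  - intros m. rewrite cf_hfam. destruct (Nat.eqb m n); ring.
Qed.

(** * Tempered distributions on the line *)

Ltac tmps := repeat first [solve [auto using tmp_sM, tmp_sD, tmp_sA, tmp_sB, tmp_hx, rap_tmp] | apply tmp_add | apply tmp_scal].
Ltac schs := repeat first [solve [auto using schwartz1_tM, schwartz1_tD, schwartz1_td, schwartz1_hfam, schwartz1_recon]
  | apply schwartz1_add | apply schwartz1_scal].
Ltac raps := repeat first [solve [auto using rap_sM, rap_sD, rap_sA, rap_sB, rap_cf] | apply rap_add | apply rap_scal].

(** Generic in the operators and in the index type, so that one expression serves distributions and
    sequences, in one and in two variables. In [a k j], [k] counts [Y] and [j] counts [X], with [X]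
    applied last. *)
Definition pol {T : Type} (a : nat -> nat -> Cx) (X Y : (T -> Cx) -> T -> Cx) (w : T -> Cx) (i : T) : Cx :=
  (a 0%nat 0%nat * w i + a 0%nat 1%nat * X w i + a 0%nat 2%nat * X (X w) i
   + a 1%nat 0%nat * Y w i + a 1%nat 1%nat * X (Y w) i + a 2%nat 0%nat * Y (Y w) i)%cx.
(** Coefficients of the transposed operator, reordered by [D M = M D - i]. *)
Definition tr (a : nat -> nat -> Cx) (k j : nat) : Cx :=
  match k, j with
  | O, O => (a 0%nat 0%nat + Ci * a 1%nat 1%nat)%cx
  | S O, O => (- a 1%nat 0%nat)%cx
  | S O, S O => (- a 1%nat 1%nat)%cx
  | _, _ => a k j
  end.
Definition P1 (a : nat -> nat -> Cx) : (nat -> Cx) -> nat -> Cx := pol a sM sD.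
Definition GRs (a : nat -> nat -> Cx) : Prop := forall w, tmp w -> rap (P1 a w) -> rap w.
Definition K0s (a : nat -> nat -> Cx) : Prop := forall w, tmp w -> (forall n, P1 a w n = C0) -> forall n, w n = C0.
Definition KSs (a : nat -> nat -> Cx) : Prop := forall w, tmp w -> (forall n, P1 a w n = C0) -> rap w.

Lemma rap_P1 a w : rap w -> rap (P1 a w).
Proof. intros H. raps. Qed.
Lemma P1_ext a v w n : (forall n, v n = w n) -> P1 a v n = P1 a w n.
Proof. intros E. rewrite (functional_extensionality _ _ E). auto. Qed.

Definition pfam (b : nat -> nat -> Cx) (F : fam1) : fam1 := fun n x =>
  (b 0%nat 0%nat * F n x + b 0%nat 1%nat * tM1 F n x + b 0%nat 2%nat * tM1 (tM1 F) n x
   + b 1%nat 0%nat * tD1 F n x + b 1%nat 1%nat * tM1 (tD1 F) n x + b 2%nat 0%nat * tD1 (tD1 F) n x)%cx.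
Lemma pfam_eq b F : pfam b F =
  fam1_add (fam1_add (fam1_add (fam1_add (fam1_add
    (fam1_scal (b 0%nat 0%nat) F) (fam1_scal (b 0%nat 1%nat) (tM1 F))) (fam1_scal (b 0%nat 2%nat) (tM1 (tM1 F))))
    (fam1_scal (b 1%nat 0%nat) (tD1 F))) (fam1_scal (b 1%nat 1%nat) (tM1 (tD1 F)))) (fam1_scal (b 2%nat 0%nat) (tD1 (tD1 F))).
Proof. auto. Qed.
Lemma schwartz1_pfam b F : schwartz1 F -> schwartz1 (pfam b F).
Proof. intros. repeat apply schwartz1_add; apply schwartz1_scal; auto using schwartz1_tM, schwartz1_tD. Qed.
Lemma cf_pfam b F : schwartz1 F -> cf (pfam b F) = P1 b (cf F).
Proof.
  intros H. apply functional_extensionality. intros n. rewrite pfam_eq.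
  rewrite !cf_add, !cf_scal by schs.
  rewrite !cf_tM, !cf_tD by auto using schwartz1_tM, schwartz1_tD.
  replace (cf (tM1 F)) with (sM (cf F)) by (apply functional_extensionality; intros; symmetry; apply cf_tM; auto).
  replace (cf (tD1 F)) with (sD (cf F)) by (apply functional_extensionality; intros; symmetry; apply cf_tD; auto).
  auto.
Qed.

Lemma pair_add_r w k l : tmp w -> rap k -> rap l -> pair w (fun n => k n + l n)%cx = (pair w k + pair w l)%cx.
Proof.
  intros. transitivity (C1 * pair w k + C1 * pair w l)%cx; [|ring]. rewrite <- pair_lin_r by auto.
  f_equal. apply functional_extensionality; intros; ring.
Qed.
Lemma pair_scal_r w k c : tmp w -> rap k -> pair w (fun n => c * k n)%cx = (c * pair w k)%cx.
Proof.
  intros. transitivity (c * pair w k + C0 * pair w k)%cx; [|ring]. rewrite <- pair_lin_r by auto.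
  f_equal. apply functional_extensionality; intros; ring.
Qed.
Lemma pair_add_l w v k : tmp w -> tmp v -> rap k -> pair (fun n => w n + v n)%cx k = (pair w k + pair v k)%cx.
Proof.
  intros. transitivity (C1 * pair w k + C1 * pair v k)%cx; [|ring]. rewrite <- pair_lin_l by auto.
  f_equal. apply functional_extensionality; intros; ring.
Qed.
Lemma pair_scal_l w k c : tmp w -> rap k -> pair (fun n => c * w n)%cx k = (c * pair w k)%cx.
Proof.
  intros. transitivity (c * pair w k + C0 * pair w k)%cx; [|ring]. rewrite <- pair_lin_l by auto.
  f_equal. apply functional_extensionality; intros; ring.
Qed.
Lemma pair_pol a w k : tmp w -> rap k -> pair w (P1 (tr a) k) = pair (P1 a w) k.
Proof.
  intros Hw Hk. unfold P1, pol.
  rewrite !pair_add_r, !pair_scal_r by (first [solve [tmps] | raps]).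
  rewrite !pair_add_l, !pair_scal_l by (first [solve [tmps] | raps]).
  cbn [tr]. rewrite <- !(pair_sM w) by auto using rap_sM, rap_sD.
  rewrite <- !(pair_sM (sM w)) by auto using rap_sM, rap_sD, tmp_sM.
  assert (E1 : forall v l, tmp v -> rap l -> pair v (sD l) = (- pair (sD v) l)%cx).
  { intros. rewrite pair_sD by auto. ring. }
  rewrite !(E1 w), !(E1 (sM w)), (E1 (sD w)) by auto using rap_sD, tmp_sM, tmp_sD.
  rewrite (functional_extensionality _ _ (sD_sM_comm w)).
  replace (fun x => sM (sD w) x - Ci * w x)%cx with (fun x => sM (sD w) x + (- Ci) * w x)%cx by (apply functional_extensionality; intros; ring).
  rewrite pair_add_l, pair_scal_l by auto using tmp_scal, tmp_sM, tmp_sD. ring.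
Qed.

Lemma pair_hfam w n : pair w (cf (hfam n)) = w n.
Proof.
  unfold pair. rewrite (CSeries_ext _ (fun m => if Nat.eqb m n then w m else C0)).
  - apply CSeries_delta.
  - intros m. rewrite cf_hfam. destruct (Nat.eqb m n); ring.
Qed.
Lemma rap_of_repr w y : schwartz1 y ->
  (forall F, schwartz1 F -> pair w (cf F) = CI (fun x => y 0%nat x * F 0%nat x)%cx) -> rap w.
Proof.
  intros Hy H. apply rap_ext with (cf y); [|apply rap_cf; auto]. intros n.
  rewrite <- (pair_hfam w n), H by apply schwartz1_hfam. apply CI_ext; intros; ring.
Qed.
Lemma pair_pfam a w F : tmp w -> schwartz1 F -> pair w (cf (pfam (tr a) F)) = pair (P1 a w) (cf F).
Proof. intros. rewrite cf_pfam, pair_pol by auto using rap_cf. auto. Qed.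

Lemma tM_tD_comm F : schwartz1 F -> tD1 (tM1 F) = fam1_add (tM1 (tD1 F)) (fam1_scal (- Ci)%cx F).
Proof.
  intros H. apply schwartz1_unique; auto using schwartz1_tM, schwartz1_tD, schwartz1_add, schwartz1_scal.
  intros x. unfold tD1, tM1, fam1_add, fam1_scal. cbn [INR pred]. change (RtoC 0) with C0. change (RtoC 1) with C1. ring.
Qed.

Lemma tempered1_add u v : tempered1 u -> tempered1 v -> tempered1 (fun F => u F + v F)%cx.
Proof.
  intros (A & B & N & C & D) (A' & B' & N' & C' & D'). split; [|split].
  - intros. rewrite A, A' by auto. ring.
  - intros. rewrite B, B' by auto. ring.
  - exists (N + N')%nat, (C + C'). intros F Mb HF H. eapply Rle_trans; [apply Cmod_tri|].
    rewrite Rmult_plus_distr_r. apply Rplus_le_compat; [apply D|apply D']; auto; intros; apply H; lia.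
Qed.
Lemma tempered1_scal c u : tempered1 u -> tempered1 (fun F => c * u F)%cx.
Proof.
  intros (A & B & N & C & D). split; [|split].
  - intros. rewrite A by auto. ring.
  - intros. rewrite B by auto. ring.
  - exists N, (Cmod c * C). intros F Mb HF H. rewrite Cmod_mul, Rmult_assoc.
    apply Rmult_le_compat_l; [apply Cmod_ge0|eauto].
Qed.
Lemma tM1_add F G : tM1 (fam1_add F G) = fam1_add (tM1 F) (tM1 G).
Proof. do 2 (apply functional_extensionality; intros). unfold tM1, fam1_add. ring. Qed.
Lemma tM1_scal c F : tM1 (fam1_scal c F) = fam1_scal c (tM1 F).
Proof. do 2 (apply functional_extensionality; intros). unfold tM1, fam1_scal. ring. Qed.
Lemma tD1_add F G : tD1 (fam1_add F G) = fam1_add (tD1 F) (tD1 G).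
Proof. do 2 (apply functional_extensionality; intros). unfold tD1, fam1_add. ring. Qed.
Lemma tD1_scal c F : tD1 (fam1_scal c F) = fam1_scal c (tD1 F).
Proof. do 2 (apply functional_extensionality; intros). unfold tD1, fam1_scal. ring. Qed.
Lemma tempered1_MM u : tempered1 u -> tempered1 (MM u).
Proof.
  intros (A & B & N & C & D). unfold MM. split; [|split].
  - intros. rewrite tM1_add, A by auto using schwartz1_tM. auto.
  - intros. rewrite tM1_scal, B by auto using schwartz1_tM. auto.
  - exists (S N), (C * (1 + INR N)). intros F Mb HF H. rewrite Rmult_assoc. apply D; [apply schwartz1_tM; auto|].
    intros j k x hj hk. apply (bd1_tM N F Mb H); auto.
Qed.
Lemma tempered1_DD u : tempered1 u -> tempered1 (DD u).
Proof.
  intros (A & B & N & C & D). unfold DD. split; [|split].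
  - intros. rewrite tD1_add, A by auto using schwartz1_tD. ring.
  - intros. rewrite tD1_scal, B by auto using schwartz1_tD. ring.
  - exists (S N), C. intros F Mb HF H. rewrite Cmod_opp. apply D; [apply schwartz1_tD; auto|].
    intros j k x hj hk. apply (bd1_tD N F Mb H); auto.
Qed.
Lemma tempered1_pol a u : tempered1 u -> tempered1 (pol a MM DD u).
Proof. intros. repeat apply tempered1_add; apply tempered1_scal; auto using tempered1_MM, tempered1_DD. Qed.

Definition hat1 (u : distR) : nat -> Cx := fun n => u (hfam n).
Definition dist1 (w : nat -> Cx) : distR := fun F => pair w (cf F).
Lemma tmp_hat1 u : tempered1 u -> tmp (hat1 u).
Proof.
  intros (_ & _ & N & C & D). destruct (hfam_bd1 N) as (A & p & A0 & H). exists p, (C * A). intros n.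
  rewrite Rmult_assoc. apply D; [apply schwartz1_hfam|]. intros j k x hj hk. apply H; auto.
Qed.
Lemma hat1_MM u n : tempered1 u -> hat1 (MM u) n = sM (hat1 u) n.
Proof.
  intros (A & B & _). unfold hat1, MM.
  replace (tM1 (hfam n)) with (fam1_scal (RtoC (/ sqrt 2)) (fam1_add
    (fam1_scal (RtoC (sqrt (INR n))) (hfam (pred n))) (fam1_scal (RtoC (sqrt (INR (S n)))) (hfam (S n))))).
  - rewrite B, A, !B by auto using schwartz1_add, schwartz1_scal, schwartz1_hfam. auto.
  - do 2 (apply functional_extensionality; intros). rewrite tM_hfam. auto.
Qed.
Lemma hat1_DD u n : tempered1 u -> hat1 (DD u) n = sD (hat1 u) n.
Proof.
  intros (A & B & _). unfold hat1, DD.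
  replace (tD1 (hfam n)) with (fam1_scal (- (Ci * RtoC (/ sqrt 2)))%cx (fam1_add
    (fam1_scal (RtoC (sqrt (INR n))) (hfam (pred n))) (fam1_scal (- RtoC (sqrt (INR (S n))))%cx (hfam (S n))))).
  - rewrite B, A, !B by auto using schwartz1_add, schwartz1_scal, schwartz1_hfam. unfold sD, sA, sB. ring.
  - do 2 (apply functional_extensionality; intros). rewrite tD_hfam. unfold sD, sA, sB, fam1_scal, fam1_add. ring.
Qed.
Lemma hat1_pol a u : tempered1 u -> hat1 (pol a MM DD u) = P1 a (hat1 u).
Proof.
  intros H. assert (EM : forall v, tempered1 v -> hat1 (MM v) = sM (hat1 v)).
  { intros. apply functional_extensionality; intros. apply hat1_MM; auto. }
  assert (ED : forall v, tempered1 v -> hat1 (DD v) = sD (hat1 v)).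
  { intros. apply functional_extensionality; intros. apply hat1_DD; auto. }
  apply functional_extensionality. intros n.
  change (hat1 (pol a MM DD u) n) with (a 0%nat 0%nat * hat1 u n + a 0%nat 1%nat * hat1 (MM u) n + a 0%nat 2%nat * hat1 (MM (MM u)) n
   + a 1%nat 0%nat * hat1 (DD u) n + a 1%nat 1%nat * hat1 (MM (DD u)) n + a 2%nat 0%nat * hat1 (DD (DD u)) n)%cx.
  rewrite !EM, !ED by auto using tempered1_MM, tempered1_DD. auto.
Qed.
Lemma dist1_tempered w : tmp w -> tempered1 (dist1 w).
Proof.
  intros Hw. unfold dist1. split; [|split].
  - intros F G HF HG. rewrite <- pair_add_r by auto using rap_cf. f_equal. apply functional_extensionality; intros; apply cf_add; auto.
  - intros c F HF. rewrite <- pair_scal_r by auto using rap_cf. f_equal. apply functional_extensionality; intros; apply cf_scal; auto.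
  - destruct Hw as (p & A & HA). destruct (cf_decay (p + 2)) as (N & C & C0 & H). exists N, (4 * (A * C)). intros F Mb HF Hb.
    replace (4 * (A * C) * Mb) with (4 * (A * (C * Mb))) by ring. apply pair_bound with p; auto.
Qed.
Lemma hat1_dist1 w : hat1 (dist1 w) = w.
Proof. apply functional_extensionality. intros n. apply pair_hfam. Qed.

Fixpoint trunc1 (N : nat) (F : fam1) : fam1 :=
  match N with O => F | S N' => fam1_add (trunc1 N' F) (fam1_scal (- cf F N')%cx (hfam N')) end.
Lemma schwartz1_trunc N F : schwartz1 F -> schwartz1 (trunc1 N F).
Proof. intros. induction N; cbn; auto using schwartz1_add, schwartz1_scal, schwartz1_hfam. Qed.
Lemma cf_trunc N F n : schwartz1 F -> cf (trunc1 N F) n = if Nat.ltb n N then C0 else cf F n.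
Proof.
  intros HF. induction N as [|N IH]; cbn [trunc1]; [reflexivity|].
  rewrite cf_add, cf_scal, IH, cf_hfam by auto using schwartz1_trunc, schwartz1_scal, schwartz1_hfam.
  destruct (Nat.ltb_spec n N), (Nat.ltb_spec n (S N)), (Nat.eqb_spec n N); try lia; subst; ring.
Qed.
(** [u] does not see partial Hermite sums, and by [rec_bound] the remainders of [F] tend to 0 in
    every seminorm like [/ wt L]. *)
Lemma tempered1_eq0 u F : tempered1 u -> (forall n, hat1 u n = C0) -> schwartz1 F -> u F = C0.
Proof.
  intros (A & B & N & C & D) H HF. destruct (rec_bound N) as (K & C' & C0' & R).
  destruct (rap_cf F HF (S K)) as [M HM].
  apply small_eq0 with (Rabs C * (C' * M)). intros L.
  assert (E : u F = u (trunc1 L F)).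
  { induction L as [|L IH]; cbn [trunc1]; [reflexivity|].
    rewrite A, B by auto using schwartz1_trunc, schwartz1_scal, schwartz1_hfam.
    change (u (hfam L)) with (hat1 u L). rewrite H, <- IH. ring. }
  rewrite E. pose proof (wt_ge1 L) as W. pose proof (sb_nonneg _ _ _ HM).
  assert (S1 : sb K (cf (trunc1 L F)) (M * / wt L)).
  { intros n. rewrite cf_trunc by auto. destruct (Nat.ltb_spec n L) as [h|h].
    - rewrite Cmod_C0, Rmult_0_r. nn.
    - specialize (HM n). apply Rmult_le_reg_r with (wt L); [lra|]. rewrite (Rmult_assoc M), Rinv_l, Rmult_1_r by lra.
      eapply Rle_trans; [|exact HM]. cbn [pow]. pose proof (wt_mono L n h). pose proof (wt_pow_ge1 n K). pose proof (Cmod_ge0 (cf F n)).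
      assert (0 <= wt n ^ K * Cmod (cf F n)) by nra. nra. }
  pose proof (R _ _ (schwartz1_trunc L F HF) S1) as Bd. pose proof (bd1_nonneg _ _ _ Bd).
  eapply Rle_trans; [apply (D _ _ (schwartz1_trunc L F HF) Bd)|].
  apply Rle_trans with (Rabs C * (C' * (M * / wt L))); [|right; ring].
  apply Rmult_le_compat_r; [auto|apply Rle_abs].
Qed.
Lemma tempered1_repr u F : tempered1 u -> schwartz1 F -> u F = dist1 (hat1 u) F.
Proof.
  intros Hu HF.
  assert (Z : (u F + (- C1) * dist1 (hat1 u) F)%cx = C0).
  { apply (tempered1_eq0 (fun F => u F + (- C1) * dist1 (hat1 u) F)%cx); auto.
    - apply tempered1_add; [auto|]. apply tempered1_scal, dist1_tempered, tmp_hat1; auto.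
    - intros n. unfold hat1 at 1. change (dist1 (hat1 u) (hfam n)) with (hat1 (dist1 (hat1 u)) n).
      rewrite hat1_dist1. unfold hat1. ring. }
  transitivity (u F + (- C1) * dist1 (hat1 u) F + dist1 (hat1 u) F)%cx; [ring|]. rewrite Z. ring.
Qed.
Lemma inS1_hat u : inS1 u -> rap (hat1 u).
Proof.
  intros (G & HG & H). apply rap_ext with (cf G); [|apply rap_cf; auto].
  intros n. unfold hat1. rewrite <- (CI_eq _ _ (H _ (schwartz1_hfam n))). apply CI_ext; intros; ring.
Qed.
Lemma hat_inS1 u : tempered1 u -> rap (hat1 u) -> inS1 u.
Proof.
  intros Hu Hr. exists (recon (hat1 u)). split; [apply schwartz1_recon; auto|]. intros F HF.
  rewrite tempered1_repr by auto. unfold dist1. rewrite <- CI_recon by auto.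
  apply CI_cint1. apply schwartz1_mul2_nice; auto using schwartz1_recon.
Qed.
Lemma inS1_ext u v : (forall F, schwartz1 F -> u F = v F) -> inS1 u -> inS1 v.
Proof. intros E (G & HG & H). exists G. split; auto. intros F HF. rewrite <- E by auto. auto. Qed.

(** Brings the source and its transpose to the ordered form [pol], so that the three transfers to
    sequences below are proved once for both. *)
Definition realizes1 (P : distR -> distR) (a : nat -> nat -> Cx) : Prop :=
  forall u, tempered1 u -> forall F, schwartz1 F -> P u F = pol a MM DD u F.
Lemma source_pol a : realizes1 (source 2 a) a.
Proof. intros u _ F _. unfold source, pol, csum. cbn [Nat.add Nat.leb Nat.iter nat_rect]. ring. Qed.
Lemma source_t_pol a : realizes1 (source_t 2 a) (tr a).
Proof.
  intros u (A & B & _) F HF.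
  assert (E : DD (MM u) F = (MM (DD u) F - Ci * u F)%cx).
  { unfold DD, MM. rewrite tM_tD_comm, A, B by auto using schwartz1_tM, schwartz1_tD, schwartz1_scal. ring. }
  unfold source_t, pol, csum, tr, Csign. cbn [Nat.add Nat.leb Nat.iter nat_rect Nat.even]. rewrite E. ring.
Qed.
Lemma glob_reg1_iff P a : realizes1 P a -> (glob_reg1 P <-> GRs a).
Proof.
  intros R. split; intros H.
  - intros w Hw Hr. pose proof (dist1_tempered w Hw) as T. rewrite <- (hat1_dist1 w). apply inS1_hat. apply H; auto.
    apply inS1_ext with (pol a MM DD (dist1 w)). { intros; symmetry; apply R; auto. }
    apply hat_inS1; [apply tempered1_pol; auto|]. rewrite hat1_pol, hat1_dist1 by auto. auto.
  - intros u Hu Hs. apply hat_inS1; auto. apply H; [apply tmp_hat1; auto|].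
    rewrite <- hat1_pol by auto. apply inS1_hat. apply inS1_ext with (P u); auto.
Qed.
Lemma ker_zero1_iff P a : realizes1 P a -> (ker_zero1 P <-> K0s a).
Proof.
  intros R. split; intros H.
  - intros w Hw Hk n. pose proof (dist1_tempered w Hw) as T. rewrite <- (hat1_dist1 w). apply H; auto using schwartz1_hfam.
    intros F HF. rewrite R by auto. apply tempered1_eq0; auto using tempered1_pol.
    intros m. rewrite hat1_pol, hat1_dist1 by auto. auto.
  - intros u Hu Hk F HF. apply tempered1_eq0; auto. apply H; [apply tmp_hat1; auto|]. intros n.
    rewrite <- hat1_pol by auto. unfold hat1. rewrite <- R by auto using schwartz1_hfam. apply Hk, schwartz1_hfam.
Qed.
Lemma ker_in_S1_iff P a : realizes1 P a -> (ker_in_S1 P <-> KSs a).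
Proof.
  intros R. split; intros H.
  - intros w Hw Hk. pose proof (dist1_tempered w Hw) as T. rewrite <- (hat1_dist1 w). apply inS1_hat. apply H; auto.
    intros F HF. rewrite R by auto. apply tempered1_eq0; auto using tempered1_pol.
    intros m. rewrite hat1_pol, hat1_dist1 by auto. auto.
  - intros u Hu Hk. apply hat_inS1; auto. apply H; [apply tmp_hat1; auto|]. intros n.
    rewrite <- hat1_pol by auto. unfold hat1. rewrite <- R by auto using schwartz1_hfam. apply Hk, schwartz1_hfam.
Qed.

(** * Two variables *)

Lemma schwartz2_cderx F : schwartz2 F -> forall a b x y, cder (fun t => F a b t y) x (F (S a) b x y).
Proof. intros [H _] a b x y. destruct (H a b x y) as (A & B & _). split; apply is_derive_Reals; assumption. Qed.
Lemma schwartz2_cdery F : schwartz2 F -> forall a b x y, cder (fun t => F a b x t) y (F a (S b) x y).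
Proof. intros [H _] a b x y. destruct (H a b x y) as (_ & _ & A & B). split; apply is_derive_Reals; assumption. Qed.
Lemma schwartz2_mk F :
  (forall a b x y, cder (fun t => F a b t y) x (F (S a) b x y)) ->
  (forall a b x y, cder (fun t => F a b x t) y (F a (S b) x y)) ->
  (forall j1 j2 a b, exists C, forall x y, Rabs x ^ j1 * Rabs y ^ j2 * Cmod (F a b x y) <= C) -> schwartz2 F.
Proof.
  intros H1 H2 K. split; [|exact K]. intros a b x y. destruct (H1 a b x y), (H2 a b x y).
  repeat split; apply is_derive_Reals; assumption.
Qed.
Lemma schwartz2_unique F G : schwartz2 F -> schwartz2 G -> (forall x y, F 0%nat 0%nat x y = G 0%nat 0%nat x y) -> F = G.
Proof.
  intros HF HG H0.
  assert (E : forall a b x y, F a b x y = G a b x y).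
  { intros a. induction a as [|a IHa].
    - intros b. induction b as [|b IHb]; [exact H0|]. intros x y.
      apply cder_unique with (fun t => F 0%nat b x t) y; [apply schwartz2_cdery; auto|].
      apply cder_ext with (fun t => G 0%nat b x t); [intros; symmetry; apply IHb|]. apply schwartz2_cdery; auto.
    - intros b x y. apply cder_unique with (fun t => F a b t y) x; [apply schwartz2_cderx; auto|].
      apply cder_ext with (fun t => G a b t y); [intros; symmetry; apply IHa|]. apply schwartz2_cderx; auto. }
  do 4 (apply functional_extensionality; intros). auto.
Qed.
Definition bd2 (N : nat) (F : fam2) (B : R) : Prop :=
  forall j1 j2 a b x y, (j1 <= N)%nat -> (j2 <= N)%nat -> (a <= N)%nat -> (b <= N)%nat ->
    Rabs x ^ j1 * Rabs y ^ j2 * Cmod (F a b x y) <= B.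
Lemma schwartz2_bd F : schwartz2 F -> forall N, exists B, bd2 N F B.
Proof.
  intros [_ H] N.
  destruct (fin_max (fun j1 B => forall j2 a b x y, (j2 <= N)%nat -> (a <= N)%nat -> (b <= N)%nat -> Rabs x ^ j1 * Rabs y ^ j2 * Cmod (F a b x y) <= B) N) as [B HB].
  { intros i B B' h K j2 a b x y h1 h2 h3. specialize (K j2 a b x y h1 h2 h3). lra. }
  { intros j1. destruct (fin_max (fun j2 B => forall a b x y, (a <= N)%nat -> (b <= N)%nat -> Rabs x ^ j1 * Rabs y ^ j2 * Cmod (F a b x y) <= B) N) as [B HB].
    { intros i B B' h K a b x y h2 h3. specialize (K a b x y h2 h3). lra. }
    { intros j2. destruct (fin_max (fun a B => forall b x y, (b <= N)%nat -> Rabs x ^ j1 * Rabs y ^ j2 * Cmod (F a b x y) <= B) N) as [B HB].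
      { intros i B B' h K b x y h3. specialize (K b x y h3). lra. }
      { intros a. destruct (fin_max (fun b B => forall x y, Rabs x ^ j1 * Rabs y ^ j2 * Cmod (F a b x y) <= B) N) as [B HB].
        { intros i B B' h K x y. specialize (K x y). lra. }
        { auto. }
        exists B. auto. }
      exists B. auto. }
    exists B. auto. }
  exists B. intros j1 j2 a b x y h1 h2 ha hb. auto.
Qed.
Lemma bd2_nonneg N F B : bd2 N F B -> 0 <= B.
Proof.
  intros H. specialize (H 0%nat 0%nat 0%nat 0%nat 0 0 ltac:(lia) ltac:(lia) ltac:(lia) ltac:(lia)). pose proof (Cmod_ge0 (F 0%nat 0%nat 0 0)). lra.
Qed.
(** Exchange of the variables: facts about y follow from those about x. *)
Definition swf (F : fam2) : fam2 := fun a b x y => F b a y x.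
Lemma schwartz2_swf F : schwartz2 F -> schwartz2 (swf F).
Proof.
  intros H. apply schwartz2_mk; unfold swf.
  - intros; apply schwartz2_cdery; auto.
  - intros; apply schwartz2_cderx; auto.
  - intros j1 j2 a b. destruct (proj2 H j2 j1 b a) as [C HC]. exists C. intros. rewrite (Rmult_comm (Rabs x ^ j1)). auto.
Qed.
Lemma bd2_swf N F B : bd2 N F B -> bd2 N (swf F) B.
Proof. intros H j1 j2 a b x y h1 h2 ha hb. rewrite (Rmult_comm (Rabs x ^ j1)). apply H; auto. Qed.
Definition slice (F : fam2) (b : nat) (y : R) : fam1 := fun a x => F a b x y.
Lemma schwartz1_slice F b y : schwartz2 F -> schwartz1 (slice F b y).
Proof.
  intros H. apply schwartz1_mk.
  - intros; apply schwartz2_cderx; auto.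
  - intros j n. destruct H as [_ H]. destruct (H j 0%nat n b) as [C HC]. exists C. intros x. specialize (HC x y). rewrite Rmult_1_r in HC. auto.
Qed.
Lemma pow2_nonneg x y j1 j2 : 0 <= Rabs x ^ j1 * Rabs y ^ j2.
Proof. nn. Qed.
Lemma schwartz2_add F G : schwartz2 F -> schwartz2 G -> schwartz2 (fam2_add F G).
Proof.
  intros HF HG. apply schwartz2_mk.
  - intros; apply cder_add; [apply (schwartz2_cderx F HF)|apply (schwartz2_cderx G HG)].
  - intros; apply cder_add; [apply (schwartz2_cdery F HF)|apply (schwartz2_cdery G HG)].
  - intros j1 j2 a b. destruct HF as [_ HF], HG as [_ HG]. destruct (HF j1 j2 a b) as [A HA], (HG j1 j2 a b) as [B HB].
    exists (A + B). intros x y. specialize (HA x y). specialize (HB x y). unfold fam2_add.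
    pose proof (Cmod_tri (F a b x y) (G a b x y)). pose proof (pow2_nonneg x y j1 j2). nra.
Qed.
Lemma schwartz2_scal c F : schwartz2 F -> schwartz2 (fam2_scal c F).
Proof.
  intros HF. apply schwartz2_mk.
  - intros; apply cder_scal; apply (schwartz2_cderx F HF).
  - intros; apply cder_scal; apply (schwartz2_cdery F HF).
  - intros j1 j2 a b. destruct HF as [_ HF]. destruct (HF j1 j2 a b) as [A HA].
    exists (Cmod c * A). intros x y. specialize (HA x y). unfold fam2_scal. rewrite Cmod_mul.
    pose proof (Cmod_ge0 c). nra.
Qed.
Lemma schwartz2_tDx F : schwartz2 F -> schwartz2 (tDx F).
Proof.
  intros H. apply (schwartz2_scal (Copp Ci) (fun a b x y => F (S a) b x y)).
  destruct H as [A B]. easy.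
Qed.
Lemma schwartz2_tDy F : schwartz2 F -> schwartz2 (tDy F).
Proof. intros H. exact (schwartz2_swf _ (schwartz2_tDx _ (schwartz2_swf _ H))). Qed.
Lemma bd2_tDx N F B : bd2 (S N) F B -> bd2 N (tDx F) B.
Proof.
  intros H j1 j2 a b x y h1 h2 ha hb. unfold tDx. rewrite Cmod_mul, Cmod_opp, Cmod_Ci, Rmult_1_l. apply H; lia.
Qed.
Lemma bd2_tMx N F B : bd2 (S N) F B -> bd2 N (tMx F) ((1 + INR N) * B).
Proof.
  intros H j1 j2 a b x y h1 h2 ha hb. pose proof (bd2_nonneg _ _ _ H).
  pose proof (H (S j1) j2 a b x y ltac:(lia) ltac:(lia) ltac:(lia) ltac:(lia)) as H1.
  pose proof (H j1 j2 (pred a) b x y ltac:(lia) ltac:(lia) ltac:(lia) ltac:(lia)) as H2.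
  unfold tMx. pose proof (Cmod_tri (RtoC x * F a b x y) (RtoC (INR a) * F (pred a) b x y)) as T.
  rewrite !Cmod_mul, !Cmod_RtoC, (Rabs_right (INR a)) in T by nn.
  pose proof (pow2_nonneg x y j1 j2). assert (INR a <= INR N) by (auto with real). pose proof (pos_INR a). cbn [pow] in H1.
  nra.
Qed.
Lemma bd2_ex F j1 j2 a b : (exists B, bd2 (j1 + j2 + a + b) F B) -> exists C, forall x y, Rabs x ^ j1 * Rabs y ^ j2 * Cmod (F a b x y) <= C.
Proof. intros [B HB]. exists B. intros. apply HB; lia. Qed.
Lemma schwartz2_tMx F : schwartz2 F -> schwartz2 (tMx F).
Proof.
  intros H. apply schwartz2_mk.
  - intros a b x y. apply (schwartz1_cder _ (schwartz1_tM _ (schwartz1_slice F b y H)) a x).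
  - intros a b x y. apply cder_add; apply cder_scal; apply (schwartz2_cdery F H).
  - intros. apply bd2_ex. destruct (schwartz2_bd F H (S (j1 + j2 + a + b))) as [B HB]. eexists. apply bd2_tMx; eauto.
Qed.
Lemma schwartz2_tMy F : schwartz2 F -> schwartz2 (tMy F).
Proof. intros H. exact (schwartz2_swf _ (schwartz2_tMx _ (schwartz2_swf _ H))). Qed.

(** * Double Hermite coefficients *)

Definition hh (n m : nat) (a b : nat) (x y : R) : Cx := (hfam n a x * hfam m b y)%cx.
Lemma hh_bd2 N : exists C p, 0 <= C /\ forall n m, bd2 N (hh n m) (C * wt n ^ p * wt m ^ p).
Proof.
  destruct (hfam_bd1 N) as (C & p & C0 & H). exists (C * C), p. split; [nra|].
  intros n m j1 j2 a b x y h1 h2 ha hb. unfold hh. rewrite Cmod_mul.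
  pose proof (H n j1 a x h1 ha) as A. pose proof (H m j2 b y h2 hb) as B.
  replace (Rabs x ^ j1 * Rabs y ^ j2 * (Cmod (hfam n a x) * Cmod (hfam m b y))) with
    ((Rabs x ^ j1 * Cmod (hfam n a x)) * (Rabs y ^ j2 * Cmod (hfam m b y))) by ring.
  replace (C * C * wt n ^ p * wt m ^ p) with ((C * wt n ^ p) * (C * wt m ^ p)) by ring.
  apply Rmult_le_compat; auto; apply Rmult_le_pos; auto using Cmod_ge0; apply pow_le, Rabs_pos.
Qed.
Lemma schwartz2_hh n m : schwartz2 (hh n m).
Proof.
  apply schwartz2_mk.
  - intros a b x y. unfold hh. eapply cder_eq; [apply cder_mul; [apply (schwartz1_cder (hfam n) (schwartz1_hfam n))|apply cder_const]|cbv beta; ring].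
  - intros a b x y. apply cder_scal. apply (schwartz1_cder (hfam m) (schwartz1_hfam m)).
  - intros. apply bd2_ex. destruct (hh_bd2 (j1 + j2 + a + b)) as (C & p & _ & H). eexists. auto.
Qed.

Lemma swf_hh n m : swf (hh n m) = hh m n.
Proof. do 4 (apply functional_extensionality; intros). unfold swf, hh. ring. Qed.
(** The coefficient in x alone, still a function of y. It is again a Schwartz family, so double
    coefficients are iterated single ones. *)
Definition Cn (F : fam2) (n : nat) : fam1 := fun b y => cf (slice F b y) n.
Lemma schwartz2_weightx F b : schwartz2 F -> forall j, exists C, 0 <= C /\ forall x y, Cmod (F 0%nat b x y) * (1 + x ^ 2) * (1 + y ^ 2) ^ j <= C.
Proof.
  intros HF j. destruct (schwartz2_bd F HF (2 + 2 * j + b)) as [B HB]. pose proof (bd2_nonneg _ _ _ HB).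
  assert (P : 0 < 2 ^ j) by nn.
  exists (2 ^ j * (4 * B)). split; [nra|]. intros x y.
  pose proof (HB 0%nat 0%nat 0%nat b x y ltac:(lia) ltac:(lia) ltac:(lia) ltac:(lia)) as h1.
  pose proof (HB 2%nat 0%nat 0%nat b x y ltac:(lia) ltac:(lia) ltac:(lia) ltac:(lia)) as h2.
  pose proof (HB 0%nat (2 * j)%nat 0%nat b x y ltac:(lia) ltac:(lia) ltac:(lia) ltac:(lia)) as h3.
  pose proof (HB 2%nat (2 * j)%nat 0%nat b x y ltac:(lia) ltac:(lia) ltac:(lia) ltac:(lia)) as h4.
  rewrite pow2_abs in h2, h4. pose proof (one_sq_pow_le y j) as L. pose proof (Cmod_ge0 (F 0%nat b x y)).
  assert (0 <= Cmod (F 0%nat b x y) * (1 + x ^ 2)) by nra.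
  nra.
Qed.
Lemma Cn_cder F n b y : schwartz2 F -> cder (Cn F n b) y (Cn F n (S b) y).
Proof.
  intros HF. destruct (schwartz2_weightx F (S (S b)) HF 0) as (M & M0 & HM).
  apply cder_of_quadratic with (8 * (2 * wt n * (2 * M))). intros h _. unfold Cn, cf.
  pose proof (fun c z => hfam_mul_nice n 0 (slice F c z) 0 (schwartz1_slice F c z HF)) as N.
  rewrite <- CI_scal, <- !CI_sub by auto using cnice_scal, cnice_sub. 
  replace (8 * (2 * wt n * (2 * M)) * h ^ 2) with (8 * (2 * wt n * (2 * M) * h ^ 2)) by ring.
  apply CI_bound; [auto using cnice_scal, cnice_sub|]. intros x.
  assert (X : 0 < 1 + x ^ 2) by nra.
  replace (hfam n 0 x * slice F b (y + h) 0%nat x - hfam n 0 x * slice F b y 0%nat x - RtoC h * (hfam n 0 x * slice F (S b) y 0%nat x))%cx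
    with (hfam n 0 x * (F 0%nat b x (y + h)%R - F 0%nat b x y - RtoC h * F 0%nat (S b) x y))%cx by (unfold slice; ring).
  rewrite Cmod_mul. unfold hfam. rewrite Cmod_RtoC. pose proof (hr_sup n x) as S1. pose proof (Rabs_pos (hr n 0 x)).
  assert (T : Cmod (F 0%nat b x (y + h)%R - F 0%nat b x y - RtoC h * F 0%nat (S b) x y) <= 2 * (M * / (1 + x ^ 2)) * h ^ 2).
  { apply (ctaylor2 (fun t => F 0%nat b x t) (fun t => F 0%nat (S b) x t) (fun t => F 0%nat (S (S b)) x t)).
    - intros; apply (schwartz2_cdery F HF).
    - intros; apply (schwartz2_cdery F HF).
    - intros t. specialize (HM x t). rewrite pow_O, Rmult_1_r in HM. apply Rmult_le_reg_r with (1 + x ^ 2); auto.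
      rewrite Rmult_assoc, Rinv_l, Rmult_1_r by lra. auto. }
  set (z := Cmod _) in *. assert (0 <= z) by apply Cmod_ge0.
  replace (2 * wt n * (2 * M) * h ^ 2) with (2 * wt n * (2 * (M * / (1 + x ^ 2)) * h ^ 2 * (1 + x ^ 2))) by (field; lra).
  rewrite Rmult_assoc. apply Rmult_le_compat; auto.
  - nra.
  - nra.
Qed.
(** One-variable decay applied to [Rabs y ^ j] times a slice, with [y] frozen. *)
Lemma Cn_decay' K L : exists N C, 0 <= C /\ forall F B, schwartz2 F -> bd2 N F B ->
  forall n, bd1 L (Cn F n) (C * B * / wt n ^ K).
Proof.
  destruct (cf_decay K) as (N & C & C0 & H). exists (N + L)%nat, C. split; [auto|]. intros F B HF HB n j b y hj hb.
  pose proof (wt_pow_ge1 n K). apply Rmult_le_reg_l with (wt n ^ K); [lra|].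
  replace (wt n ^ K * (C * B * / wt n ^ K)) with (C * B) by (field; lra).
  assert (P : 0 <= Rabs y ^ j) by nn.
  assert (Q : bd1 N (fam1_scal (RtoC (Rabs y ^ j)) (slice F b y)) B).
  { intros i a x hi ha. unfold fam1_scal, slice. rewrite Cmod_mul, Cmod_RtoC, (Rabs_right (Rabs y ^ j)) by lra.
    specialize (HB i j a b x y ltac:(lia) ltac:(lia) ltac:(lia) ltac:(lia)). lra. }
  pose proof (H _ _ (schwartz1_scal _ _ (schwartz1_slice F b y HF)) Q n) as S1.
  rewrite cf_scal, Cmod_mul, Cmod_RtoC, (Rabs_right (Rabs y ^ j)) in S1 by (auto using schwartz1_slice; lra). auto.
Qed.
Lemma schwartz1_Cn F n : schwartz2 F -> schwartz1 (Cn F n).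
Proof.
  intros HF. apply schwartz1_mk; [intros; apply Cn_cder; auto|].
  intros j b. destruct (Cn_decay' 0 (j + b)) as (N & C & _ & H). destruct (schwartz2_bd F HF N) as [B HB].
  eexists. intros y. apply (H F B HF HB n j b y); lia.
Qed.

Definition c2 (F : fam2) (p : nat * nat) : Cx := cf (Cn F (fst p)) (snd p).
Definition tmp2 (w : nat * nat -> Cx) : Prop := exists K B, forall n m, Cmod (w (n, m)) <= B * wt n ^ K * wt m ^ K.
Definition sb2 (K : nat) (w : nat * nat -> Cx) (B : R) : Prop := forall n m, wt n ^ K * wt m ^ K * Cmod (w (n, m)) <= B.
Definition rap2 (w : nat * nat -> Cx) : Prop := forall K, exists B, sb2 K w B.
Definition on1 (X : (nat -> Cx) -> nat -> Cx) (w : nat * nat -> Cx) (p : nat * nat) : Cx := X (fun n => w (n, snd p)) (fst p).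
Definition on2 (X : (nat -> Cx) -> nat -> Cx) (w : nat * nat -> Cx) (p : nat * nat) : Cx := X (fun m => w (fst p, m)) (snd p).

Lemma sb2_nonneg K w B : sb2 K w B -> 0 <= B.
Proof.
  intros H. specialize (H 0%nat 0%nat). pose proof (Cmod_ge0 (w (0, 0)%nat)). nra.
Qed.
Lemma c2_decay K : exists N C, 0 <= C /\ forall F B, schwartz2 F -> bd2 N F B -> sb2 K (c2 F) (C * B).
Proof.
  destruct (cf_decay K) as (N1 & C1 & C10 & H1). destruct (Cn_decay' K N1) as (N & C & C0 & H).
  exists N, (C1 * C). split; [nra|]. intros F B HF HB n m. unfold c2. cbn [fst snd].
  pose proof (H1 _ _ (schwartz1_Cn F n HF) (H F B HF HB n) m) as A.
  pose proof (wt_pow_ge1 n K). replace (C1 * C * B) with (wt n ^ K * (C1 * (C * B * / wt n ^ K))) by (field; lra).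
  nra.
Qed.
Lemma rap2_c2 F : schwartz2 F -> rap2 (c2 F).
Proof.
  intros HF K. destruct (c2_decay K) as (N & C & _ & H). destruct (schwartz2_bd F HF N) as [B HB]. eexists. apply H; eauto.
Qed.
Lemma c2_complete F a b x y : schwartz2 F ->
  F a b x y = pair (hx a x) (fun n => pair (hx b y) (fun m => c2 F (n, m))).
Proof.
  intros HF. change (F a b x y) with (slice F b y a x). rewrite <- cf_complete by (apply schwartz1_slice; auto).
  f_equal. apply functional_extensionality. intros n. change (cf (slice F b y) n) with (Cn F n b y).
  rewrite <- cf_complete by (apply schwartz1_Cn; auto). auto.
Qed.
Lemma pair_hx_bd N : exists K C, 0 <= C /\ forall w B j k x, sb K w B -> rap w -> (j <= N)%nat -> (k <= N)%nat ->
  Rabs x ^ j * Cmod (pair (hx k x) w) <= C * B.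
Proof.
  destruct (hfam_bd1 N) as (C & p & C0 & H). exists (p + 2)%nat, (4 * C). split; [lra|].
  intros w B j k x HB Hw hj hk. assert (P : 0 <= Rabs x ^ j) by nn.
  rewrite <- (Rabs_right (Rabs x ^ j)) by lra. rewrite <- Cmod_RtoC, <- Cmod_mul.
  unfold pair. rewrite <- CSeries_scal by (apply pair_sm; auto using tmp_hx).
  replace (4 * C * B) with (4 * (C * B)) by ring.
  rewrite (CSeries_ext _ (fun n => (RtoC (Rabs x ^ j) * hx k x n) * w n)%cx) by (intros; ring).
  apply pair_bound with p; auto. intros n. rewrite Cmod_mul, Cmod_RtoC, Rabs_right by lra. apply H; auto.
Qed.
Lemma rap2_row w n : rap2 w -> rap (fun m => w (n, m)).
Proof.
  intros H K. destruct (H K) as [B HB]. exists B. intros m. specialize (HB n m).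
  pose proof (wt_pow_ge1 n K). pose proof (wt_pow_ge1 m K). pose proof (Cmod_ge0 (w (n, m))).
  assert (0 <= wt m ^ K * Cmod (w (n, m))) by nra. nra.
Qed.
Lemma sb2_row K w B n : sb2 K w B -> sb K (fun m => w (n, m)) (B * / wt n ^ K).
Proof.
  intros H m. specialize (H n m). pose proof (wt_pow_ge1 n K). apply Rmult_le_reg_l with (wt n ^ K); [lra|].
  replace (wt n ^ K * (B * / wt n ^ K)) with B by (field; lra). lra.
Qed.
Definition recon2 (w : nat * nat -> Cx) : fam2 := fun a b x y =>
  pair (hx a x) (fun n => pair (hx b y) (fun m => w (n, m))).
(** Summing over [m] uses up [K0] powers of the weight and leaves [K] powers in [n], uniformly in
    [y]. *)
Lemma inner_sb N : exists K0 C, 0 <= C /\ forall K w B j k y, sb2 (K0 + K) w B -> rap2 w -> (j <= N)%nat -> (k <= N)%nat ->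
  sb K (fun n => RtoC (Rabs y ^ j) * pair (hx k y) (fun m => w (n, m)))%cx (C * B).
Proof.
  destruct (pair_hx_bd N) as (K0 & C & C0 & H). exists K0, C. split; [auto|].
  intros K w B j k y HB Hw hj hk n. assert (P : 0 <= Rabs y ^ j) by nn.
  rewrite Cmod_mul, Cmod_RtoC, Rabs_right by lra.
  pose proof (sb_le (K0 + K) K0 _ _ ltac:(lia) (sb2_row _ _ _ n HB)) as S1.
  pose proof (H _ _ j k y S1 (rap2_row w n Hw) hj hk) as A. pose proof (wt_pow_le n K (K0 + K) ltac:(lia)). pose proof (wt_pow_ge1 n K).
  apply Rle_trans with (wt n ^ (K0 + K) * (C * (B * / wt n ^ (K0 + K)))).
  - apply Rmult_le_compat; auto; [lra|]. nn.
  - right. field. lra.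
Qed.
Lemma rap_inner w k y : rap2 w -> rap (fun n => pair (hx k y) (fun m => w (n, m))).
Proof.
  intros Hw K. destruct (inner_sb k) as (K0 & C & C0 & H). destruct (Hw (K0 + K)%nat) as [B HB].
  exists (C * B). pose proof (H K w B 0%nat k y HB Hw ltac:(lia) (le_n _)) as S1. intros n. specialize (S1 n).
  cbn [pow] in S1. change (RtoC 1) with C1 in S1. replace (C1 * pair (hx k y) (fun m => w (n, m)))%cx with (pair (hx k y) (fun m => w (n, m))) in S1 by ring.
  auto.
Qed.
Lemma recon2_bound N : exists K C, 0 <= C /\ forall w B, rap2 w -> sb2 K w B -> bd2 N (recon2 w) (C * B).
Proof.
  destruct (inner_sb N) as (K0 & C & C0 & H). destruct (pair_hx_bd N) as (K1 & C1 & C10 & H1).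
  exists (K0 + K1)%nat, (C1 * C). split; [nra|]. intros w B Hw HB j1 j2 a b x y h1 h2 ha hb. unfold recon2.
  pose proof (H K1 w B j2 b y HB Hw h2 hb) as S1.
  assert (R1 : rap (fun n => RtoC (Rabs y ^ j2) * pair (hx b y) (fun m => w (n, m)))%cx) by exact (rap_scal _ _ (rap_inner w b y Hw)).
  pose proof (H1 _ _ j1 a x S1 R1 h1 ha) as A.
  rewrite pair_scal_r, Cmod_mul, Cmod_RtoC, (Rabs_right (Rabs y ^ j2)) in A by first [solve [auto using tmp_hx, rap_inner]|apply Rle_ge, pow_le, Rabs_pos].
  lra.
Qed.
Lemma rec2_bound N : exists K C, 0 <= C /\ forall F B, schwartz2 F -> sb2 K (c2 F) B -> bd2 N F (C * B).
Proof.
  destruct (recon2_bound N) as (K & C & C0 & H). exists K, C. split; [auto|].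
  intros F B HF HB. replace F with (recon2 (c2 F)); [apply H; auto using rap2_c2|].
  do 4 (apply functional_extensionality; intros). symmetry. apply c2_complete; auto.
Qed.
Lemma schwartz2_recon2 w : rap2 w -> schwartz2 (recon2 w).
Proof.
  intros Hw. apply schwartz2_mk.
  - intros a b x y. apply (schwartz1_cder _ (schwartz1_recon _ (rap_inner w b y Hw)) a x).
  - intros a b x y. destruct (hr_poly_bound 0 a) as (A & p & A0 & HA).
    destruct (inner_sb (S (S b))) as (K0 & C & C0 & H). destruct (Hw (K0 + (p + 2))%nat) as [B HB].
    assert (T : forall k z, (k <= S (S b))%nat -> forall n, Cmod (hx a x n * pair (hx k z) (fun m => w (n, m))) * wt n ^ 2 <= A * (C * B)).
    { intros k z hk. apply pair_terms with p.
      - intros n. specialize (HA n x). unfold hx, hfam. rewrite Cmod_RtoC. lra.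
      - pose proof (H (p + 2)%nat w B 0%nat k z HB Hw ltac:(lia) hk) as S1. intros n. specialize (S1 n). cbn [pow] in S1.
        change (RtoC 1) with C1 in S1. replace (C1 * pair (hx k z) (fun m => w (n, m)))%cx with (pair (hx k z) (fun m => w (n, m))) in S1 by ring. auto. }
    apply (CSeries_cder (fun n y => hx a x n * recon (fun m => w (n, m)) b y)%cx (fun n y => hx a x n * recon (fun m => w (n, m)) (S b) y)%cx
      (fun n y => hx a x n * recon (fun m => w (n, m)) (S (S b)) y)%cx (A * (C * B))).
    + intros n z. apply cder_scal. apply (schwartz1_cder _ (schwartz1_recon _ (rap2_row w n Hw))).
    + intros n z. apply cder_scal. apply (schwartz1_cder _ (schwartz1_recon _ (rap2_row w n Hw))).
    + intros z. eexists. apply T. lia.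
    + intros z. eexists. apply T. lia.
    + intros n z. apply T. lia.
  - intros. apply bd2_ex. destruct (recon2_bound (j1 + j2 + a + b)) as (K & C & _ & H). destruct (Hw K) as [B HB].
    eexists. apply H; eauto.
Qed.

Definition pair2 (w k : nat * nat -> Cx) : Cx := CSeries (fun n => pair (fun m => w (n, m)) (fun m => k (n, m))).
Lemma pair2_terms w k p A B : (forall n m, Cmod (w (n, m)) <= A * wt n ^ p * wt m ^ p) -> sb2 (p + 2) k B ->
  forall n, Cmod (pair (fun m => w (n, m)) (fun m => k (n, m))) * wt n ^ 2 <= 4 * (A * B).
Proof.
  intros HA HB n. pose proof (sb2_row _ _ _ n HB) as S1.
  pose proof (pair_bound (fun m => w (n, m)) (fun m => k (n, m)) p (A * wt n ^ p) _ (HA n) S1) as P.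
  pose proof (wt_pow_ge1 n 2). apply Rle_trans with (4 * (A * wt n ^ p * (B * / wt n ^ (p + 2))) * wt n ^ 2); [apply Rmult_le_compat_r; lra|].
  right. rewrite pow_add. field. pose proof (wt_ge1 n). split; [lra|]. apply pow_nonzero; lra.
Qed.
Lemma pair2_bound w k p A B : (forall n m, Cmod (w (n, m)) <= A * wt n ^ p * wt m ^ p) -> sb2 (p + 2) k B ->
  Cmod (pair2 w k) <= 16 * (A * B).
Proof.
  intros HA HB. replace (16 * (A * B)) with (4 * (4 * (A * B))) by ring. apply CSeries_bound. apply pair2_terms with p; auto.
Qed.
Lemma tmp2_row w n : tmp2 w -> tmp (fun m => w (n, m)).
Proof. intros (K & B & H). exists K, (B * wt n ^ K). auto. Qed.
Lemma pair2_sm w k : tmp2 w -> rap2 k -> sm (fun n => pair (fun m => w (n, m)) (fun m => k (n, m))).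
Proof.
  intros (p & A & HA) Hk. destruct (Hk (p + 2)%nat) as [B HB]. eexists. apply pair2_terms with p; eauto.
Qed.
Lemma pair2_add_r w k l : tmp2 w -> rap2 k -> rap2 l -> pair2 w (fun p => k p + l p)%cx = (pair2 w k + pair2 w l)%cx.
Proof.
  intros. unfold pair2. rewrite <- CSeries_add by auto using pair2_sm. apply CSeries_ext. intros n.
  apply pair_add_r; auto using tmp2_row, rap2_row.
Qed.
Lemma pair2_scal_r w k c : tmp2 w -> rap2 k -> pair2 w (fun p => c * k p)%cx = (c * pair2 w k)%cx.
Proof.
  intros. unfold pair2. rewrite <- CSeries_scal by auto using pair2_sm. apply CSeries_ext. intros n.
  apply pair_scal_r; auto using tmp2_row, rap2_row.
Qed.

Lemma Cn_add F G n : schwartz2 F -> schwartz2 G -> Cn (fam2_add F G) n = fam1_add (Cn F n) (Cn G n).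
Proof.
  intros. do 2 (apply functional_extensionality; intros). unfold Cn, fam1_add at 1.
  rewrite <- cf_add by auto using schwartz1_slice. auto.
Qed.
Lemma Cn_scal c F n : schwartz2 F -> Cn (fam2_scal c F) n = fam1_scal c (Cn F n).
Proof.
  intros. do 2 (apply functional_extensionality; intros). unfold Cn, fam1_scal at 1.
  rewrite <- cf_scal by auto using schwartz1_slice. auto.
Qed.
Lemma c2_add F G p : schwartz2 F -> schwartz2 G -> c2 (fam2_add F G) p = (c2 F p + c2 G p)%cx.
Proof. intros. unfold c2. rewrite Cn_add, cf_add by auto using schwartz1_Cn. auto. Qed.
Lemma c2_scal c F p : schwartz2 F -> c2 (fam2_scal c F) p = (c * c2 F p)%cx.
Proof. intros. unfold c2. rewrite Cn_scal, cf_scal by auto using schwartz1_Cn. auto. Qed.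
Definition delta2 (q p : nat * nat) : Cx :=
  if Nat.eqb (fst p) (fst q) then (if Nat.eqb (snd p) (snd q) then C1 else C0) else C0.
Lemma c2_hh n m p : c2 (hh n m) p = delta2 (n, m) p.
Proof.
  destruct p as [n' m']. unfold c2, delta2. cbn [fst snd].
  assert (E : Cn (hh n m) n' = fam1_scal (cf (hfam n) n') (hfam m)).
  { do 2 (apply functional_extensionality; intros). unfold Cn.
    replace (slice (hh n m) x x0) with (fam1_scal (hfam m x x0) (hfam n)).
    - rewrite cf_scal by apply schwartz1_hfam. unfold fam1_scal. ring.
    - do 2 (apply functional_extensionality; intros). unfold fam1_scal, slice, hh. ring. }
  rewrite E, cf_scal, !cf_hfam by apply schwartz1_hfam.
  destruct (Nat.eqb n' n), (Nat.eqb m' m); ring.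
Qed.
Lemma pair2_delta w n m : pair2 w (delta2 (n, m)) = w (n, m).
Proof.
  unfold pair2. rewrite (CSeries_ext _ (fun k => if Nat.eqb k n then w (k, m) else C0)).
  - apply CSeries_delta.
  - intros k. unfold pair, delta2. cbn [fst snd]. destruct (Nat.eqb k n).
    + rewrite (CSeries_ext _ (fun l => if Nat.eqb l m then w (k, l) else C0)); [apply CSeries_delta|].
      intros l. destruct (Nat.eqb l m); ring.
    + apply CSeries_zero. intros; ring.
Qed.

(** * Tempered distributions of two variables *)

Ltac sch2 := repeat first [solve [auto using schwartz2_tMx, schwartz2_tMy, schwartz2_tDx, schwartz2_tDy, schwartz2_hh]
  | apply schwartz2_add | apply schwartz2_scal].

Lemma tempered2_add u v : tempered2 u -> tempered2 v -> tempered2 (fun F => u F + v F)%cx.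
Proof.
  intros (A & B & N & C & D) (A' & B' & N' & C' & D'). split; [|split].
  - intros. rewrite A, A' by auto. ring.
  - intros. rewrite B, B' by auto. ring.
  - exists (N + N')%nat, (C + C'). intros F Mb HF H. eapply Rle_trans; [apply Cmod_tri|].
    rewrite Rmult_plus_distr_r. apply Rplus_le_compat; [apply D|apply D']; auto; intros; apply H; lia.
Qed.
Lemma tempered2_scal c u : tempered2 u -> tempered2 (fun F => c * u F)%cx.
Proof.
  intros (A & B & N & C & D). split; [|split].
  - intros. rewrite A by auto. ring.
  - intros. rewrite B by auto. ring.
  - exists N, (Cmod c * C). intros F Mb HF H. rewrite Cmod_mul, Rmult_assoc.
    apply Rmult_le_compat_l; [apply Cmod_ge0|eauto].
Qed.
Lemma tempered2_op (tO : fam2 -> fam2) u :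
  (forall F, schwartz2 F -> schwartz2 (tO F)) ->
  (forall F G, schwartz2 F -> schwartz2 G -> tO (fam2_add F G) = fam2_add (tO F) (tO G)) ->
  (forall c F, schwartz2 F -> tO (fam2_scal c F) = fam2_scal c (tO F)) ->
  (forall N, exists N' A, forall F B, bd2 N' F B -> bd2 N (tO F) (A * B)) ->
  tempered2 u -> tempered2 (fun F => u (tO F)).
Proof.
  intros H1 H2 H3 H4 (A & B & N & C & D). split; [|split].
  - intros. rewrite H2, A by auto. auto.
  - intros. rewrite H3, B by auto. auto.
  - destruct (H4 N) as (N' & K & HK). exists N', (C * K). intros F Mb HF H. rewrite Rmult_assoc.
    apply D; [auto|]. exact (HK F Mb H).
Qed.
Ltac fam2_ext := do 4 (apply functional_extensionality; intros).
Lemma tempered2_MMx u : tempered2 u -> tempered2 (MMx u).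
Proof.
  apply (tempered2_op tMx); auto using schwartz2_tMx.
  - intros; fam2_ext; unfold tMx, fam2_add; ring.
  - intros; fam2_ext; unfold tMx, fam2_scal; ring.
  - intros N. exists (S N), (1 + INR N). intros; apply bd2_tMx; auto.
Qed.
Definition swd (u : distR2) : distR2 := fun F => u (swf F).
Lemma tempered2_swd u : tempered2 u -> tempered2 (swd u).
Proof.
  apply (tempered2_op swf); auto using schwartz2_swf.
  intros N. exists N, 1. intros. rewrite Rmult_1_l. apply bd2_swf; auto.
Qed.
Lemma tempered2_MMy u : tempered2 u -> tempered2 (MMy u).
Proof. intros H. exact (tempered2_swd _ (tempered2_MMx _ (tempered2_swd _ H))). Qed.
Lemma tempered2_ext u v : (forall F, schwartz2 F -> u F = v F) -> tempered2 u -> tempered2 v.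
Proof.
  intros E (A & B & N & C & D). split; [|split].
  - intros. rewrite <- !E by sch2. auto.
  - intros. rewrite <- !E by sch2. auto.
  - exists N, C. intros. rewrite <- E by auto. eauto.
Qed.
Lemma tempered2_DDx u : tempered2 u -> tempered2 (DDx u).
Proof.
  intros H. apply tempered2_ext with (fun F => (- C1) * u (tDx F))%cx; [intros; unfold DDx; ring|].
  apply tempered2_scal. apply (tempered2_op tDx); auto using schwartz2_tDx.
  - intros; fam2_ext; unfold tDx, fam2_add; ring.
  - intros; fam2_ext; unfold tDx, fam2_scal; ring.
  - intros N. exists (S N), 1. intros. rewrite Rmult_1_l. apply bd2_tDx; auto.
Qed.
Lemma tempered2_DDy u : tempered2 u -> tempered2 (DDy u).
Proof. intros H. exact (tempered2_swd _ (tempered2_DDx _ (tempered2_swd _ H))). Qed.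
Definition hat2 (u : distR2) (p : nat * nat) : Cx := u (hh (fst p) (snd p)).
Definition dist2 (w : nat * nat -> Cx) : distR2 := fun F => pair2 w (c2 F).
Lemma tmp2_hat2 u : tempered2 u -> tmp2 (hat2 u).
Proof.
  intros (_ & _ & N & C & D). destruct (hh_bd2 N) as (A & p & A0 & H). exists p, (C * A). intros n m.
  rewrite !Rmult_assoc, <- (Rmult_assoc A). apply D; [apply schwartz2_hh|]. intros. apply H; auto.
Qed.
Lemma hat2_MMx u : tempered2 u -> hat2 (MMx u) = on1 sM (hat2 u).
Proof.
  intros (A & B & _). apply functional_extensionality. intros [n m]. unfold hat2, MMx. cbn [fst snd].
  replace (tMx (hh n m)) with (fam2_scal (RtoC (/ sqrt 2)) (fam2_add
    (fam2_scal (RtoC (sqrt (INR n))) (hh (pred n) m)) (fam2_scal (RtoC (sqrt (INR (S n)))) (hh (S n) m)))).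
  - rewrite B, A, !B by sch2. auto.
  - fam2_ext. change (tMx (hh n m) x x0 x1 x2) with (RtoC x1 * (hfam n x x1 * hfam m x0 x2) + RtoC (INR x) * (hfam n (pred x) x1 * hfam m x0 x2))%cx.
    transitivity (tM1 (hfam n) x x1 * hfam m x0 x2)%cx; [|unfold tM1; ring]. rewrite tM_hfam. unfold sM, sA, sB, fam2_scal, fam2_add, hh. ring.
Qed.
Lemma hat2_DDx u : tempered2 u -> hat2 (DDx u) = on1 sD (hat2 u).
Proof.
  intros (A & B & _). apply functional_extensionality. intros [n m]. unfold hat2, DDx. cbn [fst snd].
  replace (tDx (hh n m)) with (fam2_scal (- (Ci * RtoC (/ sqrt 2)))%cx (fam2_add
    (fam2_scal (RtoC (sqrt (INR n))) (hh (pred n) m)) (fam2_scal (- RtoC (sqrt (INR (S n))))%cx (hh (S n) m)))).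
  - rewrite B, A, !B by sch2. unfold on1, sD, sA, sB. cbn [fst snd]. ring.
  - fam2_ext. unfold tDx, hh at 3. rewrite hfam_S. unfold sD, sA, sB, fam2_scal, fam2_add, hh. apply Cx_ext; cxsimpl; ring.
Qed.
Lemma hat2_swd u n m : hat2 (swd u) (n, m) = hat2 u (m, n).
Proof. unfold hat2, swd. rewrite swf_hh. nn. Qed.
Lemma hat2_MMy u : tempered2 u -> hat2 (MMy u) = on2 sM (hat2 u).
Proof.
  intros H. apply functional_extensionality. intros [n m]. change (hat2 (swd (MMx (swd u))) (n, m) = on2 sM (hat2 u) (n, m)).
  rewrite hat2_swd, hat2_MMx by (apply tempered2_swd; auto). unfold on1, on2. f_equal. apply functional_extensionality. intros. apply hat2_swd.
Qed.
Lemma hat2_DDy u : tempered2 u -> hat2 (DDy u) = on2 sD (hat2 u).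
Proof.
  intros H. apply functional_extensionality. intros [n m]. change (hat2 (swd (DDx (swd u))) (n, m) = on2 sD (hat2 u) (n, m)).
  rewrite hat2_swd, hat2_DDx by (apply tempered2_swd; auto). unfold on1, on2. f_equal. apply functional_extensionality. intros. apply hat2_swd.
Qed.
Lemma dist2_tempered w : tmp2 w -> tempered2 (dist2 w).
Proof.
  intros Hw. unfold dist2. split; [|split].
  - intros F G HF HG. rewrite <- pair2_add_r by auto using rap2_c2. f_equal. apply functional_extensionality; intros; apply c2_add; auto.
  - intros c F HF. rewrite <- pair2_scal_r by auto using rap2_c2. f_equal. apply functional_extensionality; intros; apply c2_scal; auto.
  - destruct Hw as (p & A & HA). destruct (c2_decay (p + 2)) as (N & C & C0 & H). exists N, (16 * (A * C)). intros F Mb HF Hb.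
    replace (16 * (A * C) * Mb) with (16 * (A * (C * Mb))) by ring. apply pair2_bound with p; auto.
Qed.
Lemma hat2_dist2 w : hat2 (dist2 w) = w.
Proof.
  apply functional_extensionality. intros [n m]. unfold hat2, dist2. cbn [fst snd].
  rewrite (functional_extensionality _ _ (c2_hh n m)). apply pair2_delta.
Qed.

Fixpoint trunc_row (c : nat * nat -> Cx) (M n : nat) (G : fam2) : fam2 :=
  match M with O => G | S M' => fam2_add (trunc_row c M' n G) (fam2_scal (- c (n, M'))%cx (hh n M')) end.
Fixpoint trunc2 (c : nat * nat -> Cx) (N M : nat) (G : fam2) : fam2 :=
  match N with O => G | S N' => trunc_row c M N' (trunc2 c N' M G) end.
Lemma schwartz2_trunc_row c M n G : schwartz2 G -> schwartz2 (trunc_row c M n G).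
Proof. intros. induction M; cbn [trunc_row]; sch2. Qed.
Lemma schwartz2_trunc2 c N M G : schwartz2 G -> schwartz2 (trunc2 c N M G).
Proof. intros. induction N; cbn [trunc2]; auto using schwartz2_trunc_row. Qed.
Lemma c2_trunc_row c M n G p : schwartz2 G ->
  c2 (trunc_row c M n G) p = (c2 G p - if (Nat.eqb (fst p) n && Nat.ltb (snd p) M)%bool then c p else C0)%cx.
Proof.
  intros HG. destruct p as [n' m']. induction M as [|M IH]; cbn [trunc_row].
  - rewrite Bool.andb_false_r. ring.
  - rewrite c2_add, c2_scal, IH, c2_hh by (try apply schwartz2_scal; auto using schwartz2_trunc_row, schwartz2_hh).
    unfold delta2. cbn [fst snd]. destruct (Nat.eqb_spec n' n); cbn [andb]; [subst|ring].
    destruct (Nat.ltb_spec m' M), (Nat.ltb_spec m' (S M)), (Nat.eqb_spec m' M); try lia; subst; ring.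
Qed.
Lemma c2_trunc2 N M F p : schwartz2 F ->
  c2 (trunc2 (c2 F) N M F) p = if (Nat.ltb (fst p) N && Nat.ltb (snd p) M)%bool then C0 else c2 F p.
Proof.
  intros HF. induction N as [|N IH]; cbn [trunc2]; [reflexivity|].
  rewrite c2_trunc_row, IH by auto using schwartz2_trunc2. destruct p as [n m]; cbn [fst snd].
  destruct (Nat.ltb_spec n N), (Nat.ltb_spec n (S N)), (Nat.eqb_spec n N), (Nat.ltb_spec m M); cbn [andb]; try lia; ring.
Qed.
(** As in one variable: outside the block of size [L] by [L] one of the indices is at least [L], so
    that [wt n * wt m] is at least [wt L]. *)
Lemma tempered2_eq0 u F : tempered2 u -> (forall p, hat2 u p = C0) -> schwartz2 F -> u F = C0.
Proof.
  intros (A & B & N & C & D) H HF. destruct (rec2_bound N) as (K & C' & C0' & R).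
  destruct (rap2_c2 F HF (S K)) as [M HM].
  apply small_eq0 with (Rabs C * (C' * M)). intros L.
  assert (E1 : forall c m n G, schwartz2 G -> u (trunc_row c m n G) = u G).
  { intros c m n G HG. induction m as [|m IH]; cbn [trunc_row]; [reflexivity|].
    rewrite A, B by (try apply schwartz2_scal; auto using schwartz2_trunc_row, schwartz2_hh).
    change (u (hh n m)) with (hat2 u (n, m)). rewrite H, IH. ring. }
  assert (E : u F = u (trunc2 (c2 F) L L F)).
  { generalize L at 2. intros m. induction L as [|L IH]; cbn [trunc2]; [reflexivity|].
    rewrite E1 by auto using schwartz2_trunc2. auto. }
  rewrite E. pose proof (wt_ge1 L) as W. pose proof (sb2_nonneg _ _ _ HM).
  assert (HT : schwartz2 (trunc2 (c2 F) L L F)) by auto using schwartz2_trunc2.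
  assert (S1 : sb2 K (c2 (trunc2 (c2 F) L L F)) (M * / wt L)).
  { intros n m. rewrite c2_trunc2 by auto. cbn [fst snd]. pose proof (wt_ge1 n). pose proof (wt_ge1 m).
    assert (Z : (n < L /\ m < L)%nat \/ wt L <= wt n * wt m).
    { destruct (Nat.lt_ge_cases n L) as [h|h]; [destruct (Nat.lt_ge_cases m L) as [h'|h']; [left; auto|]|]; right.
      - pose proof (wt_mono L m h'). nra.
      - pose proof (wt_mono L n h). nra. }
    destruct Z as [[h1 h2]|Z].
    - destruct (Nat.ltb_spec n L), (Nat.ltb_spec m L); try lia. cbn [andb].
      rewrite Cmod_C0, Rmult_0_r. nn.
    - apply Rle_trans with (wt n ^ K * wt m ^ K * Cmod (c2 F (n, m))).
      { apply Rmult_le_compat_l. { nn. }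
        destruct (_ && _)%bool; [rewrite Cmod_C0; apply Cmod_ge0|lra]. }
      specialize (HM n m). apply Rmult_le_reg_r with (wt L); [lra|]. rewrite (Rmult_assoc M), Rinv_l, Rmult_1_r by lra.
      eapply Rle_trans; [|exact HM]. cbn [pow]. set (c := Cmod _). assert (0 <= c) by apply Cmod_ge0.
      replace (wt n * wt n ^ K * (wt m * wt m ^ K) * c) with (wt n ^ K * wt m ^ K * c * (wt n * wt m)) by ring.
      apply Rmult_le_compat_l; auto. nn. }
  pose proof (R _ _ HT S1) as Bd. pose proof (bd2_nonneg _ _ _ Bd).
  eapply Rle_trans; [apply (D _ _ HT Bd)|].
  apply Rle_trans with (Rabs C * (C' * (M * / wt L))); [|right; ring].
  apply Rmult_le_compat_r; [auto|apply Rle_abs].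
Qed.
Lemma tempered2_repr u F : tempered2 u -> schwartz2 F -> u F = dist2 (hat2 u) F.
Proof.
  intros Hu HF.
  assert (Z : (u F + (- C1) * dist2 (hat2 u) F)%cx = C0).
  { apply (tempered2_eq0 (fun F => u F + (- C1) * dist2 (hat2 u) F)%cx); auto.
    - apply tempered2_add; [auto|]. apply tempered2_scal, dist2_tempered, tmp2_hat2; auto.
    - intros p. unfold hat2 at 1. change (dist2 (hat2 u) (hh (fst p) (snd p))) with (hat2 (dist2 (hat2 u)) p).
      rewrite hat2_dist2. unfold hat2. ring. }
  transitivity (u F + (- C1) * dist2 (hat2 u) F + dist2 (hat2 u) F)%cx; [ring|]. rewrite Z. ring.
Qed.
Lemma inS2_hat u : inS2 u -> rap2 (hat2 u).
Proof.
  intros (G & HG & H).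
  replace (hat2 u) with (c2 G); [apply rap2_c2; auto|].
  apply functional_extensionality. intros [n m]. unfold hat2. cbn [fst snd].
  destruct (H _ (schwartz2_hh n m)) as (g & H1 & H2).
  rewrite <- (CI_eq _ _ H2). unfold c2. cbn [fst snd]. apply CI_ext. intros y.
  rewrite <- (CI_eq _ _ (H1 y)). unfold Cn, cf.
  rewrite <- CI_scal by (apply hfam_mul_nice; apply schwartz1_slice; auto). apply CI_ext. intros x. unfold hh, slice. ring.
Qed.
Lemma cnice_of_der f df C : (forall x, cder f x (df x)) -> (forall x, Cmod (f x) * (1 + x ^ 2) <= C) -> cnice f.
Proof. intros H1 H2. split; [intros x; eapply cder_ccont; auto|exists C; auto]. Qed.
Lemma recon2_cint2 w F : rap2 w -> schwartz2 F ->
  cint2 (fun x y => recon2 w 0%nat 0%nat x y * F 0%nat 0%nat x y)%cx (pair2 w (c2 F)).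
Proof.
  intros Hw HF.
  set (U := fun n => recon (fun m => w (n, m))). set (V := Cn F).
  assert (HU : forall n, schwartz1 (U n)) by (intros; apply schwartz1_recon, rap2_row; auto).
  assert (HV : forall n, schwartz1 (V n)) by (intros; apply schwartz1_Cn; auto).
  destruct (inner_sb 2) as (K0 & C & C0 & H). destruct (Hw (K0 + 3)%nat) as [B HB].
  assert (BU : forall n k y, (k <= 2)%nat -> wt n ^ 3 * Cmod (U n k y) <= C * B).
  { intros n k y hk. pose proof (H 3%nat w B 0%nat k y HB Hw ltac:(lia) hk n) as S1.
    cbn [pow Rabs] in S1. rewrite Cmod_mul, Cmod_RtoC, Rabs_R1 in S1. rewrite Rmult_1_l in S1. auto. }
  destruct (Cn_decay' 0 2) as (N' & C' & C0' & H'). destruct (schwartz2_bd F HF N') as [B' HB'].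
  assert (BV : forall n k y, (k <= 2)%nat -> Cmod (V n k y) * (1 + y ^ 2) <= 2 * (C' * B')).
  { intros n k y hk. pose proof (H' F B' HF HB' n 0%nat k y ltac:(lia) hk) as h0. pose proof (H' F B' HF HB' n 2%nat k y ltac:(lia) hk) as h2.
    rewrite pow2_abs in h2. cbn [pow] in h0, h2. unfold V. lra. }
  assert (BUV : forall n k l y, (k <= 2)%nat -> (l <= 2)%nat -> Cmod (U n k y * V n l y) * (1 + y ^ 2) * wt n ^ 3 <= C * B * (2 * (C' * B'))).
  { intros n k l y hk hl. rewrite Cmod_mul.
    replace (Cmod (U n k y) * Cmod (V n l y) * (1 + y ^ 2) * wt n ^ 3) with ((wt n ^ 3 * Cmod (U n k y)) * (Cmod (V n l y) * (1 + y ^ 2))) by ring.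
    apply Rmult_le_compat; auto; apply Rmult_le_pos; auto using Cmod_ge0; [pose proof (wt_pow_ge1 n 3); lra|nra]. }
  set (Q := C * B * (2 * (C' * B'))) in *.
  assert (BUV2 : forall n k l y, (k <= 2)%nat -> (l <= 2)%nat -> Cmod (U n k y * V n l y) * wt n ^ 2 <= Q).
  { intros n k l y hk hl. specialize (BUV n k l y hk hl). pose proof (wt_ge1 n).
    set (z := Cmod _) in *. assert (0 <= z) by apply Cmod_ge0. cbn [pow] in BUV.
    eapply Rle_trans; [|exact BUV]. replace (z * (1 + y * (y * 1)) * (wt n * (wt n * (wt n * 1)))) with (z * wt n ^ 2 * ((1 + y ^ 2) * wt n)) by ring.
    rewrite <- (Rmult_1_r (z * wt n ^ 2)) at 1. apply Rmult_le_compat_l; [nra|]. nra. }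
  assert (BUVn : forall n, cnice (fun y => U n 0%nat y * V n 0%nat y)%cx) by (intros; apply schwartz1_mul2_nice; auto).
  (* [cint2] asks for iterated integrals: the inner one at height [y] is a pairing of partial
     coefficients, a series in [n], which is then integrated in [y] term by term. *)
  set (g := fun y => CSeries (fun n => U n 0%nat y * V n 0%nat y)%cx).
  assert (Ng : cnice g).
  { apply cnice_of_der with (fun y => CSeries (fun n => U n 1%nat y * V n 0%nat y + U n 0%nat y * V n 1%nat y)%cx) (4 * Q).
    + apply (CSeries_cder (fun n y => U n 0%nat y * V n 0%nat y)%cx (fun n y => U n 1%nat y * V n 0%nat y + U n 0%nat y * V n 1%nat y)%cx
            (fun n y => (U n 2%nat y * V n 0%nat y + U n 1%nat y * V n 1%nat y) + (U n 1%nat y * V n 1%nat y + U n 0%nat y * V n 2%nat y))%cx (Q + Q + (Q + Q))).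
      * intros n y. apply cder_mul; apply schwartz1_cder; auto.
      * intros n y. apply cder_add; apply cder_mul; apply schwartz1_cder; auto.
      * intros y. exists Q. auto.
      * intros y. apply sm_add; exists Q; intros n; apply BUV2; lia.
      * intros n y. pose proof (BUV2 n 2%nat 0%nat y ltac:(lia) ltac:(lia)). pose proof (BUV2 n 1%nat 1%nat y ltac:(lia) ltac:(lia)).
        pose proof (BUV2 n 0%nat 2%nat y ltac:(lia) ltac:(lia)).
        set (z1 := (U n 2%nat y * V n 0%nat y)%cx) in *. set (z2 := (U n 1%nat y * V n 1%nat y)%cx) in *. set (z3 := (U n 0%nat y * V n 2%nat y)%cx) in *.
        pose proof (Cmod_tri (z1 + z2) (z2 + z3)). pose proof (Cmod_tri z1 z2). pose proof (Cmod_tri z2 z3). nra.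
    + intros y. assert (0 < 1 + y ^ 2) by nra. apply Rmult_le_reg_r with (/ (1 + y ^ 2)); [apply Rinv_0_lt_compat; auto|].
      rewrite Rmult_assoc, Rinv_r, Rmult_1_r by lra. rewrite Rmult_assoc. apply CSeries_bound. intros n.
      apply Rmult_le_reg_r with (1 + y ^ 2); auto. rewrite (Rmult_assoc Q), Rinv_l, Rmult_1_r by lra.
      pose proof (BUV n 0%nat 0%nat y ltac:(lia) ltac:(lia)) as X. pose proof (wt_pow_le n 2 3 ltac:(lia)).
      set (z := Cmod _) in *. assert (0 <= z) by apply Cmod_ge0. eapply Rle_trans; [|exact X].
      replace (z * wt n ^ 2 * (1 + y ^ 2)) with (z * (1 + y ^ 2) * wt n ^ 2) by ring. apply Rmult_le_compat_l; auto. nra. }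
  assert (E : CI g = pair2 w (c2 F)).
  { unfold g. rewrite (CI_CSeries (fun n y => U n 0%nat y * V n 0%nat y)%cx Q); auto. apply CSeries_ext. intros n. unfold U.
    rewrite CI_recon by auto using rap2_row. auto. }
  exists g. split.
  - intros y.
    assert (R1 : rap (fun n => U n 0%nat y)) by (apply (rap_inner w 0 y); auto).
    replace (g y) with (CI (fun x => recon (fun n => U n 0%nat y) 0%nat x * slice F 0%nat y 0%nat x)%cx).
    + apply CI_cint1, schwartz1_mul2_nice; auto using schwartz1_slice, schwartz1_recon.
    + rewrite CI_recon by auto using schwartz1_slice. auto.
  - rewrite <- E. apply CI_cint1. auto.
Qed.
Lemma hat_inS2 u : tempered2 u -> rap2 (hat2 u) -> inS2 u.
Proof.
  intros Hu Hr. exists (recon2 (hat2 u)). split; [apply schwartz2_recon2; auto|]. intros F HF.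
  rewrite tempered2_repr by auto. apply recon2_cint2; auto.
Qed.
Lemma inS2_ext u v : (forall F, schwartz2 F -> u F = v F) -> inS2 u -> inS2 v.
Proof. intros E (G & HG & H). exists G. split; auto. intros F HF. rewrite <- E by auto. auto. Qed.

(** * Symplectic reduction to a single variable *)

(** The real linear form [q1 x + p1 D_x + q2 y + p2 D_y]: a twisted operator is a polynomial in two
    such forms, and linear symplectic maps act on them. *)
Record vec4 := V4 { q1 : R; p1 : R; q2 : R; p2 : R }.
Definition opF (v : vec4) (u : distR2) : distR2 := fun F =>
  (RtoC (q1 v) * MMx u F + RtoC (p1 v) * DDx u F + RtoC (q2 v) * MMy u F + RtoC (p2 v) * DDy u F)%cx.
Definition opS (v : vec4) (w : nat * nat -> Cx) (p : nat * nat) : Cx :=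
  (RtoC (q1 v) * on1 sM w p + RtoC (p1 v) * on1 sD w p + RtoC (q2 v) * on2 sM w p + RtoC (p2 v) * on2 sD w p)%cx.
Definition GR2f (a : nat -> nat -> Cx) (v w : vec4) : Prop :=
  forall u, tempered2 u -> inS2 (pol a (opF v) (opF w) u) -> inS2 u.
Definition GR2s (a : nat -> nat -> Cx) (v w : vec4) : Prop :=
  forall z, tmp2 z -> rap2 (pol a (opS v) (opS w) z) -> rap2 z.

Lemma tempered2_opF v u : tempered2 u -> tempered2 (opF v u).
Proof.
  intros. repeat apply tempered2_add; apply tempered2_scal;
  auto using tempered2_MMx, tempered2_MMy, tempered2_DDx, tempered2_DDy.
Qed.
Lemma tempered2_pol a v w u : tempered2 u -> tempered2 (pol a (opF v) (opF w) u).
Proof. intros. repeat apply tempered2_add; apply tempered2_scal; auto using tempered2_opF. Qed.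
Lemma hat2_opF v u : tempered2 u -> hat2 (opF v u) = opS v (hat2 u).
Proof.
  intros H. apply functional_extensionality. intros p. unfold opS.
  rewrite <- hat2_MMx, <- hat2_MMy, <- hat2_DDx, <- hat2_DDy by auto. auto.
Qed.
Lemma hat2_pol a v w u : tempered2 u -> hat2 (pol a (opF v) (opF w) u) = pol a (opS v) (opS w) (hat2 u).
Proof.
  intros H. apply functional_extensionality. intros p.
  unfold pol at 2. rewrite <- !hat2_opF by auto using tempered2_opF. auto.
Qed.
Lemma GR2_iff a v w : GR2f a v w <-> GR2s a v w.
Proof.
  split; intros H.
  - intros z Hz Hr. pose proof (dist2_tempered z Hz) as T. rewrite <- (hat2_dist2 z). apply inS2_hat. apply H; auto.
    apply hat_inS2; [apply tempered2_pol; auto|]. rewrite hat2_pol, hat2_dist2 by auto. auto.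
  - intros u Hu Hs. apply hat_inS2; auto. apply H; [apply tmp2_hat2; auto|].
    rewrite <- hat2_pol by auto. apply inS2_hat. auto.
Qed.

(** The sign [(-1)^(j+k)] is absorbed by negating both forms. *)
Lemma twisted_pol al be ga de a u F :
  twisted 2 a al be ga de u F = pol a (opF (V4 be 0 0 (- al))) (opF (V4 0 (- ga) de 0)) u F.
Proof.
  unfold twisted, pol, csum, Csign. cbn [Nat.add Nat.leb Nat.iter nat_rect Nat.even].
  unfold L1, L2, opF, MMx, MMy, DDx, DDy. cbn [q1 p1 q2 p2]. change (RtoC 0) with C0.
  replace (RtoC (- al)) with (- RtoC al)%cx by cxring. replace (RtoC (- ga)) with (- RtoC ga)%cx by cxring. ring.
Qed.
Lemma glob_reg2_iff al be ga de a :
  glob_reg2 (twisted 2 a al be ga de) <-> GR2f a (V4 be 0 0 (- al)) (V4 0 (- ga) de 0).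
Proof.
  split; intros H u Hu Hs; apply H; auto; (eapply inS2_ext; [|exact Hs]); intros F _;
  [symmetry|]; rewrite <- twisted_pol; reflexivity.
Qed.

(** On Hermite coefficients, [diag (om ^ n)] with [om = c + i s] is the metaplectic operator of the rotation [om]. *)
Fixpoint cpow (z : Cx) (n : nat) : Cx := match n with O => C1 | S n' => (z * cpow z n')%cx end.
Definition rot (om : Cx) (w : nat -> Cx) (n : nat) : Cx := (cpow om n * w n)%cx.
Lemma Cmod_cpow om n : Cmod om = 1 -> Cmod (cpow om n) = 1.
Proof. intros H. induction n; cbn [cpow]; [apply Cmod_C1|]. rewrite Cmod_mul, H, IHn. ring. Qed.
Lemma cpow_inv c s n : c ^ 2 + s ^ 2 = 1 -> (cpow (mkC c (- s)) n * cpow (mkC c s) n)%cx = C1.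
Proof.
  intros H. induction n as [|n IH]; cbn [cpow]; [ring|].
  transitivity ((mkC c (- s) * mkC c s) * (cpow (mkC c (- s)) n * cpow (mkC c s) n))%cx; [ring|]. rewrite IH.
  apply Cx_ext; cxsimpl; lra.
Qed.
Lemma Cmod_unit c s : c ^ 2 + s ^ 2 = 1 -> Cmod (mkC c s) = 1.
Proof. intros H. unfold Cmod. cbn [re im]. rewrite H. apply sqrt_1. Qed.
Lemma rot_ladder c s w n : c ^ 2 + s ^ 2 = 1 ->
  sA (rot (mkC c s) w) n = (cpow (mkC c s) n * (mkC c (- s) * sA w n))%cx /\
  sB (rot (mkC c s) w) n = (cpow (mkC c s) n * (mkC c s * sB w n))%cx.
Proof.
  intros H. unfold sA, sB, rot. split.
  - destruct n as [|n]; cbn [pred].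
    + cbn [INR]. rewrite sqrt_0. change (RtoC 0) with C0. ring.
    + cbn [cpow]. set (z := cpow _ n). set (r := RtoC _). 
      transitivity ((mkC c s * mkC c (- s)) * (r * z * w n))%cx; [|ring].
      replace (mkC c s * mkC c (- s))%cx with C1; [ring|]. apply Cx_ext; cxsimpl; lra.
  - cbn [cpow]. ring.
Qed.
Lemma rot_sM c s w n : c ^ 2 + s ^ 2 = 1 ->
  sM (rot (mkC c s) w) n = (cpow (mkC c s) n * (RtoC c * sM w n - RtoC s * sD w n))%cx.
Proof.
  intros H. destruct (rot_ladder c s w n H) as [E1 E2]. unfold sM at 1. rewrite E1, E2. unfold sM, sD. cxring.
Qed.
Lemma rot_sD c s w n : c ^ 2 + s ^ 2 = 1 ->
  sD (rot (mkC c s) w) n = (cpow (mkC c s) n * (RtoC c * sD w n + RtoC s * sM w n))%cx.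
Proof.
  intros H. destruct (rot_ladder c s w n H) as [E1 E2]. unfold sD at 1. rewrite E1, E2. unfold sM, sD. cxring.
Qed.

(** Intertwining passes from the two generators to the polynomial. The right side keeps [U] on each
    term, since [U] is not assumed to be linear. *)
Lemma pol_conj {S T : Type} a (X Y : (T -> Cx) -> T -> Cx) (X' Y' : (S -> Cx) -> S -> Cx) (U : (S -> Cx) -> T -> Cx) w :
  (forall w, X (U w) = U (X' w)) -> (forall w, Y (U w) = U (Y' w)) ->
  pol a X Y (U w) = fun i => (a 0%nat 0%nat * U w i + a 0%nat 1%nat * U (X' w) i + a 0%nat 2%nat * U (X' (X' w)) i
   + a 1%nat 0%nat * U (Y' w) i + a 1%nat 1%nat * U (X' (Y' w)) i + a 2%nat 0%nat * U (Y' (Y' w)) i)%cx.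
Proof. intros HX HY. unfold pol. rewrite !HX, !HY, !HX. auto. Qed.

Definition rot2 (om : Cx) (w : nat * nat -> Cx) (p : nat * nat) : Cx := (cpow om (snd p) * w p)%cx.
Lemma opS_rot2 c s v w : c ^ 2 + s ^ 2 = 1 ->
  opS v (rot2 (mkC c s) w) = rot2 (mkC c s) (opS (V4 (q1 v) (p1 v) (c * q2 v + s * p2 v) (c * p2 v - s * q2 v)) w).
Proof.
  intros H. apply functional_extensionality. intros [n m]. unfold opS, rot2. cbn [q1 p1 q2 p2 snd].
  assert (E1 : on1 sM (fun p => cpow (mkC c s) (snd p) * w p)%cx (n, m) = (cpow (mkC c s) m * on1 sM w (n, m))%cx).
  { unfold on1, sM, sA, sB. cbn [fst snd]. ring. }
  assert (E2 : on1 sD (fun p => cpow (mkC c s) (snd p) * w p)%cx (n, m) = (cpow (mkC c s) m * on1 sD w (n, m))%cx).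
  { unfold on1, sD, sA, sB. cbn [fst snd]. ring. }
  rewrite E1, E2. unfold on2. cbn [fst snd].
  change (fun m => (cpow (mkC c s) m * w (n, m))%cx) with (rot (mkC c s) (fun m => w (n, m))).
  rewrite rot_sM, rot_sD by auto.
  replace (RtoC (c * q2 v + s * p2 v)) with (RtoC c * RtoC (q2 v) + RtoC s * RtoC (p2 v))%cx by cxring.
  replace (RtoC (c * p2 v - s * q2 v)) with (RtoC c * RtoC (p2 v) - RtoC s * RtoC (q2 v))%cx by cxring. ring.
Qed.
Lemma Cmod_rot2 om w p : Cmod om = 1 -> Cmod (rot2 om w p) = Cmod (w p).
Proof. intros H. unfold rot2. rewrite Cmod_mul, Cmod_cpow by auto. ring. Qed.
(** A diagonal operator with unimodular entries preserves all sequence seminorms, so conjugation by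
    it preserves regularity. *)
Lemma GR2s_rot a c s v w : c ^ 2 + s ^ 2 = 1 -> GR2s a v w ->
  GR2s a (V4 (q1 v) (p1 v) (c * q2 v + s * p2 v) (c * p2 v - s * q2 v)) (V4 (q1 w) (p1 w) (c * q2 w + s * p2 w) (c * p2 w - s * q2 w)).
Proof.
  intros H G z (K & B & HB) Hr. pose proof (Cmod_unit c s H) as U.
  assert (R1 : rap2 (rot2 (mkC c s) z)).
  { apply G.
    - exists K, B. intros n m. rewrite Cmod_rot2 by auto. auto.
    - intros L. destruct (Hr L) as [M HM]. exists M. intros n m. specialize (HM n m).
      rewrite (pol_conj a _ _ _ _ (rot2 (mkC c s)) z (fun w => opS_rot2 c s v w H) (fun z => opS_rot2 c s w z H)).
      rewrite <- (Cmod_rot2 (mkC c s)) in HM by auto.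
      set (X := opS (V4 (q1 v) _ _ _)) in *. set (Y := opS (V4 (q1 w) _ _ _)) in *.
      replace (_ + _)%cx with (rot2 (mkC c s) (pol a X Y z) (n, m)); [exact HM|]. unfold rot2, pol. ring. }
  intros L. destruct (R1 L) as [M HM]. exists M. intros n m. specialize (HM n m). rewrite Cmod_rot2 in HM by auto. auto.
Qed.
Definition swap2 (w : nat * nat -> Cx) (p : nat * nat) : Cx := w (snd p, fst p).
Lemma opS_swap v w : opS v (swap2 w) = swap2 (opS (V4 (q2 v) (p2 v) (q1 v) (p1 v)) w).
Proof.
  apply functional_extensionality. intros [n m]. unfold opS, swap2, on1, on2. cbn [fst snd q1 p1 q2 p2]. ring.
Qed.
Lemma GR2s_swap a v w : GR2s a v w -> GR2s a (V4 (q2 v) (p2 v) (q1 v) (p1 v)) (V4 (q2 w) (p2 w) (q1 w) (p1 w)).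
Proof.
  intros G z (K & B & HB) Hr.
  assert (R1 : rap2 (swap2 z)).
  { apply G.
    - exists K, B. intros n m. unfold swap2; cbn [fst snd]. specialize (HB m n). lra.
    - intros L. destruct (Hr L) as [M HM]. exists M. intros n m. specialize (HM m n).
      rewrite (pol_conj a _ _ _ _ swap2 z (opS_swap v) (opS_swap w)).
      eapply Rle_trans; [|exact HM]. right. unfold swap2, pol; cbn [fst snd]. ring. }
  intros L. destruct (R1 L) as [M HM]. exists M. intros n m. specialize (HM m n). unfold swap2 in HM; cbn [fst snd] in HM. lra.
Qed.

(** * Shears of the plane *)

Definition dsh (c : R) (F : fam2) : fam2 := fun a b x y => (RtoC c * F (S a) b x y + F a (S b) x y)%cx.
(** The derivative family of [(x, y) |-> F (x + c y, y)]. *)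
Definition sh (c : R) (F : fam2) : fam2 := fun a b x y => Nat.iter b (dsh c) F a 0%nat (x + c * y)%R y.
Lemma schwartz2_dsh c F : schwartz2 F -> schwartz2 (dsh c F).
Proof.
  intros H. apply (schwartz2_add (fam2_scal (RtoC c) (fun a b x y => F (S a) b x y)) (fun a b x y => F a (S b) x y)).
  - apply schwartz2_scal. destruct H as [A B]. easy.
  - destruct H as [A B]. easy.
Qed.
Lemma schwartz2_iter_dsh c F b : schwartz2 F -> schwartz2 (Nat.iter b (dsh c) F).
Proof. intros. induction b; cbn [Nat.iter nat_rect]; auto. apply schwartz2_dsh; auto. Qed.
Lemma bd2_dsh c N F B : bd2 (S N) F B -> bd2 N (dsh c F) ((Rabs c + 1) * B).
Proof.
  intros H j1 j2 a b x y h1 h2 ha hb. unfold dsh.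
  pose proof (Cmod_tri (RtoC c * F (S a) b x y) (F a (S b) x y)) as T. rewrite Cmod_mul, Cmod_RtoC in T.
  pose proof (H j1 j2 (S a) b x y ltac:(lia) ltac:(lia) ltac:(lia) ltac:(lia)).
  pose proof (H j1 j2 a (S b) x y ltac:(lia) ltac:(lia) ltac:(lia) ltac:(lia)).
  pose proof (pow2_nonneg x y j1 j2). pose proof (Rabs_pos c). nra.
Qed.
Lemma bd2_iter_dsh c b : forall N F B, bd2 (b + N) F B -> bd2 N (Nat.iter b (dsh c) F) ((Rabs c + 1) ^ b * B).
Proof.
  induction b as [|b IH]; intros N F B H; cbn [Nat.iter nat_rect pow].
  - rewrite Rmult_1_l. auto.
  - rewrite Rmult_assoc. apply bd2_dsh. apply (IH (S N)). replace (b + S N)%nat with (S b + N)%nat by lia. auto.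
Qed.
Lemma pow_add_le u v j : 0 <= u -> 0 <= v -> (u + v) ^ j <= 2 ^ j * (u ^ j + v ^ j).
Proof.
  intros hu hv. assert (0 <= u ^ j) by nn. assert (0 <= v ^ j) by nn. assert (0 < 2 ^ j) by nn.
  destruct (Rle_or_lt u v).
  - apply Rle_trans with ((2 * v) ^ j); [apply pow_incr; lra|]. rewrite Rpow_mult_distr. nra.
  - apply Rle_trans with ((2 * u) ^ j); [apply pow_incr; lra|]. rewrite Rpow_mult_distr. nra.
Qed.
Lemma bd2_sh c N : exists N' A, forall F B, bd2 N' F B -> bd2 N (sh c F) (A * B).
Proof.
  set (k := Rabs c + 1). assert (k1 : 1 <= k) by (unfold k; pose proof (Rabs_pos c); lra).
  (* Bounding [x] by [x + c y] and [y] costs up to [N] extra powers of [y], and iterating [dsh]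
     costs up to [N] further derivatives. *)
  exists (N + (N + N))%nat, (2 ^ N * (1 + k ^ N) * k ^ N). intros F B H j1 j2 a b x y h1 h2 ha hb.
  set (G := Nat.iter b (dsh c) F).
  assert (HG : bd2 (N + N) G (k ^ N * B)).
  { assert (X : bd2 (b + (N + N)) F B) by (intros ? ? ? ? ? ? ? ? ? ?; apply H; lia).
    pose proof (bd2_iter_dsh c b _ _ _ X) as Y. pose proof (bd2_nonneg _ _ _ H).
    intros i1 i2 a' b' x' y' g1 g2 g3 g4. eapply Rle_trans; [apply (Y i1 i2 a' b'); auto|].
    apply Rmult_le_compat_r; auto. apply Rle_pow; auto. }
  pose proof (HG j1 j2 a 0%nat (x + c * y) y ltac:(lia) ltac:(lia) ltac:(lia) ltac:(lia)) as A1.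
  pose proof (HG 0%nat (j1 + j2)%nat a 0%nat (x + c * y) y ltac:(lia) ltac:(lia) ltac:(lia) ltac:(lia)) as A2.
  rewrite pow_O, Rmult_1_l, pow_add in A2. set (M := k ^ N * B) in *. set (z := Cmod _) in *. assert (z0 : 0 <= z) by apply Cmod_ge0.
  set (X := Rabs (x + c * y)) in *. assert (X0 : 0 <= X) by apply Rabs_pos.
  assert (T : Rabs x <= X + Rabs c * Rabs y).
  { unfold X. rewrite <- Rabs_mult. replace x with ((x + c * y) + - (c * y)) at 1 by ring. eapply Rle_trans; [apply Rabs_triang|]. rewrite Rabs_Ropp. lra. }
  assert (T2 : Rabs x ^ j1 <= 2 ^ j1 * (X ^ j1 + Rabs c ^ j1 * Rabs y ^ j1)).
  { rewrite <- Rpow_mult_distr. eapply Rle_trans; [apply pow_incr; split; [apply Rabs_pos|exact T]|]. apply pow_add_le; auto.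
    nn. }
  assert (Yj : 0 <= Rabs y ^ j2) by nn.
  assert (c1 : Rabs c ^ j1 <= k ^ N).
  { apply Rle_trans with (k ^ j1); [apply pow_incr; unfold k; pose proof (Rabs_pos c); lra|apply Rle_pow; auto]. }
  assert (t1 : 2 ^ j1 <= 2 ^ N) by (apply Rle_pow; [lra|auto]).
  apply Rle_trans with (2 ^ j1 * (X ^ j1 * Rabs y ^ j2 * z + Rabs c ^ j1 * (Rabs y ^ j1 * Rabs y ^ j2 * z))).
  - apply Rle_trans with (2 ^ j1 * (X ^ j1 + Rabs c ^ j1 * Rabs y ^ j1) * (Rabs y ^ j2 * z)); [|right; ring].
    rewrite Rmult_assoc. apply Rmult_le_compat_r; auto. nra.
  - replace (2 ^ N * (1 + k ^ N) * k ^ N * B) with (2 ^ N * (M + k ^ N * M)) by (unfold M; ring).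
    assert (0 <= Rabs c ^ j1) by nn.
    assert (0 <= Rabs y ^ j1 * Rabs y ^ j2 * z) by nn.
    assert (Rabs c ^ j1 * (Rabs y ^ j1 * Rabs y ^ j2 * z) <= k ^ N * M) by nra.
    assert (0 <= X ^ j1 * Rabs y ^ j2 * z) by nn.
    apply Rmult_le_compat; [apply pow_le; lra| |auto|lra]. nra.
Qed.
(** The chain rule along the direction [(c, 1)], from three second order expansions: in x at height
    [y + h], in y at the base point, and in y for the x-derivative. *)
Lemma diag_cder G a b c x y : schwartz2 G ->
  cder (fun t => G a b (x + c * t)%R t) y (RtoC c * G (S a) b (x + c * y)%R y + G a (S b) (x + c * y)%R y)%cx.
Proof.
  intros HG. destruct (schwartz2_bd G HG (S (S a) + S (S b))) as [M HM].
  assert (BM : forall a' b' x y, (a' <= S (S a))%nat -> (b' <= S (S b))%nat -> Cmod (G a' b' x y) <= M).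
  { intros a' b' x' y' h1 h2. pose proof (HM 0%nat 0%nat a' b' x' y' ltac:(lia) ltac:(lia) ltac:(lia) ltac:(lia)) as K. lra. }
  assert (M0 : 0 <= M) by (eapply bd2_nonneg; eauto).
  apply cder_of_quadratic with (2 * M * c ^ 2 + 2 * M + Rabs c * (3 * M)). intros h hh1.
  set (x0 := x + c * y). replace (x + c * (y + h)) with (x0 + c * h) by (unfold x0; ring).
  pose proof (ctaylor2 (fun t => G a b t (y + h)%R) (fun t => G (S a) b t (y + h)%R) (fun t => G (S (S a)) b t (y + h)%R) M
    (fun t => schwartz2_cderx G HG _ _ _ _) (fun t => schwartz2_cderx G HG _ _ _ _) (fun t => BM (S (S a)) b t (y + h)%R (le_n _) ltac:(lia)) x0 (c * h)) as T1.
  pose proof (ctaylor2 (fun t => G a b x0 t) (fun t => G a (S b) x0 t) (fun t => G a (S (S b)) x0 t) M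
    (fun t => schwartz2_cdery G HG _ _ _ _) (fun t => schwartz2_cdery G HG _ _ _ _) (fun t => BM a (S (S b)) x0 t ltac:(lia) (le_n _)) y h) as T2.
  pose proof (ctaylor2 (fun t => G (S a) b x0 t) (fun t => G (S a) (S b) x0 t) (fun t => G (S a) (S (S b)) x0 t) M
    (fun t => schwartz2_cdery G HG _ _ _ _) (fun t => schwartz2_cdery G HG _ _ _ _) (fun t => BM (S a) (S (S b)) x0 t ltac:(lia) (le_n _)) y h) as T3.
  set (A1 := (G a b (x0 + c * h)%R (y + h)%R - G a b x0 (y + h)%R - RtoC (c * h) * G (S a) b x0 (y + h)%R)%cx) in *.
  set (A2 := (G a b x0 (y + h)%R - G a b x0 y - RtoC h * G a (S b) x0 y)%cx) in *.
  set (A3 := (G (S a) b x0 (y + h)%R - G (S a) b x0 y - RtoC h * G (S a) (S b) x0 y)%cx) in *.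
  replace (G a b (x0 + c * h)%R (y + h)%R - G a b x0 y - RtoC h * (RtoC c * G (S a) b x0 y + G a (S b) x0 y))%cx
    with (A1 + A2 + RtoC (c * h) * (A3 + RtoC h * G (S a) (S b) x0 y))%cx by (unfold A1, A2, A3; rewrite RtoC_mul; ring).
  eapply Rle_trans; [apply Cmod_tri|]. pose proof (Cmod_tri A1 A2) as S1.
  rewrite Cmod_mul, Cmod_RtoC, Rabs_mult. pose proof (Cmod_tri A3 (RtoC h * G (S a) (S b) x0 y)) as S2. rewrite Cmod_mul, Cmod_RtoC in S2.
  pose proof (BM (S a) (S b) x0 y ltac:(lia) ltac:(lia)) as S3. pose proof (Rabs_pos h). pose proof (Rabs_pos c).
  assert (h ^ 2 <= Rabs h) by (rewrite <- pow2_abs; nra).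
  set (z := Cmod (A3 + _)) in *. assert (z <= 3 * M * Rabs h).
  { nra. }
  assert (Rabs c * Rabs h * z <= Rabs c * (3 * M) * h ^ 2).
  { rewrite <- (pow2_abs h). replace (Rabs c * (3 * M) * Rabs h ^ 2) with (Rabs c * Rabs h * (3 * M * Rabs h)) by ring.
    apply Rmult_le_compat_l; auto. nra. }
  lra.
Qed.
Lemma schwartz2_sh c F : schwartz2 F -> schwartz2 (sh c F).
Proof.
  intros HF. apply schwartz2_mk.
  - intros a b x y. unfold sh. eapply cder_eq.
    + apply (cder_comp (fun t => Nat.iter b (dsh c) F a 0%nat t y) (fun t => t + c * y)).
      * apply (schwartz2_cderx _ (schwartz2_iter_dsh c F b HF)).
      * instantiate (1 := 1). auto_derive; [trivial|ring].
    + change (RtoC 1) with C1. ring.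
  - intros a b x y. apply (diag_cder (Nat.iter b (dsh c) F)). apply schwartz2_iter_dsh; auto.
  - intros. apply bd2_ex. destruct (bd2_sh c (j1 + j2 + a + b)) as (N' & A & H). destruct (schwartz2_bd F HF N') as [B HB].
    eexists. apply H; eauto.
Qed.
Lemma sh00 c F x y : sh c F 0%nat 0%nat x y = F 0%nat 0%nat (x + c * y)%R y.
Proof. auto. Qed.
Lemma sh_inv c F : schwartz2 F -> sh (- c) (sh c F) = F.
Proof.
  intros. apply schwartz2_unique; auto using schwartz2_sh. intros x y. rewrite !sh00. f_equal. ring.
Qed.
Lemma sh_add c F G : schwartz2 F -> schwartz2 G -> sh c (fam2_add F G) = fam2_add (sh c F) (sh c G).
Proof. intros. apply schwartz2_unique; auto using schwartz2_sh, schwartz2_add. Qed.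
Lemma sh_scal c k F : schwartz2 F -> sh c (fam2_scal k F) = fam2_scal k (sh c F).
Proof. intros. apply schwartz2_unique; auto using schwartz2_sh, schwartz2_scal. Qed.
Lemma sh_tMx c F : schwartz2 F -> sh c (tMx F) = fam2_add (tMx (sh c F)) (fam2_scal (RtoC c) (tMy (sh c F))).
Proof.
  intros. apply schwartz2_unique; auto using schwartz2_sh, schwartz2_add, schwartz2_scal, schwartz2_tMx, schwartz2_tMy.
  intros x y. unfold fam2_add, fam2_scal, tMx, tMy. rewrite !sh00. cbn [INR pred]. change (RtoC 0) with C0.
  rewrite RtoC_add, RtoC_mul. ring.
Qed.
Lemma sh_tMy c F : schwartz2 F -> sh c (tMy F) = tMy (sh c F).
Proof.
  intros. apply schwartz2_unique; auto using schwartz2_sh, schwartz2_tMy.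
Qed.
Lemma sh_tDx c F : schwartz2 F -> sh c (tDx F) = tDx (sh c F).
Proof. intros. apply schwartz2_unique; auto using schwartz2_sh, schwartz2_tDx. Qed.
Lemma sh_tDy c F : schwartz2 F -> sh c (tDy F) = fam2_add (tDy (sh c F)) (fam2_scal (- RtoC c)%cx (tDx (sh c F))).
Proof.
  intros. apply schwartz2_unique; auto using schwartz2_sh, schwartz2_add, schwartz2_scal, schwartz2_tDx, schwartz2_tDy.
  intros x y. unfold fam2_add, fam2_scal, tDx, tDy. unfold sh. cbn [Nat.iter nat_rect]. unfold dsh. ring.
Qed.
(** The dual action on forms: x becomes x + c y and D_y becomes D_y - c D_x. *)
Definition shv (c : R) (v : vec4) : vec4 := V4 (q1 v) (p1 v - c * p2 v) (q2 v + c * q1 v) (p2 v).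
Lemma opF_sh c v (y z : distR2) : tempered2 z -> (forall F, schwartz2 F -> y F = z (sh c F)) ->
  forall F, schwartz2 F -> opF v y F = opF (shv c v) z (sh c F).
Proof.
  intros (A & B & _) E F HF. unfold opF, MMx, MMy, DDx, DDy, shv. cbn [q1 p1 q2 p2].
  rewrite !E by sch2. rewrite sh_tMx, sh_tMy, sh_tDx, sh_tDy by auto.
  assert (HS : schwartz2 (sh c F)) by (apply schwartz2_sh; auto).
  rewrite !A, !B by sch2.
  replace (RtoC (p1 v - c * p2 v)) with (RtoC (p1 v) - RtoC c * RtoC (p2 v))%cx by cxring.
  replace (RtoC (q2 v + c * q1 v)) with (RtoC (q2 v) + RtoC c * RtoC (q1 v))%cx by cxring. ring.
Qed.
Lemma pol_sh a c v w u F : tempered2 u -> schwartz2 F ->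
  pol a (opF v) (opF w) (fun F => u (sh c F)) F = pol a (opF (shv c v)) (opF (shv c w)) u (sh c F).
Proof.
  intros Hu HF. unfold pol.
  assert (E0 : forall F, schwartz2 F -> (fun F => u (sh c F)) F = u (sh c F)) by reflexivity.
  pose proof (opF_sh c v _ u Hu E0) as Ev. pose proof (opF_sh c w _ u Hu E0) as Ew.
  rewrite (opF_sh c v _ _ (tempered2_opF _ _ Hu) Ev F HF), (opF_sh c v _ _ (tempered2_opF _ _ Hu) Ew F HF),
    (opF_sh c w _ _ (tempered2_opF _ _ Hu) Ew F HF), Ev, Ew by auto. auto.
Qed.
Lemma inS2_sh c u : inS2 u -> inS2 (fun F => u (sh c F)).
Proof.
  intros (G & HG & H). exists (sh (- c) G). split; [apply schwartz2_sh; auto|]. intros F HF.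
  destruct (H _ (schwartz2_sh c F HF)) as (g & H1 & H2). exists g. split; [|exact H2]. intros y.
  specialize (H1 y).
  assert (N : cnice (fun x => G 0%nat 0%nat x y * sh c F 0%nat 0%nat x y)%cx).
  { apply (schwartz1_mul2_nice (slice (sh c F) 0 y) (slice G 0 y) 0 0); apply schwartz1_slice; auto using schwartz2_sh. }
  assert (N' : cnice (fun x => sh (- c) G 0%nat 0%nat x y * F 0%nat 0%nat x y)%cx).
  { apply (schwartz1_mul2_nice (slice F 0 y) (slice (sh (- c) G) 0 y) 0 0); apply schwartz1_slice; auto using schwartz2_sh. }
  rewrite <- (CI_eq _ _ H1). rewrite <- (CI_shift _ (- c * y) N).
  rewrite (CI_ext _ (fun x => sh (- c) G 0%nat 0%nat x y * F 0%nat 0%nat x y)%cx); [apply CI_cint1; auto|].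
  intros x. rewrite !sh00. do 2 f_equal. ring.
Qed.
Lemma tempered2_sh c u : tempered2 u -> tempered2 (fun F => u (sh c F)).
Proof.
  apply (tempered2_op (sh c)); auto using schwartz2_sh, sh_add, sh_scal. apply bd2_sh.
Qed.
Lemma GR2f_sh a c v w : GR2f a v w -> GR2f a (shv c v) (shv c w).
Proof.
  intros G u Hu Hs.
  assert (R1 : inS2 (fun F => u (sh c F))).
  { apply G; [apply tempered2_sh; auto|]. apply (inS2_sh c) in Hs. revert Hs. apply inS2_ext.
    intros F HF. rewrite pol_sh by auto. auto. }
  apply (inS2_sh (- c)) in R1. revert R1. apply inS2_ext. intros F HF.
  replace (sh c (sh (- c) F)) with F; [reflexivity|]. rewrite <- (sh_inv (- c) F HF) at 1. rewrite Ropp_involutive. auto.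
Qed.

Lemma GR2s_sh a c v w : GR2s a v w -> GR2s a (shv c v) (shv c w).
Proof. intros H. apply GR2_iff. apply GR2f_sh. apply GR2_iff. auto. Qed.

(** Chains of elementary symplectic moves, each reversible for regularity. The relation lets a
    reduction be given by naming its moves and parameters. *)
Inductive canon : vec4 -> vec4 -> vec4 -> vec4 -> Prop :=
| canon_refl v w : canon v w v w
| canon_rot c s v w v' w' : c ^ 2 + s ^ 2 = 1 ->
    canon (V4 (q1 v) (p1 v) (c * q2 v + s * p2 v) (c * p2 v - s * q2 v)) (V4 (q1 w) (p1 w) (c * q2 w + s * p2 w) (c * p2 w - s * q2 w)) v' w' ->
    canon v w v' w'
| canon_swap v w v' w' : canon (V4 (q2 v) (p2 v) (q1 v) (p1 v)) (V4 (q2 w) (p2 w) (q1 w) (p1 w)) v' w' -> canon v w v' w'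
| canon_sh c v w v' w' : canon (shv c v) (shv c w) v' w' -> canon v w v' w'.
Lemma canon_GR a v w v' w' : canon v w v' w' -> (GR2s a v w <-> GR2s a v' w').
Proof.
  induction 1 as [v w|c s v w v' w' E H IH|v w v' w' H IH|c v w v' w' H IH].
  - tauto.
  - rewrite <- IH. split; [apply GR2s_rot; auto|]. intros G.
    apply (GR2s_rot a c (- s)) in G; [|lra].
    destruct v as [v1 v2 v3 v4], w as [w1 w2 w3 w4]. cbn [q1 p1 q2 p2] in *.
    replace (c * (c * v3 + s * v4) + - s * (c * v4 - s * v3)) with v3 in G by (transitivity ((c ^ 2 + s ^ 2) * v3); [rewrite E|]; ring).
    replace (c * (c * v4 - s * v3) - - s * (c * v3 + s * v4)) with v4 in G by (transitivity ((c ^ 2 + s ^ 2) * v4); [rewrite E|]; ring).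
    replace (c * (c * w3 + s * w4) + - s * (c * w4 - s * w3)) with w3 in G by (transitivity ((c ^ 2 + s ^ 2) * w3); [rewrite E|]; ring).
    replace (c * (c * w4 - s * w3) - - s * (c * w3 + s * w4)) with w4 in G by (transitivity ((c ^ 2 + s ^ 2) * w4); [rewrite E|]; ring).
    auto.
  - rewrite <- IH. split; [apply GR2s_swap|]. intros G. apply GR2s_swap in G. auto.
  - rewrite <- IH. split; [apply GR2s_sh|]. intros G. apply (GR2s_sh a (- c)) in G.
    destruct v as [v1 v2 v3 v4], w as [w1 w2 w3 w4]. unfold shv in *. cbn [q1 p1 q2 p2] in *.
    replace (v2 - c * v4 - - c * v4) with v2 in G by ring. replace (v3 + c * v1 + - c * v1) with v3 in G by ring.
    replace (w2 - c * w4 - - c * w4) with w2 in G by ring. replace (w3 + c * w1 + - c * w1) with w3 in G by ring. auto.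
Qed.
(* A partial Fourier transform in y followed by four shears. *)
Lemma canon_twisted al be ga de : al * de - be * ga = 1 -> be <> 0 ->
  canon (V4 be 0 0 (- al)) (V4 0 (- ga) de 0) (V4 1 0 0 0) (V4 0 1 0 0).
Proof.
  intros Hdet Hb.
  assert (E0 : ga = (al * de - 1) / be) by (apply Rmult_eq_reg_r with be; [field_simplify; [lra|auto]|auto]).
  subst ga.
  (* After a quarter turn in the second variable one form involves positions only and the other
     momenta only, as in a linear change of variables. *)
  apply (canon_rot 0 1); [ring|].
  (* Three shears bring the position form to x, its coefficients going from [(be, - al)] through
     [(be, 1)] and, up to exchange, [(1, 1)] to [(1, 0)]; the fourth removes D_y from the momentum
     form. *)
  apply (canon_sh ((1 + al) / be)). unfold shv; cbn [q1 p1 q2 p2].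
  apply canon_swap. apply (canon_sh (1 - be)).
  apply canon_swap. apply (canon_sh (-1)).
  set (g := (1 + de) / be).
  apply canon_swap. apply (canon_sh (- (de + (1 - be) * g))). unfold shv; cbn [q1 p1 q2 p2].
  apply canon_swap. cbn [q1 p1 q2 p2].
  match goal with |- canon ?v ?w _ _ => replace v with (V4 1 0 0 0); [replace w with (V4 0 1 0 0); [apply canon_refl|]|] end.
  - unfold g. f_equal; field; auto.
  - f_equal; field; auto.
Qed.

(** * Gliding hump *)

Lemma column_pol a z n m :
  pol a (opS (V4 1 0 0 0)) (opS (V4 0 1 0 0)) z (n, m) = P1 a (fun k => z (k, m)) n.
Proof.
  assert (EM : forall z, opS (V4 1 0 0 0) z = on1 sM z).
  { intros y. apply functional_extensionality. intros p. unfold opS. cbn [q1 p1 q2 p2].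
    change (RtoC 0) with C0. change (RtoC 1) with C1. ring. }
  assert (ED : forall z, opS (V4 0 1 0 0) z = on1 sD z).
  { intros y. apply functional_extensionality. intros p. unfold opS. cbn [q1 p1 q2 p2].
    change (RtoC 0) with C0. change (RtoC 1) with C1. ring. }
  unfold pol. rewrite !EM, !ED. auto.
Qed.
(** A kernel element repeated in every column is tempered with zero image, so it must decrease in
    the column index, on which it does not depend. *)
Lemma GR2s_ker a : GR2s a (V4 1 0 0 0) (V4 0 1 0 0) -> K0s a.
Proof.
  intros G w (K & B & HB) Hk n.
  assert (R : rap2 (fun p => w (fst p))).
  { apply G.
    - exists K, B. intros i m. cbn [fst]. pose proof (wt_pow_ge1 m K). specialize (HB i). pose proof (Cmod_ge0 (w i)).
      nra.
    - intros L. exists 0. intros i m. rewrite column_pol. rewrite Hk, Cmod_C0. lra. }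
  destruct (R 1%nat) as [M HM]. apply small_eq0 with M. intros m. specialize (HM n m). cbn [fst pow] in HM.
  pose proof (wt_ge1 n). pose proof (wt_ge1 m). pose proof (Cmod_ge0 (w n)).
  apply Rmult_le_reg_r with (wt m); [lra|]. rewrite Rmult_assoc, Rinv_l by lra.
  assert (0 <= wt m * Cmod (w n)) by nra. nra.
Qed.
(** A one-variable sequence is placed in the column 0, the other columns being zero. *)
Lemma GR2s_GRs a : GR2s a (V4 1 0 0 0) (V4 0 1 0 0) -> GRs a.
Proof.
  intros G w (K & B & HB) Hr. set (z := fun p : nat * nat => if Nat.eqb (snd p) 0 then w (fst p) else C0).
  assert (B0 : 0 <= B). { specialize (HB 0%nat). pose proof (Cmod_ge0 (w 0%nat)). pose proof (wt_pow_ge1 0 K). nra. }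
  assert (R : rap2 z).
  { apply G.
    - exists K, B. intros n m. unfold z. cbn [fst snd]. pose proof (wt_pow_ge1 m K). pose proof (wt_pow_ge1 n K). destruct (Nat.eqb m 0).
      + specialize (HB n). assert (0 <= B * wt n ^ K) by nra. nra.
      + rewrite Cmod_C0. nn.
    - intros L. destruct (Hr L) as [M HM]. pose proof (sb_nonneg _ _ _ HM). exists M. intros n m. rewrite column_pol. unfold z. cbn [fst snd].
      destruct (Nat.eqb_spec m 0) as [->|h].
      + rewrite pow1, Rmult_1_r. auto.
      + replace (P1 a (fun _ => C0) n) with C0. { rewrite Cmod_C0. lra. }
        unfold P1, pol, sM, sD, sA, sB. ring. }
  intros L. destruct (R L) as [M HM]. exists M. intros n. specialize (HM n 0%nat). rewrite pow1, Rmult_1_r in HM. auto.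
Qed.

Lemma P1_lin a c d v w n : P1 a (fun n => c * v n + d * w n)%cx n = (c * P1 a v n + d * P1 a w n)%cx.
Proof.
  unfold P1, pol.
  assert (EM : forall v w, sM (fun n => c * v n + d * w n)%cx = (fun n => c * sM v n + d * sM w n)%cx).
  { intros. apply functional_extensionality. intros; apply sM_lin. }
  assert (ED : forall v w, sD (fun n => c * v n + d * w n)%cx = (fun n => c * sD v n + d * sD w n)%cx).
  { intros. apply functional_extensionality. intros; apply sD_lin. }
  rewrite !EM, !ED, !EM. ring.
Qed.
Lemma P1_scal a c w n : P1 a (fun n => c * w n)%cx n = (c * P1 a w n)%cx.
Proof.
  rewrite (P1_ext a _ (fun n => c * w n + C0 * w n)%cx) by (intros; ring). rewrite P1_lin. ring.
Qed.
Lemma csum_delta (w : nat -> Cx) N n : (n < N)%nat -> csum N (fun k => w k * if Nat.eqb k n then C1 else C0)%cx = w n.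
Proof.
  assert (Z : forall N, (N <= n)%nat -> csum N (fun k => w k * if Nat.eqb k n then C1 else C0)%cx = C0).
  { induction N0 as [|M IH]; intros h; [reflexivity|]. cbn [csum]. rewrite IH by lia. destruct (Nat.eqb_spec M n); [lia|ring]. }
  induction N as [|N IH]; intros h; [lia|]. cbn [csum].
  destruct (Nat.eqb_spec N n) as [->|]; [rewrite Z by lia|rewrite IH by lia]; ring.
Qed.
(** The operator is banded of width two, so row [n] is a finite sum over the indices below [n + 3].
    This makes it commute with pointwise limits and series. *)
Lemma P1_finite a n : exists e : nat -> Cx, forall w, P1 a w n = csum (n + 3) (fun k => w k * e k)%cx.
Proof.
  set (d := fun k i => if Nat.eqb k i then C1 else C0). exists (fun k => P1 a (d k) n). intros w.
  transitivity (P1 a (fun i => csum (n + 3) (fun k => w k * d k i))%cx n).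
  - assert (H : forall i, (i < n + 3)%nat -> w i = csum (n + 3) (fun k => w k * d k i)%cx) by (intros; symmetry; apply csum_delta; auto).
    unfold P1, pol, sM, sD, sA, sB. rewrite !H by lia. auto.
  - generalize (n + 3)%nat. intros N. induction N as [|N IH]; cbn [csum].
    + unfold P1, pol, sM, sD, sA, sB. ring.
    + rewrite <- IH. rewrite (P1_ext a _ (fun i => C1 * csum N (fun k => w k * d k i) + w N * d N i)%cx) by (intros; ring).
      rewrite P1_lin. ring.
Qed.
Lemma P1_CSeries a (V : nat -> nat -> Cx) : (forall n, sm (fun l => V l n)) ->
  forall n, P1 a (fun n => CSeries (fun l => V l n)) n = CSeries (fun l => P1 a (V l) n).
Proof.
  intros H n. destruct (P1_finite a n) as (e & E). rewrite E, (CSeries_ext _ _ (fun l => E (V l))).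
  enough (X : forall N, sm (fun l => csum N (fun k => V l k * e k)%cx) /\
    csum N (fun k => CSeries (fun l => V l k) * e k)%cx = CSeries (fun l => csum N (fun k => V l k * e k)%cx)) by apply X.
  induction N as [|N [A B]]; cbn [csum].
  - split; [exists 0; intros; rewrite Cmod_C0; lra|symmetry; apply CSeries_zero; auto].
  - assert (S : sm (fun l => V l N * e N)%cx) by (apply sm_ext with (fun l => e N * V l N)%cx; [intros; ring|apply sm_scal; auto]).
    split; [apply sm_add; auto|]. rewrite CSeries_add, B by auto.
    rewrite (CSeries_ext (fun l => V l N * e N)%cx (fun l => e N * V l N)%cx), CSeries_scal by (auto; intros; ring). ring.
Qed.
Lemma P1_local a n : exists B, forall w d, (forall k, (k < n + 3)%nat -> Cmod (w k) <= d) -> Cmod (P1 a w n) <= B * d.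
Proof.
  destruct (P1_finite a n) as (e & E).
  enough (X : forall N, exists B, forall w d, (forall k, (k < N)%nat -> Cmod (w k) <= d) -> Cmod (csum N (fun k => w k * e k)%cx) <= B * d).
  { destruct (X (n + 3)%nat) as (B & HB). exists B. intros w. rewrite E. auto. }
  induction N as [|N (B & IH)]; cbn [csum].
  - exists 0. intros. rewrite Cmod_C0. lra.
  - exists (B + Cmod (e N)). intros w d H. eapply Rle_trans; [apply Cmod_tri|]. rewrite Cmod_mul, Rmult_plus_distr_r.
    apply Rplus_le_compat; [apply IH; auto|]. rewrite Rmult_comm. apply Rmult_le_compat_l; [apply Cmod_ge0|auto].
Qed.

(** * Cluster points of bounded sequences *)

Lemma real_cluster (u : nat -> R) M : (forall n, Rabs (u n) <= M) ->
  exists l, forall eps N, 0 < eps -> exists p, (N <= p)%nat /\ Rabs (u p - l) < eps.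
Proof.
  intros H. destruct (Bolzano_Weierstrass u (fun x => - M <= x <= M) (compact_P3 (- M) M)) as (l & Hl).
  - intros n. specialize (H n). apply Rabs_le_between in H. auto.
  - exists l. intros eps N he. destruct (Hl (disc l (mkposreal eps he)) N) as (p & hp & Hp).
    + exists (mkposreal eps he). easy.
    + exists p. auto.
Qed.
Lemma complex_cluster (u : nat -> Cx) M : (forall n, Cmod (u n) <= M) ->
  exists l, forall eps N, 0 < eps -> exists p, (N <= p)%nat /\ Cmod (u p - l) < eps.
Proof.
  intros H. destruct (real_cluster (fun n => re (u n)) M) as (l1 & H1).
  { intros n. eapply Rle_trans; [apply re_le_Cmod|auto]. }
  assert (CH : forall i, exists p, (i <= p)%nat /\ Rabs (re (u p) - l1) < / wt i).
  { intros i. apply H1. apply wt_inv. }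
  destruct (choice (fun i p => (i <= p)%nat /\ Rabs (re (u p) - l1) < / wt i) CH) as (phi & Hphi).
  destruct (real_cluster (fun i => im (u (phi i))) M) as (l2 & H2).
  { intros n. eapply Rle_trans; [apply im_le_Cmod|auto]. }
  exists (mkC l1 l2). intros eps N he.
  destruct (INR_unbounded (2 / eps)) as (n0 & Hn0).
  destruct (H2 (eps / 2) (N + n0)%nat) as (i & hi & Hi); [lra|].
  exists (phi i). destruct (Hphi i) as [g1 g2]. split; [lia|].
  eapply Rle_lt_trans; [apply Cmod_le_re_im|]. cxsimpl.
  assert (/ wt i < eps / 2).
  { pose proof (wt_ge1 i). assert (INR n0 <= INR i) by (apply le_INR; lia).
    apply Rmult_lt_reg_r with (wt i); [lra|]. rewrite Rinv_l by lra.
    assert (2 < eps * wt i). { unfold wt. rewrite S_INR. apply Rmult_lt_reg_r with (/ eps); [apply Rinv_0_lt_compat; auto|].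
      replace (eps * (INR i + 1) * / eps) with (INR i + 1) by (field; lra). lra. }
    lra. }
  unfold Rminus in *. lra.
Qed.

(** Extraction one coordinate at a time. Closeness on finite windows is asserted instead of naming a
    subsequence, and [Q] keeps the selected indices inside a prescribed infinite set. *)
Lemma pointwise_cluster (W : nat -> nat -> Cx) (Q : nat -> Prop) :
  (forall j n, Cmod (W j n) <= 1) -> (forall J, exists j, (J <= j)%nat /\ Q j) ->
  exists w : nat -> Cx, forall k eps J, 0 < eps -> exists j, (J <= j)%nat /\ Q j /\ forall i, (i < k)%nat -> Cmod (W j i - w i) < eps.
Proof.
  intros Hb HQ.
  set (cl := fun k (w : nat -> Cx) => forall eps J, 0 < eps -> exists j, (J <= j)%nat /\ Q j /\ forall i, (i < k)%nat -> Cmod (W j i - w i) < eps).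
  set (upd := fun (w : nat -> Cx) k z i => if Nat.eqb i k then z else w i).
  assert (step : forall k w, cl k w -> exists z, cl (S k) (upd w k z)).
  { intros k w H.
    assert (CH : forall i, exists j, (i <= j)%nat /\ Q j /\ forall i', (i' < k)%nat -> Cmod (W j i' - w i') < / wt i).
    { intros i. apply H. apply wt_inv. }
    destruct (choice (fun i j => (i <= j)%nat /\ Q j /\ forall i', (i' < k)%nat -> Cmod (W j i' - w i') < / wt i) CH) as (phi & Hphi).
    destruct (complex_cluster (fun i => W (phi i) k) 1) as (z & Hz); [auto|].
    exists z. intros eps J he. destruct (INR_unbounded (/ eps)) as (n0 & Hn0).
    destruct (Hz eps (J + n0)%nat he) as (p & hp & Hp). exists (phi p). destruct (Hphi p) as (g1 & g2 & g3).
    split; [lia|]. split; [auto|]. intros i hi. unfold upd. destruct (Nat.eqb_spec i k) as [->|h]; [exact Hp|].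
    eapply Rlt_trans; [apply g3; lia|]. assert (INR n0 <= INR p) by (apply le_INR; lia).
    rewrite <- (Rinv_inv eps). assert (0 < / eps) by nn. apply Rinv_lt_contravar.
    - apply Rmult_lt_0_compat; auto. pose proof (wt_ge1 p); lra.
    - unfold wt. rewrite S_INR. lra. }
  (* The coordinates of the limit are chosen successively; by [stab] later choices do not alter
     earlier coordinates. *)
  set (f := fix f k := match k with O => (fun _ => C0) | S k' => upd (f k') k' (epsilon (inhabits C0) (fun z => cl (S k') (upd (f k') k' z))) end).
  assert (Hf : forall k, cl k (f k)).
  { induction k as [|k IH].
    - intros eps J he. destruct (HQ J) as (j & h1 & h2). exists j. easy.
    -
      apply (epsilon_spec (inhabits C0) (fun z => cl (S k) (upd (f k) k z))). auto. }
  assert (stab : forall k i, (i < k)%nat -> f k i = f (S i) i).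
  { induction k as [|k IH]; intros i hi; [lia|]. destruct (Nat.eq_dec i k) as [->|h]; [reflexivity|].
    rewrite <- (IH i) by lia. change (f (S k) i) with (upd (f k) k (epsilon (inhabits C0) (fun z => cl (S k) (upd (f k) k z))) i).
    unfold upd. destruct (Nat.eqb_spec i k); [lia|reflexivity]. }
  exists (fun i => f (S i) i). intros k eps J he. destruct (Hf k eps J he) as (j & h1 & h2 & h3). exists j.
  split; [auto|]. split; [auto|]. intros i hi. rewrite <- (stab k) by auto. auto.
Qed.

Lemma rap_sup K w : rap w -> (exists n, w n <> C0) -> exists S, 0 < S /\ sb K w S /\ exists n, S / 2 < wt n ^ K * Cmod (w n).
Proof.
  intros Hw [n0 H0]. destruct (Hw K) as [B HB].
  destruct (completeness (fun x => exists n, x = wt n ^ K * Cmod (w n))) as (S & HS1 & HS2).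
  - exists B. intros x [n ->]. auto.
  - exists (wt n0 ^ K * Cmod (w n0)). eauto.
  - assert (P : 0 < wt n0 ^ K * Cmod (w n0)) by (apply Rmult_lt_0_compat; [pose proof (wt_pow_ge1 n0 K); lra|apply Cmod_pos; auto]).
    assert (S0 : 0 < S) by (eapply Rlt_le_trans; [exact P|apply HS1; eauto]).
    exists S. split; [auto|]. split; [intros n; apply HS1; eauto|].
    apply NNPP. intros N. assert (S <= S / 2); [|lra]. apply HS2. intros x [n ->].
    apply Rnot_lt_le. intros h. apply N. eauto.
Qed.

(** The a priori estimate is asserted for rapidly decreasing [w] only; in [GR2s_of_1d] regularity
    first puts each column in this class. *)
Definition coercive (a : nat -> nat -> Cx) : Prop :=
  forall K, exists J C, forall w B, rap w -> sb J (P1 a w) B -> sb K w (C * B).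

(* Gliding hump: if the a priori estimate failed, normalised counterexamples would tend to 0 pointwise (any pointwise limit
   lies in the kernel), and a sparse sum of them would violate global regularity. *)
Lemma coercive_of_GR a : K0s a -> GRs a -> coercive a.
Proof.
  intros HK HG K. apply NNPP. intros Hn.
  (* Failure of the estimate with [J = j] and [C = wt j ^ 2], divided by the supremum of the
     seminorm of order [K]. The lower bound [/ 2] avoids asking that the supremum be attained. *)
  assert (X : forall j : nat, exists w, rap w /\ sb K w 1 /\ (exists n, / 2 < wt n ^ K * Cmod (w n)) /\ sb j (P1 a w) (/ wt j ^ 2)).
  { intros j. pose proof (wt_pow_ge1 j 2) as W.
    assert (Y : exists w B, rap w /\ sb j (P1 a w) B /\ ~ sb K w (wt j ^ 2 * B)).
    { apply NNPP. intros N. apply Hn. exists j, (wt j ^ 2). intros w B Hw HB. apply NNPP. intros M. apply N. eauto. }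
    destruct Y as (w & B & Hw & HB & HnB). pose proof (sb_nonneg _ _ _ HB) as B0.
    assert (E0 : exists n, wt j ^ 2 * B < wt n ^ K * Cmod (w n)).
    { apply NNPP. intros N. apply HnB. intros n. apply Rnot_lt_le. intros h. apply N. eauto. }
    destruct E0 as (n1 & Hn1).
    destruct (rap_sup K w Hw) as (s & s0 & Hs & n2 & Hn2).
    { exists n1. intros E. rewrite E, Cmod_C0, Rmult_0_r in Hn1. nra. }
    assert (rs : Cmod (RtoC (/ s)) = / s).
    { rewrite Cmod_RtoC. apply Rabs_right. nn. }
    exists (fun n => RtoC (/ s) * w n)%cx. split; [apply rap_scal; auto|]. split; [|split].
    - intros n. rewrite Cmod_mul, rs. specialize (Hs n). apply Rmult_le_reg_l with s; [auto|].
      replace (s * (wt n ^ K * (/ s * Cmod (w n)))) with (wt n ^ K * Cmod (w n)) by (field; lra). lra.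
    - exists n2. rewrite Cmod_mul, rs. apply Rmult_lt_reg_l with s; [auto|].
      replace (s * (wt n2 ^ K * (/ s * Cmod (w n2)))) with (wt n2 ^ K * Cmod (w n2)) by (field; lra). lra.
    - intros n. rewrite P1_scal, Cmod_mul, rs. specialize (HB n).
      assert (wt j ^ 2 * B < s) by (eapply Rlt_le_trans; [exact Hn1|apply Hs]).
      apply Rmult_le_reg_l with (s * wt j ^ 2); [nra|].
      replace (s * wt j ^ 2 * (wt n ^ j * (/ s * Cmod (P1 a w n)))) with (wt j ^ 2 * (wt n ^ j * Cmod (P1 a w n))) by (field; lra).
      replace (s * wt j ^ 2 * / wt j ^ 2) with s by (field; pose proof (wt_ge1 j); lra).
      nra. }
  destruct (choice _ X) as (W & HW).
  assert (W1 : forall j n, Cmod (W j n) <= 1).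
  { intros j n. destruct (HW j) as (_ & H & _). specialize (H n). pose proof (wt_pow_ge1 n K). nra. }
  (* If some coordinate stayed above [e0] for infinitely many [j], a pointwise cluster point would
     be a bounded kernel element that does not vanish there. *)
  assert (Hpt : forall n eps, 0 < eps -> exists J, forall j, (J <= j)%nat -> Cmod (W j n) < eps).
  { intros n0 e0 he0. apply NNPP. intros N.
    destruct (pointwise_cluster W (fun j => e0 <= Cmod (W j n0)) W1) as (w & Hw).
    { intros J. apply NNPP. intros M. apply N. exists J. intros j hj. apply Rnot_le_lt. intros h. apply M. eauto. }
    assert (wb : forall n, Cmod (w n) <= 1).
    { intros n. apply le_epsilon. intros e he. destruct (Hw (S n) e 0%nat he) as (j & _ & _ & H). specialize (H n ltac:(lia)).
      pose proof (W1 j n). replace (w n) with (W j n - (W j n - w n))%cx by ring. pose proof (Cmod_sub_le (W j n) (W j n - w n)). lra. }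
    assert (w0 : w n0 = C0).
    { apply HK.
      - exists 0%nat, 1. intros n. specialize (wb n). lra.
      - intros n. apply Cmod_eq0. apply Rle_antisym; [|apply Cmod_ge0]. apply le_epsilon. intros e he.
        destruct (P1_local a n) as (B & HB). pose proof (Rabs_pos B) as b0.
        destruct (INR_unbounded (2 / e)) as (J & HJ).
        destruct (Hw (n + 3)%nat (e / (2 * (Rabs B + 1))) J) as (j & hj & _ & H); [apply Rdiv_lt_0_compat; lra|].
        specialize (HB (fun k => C1 * w k + (- C1) * W j k)%cx (e / (2 * (Rabs B + 1)))). rewrite P1_lin in HB.
        destruct (HW j) as (_ & _ & _ & HP). specialize (HP n). pose proof (wt_pow_ge1 n j).
        assert (/ wt j ^ 2 <= e / 2).
        { assert (INR J <= INR j) by (auto with real). pose proof (wt_ge1 j). apply Rmult_le_reg_r with (wt j ^ 2); [nra|].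
          rewrite Rinv_l by nra. assert (2 <= e * wt j). { unfold wt. rewrite S_INR. apply Rmult_le_reg_r with (/ e); [apply Rinv_0_lt_compat; auto|].
           replace (e * (INR j + 1) * / e) with (INR j + 1) by (field; lra). lra. } nra. }
        assert (B * (e / (2 * (Rabs B + 1))) <= e / 2).
        { replace (e / 2) with ((Rabs B + 1) * (e / (2 * (Rabs B + 1)))) by (field; lra). apply Rmult_le_compat_r.
          - nn.
          - pose proof (Rle_abs B). lra. }
        replace (P1 a w n) with ((C1 * P1 a w n + - C1 * P1 a (W j) n) + P1 a (W j) n)%cx by ring.
        eapply Rle_trans; [apply Cmod_tri|]. enough (Cmod (C1 * P1 a w n + - C1 * P1 a (W j) n) <= e / 2) by nra.
        eapply Rle_trans; [apply HB|lra]. intros k hk. left. rewrite <- Cmod_opp.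
        replace (- (C1 * w k + - C1 * W j k))%cx with (W j k - w k)%cx by ring. auto. }
    destruct (Hw (S n0) (e0 / 2) 0%nat) as (j & _ & Hj & H); [lra|]. specialize (H n0 ltac:(lia)). rewrite w0 in H.
    replace (W j n0 - C0)%cx with (W j n0) in H by ring. lra. }
  assert (Hpt2 : forall M eps, 0 < eps -> exists J, forall j, (J <= j)%nat -> forall n, (n <= M)%nat -> Cmod (W j n) < eps).
  { induction M as [|M IH]; intros eps he.
    - destruct (Hpt 0%nat eps he) as (J & HJ). exists J. intros j hj n hn. replace n with 0%nat by lia. auto.
    - destruct (IH eps he) as (J & HJ). destruct (Hpt (S M) eps he) as (J' & HJ'). exists (J + J')%nat.
      intros j hj n hn. destruct (Nat.eq_dec n (S M)) as [->|]; [apply HJ'; lia|apply HJ; lia]. }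
  (* Tolerances with [e l * wt l ^ 2 <= / 64]: by [CSeries_bound] all other humps together
     contribute at most [/ 16] where one of them peaks above [/ 2]. *)
  set (e := fun l => / (64 * wt l ^ 2)). assert (ep : forall l, 0 < e l).
  { intros l. apply Rinv_0_lt_compat. pose proof (wt_pow_ge1 l 2). lra. }
  assert (e1 : forall l, e l * wt l ^ 2 <= / 64).
  { intros l. unfold e. right. field. pose proof (wt_ge1 l). lra. }
  assert (e2 : forall l, e l <= / 64).
  { intros l. pose proof (e1 l). pose proof (wt_pow_ge1 l 2). nra. }
  (* The next hump: negligible up to [M], peaking at a later index, and negligible again beyond a
     further index, which becomes the next [M]. *)
  assert (step : forall l M : nat, exists q : (nat -> Cx) * (nat * nat),
    rap (fst q) /\ sb K (fst q) 1 /\ (forall n, (n <= M)%nat -> wt n ^ K * Cmod (fst q n) <= e l) /\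
    (M < fst (snd q) <= snd (snd q))%nat /\ / 2 < wt (fst (snd q)) ^ K * Cmod (fst q (fst (snd q))) /\
    (forall n, (snd (snd q) < n)%nat -> wt n ^ K * Cmod (fst q n) <= e l) /\ sb l (P1 a (fst q)) (/ wt l ^ 2)).
  { intros l M. pose proof (wt_pow_ge1 M K) as WM.
    destruct (Hpt2 M (e l / wt M ^ K)) as (J & HJ); [apply Rdiv_lt_0_compat; auto; lra|].
    set (j := (J + l)%nat). destruct (HW j) as (h1 & h2 & (n0 & h3) & h4). specialize (HJ j ltac:(lia)).
    assert (small : forall n, (n <= M)%nat -> wt n ^ K * Cmod (W j n) <= e l).
    { intros n hn. specialize (HJ n hn). pose proof (Cmod_ge0 (W j n)). pose proof (wt_ge1 n).
      assert (wt n ^ K <= wt M ^ K) by (apply pow_incr; split; [lra|apply wt_mono; auto]).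
      apply Rle_trans with (wt M ^ K * (e l / wt M ^ K)); [|right; field; lra].
      nra. }
    destruct (h1 (S K)) as (B & HB).
    destruct (INR_unbounded (B / e l)) as (N & HN).
    exists (W j, (n0, (n0 + N)%nat)). cbn [fst snd]. split; [auto|]. split; [auto|]. split; [auto|]. split; [|split; [auto|split]].
    - split; [|lia]. apply Nat.nle_gt. intros h. specialize (small n0 h). pose proof (e2 l). lra.
    - intros n hn. specialize (HB n). cbn [pow] in HB. pose proof (wt_ge1 n). pose proof (ep l).
      assert (INR N <= wt n) by (unfold wt; apply le_INR; lia).
      assert (B <= e l * wt n). { apply Rmult_le_reg_r with (/ e l); [apply Rinv_0_lt_compat; auto|].
        replace (e l * wt n * / e l) with (wt n) by (field; lra). lra. }
      nra.
    - intros n. pose proof (sb_le j l _ _ ltac:(lia) h4 n) as T. eapply Rle_trans; [exact T|].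
      pose proof (wt_pow_ge1 l 2). apply Rinv_le_contravar; [lra|]. apply pow_incr. split; [pose proof (wt_ge1 l); lra|apply wt_mono; lia]. }
  destruct (choice (fun lM q => let l := fst lM in let M := snd lM in 
    rap (fst q) /\ sb K (fst q) 1 /\ (forall n, (n <= M)%nat -> wt n ^ K * Cmod (fst q n) <= e l) /\
    (M < fst (snd q) <= snd (snd q))%nat /\ / 2 < wt (fst (snd q)) ^ K * Cmod (fst q (fst (snd q))) /\
    (forall n, (snd (snd q) < n)%nat -> wt n ^ K * Cmod (fst q n) <= e l) /\ sb l (P1 a (fst q)) (/ wt l ^ 2))
    (fun lM : nat * nat => step (fst lM) (snd lM))) as (F & HF).
  set (M := fix M (l : nat) := match l with O => O | S l' => snd (snd (F (l', M l'))) end).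
  set (V := fun l => fst (F (l, M l))). set (h := fun l => fst (snd (F (l, M l)))).
  assert (HV : forall l, rap (V l) /\ sb K (V l) 1 /\ (forall n, (n <= M l)%nat -> wt n ^ K * Cmod (V l n) <= e l) /\
    (M l < h l <= M (S l))%nat /\ / 2 < wt (h l) ^ K * Cmod (V l (h l)) /\
    (forall n, (M (S l) < n)%nat -> wt n ^ K * Cmod (V l n) <= e l) /\ sb l (P1 a (V l)) (/ wt l ^ 2)) by (intros l; exact (HF (l, M l))).
  assert (Mmono : forall l k, (l <= k)%nat -> (M l <= M k)%nat).
  { intros l k hk. induction hk as [|k hk IH]; [lia|]. destruct (HV k) as (_ & _ & _ & g & _). lia. }
  assert (Ml : forall l, (l <= M l)%nat).
  { induction l as [|l IH]; [cbn; lia|]. destruct (HV l) as (_ & _ & _ & g & _). lia. }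
  (* The windows [(M k, M (k + 1)]] are disjoint, so at each index at most one hump is not
     negligible. *)
  assert (block : forall n, exists k, forall l, l <> k -> wt n ^ K * Cmod (V l n) <= e l).
  { intros n.
    assert (Z : exists k, (M k < n <= M (S k))%nat \/ n = 0%nat).
    { destruct n as [|n]; [exists 0%nat; auto|]. assert (Y : exists k, (S n <= M k)%nat) by (exists (S n); apply Ml).
      destruct Y as (k & Hk). induction k as [|k IH]; [cbn in Hk; lia|].
      destruct (Nat.le_gt_cases (S n) (M k)) as [g|g]; [auto|]. exists k. auto. }
    destruct Z as (k & Hk). exists k. intros l hl. destruct (HV l) as (_ & _ & g1 & _ & _ & g2 & _).
    destruct (Nat.le_gt_cases n (M l)) as [g|g]; [auto|]. apply g2.
    destruct (Nat.lt_trichotomy l k) as [o|[o|o]]; [|lia|].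
    - pose proof (Mmono (S l) k o). lia.
    - pose proof (Mmono (S k) l o). lia. }
  assert (rest : forall n k, (forall l, l <> k -> wt n ^ K * Cmod (V l n) <= e l) ->
     sm (fun l => V l n) /\ wt n ^ K * Cmod (CSeries (fun l => V l n) - V k n) <= / 16).
  { intros n k Hk. pose proof (wt_pow_ge1 n K) as Wn.
    set (r := fun l => if Nat.eqb l k then C0 else V l n).
    assert (Br : forall l, Cmod (r l) * wt l ^ 2 <= / 64 * / wt n ^ K).
    { intros l. unfold r. destruct (Nat.eqb_spec l k) as [->|g].
      - rewrite Cmod_C0, Rmult_0_l. nn.
      - specialize (Hk l g). pose proof (e1 l). apply Rmult_le_reg_l with (wt n ^ K); [lra|].
        replace (wt n ^ K * (/ 64 * / wt n ^ K)) with (/ 64) by (field; lra).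
        nra. }
    assert (Sr : sm r) by (eexists; exact Br).
    assert (Sd : sm (fun l => if Nat.eqb l k then V k n else C0)) by apply (sm_delta k (fun _ => V k n)).
    assert (Ev : forall l, V l n = (r l + if Nat.eqb l k then V k n else C0)%cx).
    { intros l. unfold r. destruct (Nat.eqb_spec l k) as [->|g]; ring. }
    split.
    - apply sm_ext with (fun l => r l + if Nat.eqb l k then V k n else C0)%cx; [intros; symmetry; apply Ev|]. apply sm_add; auto.
    - rewrite (CSeries_ext _ _ Ev). rewrite CSeries_add by auto. rewrite (CSeries_delta k (fun _ => V k n)).
      replace (CSeries r + V k n - V k n)%cx with (CSeries r) by ring.
      pose proof (CSeries_bound r _ Br) as T. apply Rle_trans with (wt n ^ K * (4 * (/ 64 * / wt n ^ K))).
      + nra.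
      + right. field. lra. }
  assert (Ssm : forall n, sm (fun l => V l n)).
  { intros n. destruct (block n) as (k & Hk). apply (rest n k Hk). }
  set (u := fun n => CSeries (fun l => V l n)).
  assert (Hu : rap u).
  { apply HG.
    - exists 0%nat, 2. intros n. destruct (block n) as (k & Hk). destruct (rest n k Hk) as (_ & T).
      pose proof (wt_pow_ge1 n K). destruct (HV k) as (_ & g & _). specialize (g n).
      assert (Cmod (V k n) <= 1) by nra.
      assert (Cmod (CSeries (fun l => V l n) - V k n) <= / 16) by nra.
      unfold u. replace (CSeries (fun l => V l n)) with ((CSeries (fun l => V l n) - V k n) + V k n)%cx by ring.
      pose proof (Cmod_tri (CSeries (fun l => V l n) - V k n) (V k n)). lra.
    (* In the seminorm of order [J] the image of hump [l] is at most [/ wt l ^ 2] once [l > J]; the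
       finitely many other images are rapidly decreasing. *)
    - intros J.
      destruct (fin_max (fun l B => forall n, Cmod (P1 a (V l) n) * wt n ^ J * wt l ^ 2 <= B) J) as (B & HB).
      + intros i B B' hB Q n. specialize (Q n). lra.
      + intros l. destruct (HV l) as (g & _). destruct (rap_P1 a _ g J) as (C & HC). exists (C * wt l ^ 2). intros n.
        specialize (HC n). nra.
      + exists (4 * Rmax 1 B). intros n. unfold u; rewrite P1_CSeries by exact Ssm. pose proof (wt_pow_ge1 n J) as Wn.
        apply Rmult_le_reg_l with (/ wt n ^ J); [apply Rinv_0_lt_compat; lra|]. rewrite <- Rmult_assoc, Rinv_l, Rmult_1_l by lra.
        replace (/ wt n ^ J * (4 * Rmax 1 B)) with (4 * (Rmax 1 B * / wt n ^ J)) by ring. apply CSeries_bound. intros l.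
        apply Rmult_le_reg_r with (wt n ^ J); [lra|]. rewrite (Rmult_assoc (Rmax 1 B)), Rinv_l, Rmult_1_r by lra.
        destruct (Nat.le_gt_cases l J) as [g|g].
        * specialize (HB l g n). pose proof (Rmax_r 1 B). lra.
        * destruct (HV l) as (_ & _ & _ & _ & _ & _ & Hs). pose proof (sb_le l J _ _ ltac:(lia) Hs n) as T.
          pose proof (Rmax_l 1 B). pose proof (wt_pow_ge1 l 2).
          apply Rle_trans with (/ wt l ^ 2 * wt l ^ 2); [|rewrite Rinv_l; lra].
          nra. }
  (* At the peak of hump [l] the weighted size of [u] is at least [/ 4], while decrease with one
     more power bounds it by [B / wt (h l)]; [l] is taken beyond [4 * B]. *)
  destruct (Hu (S K)) as (B & HB). destruct (INR_unbounded (4 * B)) as (l & Hl).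
  destruct (HV l) as (_ & _ & g1 & g2 & g3 & _). specialize (HB (h l)).
  assert (Hk : forall k, k <> l -> wt (h l) ^ K * Cmod (V k (h l)) <= e k).
  { intros k hk. destruct (HV k) as (_ & _ & f1 & _ & _ & f2 & _). destruct (Nat.lt_trichotomy k l) as [o|[o|o]]; [|lia|].
    - apply f2. pose proof (Mmono (S k) l o). lia.
    - apply f1. pose proof (Mmono (S l) k o). lia. }
  destruct (rest (h l) l Hk) as (_ & T). cbn [pow] in HB.
  assert (/ 4 <= wt (h l) ^ K * Cmod (u (h l))).
  { unfold u.
    pose proof (Cmod_tri (CSeries (fun k => V k (h l))) (V l (h l) - CSeries (fun k => V k (h l)))) as Q2.
    replace (CSeries (fun k => V k (h l)) + (V l (h l) - CSeries (fun k => V k (h l))))%cx with (V l (h l)) in Q2 by ring.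
    rewrite <- (Cmod_opp (V l (h l) - _)) in Q2.
    replace (- (V l (h l) - CSeries (fun k => V k (h l))))%cx with (CSeries (fun k => V k (h l)) - V l (h l))%cx in Q2 by ring.
    pose proof (wt_pow_ge1 (h l) K). nra. }
  assert (INR l <= wt (h l)) by (unfold wt; apply le_INR; pose proof (Ml l); lia).
  pose proof (wt_ge1 (h l)). nra.
Qed.
(** The estimate is applied in every column. Its constants do not depend on the column, so decay of
    the data in [m] passes to the solution. *)
Lemma GR2s_of_1d a : K0s a -> GRs a -> GR2s a (V4 1 0 0 0) (V4 0 1 0 0).
Proof.
  intros HK HG z (p & A & HA) Hr K. destruct (coercive_of_GR a HK HG K) as (J & C & H).
  destruct (Hr (J + K)%nat) as (B & HB). exists (C * B). intros n m.
  assert (R : rap (P1 a (fun k => z (k, m)))).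
  { intros L. destruct (Hr L) as (M & HM). exists M. intros k. specialize (HM k m). rewrite column_pol in HM.
    pose proof (wt_pow_ge1 k L). pose proof (wt_pow_ge1 m L). set (c := Cmod _) in *. assert (0 <= c) by apply Cmod_ge0.
    assert (0 <= wt k ^ L * c) by nra. nra. }
  assert (Rz : rap (fun k => z (k, m))).
  { apply HG; auto. exists p, (A * wt m ^ p). intros k. specialize (HA k m). lra. }
  assert (S1 : sb J (P1 a (fun k => z (k, m))) (B * / wt m ^ K)).
  { intros k. specialize (HB k m). rewrite column_pol in HB. pose proof (wt_pow_ge1 m K) as W.
    apply Rmult_le_reg_r with (wt m ^ K); [lra|]. rewrite (Rmult_assoc B), Rinv_l, Rmult_1_r by lra.
    eapply Rle_trans; [|exact HB]. set (c := Cmod _). assert (0 <= c) by apply Cmod_ge0.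
    pose proof (wt_pow_le k J (J + K) ltac:(lia)). pose proof (wt_pow_le m K (J + K) ltac:(lia)). pose proof (wt_pow_ge1 k J).
    replace (wt k ^ J * c * wt m ^ K) with (wt k ^ J * wt m ^ K * c) by ring. apply Rmult_le_compat_r; auto. nra. }
  pose proof (H _ _ Rz S1 n) as T. pose proof (wt_pow_ge1 m K) as W.
  apply Rmult_le_reg_r with (/ wt m ^ K); [apply Rinv_0_lt_compat; lra|].
  replace (wt n ^ K * wt m ^ K * Cmod (z (n, m)) * / wt m ^ K) with (wt n ^ K * Cmod (z (n, m))) by (field; lra). lra.
Qed.

(** * Elliptic operators *)

Lemma P1_coef_ext a b w n :
  a 0%nat 0%nat = b 0%nat 0%nat -> a 0%nat 1%nat = b 0%nat 1%nat -> a 0%nat 2%nat = b 0%nat 2%nat ->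
  a 1%nat 0%nat = b 1%nat 0%nat -> a 1%nat 1%nat = b 1%nat 1%nat -> a 2%nat 0%nat = b 2%nat 0%nat -> P1 a w n = P1 b w n.
Proof. intros E1 E2 E3 E4 E5 E6. unfold P1, pol. rewrite E1, E2, E3, E4, E5, E6. auto. Qed.
Lemma P1_op_ext a b : (forall w n, P1 a w n = P1 b w n) ->
  (GRs a <-> GRs b) /\ (K0s a <-> K0s b) /\ (KSs a <-> KSs b).
Proof.
  intros E. assert (F : forall w, P1 a w = P1 b w) by (intros; apply functional_extensionality; auto).
  repeat split; intros H w; specialize (H w); rewrite F in *; auto.
Qed.

(** Coefficients after substituting [c M - s D] for [M] and [c D + s M] for [D] and reordering; the
    multiple of [Ci] in the constant term collects the commutators. *)
Definition rota (c s : R) (a : nat -> nat -> Cx) (k j : nat) : Cx :=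
  let a00 := a 0%nat 0%nat in let a01 := a 0%nat 1%nat in let a02 := a 0%nat 2%nat in
  let a10 := a 1%nat 0%nat in let a11 := a 1%nat 1%nat in let a20 := a 2%nat 0%nat in
  match k, j with
  | 2%nat, 0%nat => (RtoC (s * s) * a02 - RtoC (c * s) * a11 + RtoC (c * c) * a20)%cx
  | 1%nat, 1%nat => (RtoC (- 2 * c * s) * a02 + RtoC (c * c - s * s) * a11 + RtoC (2 * c * s) * a20)%cx
  | 0%nat, 2%nat => (RtoC (c * c) * a02 + RtoC (c * s) * a11 + RtoC (s * s) * a20)%cx
  | 1%nat, 0%nat => (RtoC c * a10 - RtoC s * a01)%cx
  | 0%nat, 1%nat => (RtoC c * a01 + RtoC s * a10)%cx
  | _, _ => (a00 + Ci * (RtoC (c * s) * (a02 - a20) + RtoC (s * s) * a11))%cx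
  end.
Lemma P1_rot c s a w n : c ^ 2 + s ^ 2 = 1 ->
  P1 a (rot (mkC c s) w) n = rot (mkC c s) (P1 (rota c s a) w) n.
Proof.
  intros H.
  set (X := fun (w : nat -> Cx) n => (RtoC c * sM w n + (- RtoC s) * sD w n)%cx).
  set (Y := fun (w : nat -> Cx) n => (RtoC c * sD w n + RtoC s * sM w n)%cx).
  assert (EX : forall w, sM (rot (mkC c s) w) = rot (mkC c s) (X w)).
  { intros v. apply functional_extensionality. intros i. rewrite rot_sM by auto. unfold rot, X. ring. }
  assert (EY : forall w, sD (rot (mkC c s) w) = rot (mkC c s) (Y w)).
  { intros v. apply functional_extensionality. intros i. rewrite rot_sD by auto. auto. }
  unfold P1. rewrite (pol_conj a sM sD X Y (rot (mkC c s)) w EX EY). unfold rot. unfold pol, X, Y. rewrite !sM_lin, !sD_lin, !sD_sM_comm. unfold rota. 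
  rewrite !(RtoC_mul). replace (RtoC (c * c - s * s)) with (RtoC c * RtoC c - RtoC s * RtoC s)%cx by cxring.
  replace (RtoC (-2)) with (- (C1 + C1))%cx by cxring. replace (RtoC 2) with (C1 + C1)%cx by cxring. ring.
Qed.
Lemma rap_rot om w : Cmod om = 1 -> rap w -> rap (rot om w).
Proof.
  intros H Hw K. destruct (Hw K) as [B HB]. exists B. intros n. unfold rot. rewrite Cmod_mul, Cmod_cpow, Rmult_1_l by auto. auto.
Qed.
Lemma tmp_rot om w : Cmod om = 1 -> tmp w -> tmp (rot om w).
Proof.
  intros H (K & B & HB). exists K, B. intros n. unfold rot. rewrite Cmod_mul, Cmod_cpow, Rmult_1_l by auto. auto.
Qed.
Lemma rot_inv c s w : c ^ 2 + s ^ 2 = 1 -> rot (mkC c s) (rot (mkC c (- s)) w) = w.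
Proof.
  intros H. apply functional_extensionality. intros n. unfold rot. pose proof (cpow_inv c s n H) as E.
  transitivity ((cpow (mkC c (- s)) n * cpow (mkC c s) n) * w n)%cx; [ring|]. rewrite E. ring.
Qed.
Lemma rota_equiv c s a : c ^ 2 + s ^ 2 = 1 ->
  (GRs a <-> GRs (rota c s a)) /\ (K0s a <-> K0s (rota c s a)) /\ (KSs a <-> KSs (rota c s a)).
Proof.
  intros H. assert (H' : c ^ 2 + (- s) ^ 2 = 1) by lra.
  pose proof (Cmod_unit c s H) as U. pose proof (Cmod_unit c (- s) H') as U'.
  assert (back : forall w, rot (mkC c (- s)) (rot (mkC c s) w) = w).
  { intros w. pose proof (rot_inv c (- s) w H') as E. rewrite Ropp_involutive in E. auto. }
  assert (z0 : forall w n, rot (mkC c s) w n = C0 <-> w n = C0).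
  { intros w n. unfold rot. split; intros E; [|rewrite E; ring]. apply Cmod_eq0. apply (f_equal Cmod) in E.
    rewrite Cmod_mul, Cmod_cpow, Cmod_C0 in E by auto. lra. }
  assert (F : forall w, P1 a (rot (mkC c s) w) = rot (mkC c s) (P1 (rota c s a) w)).
  { intros. apply functional_extensionality. intros. apply P1_rot; auto. }
  split; [|split]; split; intros G w Hw HP.
  - rewrite <- back. apply rap_rot; auto. apply G; [apply tmp_rot; auto|]. rewrite F. apply rap_rot; auto.
  - rewrite <- (rot_inv c s w H). apply rap_rot; auto. apply G; [apply tmp_rot; auto|].
    rewrite <- back, <- F, rot_inv by auto. apply rap_rot; auto.
  - intros n. apply z0. revert n. apply G; [apply tmp_rot; auto|]. intros n. rewrite F. apply z0. auto.
  - intros n. rewrite <- (rot_inv c s w H). apply z0. revert n. apply G; [apply tmp_rot; auto|].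
    intros n. apply z0. rewrite <- F, rot_inv by auto. auto.
  - rewrite <- back. apply rap_rot; auto. apply G; [apply tmp_rot; auto|]. intros n. rewrite F. apply z0. auto.
  - rewrite <- (rot_inv c s w H). apply rap_rot; auto. apply G; [apply tmp_rot; auto|].
    intros n. apply z0. rewrite <- F, rot_inv by auto. auto.
Qed.
(** Transposition changes the sign of D, hence reverses the rotation. *)
Lemma tr_rota c s a w n : c ^ 2 + s ^ 2 = 1 -> P1 (tr (rota c s a)) w n = P1 (rota c (- s) (tr a)) w n.
Proof.
  intros H. assert (E : (RtoC c * RtoC c)%cx = (C1 - RtoC s * RtoC s)%cx) by (apply Cx_ext; cxsimpl; lra).
  apply P1_coef_ext; cbn [tr rota]; try (apply Cx_ext; cxsimpl; ring). replace (RtoC (c * c - s * s)) with (RtoC c * RtoC c - RtoC s * RtoC s)%cx by cxring.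
  rewrite E. apply Cx_ext; cxsimpl; ring.
Qed.

(** It concerns an operator together with its transpose, so that a rotation, which acts on both,
    preserves it. *)
Definition dichotomy (a : nat -> nat -> Cx) : Prop :=
  K0s a -> (GRs a /\ GRs (tr a)) \/ (~ GRs a /\ ~ KSs (tr a)).
Lemma dichotomy_rota c s a : c ^ 2 + s ^ 2 = 1 -> dichotomy (rota c s a) -> dichotomy a.
Proof.
  intros H D K. destruct (rota_equiv c s a H) as (E1 & E2 & _).
  assert (H' : c ^ 2 + (- s) ^ 2 = 1) by lra. destruct (rota_equiv c (- s) (tr a) H') as (E3 & _ & E4).
  destruct (P1_op_ext _ _ (fun w n => tr_rota c s a w n H)) as (E5 & _ & E6).
  destruct D as [[D1 D2]|[D1 D2]]; [apply E2; auto| |]; [left|right]; split.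
  - apply E1; auto. - apply E3, E5; auto. - rewrite E1; auto. - rewrite E4, <- E6. auto.
Qed.

(** The square root of [wt]: [sM] and [sD] each cost exactly one power of it, so half orders become
    visible. *)
Definition om (n : nat) : R := sqrt (wt n).
Lemma om_ge1 n : 1 <= om n.
Proof. rewrite <- sqrt_1. apply sqrt_le_1_alt. apply wt_ge1. Qed.
Lemma om_sq n : om n ^ 2 = wt n.
Proof. rewrite <- Rsqr_pow2. apply Rsqr_sqrt. pose proof (wt_ge1 n); lra. Qed.
Lemma om_mono n m : (n <= m)%nat -> om n <= om m.
Proof. intros. apply sqrt_le_1_alt, wt_mono; auto. Qed.
Lemma om_pow_pos n k : 1 <= om n ^ k.
Proof. apply pow_R1_Rle, om_ge1. Qed.
Lemma pow_1p e t : 0 <= t <= 1 -> (1 + t) ^ e <= 1 + 3 ^ e * t.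
Proof.
  intros H. induction e as [|e IH]; cbn [pow]; [lra|]. assert (1 <= 3 ^ e) by (apply pow_R1_Rle; lra).
  apply Rle_trans with ((1 + t) * (1 + 3 ^ e * t)); [apply Rmult_le_compat_l; lra|].
  assert (0 <= 3 ^ e * t * (1 - t)) by nn. nra.
Qed.
Lemma om_ratio e eta : 0 < eta -> exists N, forall m, (N <= m)%nat -> (om (m + 2) / om m) ^ e <= 1 + eta.
Proof.
  intros he.
  (* This [N] makes [2 / wt m] at most 1, as [pow_1p] requires, and [3 ^ e * (2 / wt m)] at most
     [eta]. *)
  destruct (INR_unbounded (2 * 3 ^ e / eta + 2)) as (N & HN). exists N. intros m hm.
  assert (INR N <= INR m) by (auto with real). assert (q : 0 < 3 ^ e / eta) by nn.
  assert (Hw : INR m <= wt m) by (unfold wt; rewrite S_INR; lra).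
  assert (t1 : 0 <= 2 / wt m <= 1).
  { split; [apply Rdiv_le_0_compat; lra|]. apply Rmult_le_reg_r with (wt m); [lra|]. unfold Rdiv. rewrite Rmult_assoc, Rinv_l by lra. lra. }
  apply Rle_trans with ((1 + 2 / wt m) ^ e).
  - apply pow_incr. pose proof (om_ge1 m). pose proof (om_ge1 (m + 2)). split; [apply Rdiv_le_0_compat; lra|].
    apply Rmult_le_reg_r with (om m); [lra|]. unfold Rdiv at 1. rewrite Rmult_assoc, Rinv_l, Rmult_1_r by lra.
    apply Rsqr_incr_0_var; [|nra]. rewrite !Rsqr_pow2, Rpow_mult_distr, !om_sq.
    replace (wt (m + 2)) with (wt m + 2) by (unfold wt; rewrite !S_INR, plus_INR; cbn [INR]; ring). set (t := 2 / wt m) in *.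
    assert (wt m * t = 2) by (unfold t; field; lra). nra.
  - eapply Rle_trans; [apply pow_1p; auto|]. apply Rplus_le_compat_l.
    apply Rmult_le_reg_r with (wt m); [lra|]. replace (3 ^ e * (2 / wt m) * wt m) with (2 * 3 ^ e) by (field; lra).
    replace (2 * 3 ^ e) with (eta * (2 * 3 ^ e * / eta)) by (field; lra). nra.
Qed.

(** Size [om n] to the power [k - j], with two exponents to stay clear of subtraction in [nat]. *)
Definition ord (j k : nat) (w : nat -> Cx) : Prop := exists C, forall n, Cmod (w n) * om n ^ j <= C * om n ^ k.

Lemma iter_forward (y : nat -> R) N rho C :
  0 <= rho < 1 -> (forall m, (N <= m)%nat -> y (m + 2)%nat <= rho * y m + C) -> exists B, forall m, y m <= B.
Proof.
  intros hr H. destruct (fin_max (fun i B => y i <= B) (N + 1)) as [B HB].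
  { nn. } { intros i; exists (y i); lra. }
  set (B' := Rmax B (C / (1 - rho))). exists B'.
  assert (C <= (1 - rho) * B').
  { pose proof (Rmax_r B (C / (1 - rho))). fold B' in H0. apply Rle_trans with ((1 - rho) * (C / (1 - rho))); [right; field; lra|]. nra. }
  intros m. induction m as [m IH] using lt_wf_ind. destruct (Nat.le_gt_cases m (N + 1)) as [h|h].
  - eapply Rle_trans; [apply HB; auto|apply Rmax_l].
  - replace m with (m - 2 + 2)%nat by lia. eapply Rle_trans; [apply H; lia|]. specialize (IH (m - 2)%nat ltac:(lia)). nra.
Qed.
Lemma geom_poly rho p : 0 <= rho < 1 -> exists B, forall i, rho ^ i * wt i ^ p <= B.
Proof.
  intros hr. destruct (Req_dec rho 0) as [->|h0].
  { exists 1. intros [|i]; cbn [pow]; [|rewrite !Rmult_0_l; lra]. rewrite pow1. lra. }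
  set (d := - ln rho). assert (dp : 0 < d) by (unfold d; pose proof (ln_increasing rho 1 ltac:(lra) ltac:(lra)) as T; rewrite ln_1 in T; lra).
  destruct (pow_le_exp p) as (C & C0 & HC). exists (C * exp d * (/ d) ^ p). intros i.
  assert (E : rho ^ i = exp (- (d * INR i))).
  { unfold d. induction i as [|i IH]; [cbn [pow INR]; rewrite Rmult_0_r, Ropp_0, exp_0; reflexivity|].
    rewrite S_INR. cbn [pow]. rewrite IH. replace (- (- ln rho * (INR i + 1))) with (ln rho + - (- ln rho * INR i)) by ring.
    rewrite exp_plus, exp_ln by lra. auto. }
  specialize (HC (d * wt i) ltac:(pose proof (wt_ge1 i); nra)). rewrite Rpow_mult_distr in HC.
  assert (wt i ^ p <= (/ d) ^ p * (C * exp (d * wt i))).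
  { assert (0 < (/ d) ^ p) by nn.
    apply Rle_trans with ((/ d) ^ p * (d ^ p * wt i ^ p)); [|apply Rmult_le_compat_l; lra].
    rewrite <- Rmult_assoc, <- Rpow_mult_distr, Rinv_l, pow1 by lra. lra. }
  rewrite E. apply Rle_trans with (exp (- (d * INR i)) * ((/ d) ^ p * (C * exp (d * wt i)))).
  - apply Rmult_le_compat_l; [left; apply exp_pos|auto].
  - right. replace (d * wt i) with (d * INR i + d) by (unfold wt; rewrite S_INR; ring). rewrite exp_plus, exp_Ropp. field.
    pose proof (exp_pos (d * INR i)). lra.
Qed.
(** Iterating upwards leaves [rho ^ i] times the value at index [m + 2 i], which the polynomial
    bound sends to 0: temperedness serves as a condition at infinity. *)
Lemma iter_backward (y : nat -> R) N rho C D p :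
  0 <= rho < 1 -> (forall m, (N <= m)%nat -> y m <= rho * y (m + 2)%nat + C) -> (forall m, 0 <= y m <= D * wt m ^ p) ->
  exists B, forall m, y m <= B.
Proof.
  intros hr H Hp. destruct (fin_max (fun i B => y i <= B) N) as [B HB].
  { nn. } { intros i; exists (y i); lra. }
  assert (D0 : 0 <= D). { pose proof (Hp 0%nat). pose proof (wt_pow_ge1 0 p). nra. }
  set (G := Rmax 0 C / (1 - rho)). assert (G0 : 0 <= G) by (apply Rdiv_le_0_compat; [apply Rmax_l|lra]).
  assert (GC : C <= (1 - rho) * G). { unfold G. replace ((1 - rho) * (Rmax 0 C / (1 - rho))) with (Rmax 0 C) by (field; lra). apply Rmax_r. }
  assert (It : forall i m, (N <= m)%nat -> y m <= rho ^ i * y (m + 2 * i)%nat + G).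
  { induction i as [|i IH]; intros m hm.
    - replace (m + 2 * 0)%nat with m by lia. lra.
    - eapply Rle_trans; [apply H; auto|]. specialize (IH (m + 2)%nat ltac:(lia)). replace (m + 2 + 2 * i)%nat with (m + 2 * S i)%nat in IH by lia.
      cbn [pow]. nra. }
  exists (Rmax B (G + 1)). intros m. destruct (Nat.le_gt_cases m N) as [h|h].
  - eapply Rle_trans; [apply HB; auto|apply Rmax_l].
  - eapply Rle_trans; [|apply Rmax_r]. destruct (geom_poly rho (S p) hr) as (Q & HQ).
    assert (E : forall i, rho ^ i * y (m + 2 * i)%nat <= D * (2 * wt m) ^ p * Q * / wt i).
    { intros i. pose proof (wt_ge1 i). pose proof (wt_ge1 m). assert (0 <= rho ^ i) by nn.
      assert (W : wt (m + 2 * i) <= 2 * wt m * wt i). { unfold wt. rewrite !S_INR, plus_INR, mult_INR. change (INR 2) with (1 + 1).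
      pose proof (pos_INR m). pose proof (pos_INR i). nra. }
      assert (y (m + 2 * i)%nat <= D * ((2 * wt m) ^ p * wt i ^ p)).
      { eapply Rle_trans; [apply Hp|]. apply Rmult_le_compat_l; auto. rewrite <- Rpow_mult_distr. apply pow_incr.
        split; [pose proof (wt_ge1 (m + 2 * i)); lra|auto]. }
      specialize (HQ i). cbn [pow] in HQ. apply Rle_trans with (rho ^ i * (D * ((2 * wt m) ^ p * wt i ^ p))); [apply Rmult_le_compat_l; auto|].
      assert (0 <= D * (2 * wt m) ^ p) by nn.
      apply Rmult_le_reg_r with (wt i); [lra|]. rewrite (Rmult_assoc _ (/ wt i)), Rinv_l, Rmult_1_r by lra.
      nra. }
    destruct (INR_unbounded (Rabs (D * (2 * wt m) ^ p * Q))) as (i & hi).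
    specialize (It i m ltac:(lia)). specialize (E i). pose proof (wt_ge1 i).
    assert (D * (2 * wt m) ^ p * Q * / wt i <= 1).
    { apply Rmult_le_reg_r with (wt i); [lra|]. rewrite Rmult_assoc, Rinv_l by lra. pose proof (Rle_abs (D * (2 * wt m) ^ p * Q)).
      assert (INR i <= wt i) by (unfold wt; apply le_INR; lia). lra. }
    lra.
Qed.

Definition Lz (z : Cx) (w : nat -> Cx) (n : nat) : Cx := (sD w n - z * sM w n)%cx.
(** [Lz] is a two-term recurrence whose coefficients have moduli proportional to [Cmod (Ci - z)] and
    [Cmod (Ci + z)], and these differ exactly when [z] is not real. If the second is larger, the
    recurrence contracts upwards; otherwise it contracts downwards, from infinity. *)
Lemma Lz_gain z j k w : im z <> 0 -> tmp w -> ord j k (Lz z w) -> ord (S j) k w.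
Proof.
  intros hz Hw (C0 & HC). destruct (tmp_nonneg w Hw) as (p & D & D0 & HD).
  set (mu := (Ci - z)%cx). set (nu := (Ci + z)%cx).
  set (C := sqrt 2 * Rmax 0 C0). assert (Cp : 0 <= C) by (apply Rmult_le_pos; [left; apply sqrt2_pos|apply Rmax_l]).
  (* The size to be proved for [w]. Ratios of its neighbouring values tend to 1, so they do not
     spoil the contraction. *)
  set (sg := fun n => om n ^ k / om n ^ S j).
  assert (sp : forall n, 0 < sg n) by (intros n; apply Rdiv_lt_0_compat; pose proof (om_pow_pos n k); pose proof (om_pow_pos n (S j)); lra).
  assert (rec : forall m, Cmod (RtoC (om m) * mu * w m - RtoC (om (S m)) * nu * w (S (S m))) <= C * (sg (S m) * om (S m))).
  { intros m. specialize (HC (S m)).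
    assert (E : Lz z w (S m) = (RtoC (/ sqrt 2) * (RtoC (om m) * mu * w m - RtoC (om (S m)) * nu * w (S (S m))))%cx).
    { unfold Lz, sD, sM, sA, sB, mu, nu, om, wt. cbn [pred]. ring. }
    rewrite E, Cmod_mul, Cmod_RtoC, Rabs_right in HC by (left; apply inv_sqrt2_bounds).
    set (x := Cmod (_ - _)) in *. pose proof sqrt2_pos as s2. pose proof (om_pow_pos (S m) j) as W.
    pose proof (om_pow_pos (S m) k). pose proof (om_ge1 (S m)).
    apply Rmult_le_reg_r with (om (S m) ^ j * / sqrt 2); [apply Rmult_lt_0_compat; [lra|apply Rinv_0_lt_compat; auto]|].
    replace (x * (om (S m) ^ j * / sqrt 2)) with (/ sqrt 2 * x * om (S m) ^ j) by ring. eapply Rle_trans; [exact HC|].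
    unfold C, sg. cbn [pow]. 
    replace (sqrt 2 * Rmax 0 C0 * (om (S m) ^ k / (om (S m) * om (S m) ^ j) * om (S m)) * (om (S m) ^ j * / sqrt 2)) with (Rmax 0 C0 * om (S m) ^ k) by (field; lra).
    apply Rmult_le_compat_r; [lra|apply Rmax_r]. }
  set (y := fun n => Cmod (w n) / sg n).
  enough (exists B, forall m, y m <= B) as (B & HB).
  { exists B. intros n. specialize (HB n). pose proof (om_pow_pos n k). pose proof (om_pow_pos n (S j)).
    apply Rmult_le_reg_r with (/ om n ^ k); [apply Rinv_0_lt_compat; lra|].
    replace (B * om n ^ k * / om n ^ k) with B by (field; lra).
    replace (Cmod (w n) * om n ^ S j * / om n ^ k) with (Cmod (w n) / (om n ^ k / om n ^ S j)) by (field; lra). auto. }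
  assert (y0 : forall m, 0 <= y m) by (intros; apply Rdiv_le_0_compat; [apply Cmod_ge0|auto]).
  assert (wy : forall m, Cmod (w m) = y m * sg m) by (intros m; unfold y; field; specialize (sp m); lra).
  assert (ratio : forall eta, 0 < eta -> exists N, forall m, (N <= m)%nat ->
     sg m <= (1 + eta) * sg (m + 2)%nat /\ om (S m) * sg (m + 2)%nat <= (1 + eta) * (om m * sg m) /\
     sg (S m) <= (1 + eta) * sg (m + 2)%nat /\ om (S m) * sg (S m) <= (1 + eta) * (om m * sg m)).
  { intros eta he. destruct (om_ratio (S j + S k) eta he) as (N & HN). exists N. intros m hm. specialize (HN m hm).
    pose proof (om_ge1 m) as a1. pose proof (om_mono m (S m) ltac:(lia)) as a2. pose proof (om_mono (S m) (m + 2) ltac:(lia)) as a3.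
    set (Rt := om (m + 2) / om m) in *.
    assert (R1 : 1 <= Rt) by (unfold Rt; apply Rmult_le_reg_r with (om m); [lra|]; unfold Rdiv; rewrite Rmult_assoc, Rinv_l by lra; lra).
    assert (up : forall e, (e <= S j + S k)%nat -> Rt ^ e <= 1 + eta) by (intros e hle; eapply Rle_trans; [apply Rle_pow; [exact R1|exact hle]|exact HN]).
    assert (ER : om (m + 2) = Rt * om m) by (unfold Rt; field; lra).
    assert (cmp : forall x q, 0 < x -> om m <= x -> x <= q -> q <= Rt * x -> q ^ k / q ^ S j <= Rt ^ k * (x ^ k / x ^ S j) /\ x ^ k / x ^ S j <= Rt ^ S j * (q ^ k / q ^ S j)).
    { intros x q x0 _ xq qx. assert (0 < x ^ S j) by nn. assert (0 < q ^ S j) by nn.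
      assert (0 < x ^ k) by nn.
      assert (x ^ S j <= q ^ S j) by (apply pow_incr; lra). assert (q ^ S j <= Rt ^ S j * x ^ S j) by (rewrite <- Rpow_mult_distr; apply pow_incr; lra).
      assert (x ^ k <= q ^ k) by (apply pow_incr; lra). assert (q ^ k <= Rt ^ k * x ^ k) by (rewrite <- Rpow_mult_distr; apply pow_incr; lra).
      split.
      - unfold Rdiv. rewrite <- Rmult_assoc. apply Rmult_le_compat; try lra; [left; apply Rinv_0_lt_compat; auto|apply Rinv_le_contravar; auto].
      - apply Rmult_le_reg_r with (x ^ S j * q ^ S j); [apply Rmult_lt_0_compat; auto|].
        replace (x ^ k / x ^ S j * (x ^ S j * q ^ S j)) with (x ^ k * q ^ S j) by (field; lra).
        replace (Rt ^ S j * (q ^ k / q ^ S j) * (x ^ S j * q ^ S j)) with (q ^ k * (Rt ^ S j * x ^ S j)) by (field; lra).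
        nra. }
    destruct (cmp (om m) (om (m + 2)) ltac:(lra) ltac:(lra) ltac:(lra) ltac:(lra)) as [b1 b2].
    destruct (cmp (om (S m)) (om (m + 2)) ltac:(lra) ltac:(lra) ltac:(lra) ltac:(nra)) as [b3 b4].
    destruct (cmp (om m) (om (S m)) ltac:(lra) ltac:(lra) ltac:(lra) ltac:(nra)) as [b5 b6].
    fold (sg m) in *. fold (sg (m + 2)%nat) in *. fold (sg (S m)) in *.
    pose proof (sp m). pose proof (sp (m + 2)%nat).
    assert (u1 := up (S j) ltac:(lia)). assert (u2 := up (S k) ltac:(lia)). cbn [pow] in u2.
    split; [|split; [|split]].
    - nra.
    - apply Rle_trans with ((Rt * om m) * (Rt ^ k * sg m)); [apply Rmult_le_compat; try lra; nra|].
      replace (Rt * om m * (Rt ^ k * sg m)) with (Rt * Rt ^ k * (om m * sg m)) by ring. apply Rmult_le_compat_r; nra.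
    - nra.
    - apply Rle_trans with ((Rt * om m) * (Rt ^ k * sg m)); [apply Rmult_le_compat; try lra; nra|].
      replace (Rt * om m * (Rt ^ k * sg m)) with (Rt * Rt ^ k * (om m * sg m)) by ring. apply Rmult_le_compat_r; nra. }
  set (A := Cmod mu). set (B := Cmod nu). assert (A0 : 0 <= A) by apply Cmod_ge0. assert (B0 : 0 <= B) by apply Cmod_ge0.
  assert (AB : A <> B).
  { intros E. assert (E2 : A ^ 2 = B ^ 2) by nra. unfold A, B, mu, nu in E2. rewrite !Cmod_sq in E2.
    cbn [re im Cadd Csub Copp Ci] in E2. lra. }
  destruct (Rtotal_order A B) as [h|[h|h]]; [|contradiction|].
  (* The margin [eta] keeps [A * (1 + eta)] below the mean of [A] and [B], which leaves a
     contraction factor below 1. *)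
  - assert (e0 : 0 < (B - A) / (2 * (A + 1))) by nn.
    destruct (ratio ((B - A) / (2 * (A + 1))) e0) as (N & HN). set (eta := (B - A) / (2 * (A + 1))) in *.
    assert (Ae : A * (1 + eta) <= (A + B) / 2).
    { assert (2 * (A + 1) * eta = B - A) by (unfold eta; field; lra). nra. }
    apply (iter_forward y N ((A + B) / 2 / B) (C * (1 + eta) / B)).
    + split; [apply Rdiv_le_0_compat; lra|]. apply Rmult_lt_reg_r with B; [lra|]. unfold Rdiv. rewrite !Rmult_assoc, Rinv_l by lra. lra.
    + intros m hm. destruct (HN m hm) as (r1 & _ & r3 & _). specialize (rec m). replace (m + 2)%nat with (S (S m)) in * by lia.
      pose proof (Cmod_sub_lower (RtoC (om (S m)) * nu * w (S (S m))) (RtoC (om m) * mu * w m)) as T.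
      rewrite <- (Cmod_opp (_ - _)) in T.
      replace (- (RtoC (om (S m)) * nu * w (S (S m)) - RtoC (om m) * mu * w m))%cx with (RtoC (om m) * mu * w m - RtoC (om (S m)) * nu * w (S (S m)))%cx in T by ring.
      rewrite !Cmod_mul, !Cmod_RtoC, !wy in T. fold A B in T. pose proof (om_ge1 m). pose proof (om_mono m (S m) ltac:(lia)).
      rewrite !Rabs_right in T by lra. pose proof (y0 m).
      assert (F1 : om (S m) * B * (y (S (S m)) * sg (S (S m))) <= om (S m) * (A * (y m * sg m)) + om (S m) * (C * sg (S m))).
      { assert (om m * A * (y m * sg m) <= om (S m) * (A * (y m * sg m))).
        { rewrite Rmult_assoc. apply Rmult_le_compat_r; [|lra]. nn. } lra. }
      assert (F2 : B * y (S (S m)) * sg (S (S m)) <= A * y m * sg m + C * sg (S m)).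
      { nra. }
      assert (F3 : B * y (S (S m)) <= A * (1 + eta) * y m + C * (1 + eta)).
      { apply Rmult_le_reg_r with (sg (S (S m))); [auto|]. eapply Rle_trans; [exact F2|].
        assert (A * y m * sg m <= A * y m * ((1 + eta) * sg (S (S m)))) by (apply Rmult_le_compat_l; [apply Rmult_le_pos|]; auto).
        nra. }
      apply Rmult_le_reg_l with B; [lra|].
      replace (B * ((A + B) / 2 / B * y m + C * (1 + eta) / B)) with ((A + B) / 2 * y m + C * (1 + eta)) by (field; lra). nra.
  - assert (e0 : 0 < (A - B) / (2 * (B + 1))) by nn.
    destruct (ratio ((A - B) / (2 * (B + 1))) e0) as (N & HN). set (eta := (A - B) / (2 * (B + 1))) in *.
    assert (Be : B * (1 + eta) <= (A + B) / 2).
    { assert (2 * (B + 1) * eta = A - B) by (unfold eta; field; lra). nra. }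
    apply (iter_backward y N ((A + B) / 2 / A) (C * (1 + eta) / A) D (p + S j)).
    + split; [apply Rdiv_le_0_compat; lra|]. apply Rmult_lt_reg_r with A; [lra|]. unfold Rdiv. rewrite !Rmult_assoc, Rinv_l by lra. lra.
    + intros m hm. destruct (HN m hm) as (_ & r2 & _ & r4). specialize (rec m). replace (m + 2)%nat with (S (S m)) in * by lia.
      pose proof (Cmod_sub_lower (RtoC (om m) * mu * w m) (RtoC (om (S m)) * nu * w (S (S m)))) as T.
      rewrite !Cmod_mul, !Cmod_RtoC, !wy in T. fold A B in T. pose proof (om_ge1 m). pose proof (om_mono m (S m) ltac:(lia)).
      rewrite !Rabs_right in T by lra. pose proof (y0 (S (S m))). pose proof (sp m).
      assert (F3 : A * y m <= B * (1 + eta) * y (S (S m)) + C * (1 + eta)).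
      { apply Rmult_le_reg_r with (om m * sg m); [apply Rmult_lt_0_compat; lra|].
        assert (B * y (S (S m)) * (om (S m) * sg (S (S m))) <= B * y (S (S m)) * ((1 + eta) * (om m * sg m))) by (apply Rmult_le_compat_l; [apply Rmult_le_pos|]; auto).
        nra. }
      apply Rmult_le_reg_l with A; [lra|].
      replace (A * ((A + B) / 2 / A * y (S (S m)) + C * (1 + eta) / A)) with ((A + B) / 2 * y (S (S m)) + C * (1 + eta)) by (field; lra). nra.
    + intros m. split; [auto|]. unfold y, sg. pose proof (om_pow_pos m k). pose proof (om_pow_pos m (S j)) as o1.
      replace (Cmod (w m) / (om m ^ k / om m ^ S j)) with (Cmod (w m) * om m ^ S j * / om m ^ k) by (field; lra).
      assert (i1 : 0 < / om m ^ k <= 1) by (split; [apply Rinv_0_lt_compat; lra|rewrite <- Rinv_1; apply Rinv_le_contravar; lra]).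
      assert (o2 : om m ^ S j <= wt m ^ S j) by (rewrite <- om_sq; apply pow_incr; pose proof (om_ge1 m); nra).
      assert (0 <= Cmod (w m) * om m ^ S j) by nn.
      apply Rle_trans with (Cmod (w m) * om m ^ S j); [nra|]. rewrite pow_add, <- Rmult_assoc. apply Rmult_le_compat; auto using Cmod_ge0; lra.
Qed.

Lemma ord_bound j k w : ord j k w -> exists C, 0 <= C /\ forall n, Cmod (w n) * om n ^ j <= C * om n ^ k.
Proof.
  intros [C H]. exists C. split; auto. specialize (H 0%nat). pose proof (om_pow_pos 0 k). pose proof (om_pow_pos 0 j). pose proof (Cmod_ge0 (w 0%nat)).
  nra.
Qed.
Lemma ord_add j k v w : ord j k v -> ord j k w -> ord j k (fun n => v n + w n)%cx.
Proof.
  intros [C H] [D G]. exists (C + D). intros n. specialize (H n). specialize (G n). pose proof (om_pow_pos n j).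
  pose proof (Cmod_tri (v n) (w n)). nra.
Qed.
Lemma ord_scal c j k w : ord j k w -> ord j k (fun n => c * w n)%cx.
Proof.
  intros [C H]. exists (Cmod c * C). intros n. rewrite Cmod_mul, !Rmult_assoc.
  apply Rmult_le_compat_l; [apply Cmod_ge0|auto].
Qed.
Lemma ord_ext j k v w : (forall n, v n = w n) -> ord j k v -> ord j k w.
Proof. intros E [C H]. exists C. intros n. rewrite <- E. auto. Qed.
Lemma ord_S j k w : ord j k w -> ord j (S k) w.
Proof.
  intros H. destruct (ord_bound _ _ _ H) as (C & c0 & B). exists C. intros n. eapply Rle_trans; [apply B|].
  apply Rmult_le_compat_l; auto. cbn [pow]. pose proof (om_pow_pos n k). pose proof (om_ge1 n). nra.
Qed.
Lemma ord_rap j k w : rap w -> ord j k w.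
Proof.
  intros H. destruct (H j) as [B HB]. exists B. intros n. specialize (HB n). pose proof (om_pow_pos n k).
  assert (om n ^ j <= wt n ^ j) by (rewrite <- om_sq; apply pow_incr; pose proof (om_ge1 n); nra).
  pose proof (om_pow_pos n j). pose proof (Cmod_ge0 (w n)).
  assert (b1 : Cmod (w n) * om n ^ j <= B) by nra.
  assert (0 <= Cmod (w n) * om n ^ j) by nra. nra.
Qed.
Lemma om_succ n : om (S n) <= 2 * om n.
Proof.
  pose proof (om_ge1 n). pose proof (om_sq n). pose proof (om_sq (S n)).
  assert (wt (S n) <= 2 * wt n) by (unfold wt; rewrite !S_INR; pose proof (pos_INR n); lra). nra.
Qed.
Lemma ord_sA j k w : ord j k w -> ord j (S k) (sA w).
Proof.
  intros H. destruct (ord_bound _ _ _ H) as (C & c0 & B). exists (2 ^ j * C). intros n. unfold sA. rewrite Cmod_mul, Cmod_RtoC.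
  rewrite Rabs_right by (apply Rle_ge, sqrt_pos). pose proof (om_ge1 n) as o1.
  assert (s : sqrt (INR n) <= om n) by (apply sqrt_le_1_alt; unfold wt; rewrite S_INR; lra).
  assert (p : om n <= 2 * om (pred n)) by (destruct n; [cbn [pred]; lra|apply om_succ]).
  assert (q : om (pred n) ^ k <= om n ^ k) by (apply pow_incr; split; [lra|apply om_mono; lia]).
  assert (r : om n ^ j <= 2 ^ j * om (pred n) ^ j) by (rewrite <- Rpow_mult_distr; apply pow_incr; lra).
  specialize (B (pred n)). pose proof (Cmod_ge0 (w (pred n))). pose proof (sqrt_pos (INR n)). assert (0 < 2 ^ j) by nn.
  pose proof (om_pow_pos n j).
  assert (t : Cmod (w (pred n)) * om n ^ j <= 2 ^ j * (C * om n ^ k)).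
  { apply Rle_trans with (Cmod (w (pred n)) * (2 ^ j * om (pred n) ^ j)); [apply Rmult_le_compat_l; auto|].
    replace (Cmod (w (pred n)) * (2 ^ j * om (pred n) ^ j)) with (2 ^ j * (Cmod (w (pred n)) * om (pred n) ^ j)) by ring.
    apply Rmult_le_compat_l; [lra|]. nra. }
  rewrite Rmult_assoc. cbn [pow]. replace (2 ^ j * C * (om n * om n ^ k)) with (om n * (2 ^ j * (C * om n ^ k))) by ring.
  apply Rmult_le_compat; auto. nra.
Qed.
Lemma ord_sB j k w : ord j k w -> ord j (S k) (sB w).
Proof.
  intros H. destruct (ord_bound _ _ _ H) as (C & c0 & B). exists (2 ^ k * C). intros n. unfold sB. rewrite Cmod_mul, Cmod_RtoC.
  rewrite Rabs_right by (apply Rle_ge, sqrt_pos). pose proof (om_ge1 n) as o1.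
  assert (s : sqrt (INR (S n)) <= om n) by easy.
  assert (q : om (S n) ^ k <= 2 ^ k * om n ^ k) by (rewrite <- Rpow_mult_distr; apply pow_incr; pose proof (om_ge1 (S n)); pose proof (om_succ n); lra).
  assert (r : om n ^ j <= om (S n) ^ j) by (apply pow_incr; split; [lra|apply om_mono; lia]).
  specialize (B (S n)). pose proof (Cmod_ge0 (w (S n))). pose proof (sqrt_pos (INR (S n))). pose proof (om_pow_pos n j).
  assert (t : Cmod (w (S n)) * om n ^ j <= C * (2 ^ k * om n ^ k)).
  { nra. }
  rewrite Rmult_assoc. cbn [pow]. replace (2 ^ k * C * (om n * om n ^ k)) with (om n * (C * (2 ^ k * om n ^ k))) by ring.
  apply Rmult_le_compat; auto. nra.
Qed.
Lemma ord_sMD j k w : ord j k w -> ord j (S k) (sM w) /\ ord j (S k) (sD w).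
Proof.
  intros H. apply ord_sA in H as A. apply ord_sB in H as B. split.
  - apply ord_ext with (fun n => RtoC (/ sqrt 2) * (sA w n + sB w n))%cx; [intros; unfold sM; ring|]. apply ord_scal, ord_add; auto.
  - apply ord_ext with (fun n => Ci * RtoC (/ sqrt 2) * (sA w n + (- C1) * sB w n))%cx; [intros; unfold sD; ring|]. apply ord_scal, ord_add; auto.
    apply ord_scal; auto.
Qed.
Lemma tmp_ord w : tmp w -> exists k, ord 0 k w.
Proof.
  intros (K & B & H). exists (2 * K)%nat, B. intros n. rewrite pow_mult, om_sq. specialize (H n). lra.
Qed.
Lemma ord_all_rap w k : (forall i, ord (2 * i) (k + i) w) -> rap w.
Proof.
  intros H K. destruct (ord_bound _ _ _ (H (k + 2 * K)%nat)) as (C & c0 & HC). exists C. intros n. specialize (HC n).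
  replace (2 * (k + 2 * K))%nat with (k + (k + 2 * K) + 2 * K)%nat in HC by lia. rewrite pow_add, (pow_mult _ 2), om_sq in HC.
  pose proof (om_pow_pos n (k + (k + 2 * K))). nra.
Qed.

(** With [a20 (D - z1 M) (D - z2 M)] as principal part and [z1], [z2] not real, each factor gains half
    an order in the Hermite scale while the lower order terms lose only half an order. *)
Lemma elliptic_GR a z1 z2 : a 2%nat 0%nat <> C0 -> im z1 <> 0 -> im z2 <> 0 ->
  a 1%nat 1%nat = (- (a 2%nat 0%nat * (z1 + z2)))%cx -> a 0%nat 2%nat = (a 2%nat 0%nat * (z1 * z2))%cx -> GRs a.
Proof.
  intros h0 h1 h2 E1 E2 w Hw Hr. set (q := a 2%nat 0%nat) in *.
  set (low := fun n => (a 1%nat 0%nat * sD w n + (a 0%nat 1%nat * sM w n + (a 0%nat 0%nat - Ci * (q * z2)) * w n))%cx).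
  assert (E : forall n, Lz z1 (Lz z2 w) n = (Cinv q * (P1 a w n + (- C1) * low n))%cx).
  { intros n. assert (S : (q * Cinv q)%cx = C1) by (eapply eq_trans; [|apply Cinv_l; eassumption]; ring).
    transitivity ((q * Cinv q) * Lz z1 (Lz z2 w) n)%cx; [rewrite S; ring|]. unfold Lz, low, P1, pol. rewrite E1, E2. fold q.
    replace (fun n0 => (sD w n0 - z2 * sM w n0)%cx) with (fun n0 => (C1 * sD w n0 + (- z2) * sM w n0)%cx) by (apply functional_extensionality; intros; ring).
    rewrite sD_lin, sM_lin, sD_sM_comm. ring. }
  destruct (tmp_ord w Hw) as [k Hk]. apply (ord_all_rap w k). induction i as [|i IH].
  { replace (k + 0)%nat with k by lia. auto. }
  replace (2 * S i)%nat with (S (S (2 * i))) by lia. replace (k + S i)%nat with (S (k + i)) by lia.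
  destruct (ord_sMD _ _ _ IH) as [oM oD].
  apply (Lz_gain z2); auto. apply (Lz_gain z1); auto.
  { unfold Lz. apply tmp_ext with (fun n => sD w n + (- z2) * sM w n)%cx; [intros; ring|]. tmps. }
  apply ord_ext with (1 := fun n => eq_sym (E n)). apply ord_scal, ord_add; [apply ord_rap; auto|].
  apply ord_scal. repeat apply ord_add; apply ord_scal; auto. apply ord_S; auto.
Qed.
Lemma elliptic_dichotomy a z1 z2 : a 2%nat 0%nat <> C0 -> im z1 <> 0 -> im z2 <> 0 ->
  a 1%nat 1%nat = (- (a 2%nat 0%nat * (z1 + z2)))%cx -> a 0%nat 2%nat = (a 2%nat 0%nat * (z1 * z2))%cx -> dichotomy a.
Proof.
  intros h0 h1 h2 E1 E2 _. left. split; [apply (elliptic_GR a z1 z2); auto|].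
  apply (elliptic_GR _ (- z1)%cx (- z2)%cx); cbn [tr]; auto; try (cxsimpl; lra).
  - rewrite E1. ring. - rewrite E2. ring.
Qed.
(** A real root of the principal symbol can be rotated to infinity. *)
Lemma dichotomy_of_first_order :
  (forall a, a 2%nat 0%nat = C0 -> dichotomy a) -> forall a, dichotomy a.
Proof.
  intros H a. destruct (classic (a 2%nat 0%nat = C0)) as [h|h]; auto.
  set (q := a 2%nat 0%nat) in *. destruct (Cx_sqrt_ex ((a 1%nat 1%nat * a 1%nat 1%nat - (C1 + C1 + C1 + C1) * q * a 0%nat 2%nat))%cx) as (d & Hd).
  set (z1 := ((d - a 1%nat 1%nat) * Cinv ((C1 + C1) * q))%cx). set (z2 := ((- d - a 1%nat 1%nat) * Cinv ((C1 + C1) * q))%cx).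
  assert (h2 : ((C1 + C1) * q)%cx <> C0).
  { intros E. apply Cmul_eq0 in E. destruct E as [E|E]; auto. apply (f_equal re) in E. cbn in E. lra. }
  assert (S : ((C1 + C1) * q * Cinv ((C1 + C1) * q))%cx = C1) by (eapply eq_trans; [|apply Cinv_l; eassumption]; ring). set (v := Cinv _) in *.
  assert (E1 : a 1%nat 1%nat = (- (q * (z1 + z2)))%cx).
  { transitivity (a 1%nat 1%nat * ((C1 + C1) * q * v))%cx; [rewrite S; ring|]. unfold z1, z2. ring. }
  assert (E2 : a 0%nat 2%nat = (q * (z1 * z2))%cx).
  { assert (X : ((C1 + C1) * q * ((C1 + C1) * q) * a 0%nat 2%nat)%cx = ((C1 + C1) * q * ((C1 + C1) * q) * (q * (z1 * z2)))%cx).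
    { unfold z1, z2. transitivity (q * (((C1 + C1) * q * v) * ((C1 + C1) * q * v)) * ((a 1%nat 1%nat * a 1%nat 1%nat) - d * d))%cx; [rewrite S, Hd|]; ring. }
    transitivity (((C1 + C1) * q * v) * ((C1 + C1) * q * v) * a 0%nat 2%nat)%cx; [rewrite S; ring|].
    transitivity (v * v * ((C1 + C1) * q * ((C1 + C1) * q) * a 0%nat 2%nat))%cx; [ring|]. rewrite X.
    transitivity ((((C1 + C1) * q * v) * ((C1 + C1) * q * v)) * (q * (z1 * z2)))%cx; [ring|]. rewrite S. ring. }
  assert (real : forall y : R, (RtoC (y * y) * q + RtoC y * a 1%nat 1%nat + a 0%nat 2%nat = C0)%cx -> dichotomy a).
  { intros y Hy. set (t := / sqrt (1 + y ^ 2)).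
    assert (t2 : t ^ 2 * (1 + y ^ 2) = 1).
    { unfold t. rewrite pow_inv, <- Rsqr_pow2, Rsqr_sqrt by nra. field. nra. }
    apply (dichotomy_rota (y * t) (- t)); [rewrite <- t2; ring|]. apply H. cbn [rota]. fold q.
    transitivity (RtoC (t * t) * (RtoC (y * y) * q + RtoC y * a 1%nat 1%nat + a 0%nat 2%nat))%cx; [|rewrite Hy; ring].
    apply Cx_ext; cxsimpl; ring. }
  destruct (Req_dec (im z1) 0) as [i1|i1].
  { apply (real (re z1)). replace (RtoC (re z1 * re z1)) with (z1 * z1)%cx by (apply Cx_ext; cxsimpl; rewrite i1; ring).
    replace (RtoC (re z1)) with z1 by (apply Cx_ext; cxsimpl; auto). rewrite E1, E2. ring. }
  destruct (Req_dec (im z2) 0) as [i2|i2].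
  { apply (real (re z2)). replace (RtoC (re z2 * re z2)) with (z2 * z2)%cx by (apply Cx_ext; cxsimpl; rewrite i2; ring).
    replace (RtoC (re z2)) with z2 by (apply Cx_ext; cxsimpl; auto). rewrite E1, E2. ring. }
  apply (elliptic_dichotomy a z1 z2); auto.
Qed.

(** * First-order operators *)

Definition moder (Y : R -> Cx) : Prop :=
  (forall x, ccont Y x) /\ exists A K, 0 <= A /\ forall x, Cmod (Y x) <= A * (1 + x ^ 2) ^ K.
Lemma sq_pow_ge1 x K : 1 <= (1 + x ^ 2) ^ K.
Proof. apply pow_R1_Rle. nra. Qed.
Lemma moder_const c : moder (fun _ => c).
Proof. split; [intros; apply ccont_const|]. exists (Cmod c), 0%nat. nn. Qed.
Lemma moder_id : moder RtoC.
Proof.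
  split; [intros; apply ccont_id|]. exists 1, 1%nat. split; [lra|]. intros x. rewrite Cmod_RtoC. unfold Rabs. destruct (Rcase_abs x); nra.
Qed.
Lemma moder_mul f g : moder f -> moder g -> moder (fun x => f x * g x)%cx.
Proof.
  intros [c1 (A & K & A0 & H)] [c2 (B & L & B0 & G)]. split; [intros; apply ccont_mul; auto|].
  exists (A * B), (K + L)%nat. split; [apply Rmult_le_pos; auto|]. intros x. rewrite Cmod_mul, pow_add.
  replace (A * B * ((1 + x ^ 2) ^ K * (1 + x ^ 2) ^ L)) with (A * (1 + x ^ 2) ^ K * (B * (1 + x ^ 2) ^ L)) by ring.
  apply Rmult_le_compat; auto using Cmod_ge0.
Qed.
Lemma moder_add f g : moder f -> moder g -> moder (fun x => f x + g x)%cx.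
Proof.
  intros [c1 (A & K & A0 & H)] [c2 (B & L & B0 & G)]. split; [intros; apply ccont_add; auto|].
  exists (A + B), (K + L)%nat. split; [lra|]. intros x. eapply Rle_trans; [apply Cmod_tri|]. specialize (H x). specialize (G x).
  pose proof (sq_pow_ge1 x K). pose proof (sq_pow_ge1 x L). rewrite pow_add, Rmult_plus_distr_r.
  apply Rplus_le_compat; (eapply Rle_trans; [eassumption|apply Rmult_le_compat_l; auto; nra]).
Qed.
Lemma moder_ext f g : (forall x, f x = g x) -> moder f -> moder g.
Proof. intros E. rewrite (functional_extensionality _ _ E). auto. Qed.
Ltac moders := cbv beta; match goal with
  | |- moder (fun x => Cadd (@?f x) (@?g x)) => apply (moder_add f g); moders
  | |- moder (fun x => Cmul (@?f x) (@?g x)) => apply (moder_mul f g); moders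
  | |- moder (fun x => RtoC x) => exact moder_id
  | |- moder RtoC => exact moder_id
  | |- moder (fun _ => ?c) => exact (moder_const c)
  | |- _ => idtac
  end.
Lemma moder_schwartz F n : schwartz1 F -> moder (F n).
Proof.
  intros H. split; [intros; apply schwartz1_ccont; auto|]. destruct (schwartz1_weight F H n 0) as (C & c0 & HC). exists C, 0%nat.
  split; auto. intros x. specialize (HC x). lra.
Qed.
Lemma moder_cnice Y F n : moder Y -> schwartz1 F -> cnice (fun x => Y x * F n x)%cx.
Proof. intros [c (A & K & _ & H)] HF. eapply schwartz1_mul_nice; eauto. Qed.

(** Hermite coefficients of the distribution given by a function of polynomial growth. *)
Definition fs (Y : R -> Cx) : nat -> Cx := fun n => CI (fun x => Y x * hfam n 0 x)%cx.
Lemma tempered1_fun Y : moder Y -> tempered1 (fun F => CI (fun x => Y x * F 0%nat x)%cx).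
Proof.
  intros HY. split; [|split].
  - intros F G HF HG. rewrite <- CI_add by (apply moder_cnice; auto). apply CI_ext. intros; unfold fam1_add; ring.
  - intros c F HF. rewrite <- CI_scal by (apply moder_cnice; auto). apply CI_ext. intros; unfold fam1_scal; ring.
  - pose proof HY as [c (A & K & A0 & H)]. exists (2 * S K)%nat, (8 * (A * (2 ^ S K * 2))). intros F Mb HF HM.
    rewrite (Rmult_assoc 8). apply CI_bound; [apply moder_cnice; auto|]. intros x. rewrite Cmod_mul. specialize (H x).
    pose proof (one_sq_pow_le x (S K)) as P. pose proof (HM 0%nat 0%nat x ltac:(lia) ltac:(lia)) as B1.
    pose proof (HM (2 * S K)%nat 0%nat x ltac:(lia) ltac:(lia)) as B2. pose proof (Cmod_ge0 (F 0%nat x)) as f0. set (f := Cmod (F 0%nat x)) in *.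
    assert (0 < 2 ^ S K) by nn.
    apply Rle_trans with (A * ((1 + x ^ 2) ^ S K * f)).
    { replace (A * ((1 + x ^ 2) ^ S K * f)) with (A * (1 + x ^ 2) ^ K * f * (1 + x ^ 2)) by (cbn [pow]; ring).
      apply Rmult_le_compat_r; [nra|]. nra. }
    rewrite (Rmult_assoc A). apply Rmult_le_compat_l; auto.
    nra.
Qed.
Lemma tmp_fs Y : moder Y -> tmp (fs Y).
Proof. intros H. exact (tmp_hat1 _ (tempered1_fun Y H)). Qed.
Lemma pair_fs Y F : moder Y -> schwartz1 F -> pair (fs Y) (cf F) = CI (fun x => Y x * F 0%nat x)%cx.
Proof. intros H HF. symmetry. exact (tempered1_repr _ F (tempered1_fun Y H) HF). Qed.
Lemma fs_schwartz F : schwartz1 F -> forall n, fs (F 0%nat) n = cf F n.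
Proof. intros H n. apply CI_ext. intros; ring. Qed.

(** A single integration by parts differentiates only the product of [Y] with the leading
    coefficient. At a zero of that coefficient [Y] may therefore be merely continuous, as the
    singular solutions will be. *)
Lemma fs_P1 a Y dG : a 2%nat 0%nat = C0 -> moder Y -> moder dG ->
  (forall x, cder (fun x => (a 1%nat 1%nat * RtoC x + a 1%nat 0%nat) * Y x)%cx x (dG x)) ->
  forall n, P1 a (fs Y) n = fs (fun x => - Ci * (dG x - a 1%nat 1%nat * Y x)
     + (a 0%nat 0%nat + a 0%nat 1%nat * RtoC x + a 0%nat 2%nat * (RtoC x * RtoC x)) * Y x)%cx n.
Proof.
  intros E HY HG HD n. set (m := fun x => (a 1%nat 1%nat * RtoC x + a 1%nat 0%nat)%cx).
  set (f := fun x => (- Ci * (dG x - a 1%nat 1%nat * Y x) + (a 0%nat 0%nat + a 0%nat 1%nat * RtoC x + a 0%nat 2%nat * (RtoC x * RtoC x)) * Y x)%cx).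
  assert (Mm : moder m) by (unfold m; moders).
  assert (Mf : moder f).
  { apply moder_ext with (fun x => (- Ci * (dG x + (- a 1%nat 1%nat) * Y x) + (a 0%nat 0%nat + a 0%nat 1%nat * RtoC x + a 0%nat 2%nat * (RtoC x * RtoC x)) * Y x)%cx); [intros; unfold f; ring|].
    moders; auto. }
  set (H := hfam n). assert (SH : schwartz1 H) by apply schwartz1_hfam. assert (SL : schwartz1 (pfam (tr a) H)) by (apply schwartz1_pfam; auto).
  rewrite <- (pair_hfam (P1 a (fs Y)) n), <- (pair_hfam (fs f) n). fold H. rewrite <- pair_pfam by (auto; apply tmp_fs; auto).
  rewrite !pair_fs by auto. 
  assert (Z : CI (fun x => Y x * pfam (tr a) H 0%nat x - f x * H 0%nat x)%cx = C0).
  { pose proof (moder_mul _ _ Mm HY) as MY. destruct (moder_cnice _ H 0 MY SH) as [_ [C HC]].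
    pose proof (moder_cnice _ H 0 HG SH) as [c1 _]. pose proof (moder_cnice _ H 1 MY SH) as [c2 _].
    apply (CI_deriv (fun x => Ci * (m x * Y x * H 0%nat x))%cx _ C).
    - intros x. eapply cder_eq; [apply cder_scal, cder_mul; [apply HD|apply (schwartz1_cder H SH)]|].
      unfold pfam, f, m, tD1, tM1. cbn [tr pred INR]. rewrite E. change (RtoC 0) with C0. ring.
    - intros x. apply ccont_ext with (fun x => Ci * (dG x * H 0%nat x + m x * Y x * H 1%nat x))%cx.
      + intros t. unfold pfam, f, m, tD1, tM1. cbn [tr pred INR]. rewrite E. change (RtoC 0) with C0. ring.
      + apply ccont_mul; [apply ccont_const|]. apply ccont_add; auto.
    - intros x. rewrite Cmod_mul, Cmod_Ci, Rmult_1_l. auto. }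
  rewrite CI_sub in Z by (apply moder_cnice; auto). set (u := CI _) in *. set (v := CI (fun x => f x * H 0%nat x)%cx) in *.
  transitivity (u - v + v)%cx; [ring|]. rewrite Z. ring.
Qed.

(** * Complex exponential and reciprocal *)

Definition cexp (z : Cx) : Cx := mkC (exp (re z) * cos (im z)) (exp (re z) * sin (im z)).
Lemma Cmod_cexp z : Cmod (cexp z) = exp (re z).
Proof.
  pose proof (exp_pos (re z)). unfold Cmod, cexp. cbn [re im].
  replace (_ + _) with (exp (re z) ^ 2 * (Rsqr (sin (im z)) + Rsqr (cos (im z)))) by (unfold Rsqr; ring).
  rewrite sin2_cos2, Rmult_1_r. apply sqrt_pow2. lra.
Qed.
Lemma cexp_neg z : (cexp (- z) * cexp z)%cx = C1.
Proof.
  assert (E : exp (- re z) * exp (re z) = 1) by (rewrite <- exp_plus, Rplus_opp_l, exp_0; reflexivity).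
  pose proof (sin2_cos2 (im z)) as T. unfold Rsqr in T. unfold cexp. cbn [re im Copp]. rewrite cos_neg, sin_neg.
  apply Cx_ext; cbn [re im Cmul C1]; [|ring].
  nra.
Qed.
Lemma cexp_neq0 z : cexp z <> C0.
Proof. intros E. pose proof (exp_pos (re z)) as P. rewrite <- Cmod_cexp, E, Cmod_C0 in P. lra. Qed.
Lemma cder_cexp f x l : cder f x l -> cder (fun t => cexp (f t)) x (l * cexp (f x))%cx.
Proof.
  intros [H1 H2].
  assert (E : is_derive (fun t => exp (re (f t))) x (re l * exp (re (f x)))).
  { eapply is_derive_eq; [exact (is_derive_comp exp (fun t => re (f t)) x _ _ (proj2 (is_derive_Reals exp _ _) (derivable_pt_lim_exp _)) H1)|]. auto. }
  assert (C : is_derive (fun t => cos (im (f t))) x (im l * - sin (im (f x)))).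
  { eapply is_derive_eq; [exact (is_derive_comp cos (fun t => im (f t)) x _ _ (proj2 (is_derive_Reals cos _ _) (derivable_pt_lim_cos _)) H2)|]. auto. }
  assert (S : is_derive (fun t => sin (im (f t))) x (im l * cos (im (f x)))).
  { eapply is_derive_eq; [exact (is_derive_comp sin (fun t => im (f t)) x _ _ (proj2 (is_derive_Reals sin _ _) (derivable_pt_lim_sin _)) H2)|]. auto. }
  split; cbn [re im cexp Cmul].
  - eapply is_derive_eq; [exact (is_derive_mult_R _ _ x _ _ E C)|]. lra.
  - eapply is_derive_eq; [exact (is_derive_mult_R _ _ x _ _ E S)|]. lra.
Qed.
Lemma cder_inv f x l : cder f x l -> (forall t, f t <> C0) -> cder (fun t => Cinv (f t)) x (- (l * Cinv (f x) * Cinv (f x)))%cx.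
Proof.
  intros [H1 H2] N. assert (P : forall t, 0 < re (f t) ^ 2 + im (f t) ^ 2).
  { intros t. destruct (Rle_lt_or_eq_dec 0 (re (f t) ^ 2 + im (f t) ^ 2)) as [h|h]; auto.
    - nra.
    - exfalso. apply (N t). apply Cmod_eq0. unfold Cmod. rewrite <- h. apply sqrt_0. }
  set (X := re (f x)) in *. set (Y := im (f x)) in *. pose proof (P x) as Px. fold X Y in Px.
  assert (D1 : is_derive (fun t => re (f t) ^ 2 + im (f t) ^ 2) x (2 * (X * re l + Y * im l))).
  { pose proof (is_derive_mult_R _ _ x _ _ H1 H1) as A. pose proof (is_derive_mult_R _ _ x _ _ H2 H2) as B. cbv beta in A, B. fold X Y in A, B.
    eapply is_derive_ext; [|eapply is_derive_eq; [exact (is_derive_plus (V := R_NormedModule) _ _ x _ _ A B)|cbn; ring]]. intros; cbn; ring. }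
  assert (D2 : is_derive (fun t => / (re (f t) ^ 2 + im (f t) ^ 2)) x (- (2 * (X * re l + Y * im l)) / (X ^ 2 + Y ^ 2) ^ 2)).
  { apply (is_derive_inv (fun t => re (f t) ^ 2 + im (f t) ^ 2)); auto. fold X Y. lra. }
  split; cbn [re im Cmul Copp].
  - eapply is_derive_ext; [|eapply is_derive_eq; [exact (is_derive_mult_R _ _ x _ _ H1 D2)|]]; [intros; cbn; unfold Rdiv; reflexivity|cbn]. fold X Y. field. lra.
  - eapply is_derive_ext; [|eapply is_derive_eq; [exact (is_derive_mult_R _ _ x _ _ (is_derive_opp (V := R_NormedModule) _ _ _ H2) D2)|]]; [intros; cbn; unfold Rdiv; reflexivity|cbn]. fold X Y. field. lra.
Qed.
(** [v] will satisfy [v' = p v^2], like the reciprocal of an affine function. The class is then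
    closed under differentiation as soon as the generators have their derivatives in it: smoothness
    follows without formulas for higher derivatives. *)
Inductive cls (B : (R -> Cx) -> Prop) (v : R -> Cx) : (R -> Cx) -> Prop :=
| cls_base f : B f -> cls B v f
| cls_add f g : cls B v f -> cls B v g -> cls B v (fun x => f x + g x)%cx
| cls_scal c f : cls B v f -> cls B v (fun x => c * f x)%cx
| cls_x f : cls B v f -> cls B v (fun x => RtoC x * f x)%cx
| cls_v f : cls B v f -> cls B v (fun x => v x * f x)%cx.
Lemma cls_cder (D : R -> Prop) B v p :
  (forall x, D x -> cder v x (p * (v x * v x))%cx) ->
  (forall f, B f -> exists g, cls B v g /\ forall x, D x -> cder f x (g x)) ->
  forall f, cls B v f -> exists g, cls B v g /\ forall x, D x -> cder f x (g x).
Proof.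
  intros Hv HB f H. induction H as [f H|f g H1 (f' & a1 & b1) H2 (g' & a2 & b2)|c f H (f' & a1 & b1)|f H (f' & a1 & b1)|f H (f' & a1 & b1)].
  - auto.
  - exists (fun x => f' x + g' x)%cx. split; [apply cls_add; auto|]. intros; apply cder_add; auto.
  - exists (fun x => c * f' x)%cx. split; [apply cls_scal; auto|]. intros; apply cder_scal; auto.
  - exists (fun x => RtoC x * f' x + f x)%cx. split; [apply cls_add; auto; apply cls_x; auto|].
    intros x Dx. eapply cder_eq; [apply cder_mul; [apply cder_id|apply b1; auto]|cbn; ring].
  - exists (fun x => v x * f' x + p * (v x * (v x * f x)))%cx. split; [apply cls_add; [apply cls_v; auto|apply cls_scal, cls_v, cls_v; auto]|].
    intros x Dx. eapply cder_eq; [apply cder_mul; [apply Hv; auto|apply b1; auto]|cbn; ring].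
Qed.
(** The derivative family is obtained by choosing derivatives inside the class, one after the
    other. *)
Lemma fam_of_closed (K : (R -> Cx) -> Prop) :
  (forall f, K f -> exists g, K g /\ forall x, cder f x (g x)) ->
  (forall f, K f -> forall j, exists C, forall x, Rabs x ^ j * Cmod (f x) <= C) ->
  forall f, K f -> exists F, schwartz1 F /\ F 0%nat = f.
Proof.
  intros H1 H2 f Hf.
  set (nx := fun q : {f | K f} => constructive_indefinite_description _ (H1 (proj1_sig q) (proj2_sig q))).
  set (nxt := fun q : {f | K f} => exist K (proj1_sig (nx q)) (proj1 (proj2_sig (nx q)))).
  exists (fun n => proj1_sig (Nat.iter n nxt (exist K f Hf))). split; [|reflexivity]. apply schwartz1_mk.
  - intros n x. exact (proj2 (proj2_sig (nx (Nat.iter n nxt (exist K f Hf)))) x).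
  - intros j n. apply H2. apply proj2_sig.
Qed.

Definition rapidf (f : R -> Cx) : Prop := forall j, exists C, forall x, Rabs x ^ j * Cmod (f x) <= C.
Lemma rapidf_add f g : rapidf f -> rapidf g -> rapidf (fun x => f x + g x)%cx.
Proof.
  intros H G j. destruct (H j) as [C HC]. destruct (G j) as [D HD]. exists (C + D). intros x. specialize (HC x). specialize (HD x).
  assert (0 <= Rabs x ^ j) by nn. pose proof (Cmod_tri (f x) (g x)). 
  nra.
Qed.
Lemma rapidf_bmul v f A : (forall x, Cmod (v x) <= A) -> rapidf f -> rapidf (fun x => v x * f x)%cx.
Proof.
  intros Hv H j. destruct (H j) as [C HC]. exists (A * C). intros x. rewrite Cmod_mul.
  replace (Rabs x ^ j * (Cmod (v x) * Cmod (f x))) with (Cmod (v x) * (Rabs x ^ j * Cmod (f x))) by ring.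
  apply Rmult_le_compat; auto using Cmod_ge0. nn.
Qed.
Lemma rapidf_x f : rapidf f -> rapidf (fun x => RtoC x * f x)%cx.
Proof. intros H j. destruct (H (S j)) as [C HC]. exists C. intros x. rewrite Cmod_mul, Cmod_RtoC. specialize (HC x). cbn [pow] in HC. lra. Qed.
Lemma rapidf_schwartz F n : schwartz1 F -> rapidf (F n).
Proof. intros [_ H] j. auto. Qed.
Lemma cls_rapid B v A : (forall x, Cmod (v x) <= A) -> (forall f, B f -> rapidf f) -> forall f, cls B v f -> rapidf f.
Proof.
  intros Hv HB f H. induction H as [f H|f g H1 I1 H2 I2|c f H I|f H I|f H I]; auto.
  - apply rapidf_add; auto. - apply (rapidf_bmul (fun _ => c) f (Cmod c)); auto. nn.
  - apply rapidf_x; auto. - apply rapidf_bmul with A; auto.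
Qed.
Lemma cls_schwartz B v A p :
  (forall x, Cmod (v x) <= A) -> (forall x, cder v x (p * (v x * v x))%cx) ->
  (forall f, B f -> rapidf f /\ exists g, cls B v g /\ forall x, cder f x (g x)) ->
  forall f, cls B v f -> exists F, schwartz1 F /\ F 0%nat = f.
Proof.
  intros Hv Hd HB. apply fam_of_closed.
  - intros f Hf. destruct (cls_cder (fun _ => True) B v p) with f as (g & H1 & H2); auto.
    + intros h Hh. destruct (HB h Hh) as (_ & g & G1 & G2). eauto. + exists g. auto.
  - intros f Hf. apply (cls_rapid B v A Hv); auto. intros h Hh. apply HB; auto.
Qed.

(** * Differential inequalities at infinity *)

Lemma is_derive_pow_id n (s : R) : is_derive (fun s => s ^ n) s (INR n * s ^ pred n).
Proof. eapply is_derive_eq; [exact (is_derive_pow (fun s => s) n s 1 (is_derive_id s))|change (INR n * 1 * s ^ pred n = INR n * s ^ pred n); ring]. Qed.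
Ltac rring := cbv beta; match goal with |- ?a = ?b => change (@eq R a b) end; ring.
Lemma is_derive_sub_const (f : R -> R) l c s : is_derive f s l -> is_derive (fun t => f t - c) s l.
Proof.
  intros H. eapply is_derive_eq; [exact (is_derive_minus (V := R_NormedModule) _ _ s _ _ H (is_derive_const c s))|].
  change (l - 0 = l). ring.
Qed.
(** Half of the damping [e] absorbs the derivative of [t ^ j] once [t >= 2 j / e]; the other half
    makes [(t ^ j * V t - L) * exp (e / 2 * t)] nonincreasing. *)
Lemma decay_of_damping (V dV : R -> R) e X0 :
  0 < e -> 1 <= X0 -> (forall t, X0 <= t -> is_derive V t (dV t)) -> (forall t, 0 <= V t) ->
  (forall j, exists C, forall t, X0 <= t -> t ^ j * (dV t + e * V t) <= C) ->
  forall j, exists C, forall t, X0 <= t -> t ^ j * V t <= C.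
Proof.
  intros he h1 HD Hp H j. destruct (H j) as [Cj HC]. destruct (H 0%nat) as [C0 HC0]. set (C := Rmax 0 Cj). set (K := Rmax 0 C0).
  assert (B0 : forall t, X0 <= t -> V t <= V X0 + K * (t - X0)).
  { intros t ht. pose proof (derive_compare V (fun s => K * s) dV (fun _ => K) X0 t ht) as T.
    assert (V t - V X0 <= K * t - K * X0); [|lra]. apply T.
    - nn. - intros; auto_derive; [trivial|ring].
    - intros s hs. specialize (HC0 s ltac:(lra)). specialize (Hp s). pose proof (Rmax_r 0 C0). fold K in H0. nra. }
  set (X1 := Rmax X0 (2 * INR j / e)). assert (X01 : X0 <= X1) by apply Rmax_l. set (d := e / 2). set (L := C / d).
  assert (LC : d * L = C) by (unfold L, d; field; lra). assert (dp : 0 < d) by (unfold d; lra).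
  assert (cp : 0 <= C) by apply Rmax_l. assert (kp : 0 <= K) by apply Rmax_l.
  assert (L0 : 0 <= L) by nra.
  assert (M : forall t, X1 <= t -> t ^ j * V t <= L + Rabs (X1 ^ j * V X1 - L)).
  { intros t ht.
    pose proof (derive_compare (fun s => (s ^ j * V s - L) * exp (d * s)) (fun _ => 0) (fun s => (INR j * s ^ pred j * V s + s ^ j * dV s + d * (s ^ j * V s - L)) * exp (d * s)) (fun _ => 0) X1 t ht) as T.
    assert (T' : (t ^ j * V t - L) * exp (d * t) - (X1 ^ j * V X1 - L) * exp (d * X1) <= 0 - 0).
    { apply T.
      - intros s hs. assert (A : is_derive (fun s => s ^ j * V s - L) s (INR j * s ^ pred j * V s + s ^ j * dV s)).
        { pose proof (is_derive_mult_R (fun s => s ^ j) V s (INR j * s ^ pred j) (dV s) (is_derive_pow_id j s) (HD s ltac:(lra))) as A.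
          exact (is_derive_sub_const _ _ L s A). }
        assert (B : is_derive (fun s => exp (d * s)) s (d * exp (d * s))) by (auto_derive; [trivial|ring]).
        eapply is_derive_eq; [exact (is_derive_mult_R _ _ s _ _ A B)|]. rring.
      - intros s _; exact (is_derive_const (K := R_AbsRing) (V := R_NormedModule) 0 s).
      - intros s hs. pose proof (exp_pos (d * s)). specialize (HC s ltac:(lra)).
        assert (hj : INR j * s ^ pred j * V s <= d * (s ^ j * V s)).
        { destruct j as [|i]; [cbn [INR]; rewrite !Rmult_0_l; apply Rmult_le_pos; [lra|apply Rmult_le_pos; auto; apply pow_le; lra]|].
          cbn [pred]. assert (INR (S i) <= d * s).
          { assert (2 * INR (S i) / e <= s) by (eapply Rle_trans; [apply Rmax_r|]; apply hs). unfold d.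
            apply Rmult_le_reg_l with (2 / e); [apply Rdiv_lt_0_compat; lra|].
            replace (2 / e * (e / 2 * s)) with s by (field; lra). lra. }
          assert (0 <= s ^ i) by nn. replace (d * (s ^ S i * V s)) with (d * s * s ^ i * V s) by (cbn [pow]; ring).
          apply Rmult_le_compat_r; auto. nra. }
        assert (Cj <= C) by apply Rmax_r. assert (E : s ^ j * (dV s + e * V s) = s ^ j * dV s + 2 * (d * (s ^ j * V s))) by (unfold d; field).
        nra. }
    assert (m : exp (d * X1) <= exp (d * t)) by (destruct (Req_dec X1 t) as [->|]; [lra|left; apply exp_increasing; nra]).
    pose proof (exp_pos (d * X1)). pose proof (Rle_abs (X1 ^ j * V X1 - L)). pose proof (Rabs_pos (X1 ^ j * V X1 - L)).
    nra. }
  exists (L + Rabs (X1 ^ j * V X1 - L) + X1 ^ j * (V X0 + K * (X1 - X0))). intros t ht.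
  assert (V0 : 0 <= V X0) by apply Hp. assert (0 <= X1 ^ j) by nn. assert (0 <= K * (X1 - X0)) by nra.
  assert (0 <= X1 ^ j * (V X0 + K * (X1 - X0))) by nra. pose proof (Rabs_pos (X1 ^ j * V X1 - L)).
  destruct (Rle_dec X1 t) as [g|g]; [specialize (M t g); lra|].
  assert (t ^ j * V t <= X1 ^ j * (V X0 + K * (X1 - X0))); [|lra]. specialize (B0 t ht).
  apply Rmult_le_compat; [apply pow_le; lra|auto|apply pow_incr; lra|]. nra.
Qed.
(** If [t ^ j * V t] once exceeded [L], the excess would from then on grow at least like
    [exp (e * t)], against the polynomial bound. *)
Lemma decay_of_growth (V dV : R -> R) e X0 A N :
  0 < e -> 1 <= X0 -> (forall t, X0 <= t -> is_derive V t (dV t)) -> (forall t, 0 <= V t) ->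
  (forall j, exists C, forall t, X0 <= t -> t ^ j * (e * V t - dV t) <= C) -> (forall t, X0 <= t -> V t <= A * t ^ N) ->
  forall j, exists C, forall t, X0 <= t -> t ^ j * V t <= C.
Proof.
  intros he h1 HD Hp H HA j. destruct (H j) as [C HC]. set (L := C / e). exists L. intros t ht.
  assert (LC : e * L = C) by (unfold L; field; lra). apply Rnot_lt_le. intros hL.
  set (w := (t ^ j * V t - L) * exp (- e * t)). assert (wp : 0 < w) by (apply Rmult_lt_0_compat; [lra|apply exp_pos]).
  assert (M : forall T, t <= T -> w <= (T ^ j * V T - L) * exp (- e * T)).
  { intros T hT.
    pose proof (derive_compare (fun _ => 0) (fun s => (s ^ j * V s - L) * exp (- e * s)) (fun _ => 0) (fun s => (INR j * s ^ pred j * V s + s ^ j * dV s - e * (s ^ j * V s - L)) * exp (- e * s)) t T hT) as Q.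
    assert (0 - 0 <= (T ^ j * V T - L) * exp (- e * T) - (t ^ j * V t - L) * exp (- e * t)); [|unfold w; lra]. apply Q.
    - intros s _; exact (is_derive_const (K := R_AbsRing) (V := R_NormedModule) 0 s).
    - intros s hs. assert (A1 : is_derive (fun s => s ^ j * V s - L) s (INR j * s ^ pred j * V s + s ^ j * dV s)).
      { pose proof (is_derive_mult_R (fun s => s ^ j) V s (INR j * s ^ pred j) (dV s) (is_derive_pow_id j s) (HD s ltac:(lra))) as A1.
        exact (is_derive_sub_const _ _ L s A1). }
      assert (B : is_derive (fun s => exp (- e * s)) s (- e * exp (- e * s))) by (auto_derive; [trivial|ring]).
      eapply is_derive_eq; [exact (is_derive_mult_R _ _ s _ _ A1 B)|]. rring.
    - intros s hs. pose proof (exp_pos (- e * s)). specialize (HC s ltac:(lra)).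
      assert (0 <= INR j * s ^ pred j * V s) by nn.
      nra. }
  destruct (pow_le_exp (S (j + N))) as (D & D0 & HE).
  set (G := Rabs A * D * (/ e) ^ S (j + N) + Rabs L * D * / e ^ S (j + N)). 
  assert (bnd : forall T, t <= T -> w * T <= G).
  { intros T hT. specialize (M T hT). specialize (HE (e * T) ltac:(apply Rmult_le_pos; lra)). pose proof (exp_pos (e * T)) as P. rewrite Rpow_mult_distr in HE.
    assert (ep : 0 < e ^ S (j + N)) by nn. set (J := S (j + N)) in *.
    assert (TJ : T ^ J <= (/ e) ^ J * (D * exp (e * T))).
    { rewrite pow_inv. apply Rmult_le_reg_l with (e ^ J); auto. rewrite <- Rmult_assoc, Rinv_r by lra. lra. }
    assert (T1 : 1 <= T) by lra. assert (b1 : (T ^ j * V T - L) * T <= (Rabs A + Rabs L) * T ^ J).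
    { assert (T ^ j * V T <= Rabs A * T ^ (j + N)).
      { rewrite pow_add. apply Rle_trans with (T ^ j * (A * T ^ N)); [apply Rmult_le_compat_l; [apply pow_le; lra|apply HA; lra]|].
        replace (T ^ j * (A * T ^ N)) with (A * (T ^ j * T ^ N)) by ring. apply Rmult_le_compat_r; [apply Rmult_le_pos; apply pow_le; lra|apply Rle_abs]. }
      assert (1 <= T ^ (j + N)) by (apply pow_R1_Rle; auto). pose proof (Rle_abs (- L)) as q. rewrite Rabs_Ropp in q. pose proof (Rabs_pos L).
      unfold J. cbn [pow]. replace ((Rabs A + Rabs L) * (T * T ^ (j + N))) with ((Rabs A * T ^ (j + N) + Rabs L * T ^ (j + N)) * T) by ring.
      apply Rmult_le_compat_r; [lra|]. nra. }
    assert (ET : exp (- e * T) * exp (e * T) = 1) by (rewrite <- exp_plus; replace (- e * T + e * T) with 0 by ring; apply exp_0).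
    apply Rle_trans with ((T ^ j * V T - L) * exp (- e * T) * T); [apply Rmult_le_compat_r; lra|].
    apply Rmult_le_reg_r with (exp (e * T)); auto.
    replace ((T ^ j * V T - L) * exp (- e * T) * T * exp (e * T)) with ((T ^ j * V T - L) * T * (exp (- e * T) * exp (e * T))) by ring. rewrite ET, Rmult_1_r.
    eapply Rle_trans; [exact b1|]. apply Rle_trans with ((Rabs A + Rabs L) * ((/ e) ^ J * (D * exp (e * T)))).
    - apply Rmult_le_compat_l; auto. nn.
    - right. unfold G. rewrite <- (pow_inv e J). ring. }
  pose proof (bnd (Rmax t (Rabs G / w + 1)) (Rmax_l _ _)) as b. pose proof (Rmax_r t (Rabs G / w + 1)) as r. pose proof (Rle_abs G).
  assert (w * (Rabs G / w + 1) = Rabs G + w) by (field; lra). nra.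
Qed.

(** [limp_tail] from every starting point [t], with the tail weighted by [E t]; [E] will be the
    modulus of a growing homogeneous solution. *)
Lemma lim_at_infty (q dq E : R -> R) X0 C :
  1 <= X0 -> (forall t, X0 <= t -> is_derive q t (dq t)) -> (forall t, 0 < E t) ->
  (forall t s, X0 <= t <= s -> E t * (Rabs (dq s) * s ^ 2) <= C) ->
  exists L, limp q L /\ forall t, X0 <= t -> E t * Rabs (L - q t) <= C.
Proof.
  intros h1 HD Ep H.
  assert (K : forall t, X0 <= t -> exists L, limp q L /\ E t * Rabs (L - q t) <= C).
  { intros t ht. specialize (Ep t). assert (EC : E t * (C / E t) = C) by (field; lra).
    destruct (limp_tail q dq t (C / E t)) as (L & A & B); [lra|intros; apply HD; lra| |].
    - intros s hs. apply Rmult_le_reg_l with (E t); [auto|]. rewrite EC. auto.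
    - exists L. split; [exact A|]. nra. }
  destruct (K X0 (Rle_refl _)) as (L & A & _). exists L. split; [exact A|]. intros t ht.
  destruct (K t ht) as (L' & A' & B). rewrite (limp_unique _ _ _ A A'). auto.
Qed.

(** * Functions flat at a point *)

Definition ext0 (c : R) (f : R -> Cx) (x : R) : Cx := if Rlt_dec c x then f (x - c) else C0.
Lemma ext0_gt c f x : c < x -> ext0 c f x = f (x - c).
Proof. intros h. unfold ext0. destruct (Rlt_dec c x); [reflexivity|contradiction]. Qed.
Lemma ext0_le c f x : x <= c -> ext0 c f x = C0.
Proof. intros h. unfold ext0. destruct (Rlt_dec c x); [lra|reflexivity]. Qed.
Lemma cder_ext0 c f x l : c < x -> cder f (x - c) l -> cder (ext0 c f) x l.
Proof.
  intros h H. apply (cder_ext_loc (fun x => f (x - c)) _ x l (x - c)); [lra| |].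
  - intros t ht. rewrite ext0_gt; [reflexivity|]. apply Rabs_def2 in ht. lra.
  - eapply cder_eq; [apply (cder_comp f (fun x => x - c) x l 1 H)|]; [auto_derive; [trivial|ring]|change (RtoC 1) with C1; ring].
Qed.
Lemma cder_vanishing f c x : (forall x, x <= c -> f x = C0) -> x < c -> cder f x C0.
Proof.
  intros H h. apply (cder_ext_loc (fun _ => C0) _ x C0 (c - x)); [lra| |apply cder_const].
  intros t ht. rewrite H; [reflexivity|]. apply Rabs_def2 in ht. lra.
Qed.
Lemma ccont_small f c : f c = C0 -> (forall eps, 0 < eps -> exists d, 0 < d /\ forall x, Rabs (x - c) < d -> Cmod (f x) < eps) -> ccont f c.
Proof.
  intros E H. split; apply filterlim_locally; intros [eps he]; destruct (H eps he) as (d & dp & Hd); exists (mkposreal d dp); intros x hx; specialize (Hd x hx); rewrite E.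
  - change (Rabs (re (f x) - 0) < eps). rewrite Rminus_0_r. eapply Rle_lt_trans; [apply re_le_Cmod|auto].
  - change (Rabs (im (f x) - 0) < eps). rewrite Rminus_0_r. eapply Rle_lt_trans; [apply im_le_Cmod|auto].
Qed.
Lemma exp_ln_pow z N : 0 < z -> exp (INR N * ln z) = z ^ N.
Proof. intros h. rewrite <- Rpower_pow by auto. auto. Qed.
Lemma exp_le x y : x <= y -> exp x <= exp y.
Proof. intros [h| ->]; [left; apply exp_increasing; auto|lra]. Qed.
Lemma exp_ln_bound sg N z : 0 < z -> Rabs sg <= INR N -> exp (sg * ln z) <= z ^ N + (/ z) ^ N.
Proof.
  intros hz h. pose proof (pow_lt z N hz). pose proof (pow_lt (/ z) N (Rinv_0_lt_compat _ hz)).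
  assert (E : (/ z) ^ N = exp (- (INR N * ln z))) by (rewrite pow_inv, exp_Ropp, exp_ln_pow by auto; reflexivity).
  pose proof (Rle_abs sg). pose proof (Rle_abs (- sg)) as h'. rewrite Rabs_Ropp in h'.
  destruct (Rle_dec 0 (ln z)) as [l|l].
  - apply Rle_trans with (exp (INR N * ln z)); [apply exp_le, Rmult_le_compat_r; lra|rewrite exp_ln_pow by auto; lra].
  - apply Rnot_le_lt in l. apply Rle_trans with (exp (- (INR N * ln z))); [apply exp_le; nra|rewrite <- E; lra].
Qed.
Lemma flat_decay N : exists C, 0 <= C /\ forall z, 0 < z -> exp (- / z - z ^ 2) * (z ^ N + (/ z) ^ N) <= C.
Proof.
  destruct (pow_le_exp N) as (C & C0 & H). exists (1 + C + C). split; [lra|]. intros z hz. pose proof (Rinv_0_lt_compat z hz) as iz.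
  assert (A1 : exp (- / z) <= 1) by (rewrite <- exp_0; apply exp_le; lra).
  assert (A2 : exp (- z ^ 2) <= 1) by (rewrite <- exp_0; apply exp_le; pose proof (pow2_ge_0 z); lra).
  pose proof (exp_pos (- / z)). pose proof (exp_pos (- z ^ 2)).
  assert (B1 : exp (- / z) * (/ z) ^ N <= C).
  { apply Rle_trans with (exp (- / z) * (C * exp (/ z))); [apply Rmult_le_compat_l; [lra|apply H; lra]|]. rewrite exp_Ropp. right. field.
    pose proof (exp_pos (/ z)). lra. }
  assert (B2 : exp (- z ^ 2) * z ^ N <= 1 + C).
  { assert (z ^ N <= 1 + (z ^ 2) ^ N).
    { destruct (Rle_dec z 1) as [g|g]; [assert (z ^ N <= 1) by (rewrite <- (pow1 N); apply pow_incr; lra); pose proof (pow_le (z ^ 2) N (pow2_ge_0 z)); lra|].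
      apply Rnot_le_lt in g. assert (z ^ N <= (z ^ 2) ^ N) by (apply pow_incr; nra). lra. }
    specialize (H (z ^ 2) (pow2_ge_0 z)). apply Rle_trans with (exp (- z ^ 2) * (1 + C * exp (z ^ 2))); [apply Rmult_le_compat_l; lra|].
    rewrite Rmult_plus_distr_l. apply Rplus_le_compat; [lra|]. rewrite exp_Ropp. right. field. pose proof (exp_pos (z ^ 2)). lra. }
  unfold Rminus. rewrite exp_plus, Rmult_plus_distr_l. nra.
Qed.

(** The term [- / z] makes the exponential flat at 0 and [- z ^ 2] makes it small at infinity; the
    other terms are those found in the explicit solutions. *)
Definition phase (mu k1 k2 : Cx) (z : R) : Cx := (RtoC (- / z - z ^ 2) + (mu * RtoC (ln z) + (k1 * RtoC z + k2 * RtoC (z ^ 2))))%cx.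
Lemma cder_phase mu k1 k2 z : 0 < z ->
  cder (phase mu k1 k2) z (RtoC (/ z * / z) + (mu * RtoC (/ z) + (k1 + (k2 + k2 - (C1 + C1)) * RtoC z)))%cx.
Proof.
  intros hz. eapply cder_eq.
  - apply cder_add; [apply cder_RtoC|apply cder_add; [apply cder_scal, cder_RtoC|apply cder_add; apply cder_scal, cder_RtoC]].
    + instantiate (1 := / z * / z - 2 * z). auto_derive; [lra|field; lra].
    + instantiate (1 := / z). auto_derive; [lra|field; lra].
    + instantiate (1 := 1). auto_derive; [trivial|ring].
    + instantiate (1 := 2 * z). auto_derive; [trivial|ring].
  - apply Cx_ext; cbn; ring.
Qed.
(** Negative powers are included so that the property survives division by [x - c], the factor [v]
    of the class used in [flat_family]. *)
Definition flatf (c : R) (f : R -> Cx) : Prop := (forall x, x <= c -> f x = C0) /\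
  forall j, exists C, forall x, c < x -> Cmod (f x) * (x - c) ^ j <= C /\ Cmod (f x) * (/ (x - c)) ^ j <= C.
Lemma flatf_rapid c f : flatf c f -> rapidf f.
Proof.
  intros [Z H] j. destruct (H j) as [C HC]. destruct (H 0%nat) as [D HD]. exists (Rabs (((1 + Rabs c) * 2) ^ j * (Rabs C + Rabs D))). intros x.
  pose proof (Rabs_pos c). assert (K : 0 <= ((1 + Rabs c) * 2) ^ j) by nn. pose proof (Rle_abs C). pose proof (Rle_abs D). pose proof (Rabs_pos C).
  pose proof (Rabs_pos D).
  rewrite (Rabs_right (_ * _)) by nra.
  destruct (Rle_dec x c) as [h|h]; [rewrite Z by auto; rewrite Cmod_C0, Rmult_0_r; apply Rmult_le_pos; lra|]. apply Rnot_le_lt in h.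
  destruct (HC x h) as [h1 _]. destruct (HD x h) as [h2 _]. set (z := x - c) in *. assert (zp : 0 < z) by (unfold z; lra).
  assert (X : Rabs x <= (1 + Rabs c) * (1 + z)). { replace x with (z + c) by (unfold z; ring). eapply Rle_trans; [apply Rabs_triang|].
  rewrite (Rabs_right z) by lra. nra. }
  assert (Y : (1 + z) ^ j <= 2 ^ j * (1 + z ^ j)).
  { pose proof (pow_le z j ltac:(lra)). assert (0 < 2 ^ j) by nn. destruct (Rle_dec z 1) as [g|g].
    - assert ((1 + z) ^ j <= 2 ^ j) by (apply pow_incr; lra). nra.
    - apply Rnot_le_lt in g. assert ((1 + z) ^ j <= (2 * z) ^ j) by (apply pow_incr; lra). rewrite Rpow_mult_distr in *. nra. }
  apply Rle_trans with (((1 + Rabs c) * (1 + z)) ^ j * Cmod (f x)); [apply Rmult_le_compat_r; [apply Cmod_ge0|apply pow_incr; split; [apply Rabs_pos|auto]]|].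
  rewrite !Rpow_mult_distr, !Rmult_assoc. apply Rmult_le_compat_l; [apply pow_le; lra|].
  apply Rle_trans with (2 ^ j * (1 + z ^ j) * Cmod (f x)); [apply Rmult_le_compat_r; auto using Cmod_ge0|]. rewrite Rmult_assoc.
  apply Rmult_le_compat_l; [apply pow_le; lra|]. lra.
Qed.
Lemma cls_flat B c : (forall f, B f -> flatf c f) -> forall f, cls B (fun x => Cinv (RtoC (x - c))) f -> flatf c f.
Proof.
  intros HB f H. induction H as [f H|f g H1 [z1 I1] H2 [z2 I2]|k f H [z I]|f H [z I]|f H [z I]]; auto.
  - split; [intros x hx; rewrite z1, z2 by auto; ring|]. intros j. destruct (I1 j) as [C HC]. destruct (I2 j) as [D HD]. exists (C + D). intros x hx.
    destruct (HC x hx), (HD x hx). pose proof (Cmod_tri (f x) (g x)). assert (yp : 0 < x - c) by lra.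
    pose proof (pow_lt _ j yp). pose proof (pow_lt _ j (Rinv_0_lt_compat _ yp)). nra.
  - split; [intros x hx; rewrite z by auto; ring|]. intros j. destruct (I j) as [C HC]. exists (Cmod k * C). intros x hx. destruct (HC x hx).
    rewrite Cmod_mul, !Rmult_assoc.
    pose proof (Cmod_ge0 k). nra.
  - split; [intros x hx; rewrite z by auto; ring|]. intros j. destruct (I (S j)) as [C HC]. destruct (I j) as [D HD].
    exists (Rabs c * D + C + C + D). intros x hx. destruct (HC x hx) as [h1 h1']. destruct (HD x hx) as [h2 h2'].
    rewrite Cmod_mul, Cmod_RtoC. cbn [pow] in *. set (y := x - c) in *. assert (yp : 0 < y) by (unfold y; lra).
    pose proof (Rinv_0_lt_compat y yp) as iy. pose proof (Cmod_ge0 (f x)) as f0.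
    pose proof (pow_lt y j yp). pose proof (pow_lt (/ y) j iy). pose proof (Rabs_pos c).
    assert (X : Rabs x <= Rabs c + y). { replace x with (y + c) by (unfold y; ring). eapply Rle_trans; [apply Rabs_triang|]. rewrite (Rabs_right y) by lra. lra. }
    assert (q1 : 0 <= Cmod (f x) * y ^ j) by nra. assert (q2 : 0 <= Cmod (f x) * (/ y) ^ j) by nra.
    assert (q3 : 0 <= C) by nra. assert (q5 : Rabs c * (Cmod (f x) * (/ y) ^ j) <= Rabs c * D) by nra.
    split.
    + nra.
    + apply Rle_trans with ((Rabs c + y) * (Cmod (f x) * (/ y) ^ j)); [rewrite Rmult_assoc; apply Rmult_le_compat_r; auto|].
      destruct (Rle_dec y 1) as [g|g]; [nra|]. apply Rnot_le_lt in g.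
      assert ((/ y) ^ j <= y ^ j). { apply pow_incr. split; [lra|]. apply Rle_trans with 1; [|lra]. rewrite <- Rinv_1. apply Rinv_le_contravar; lra. }
      nra.
  - split; [intros x hx; rewrite z by auto; ring|]. intros j. destruct (I (S j)) as [C HC]. destruct (I j) as [D HD]. exists (C + D). intros x hx.
    destruct (HC x hx) as [h1 h1']. destruct (HD x hx) as [h2 h2'].
    cbn [pow] in *. set (y := x - c) in *. assert (yp : 0 < y) by (unfold y; lra). pose proof (Rinv_0_lt_compat y yp) as iy. pose proof (Cmod_ge0 (f x)) as f0.
    rewrite Cmod_mul, Cmod_inv, Cmod_RtoC, Rabs_right by (try lra; intros E; apply (f_equal re) in E; cbn in E; lra).
    pose proof (pow_lt y j yp). pose proof (pow_lt (/ y) j iy).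
    assert (q3 : 0 <= C) by (eapply Rle_trans; [|exact h1']; apply Rmult_le_pos; auto; apply Rmult_le_pos; lra).
    assert (q1 : 0 <= Cmod (f x) * y ^ j) by nra. split; [|lra].
    destruct (Rle_dec y 1) as [g|g].
    + assert (y ^ j <= (/ y) ^ j). { apply pow_incr. split; [lra|]. apply Rle_trans with 1; [lra|]. rewrite <- Rinv_1. apply Rinv_le_contravar; lra. }
      nra.
    + apply Rnot_le_lt in g. assert (/ y <= 1) by (rewrite <- Rinv_1; apply Rinv_le_contravar; lra). nra.
Qed.
Lemma cder_flat_end f c : (forall x, x <= c -> f x = C0) -> (exists C, forall x, c < x -> Cmod (f x) * (/ (x - c)) ^ 2 <= C) -> cder f c C0.
Proof.
  intros Z [C HC]. apply (cder_of_quadratic f c C0 (Rabs C)). intros h _. rewrite (Z c) by lra.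
  replace (f (c + h)%R - C0 - RtoC h * C0)%cx with (f (c + h)%R) by ring. pose proof (Rle_abs C). pose proof (Rabs_pos C).
  destruct (Rle_dec h 0) as [g|g]; [rewrite Z by lra; rewrite Cmod_C0; apply Rmult_le_pos; auto; apply pow2_ge_0|]. apply Rnot_le_lt in g.
  specialize (HC (c + h) ltac:(lra)). replace (c + h - c) with h in HC by ring.
  apply Rmult_le_reg_r with ((/ h) ^ 2); [apply pow_lt, Rinv_0_lt_compat; auto|]. replace (Rabs C * h ^ 2 * (/ h) ^ 2) with (Rabs C) by (field; lra). lra.
Qed.
Lemma flat_family c mu k1 k2 H : (forall z, 0 < z -> re k1 * z + re k2 * z ^ 2 <= H) ->
  exists F, schwartz1 F /\ F 0%nat = ext0 c (fun z => cexp (phase mu k1 k2 z)).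
Proof.
  intros Hk. set (f0 := ext0 c (fun z => cexp (phase mu k1 k2 z))). set (v := fun x => Cinv (RtoC (x - c))). set (B := fun f : R -> Cx => f = f0).
  assert (F0 : flatf c f0).
  { split; [intros; apply ext0_le; auto|]. intros j. destruct (INR_unbounded (Rabs (re mu) + INR j)) as (N & HN). destruct (flat_decay N) as (C & C0 & HC).
    exists (exp H * C). intros x hx. unfold f0. rewrite ext0_gt, Cmod_cexp by auto. set (z := x - c). assert (hz : 0 < z) by (unfold z; lra). specialize (HC z hz).
    assert (E : re (phase mu k1 k2 z) = (- / z - z ^ 2) + re mu * ln z + (re k1 * z + re k2 * z ^ 2)) by (unfold phase; cbn; ring).
    assert (main : forall sg, Rabs sg <= Rabs (re mu) + INR j -> exp (- / z - z ^ 2) * exp (sg * ln z) * exp H <= exp H * C).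
    { intros sg hs. rewrite (Rmult_comm _ (exp H)). apply Rmult_le_compat_l; [left; apply exp_pos|]. eapply Rle_trans; [|exact HC].
      apply Rmult_le_compat_l; [left; apply exp_pos|]. apply exp_ln_bound; auto. lra. } pose proof (pos_INR j).
    assert (B1 : exp (re (phase mu k1 k2 z)) <= exp (- / z - z ^ 2) * exp (re mu * ln z) * exp H).
    { rewrite E, exp_plus, (exp_plus (- / z - z ^ 2)). apply Rmult_le_compat_l; [left; apply Rmult_lt_0_compat; apply exp_pos|apply exp_le; auto]. }
    split.
    - apply Rle_trans with (exp (- / z - z ^ 2) * exp ((re mu + INR j) * ln z) * exp H); [|apply main; eapply Rle_trans; [apply Rabs_triang|]; rewrite (Rabs_right (INR j)); lra].
      rewrite Rmult_plus_distr_r, exp_plus, exp_ln_pow by auto.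
      replace (exp (- / z - z ^ 2) * (exp (re mu * ln z) * z ^ j) * exp H) with (exp (- / z - z ^ 2) * exp (re mu * ln z) * exp H * z ^ j) by ring.
      apply Rmult_le_compat_r; auto. nn.
    - apply Rle_trans with (exp (- / z - z ^ 2) * exp ((re mu - INR j) * ln z) * exp H); [|apply main; unfold Rminus; eapply Rle_trans; [apply Rabs_triang|]; rewrite Rabs_Ropp, (Rabs_right (INR j)); lra].
      replace ((re mu - INR j) * ln z) with (re mu * ln z + - (INR j * ln z)) by ring. rewrite exp_plus, exp_Ropp, exp_ln_pow, <- pow_inv by auto.
      replace (exp (- / z - z ^ 2) * (exp (re mu * ln z) * (/ z) ^ j) * exp H) with (exp (- / z - z ^ 2) * exp (re mu * ln z) * exp H * (/ z) ^ j) by ring.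
      apply Rmult_le_compat_r; auto. nn. }
  assert (Fl : forall f, cls B v f -> flatf c f) by (apply cls_flat; intros f ->; auto).
  assert (By : cls B v f0) by (apply cls_base; reflexivity).
  assert (vE : forall x, c < x -> v x = RtoC (/ (x - c))).
  { intros x hx. unfold v. assert (n : RtoC (x - c) <> C0) by (intros e; apply (f_equal re) in e; cbn in e; lra).
    transitivity (Cinv (RtoC (x - c)) * (RtoC (x - c) * RtoC (/ (x - c))))%cx; [|transitivity ((Cinv (RtoC (x - c)) * RtoC (x - c)) * RtoC (/ (x - c)))%cx; [ring|rewrite Cinv_l by auto; ring]].
    rewrite <- RtoC_mul, Rinv_r by lra. change (RtoC 1) with C1. ring. }
  apply (fam_of_closed (cls B v)); auto; [|intros f Hf; apply (flatf_rapid c); auto].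
  intros f Hf. destruct (cls_cder (fun x => c < x) B v (- C1)%cx) with f as (g & Hg & D); auto.
  - intros x hx. rewrite !vE by auto. apply (cder_ext_loc (fun x => RtoC (/ (x - c))) v x _ (x - c)); [lra| |].
    + intros t ht. symmetry. apply vE. apply Rabs_def2 in ht. lra.
    + eapply cder_eq; [apply cder_RtoC; instantiate (1 := - (/ (x - c) * / (x - c))); auto_derive; [lra|field; lra]|]. apply Cx_ext; cbn; ring.
  - intros h ->. exists (fun x => v x * (v x * f0 x) + (mu * (v x * f0 x) + ((k1 + (k2 + k2 - (C1 + C1)) * RtoC (- c)) * f0 x + (k2 + k2 - (C1 + C1)) * (RtoC x * f0 x))))%cx. split.
    + apply cls_add; [apply cls_v, cls_v; auto|]. apply cls_add; [apply cls_scal, cls_v; auto|]. apply cls_add; apply cls_scal; auto. apply cls_x; auto.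
    + intros x hx. apply cder_ext0; auto. eapply cder_eq; [apply cder_cexp, cder_phase; lra|]. rewrite vE by auto. unfold f0.
      rewrite ext0_gt by auto. replace (RtoC (x - c)) with (RtoC x + RtoC (- c))%cx by (apply Cx_ext; cbn; ring). rewrite RtoC_mul. ring.
  - exists g. split; auto. intros x. destruct (Fl f Hf) as [Zf If]. destruct (Fl g Hg) as [Zg _].
    destruct (Rtotal_order x c) as [h|[->|h]].
    + rewrite Zg by lra. apply cder_vanishing with c; auto.
    + rewrite Zg by lra. apply cder_flat_end; auto. destruct (If 2%nat) as [C HC]. exists C. intros x hx. apply HC; auto.
    + auto.
Qed.

(** * Bump functions *)

Inductive prods (F G : fam1) : (R -> Cx) -> Prop :=
| prods_mul n m : prods F G (fun x => F n x * G m x)%cx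
| prods_add f g : prods F G f -> prods F G g -> prods F G (fun x => f x + g x)%cx.
Lemma schwartz1_prod F G : schwartz1 F -> schwartz1 G -> exists P, schwartz1 P /\ P 0%nat = (fun x => F 0%nat x * G 0%nat x)%cx.
Proof.
  intros HF HG. apply (fam_of_closed (prods F G)); [| |constructor].
  - intros f H. induction H as [n m|f g _ (f' & A & B) _ (g' & C & D)].
    + exists (fun x => F (S n) x * G m x + F n x * G (S m) x)%cx. split; [apply prods_add; constructor|].
      intros x. apply cder_mul; apply schwartz1_cder; auto.
    + exists (fun x => f' x + g' x)%cx. split; [apply prods_add; auto|]. intros x. apply cder_add; auto.
  - intros f H. induction H as [n m|f g _ IHf _ IHg]; [|apply rapidf_add; auto].
    destruct (schwartz1_weight F HF n 0) as (A & _ & HA). apply rapidf_bmul with A; [|apply rapidf_schwartz; auto].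
    intros x. specialize (HA x). lra.
Qed.
Lemma schwartz1_refl F : schwartz1 F -> schwartz1 (fun n x => RtoC ((-1) ^ n) * F n (- x)%R)%cx.
Proof.
  intros HF. apply schwartz1_mk.
  - intros n x. eapply cder_eq; [apply cder_scal, (cder_comp (F n) Ropp x (F (S n) (- x)) (-1)); [apply schwartz1_cder; auto|]|].
    + apply (is_derive_opp (V := R_NormedModule) (fun x => x)), (is_derive_id (K := R_AbsRing)).
    + cbn [pow]. rewrite RtoC_mul. ring.
  - intros j n. destruct (rapidf_schwartz F n HF j) as [C HC]. exists C. intros x. specialize (HC (- x)).
    rewrite Rabs_Ropp in HC. rewrite Cmod_mul, Cmod_RtoC, pow_1_abs, Rmult_1_l. auto.
Qed.
(** A product of two flat functions, one starting at [x0 - d], the other reflected and ending at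
    [x0 + d]. *)
Lemma bump x0 d : 0 < d -> exists F, schwartz1 F /\ (forall x, im (F 0%nat x) = 0 /\ 0 <= re (F 0%nat x)) /\ 0 < re (F 0%nat x0) /\
  forall x, d <= Rabs (x - x0) -> F 0%nat x = C0.
Proof.
  intros hd. set (e := fun z => cexp (phase C0 C0 C0 z)).
  assert (Pe : forall z, im (e z) = 0 /\ 0 < re (e z)).
  { intros z. unfold e. replace (phase C0 C0 C0 z) with (RtoC (- / z - z ^ 2)) by (unfold phase; ring).
    cbn [cexp re im RtoC]. rewrite sin_0, cos_0, Rmult_1_r. split; [ring|apply exp_pos]. }
  assert (Pp : forall c x, im (ext0 c e x) = 0 /\ 0 <= re (ext0 c e x)).
  { intros c x. unfold ext0. destruct (Rlt_dec c x); [destruct (Pe (x - c))|cbn]; lra. }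
  destruct (flat_family (x0 - d) C0 C0 C0 0) as (F & SF & EF); [intros; cbn; lra|].
  destruct (flat_family (- x0 - d) C0 C0 C0 0) as (G & SG & EG); [intros; cbn; lra|]. fold e in EF, EG.
  destruct (schwartz1_prod F _ SF (schwartz1_refl G SG)) as (P & SP & EP). cbn [pow] in EP.
  assert (EP' : forall x, P 0%nat x = (ext0 (x0 - d) e x * ext0 (- x0 - d) e (- x))%cx).
  { intros x. rewrite EP, EF, EG. change (RtoC 1) with C1. ring. }
  exists P. split; [auto|]. split; [|split].
  - intros x. rewrite EP'. destruct (Pp (x0 - d) x), (Pp (- x0 - d) (- x)). cbn [re im Cmul]. nra.
  - rewrite EP', !ext0_gt by lra. destruct (Pe (x0 - (x0 - d))), (Pe (- x0 - (- x0 - d))). cbn [re Cmul].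
    nra.
  - intros x hx. rewrite EP'. unfold Rabs in hx. destruct (Rcase_abs (x - x0)).
    + rewrite ext0_le by lra. ring.
    + rewrite (ext0_le _ _ (- x)) by lra. ring.
Qed.
(** Otherwise a bump times the conjugate of [Y x0], supported where [re (T * Y x)] is positive,
    would give a positive integral. *)
Lemma moder_null Y : moder Y -> (forall F, schwartz1 F -> CI (fun x => Y x * F 0%nat x)%cx = C0) -> forall x, Y x = C0.
Proof.
  intros HY H x0. apply NNPP. intros N. set (T := Cconj (Y x0)).
  assert (g0 : 0 < re (T * Y x0)%cx).
  { pose proof (f_equal re (Cmul_conj (Y x0))) as E. replace (T * Y x0)%cx with (Y x0 * Cconj (Y x0))%cx by (unfold T; ring). rewrite E. apply pow_lt, Cmod_pos, N. }
  assert (gc : continuous (fun x => re (T * Y x)%cx) x0) by (apply ccont_mul; [apply ccont_const|apply HY]).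
  destruct (proj1 (filterlim_locally _ _) gc (mkposreal _ g0)) as ([d dp] & D).
  assert (Dp : forall x, Rabs (x - x0) < d -> 0 < re (T * Y x)%cx).
  { intros x hx. specialize (D x hx). apply Rabs_def2 in D. cbn in D |- *. lra. }
  destruct (bump x0 d dp) as (F & SF & F1 & F2 & F3). pose proof (schwartz1_scal T F SF) as ST.
  assert (E : forall x, re (Y x * fam1_scal T F 0%nat x)%cx = re (T * Y x)%cx * re (F 0%nat x)).
  { intros x. destruct (F1 x) as [z _]. cbn. nra. }
  pose proof (f_equal re (H _ ST)) as Z. cbn [re CI C0] in Z.
  pose proof (I_pos _ x0 (cnice_re _ (moder_cnice Y _ 0 HY ST))) as P. cbv beta in P. rewrite Z in P.
  enough (0 < 0) by lra. apply P; intros; rewrite E.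
  - destruct (Rlt_dec (Rabs (x - x0)) d) as [h|h].
    + apply Rmult_le_pos; [left; auto|apply F1].
    + rewrite F3 by lra. cbn [re C0]. lra.
  - nra.
Qed.

(** * Growth of solutions at the two ends *)

Definition mx (a : nat -> nat -> Cx) (x : R) : Cx := (a 1%nat 1%nat * RtoC x + a 1%nat 0%nat)%cx.
Definition gx (a : nat -> nat -> Cx) (x : R) : Cx := (a 0%nat 0%nat + a 0%nat 1%nat * RtoC x + a 0%nat 2%nat * (RtoC x * RtoC x))%cx.
(** A solution of the operator with [a 2 0 = 0] satisfies [y' = bt y + i f / mx]. *)
Definition bt (a : nat -> nat -> Cx) (x : R) : Cx := (- (Ci * (gx a x * Cinv (mx a x))))%cx.
(** [s] is 1 or -1 and names an end; [s * re (bt a (s * t))] is the outward logarithmic derivative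
    of the modulus of a homogeneous solution. *)
Definition growing a (s : R) := exists e X, 0 < e /\ 1 <= X /\ forall t, X <= t -> e <= s * re (bt a (s * t)).
Definition decaying a (s : R) := exists e X, 0 < e /\ 1 <= X /\ forall t, X <= t -> s * re (bt a (s * t)) <= - e.

(** Signs under which a cubic numerator eventually dominates a positive multiple of the denominator.
    A numerator of degree one or zero can do so only over a constant denominator, hence [d2 = 0] in
    the last case. *)
Definition lead (c3 c2 c1 c0 d2 : R) : Prop :=
  0 < c3 \/ (c3 = 0 /\ 0 < c2) \/ (d2 = 0 /\ c3 = 0 /\ c2 = 0 /\ (0 < c1 \/ (c1 = 0 /\ 0 < c0))).
Lemma cubic_ev c3 c2 c1 c0 : 0 < c3 \/ (c3 = 0 /\ 0 < c2) \/ (c3 = 0 /\ c2 = 0 /\ 0 < c1) \/ (c3 = 0 /\ c2 = 0 /\ c1 = 0 /\ 0 <= c0) ->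
  exists X, 1 <= X /\ forall t, X <= t -> 0 <= c3 * t ^ 3 + c2 * t ^ 2 + c1 * t + c0.
Proof.
  intros H. assert (key : forall c S t, 0 < c -> 0 <= S -> S / c + 1 <= t -> S <= c * t).
  { intros c S t hc hS ht. apply Rle_trans with (c * (S / c + 1)); [|apply Rmult_le_compat_l; lra]. replace (c * (S / c + 1)) with (S + c) by (field; lra). lra. }
  pose proof (Rabs_pos c2) as p2. pose proof (Rabs_pos c1) as p1. pose proof (Rabs_pos c0) as p0.
  pose proof (Rle_abs (- c2)) as q2. pose proof (Rle_abs (- c1)) as q1. pose proof (Rle_abs (- c0)) as q0. rewrite Rabs_Ropp in q2, q1, q0.
  destruct H as [h|[[-> h]|[(-> & -> & h)|(-> & -> & -> & h)]]].
  - set (S := Rabs c2 + Rabs c1 + Rabs c0). exists (S / c3 + 1). assert (0 <= S / c3) by (apply Rdiv_le_0_compat; unfold S; lra). split; [lra|].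
    intros t ht. pose proof (key c3 S t h ltac:(unfold S; lra) ht) as k. assert (t2 : t <= t ^ 2) by nra. unfold S in k.
    nra.
  - set (S := Rabs c1 + Rabs c0). exists (S / c2 + 1). assert (0 <= S / c2) by (apply Rdiv_le_0_compat; unfold S; lra). split; [lra|].
    intros t ht. pose proof (key c2 S t h ltac:(unfold S; lra) ht) as k. unfold S in k.
    nra.
  - exists (Rabs c0 / c1 + 1). assert (0 <= Rabs c0 / c1) by nn. split; [lra|].
    intros t ht. pose proof (key c1 (Rabs c0) t h p0 ht). lra.
  - exists 1. nn.
Qed.
Lemma lead_ev c3 c2 c1 c0 d2 d1 d0 : 0 <= d2 -> (d2 = 0 -> d1 = 0) -> 0 <= d0 -> lead c3 c2 c1 c0 d2 ->
  exists e X, 0 < e /\ 1 <= X /\ forall t, X <= t -> e * (d2 * t ^ 2 + d1 * t + d0) <= c3 * t ^ 3 + c2 * t ^ 2 + c1 * t + c0.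
Proof.
  intros hd h1 h0 H.
  assert (W : exists e, 0 < e /\ (0 < c3 \/ (c3 = 0 /\ 0 < c2 - e * d2) \/ (c3 = 0 /\ c2 - e * d2 = 0 /\ 0 < c1 - e * d1) \/ (c3 = 0 /\ c2 - e * d2 = 0 /\ c1 - e * d1 = 0 /\ 0 <= c0 - e * d0))).
  { destruct H as [h|[[hz h]|(-> & hz & hy & [h|[hw h]])]].
    - exists 1. lra.
    - exists (c2 / (d2 + 1)). split; [apply Rdiv_lt_0_compat; lra|]. right; left. split; auto.
      replace (c2 - c2 / (d2 + 1) * d2) with (c2 / (d2 + 1)) by (field; lra). nn.
    - exists 1. lra.
    - exists (c0 / (d0 + 1)). split; [apply Rdiv_lt_0_compat; lra|]. right; right; right. rewrite h1 by auto. repeat split; try lra.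
      replace (c0 - c0 / (d0 + 1) * d0) with (c0 / (d0 + 1)) by (field; lra). nn. }
  destruct W as (e & ep & W). destruct (cubic_ev c3 (c2 - e * d2) (c1 - e * d1) (c0 - e * d0) W) as (X & X1 & HX).
  exists e, X. split; [|split]; auto. intros t ht. specialize (HX t ht). lra.
Qed.

(** [kn3] to [kn0] are the coefficients of the imaginary part of [gx] times the conjugate of [mx],
    and [kd2] to [kd0] those of the squared modulus of [mx]; the quotient is the real part of
    [bt]. *)
Definition kn3 (a : nat -> nat -> Cx) : R := im (a 0%nat 2%nat * Cconj (a 1%nat 1%nat))%cx.
Definition kn2 (a : nat -> nat -> Cx) : R := im (a 0%nat 2%nat * Cconj (a 1%nat 0%nat) + a 0%nat 1%nat * Cconj (a 1%nat 1%nat))%cx.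
Definition kn1 (a : nat -> nat -> Cx) : R := im (a 0%nat 1%nat * Cconj (a 1%nat 0%nat) + a 0%nat 0%nat * Cconj (a 1%nat 1%nat))%cx.
Definition kn0 (a : nat -> nat -> Cx) : R := im (a 0%nat 0%nat * Cconj (a 1%nat 0%nat))%cx.
Definition kd2 (a : nat -> nat -> Cx) : R := re (a 1%nat 1%nat * Cconj (a 1%nat 1%nat))%cx.
Definition kd1 (a : nat -> nat -> Cx) : R := 2 * re (a 1%nat 1%nat * Cconj (a 1%nat 0%nat))%cx.
Definition kd0 (a : nat -> nat -> Cx) : R := re (a 1%nat 0%nat * Cconj (a 1%nat 0%nat))%cx.
Lemma den_pos a s t : (forall x, mx a x <> C0) -> s * s = 1 -> 0 < kd2 a * t ^ 2 + s * kd1 a * t + kd0 a.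
Proof.
  intros m0 hs. specialize (m0 (s * t)). destruct (Rle_lt_or_eq_dec 0 (re (mx a (s * t)) ^ 2 + im (mx a (s * t)) ^ 2)) as [h|h].
  - nra.
  - eapply Rlt_le_trans; [exact h|]. unfold kd2, kd1, kd0, mx. cbn. nra.
  - exfalso. apply m0. apply Cmod_eq0. unfold Cmod. rewrite <- h. apply sqrt_0.
Qed.
Lemma re_bt a s t : (forall x, mx a x <> C0) -> s * s = 1 -> s * re (bt a (s * t)) * (kd2 a * t ^ 2 + s * kd1 a * t + kd0 a) = kn3 a * t ^ 3 + s * kn2 a * t ^ 2 + kn1 a * t + s * kn0 a.
Proof.
  intros m0 hs. pose proof (den_pos a s t m0 hs) as P.
  assert (E : re (mx a (s * t)) ^ 2 + im (mx a (s * t)) ^ 2 = kd2 a * t ^ 2 + s * kd1 a * t + kd0 a).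
  { unfold kd2, kd1, kd0, mx. cbn. nra. }
  unfold bt, Cinv. cbn [re im Copp Cmul Ci]. rewrite E.
  transitivity (s * (im (gx a (s * t)) * re (mx a (s * t)) - re (gx a (s * t)) * im (mx a (s * t)))); [field; lra|]. cbn. ring_simplify.
  replace (s ^ 4) with ((s * s) * (s * s)) by ring. replace (s ^ 3) with ((s * s) * s) by ring. replace (s ^ 2) with (s * s) by ring. rewrite hs. ring.
Qed.
Lemma d2_facts a : 0 <= kd2 a /\ 0 <= kd0 a /\ (kd2 a = 0 -> kd1 a = 0 /\ kn3 a = 0).
Proof.
  unfold kd2, kd1, kd0, kn3. destruct (a 1%nat 1%nat) as [u v], (a 1%nat 0%nat) as [u0 v0]. cbn. pose proof (Rle_0_sqr u) as q1.
  pose proof (Rle_0_sqr v) as q2. pose proof (Rle_0_sqr u0) as q3. pose proof (Rle_0_sqr v0) as q4. unfold Rsqr in *. split; [lra|]. split; [lra|]. intros h.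
  assert (u = 0) by nra. assert (v = 0) by nra. nra.
Qed.
Lemma growing_lead a s : (forall x, mx a x <> C0) -> s * s = 1 -> lead (kn3 a) (s * kn2 a) (kn1 a) (s * kn0 a) (kd2 a) -> growing a s.
Proof.
  intros m0 hs H. destruct (d2_facts a) as (p2 & p0 & p1).
  destruct (lead_ev _ _ _ _ (kd2 a) (s * kd1 a) (kd0 a) p2 ltac:(intros h; rewrite (proj1 (p1 h)); ring) p0 H) as (e & X & ep & X1 & HX).
  exists e, X. split; [|split]; auto. intros t ht. specialize (HX t ht). rewrite <- re_bt in HX by auto. apply Rmult_le_reg_r in HX; auto. apply den_pos; auto.
Qed.
Lemma decaying_lead a s : (forall x, mx a x <> C0) -> s * s = 1 -> lead (- kn3 a) (- (s * kn2 a)) (- kn1 a) (- (s * kn0 a)) (kd2 a) -> decaying a s.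
Proof.
  intros m0 hs H. destruct (d2_facts a) as (p2 & p0 & p1).
  destruct (lead_ev _ _ _ _ (kd2 a) (s * kd1 a) (kd0 a) p2 ltac:(intros h; rewrite (proj1 (p1 h)); ring) p0 H) as (e & X & ep & X1 & HX).
  exists e, X. split; [|split]; auto. intros t ht. specialize (HX t ht). pose proof (re_bt a s t m0 hs). pose proof (den_pos a s t m0 hs). 
  nra.
Qed.
(** It makes [exp] of a primitive of [bt] polynomially bounded at the end [s]. *)
Definition power_bounded a s := exists N X, 0 <= N /\ 1 <= X /\ forall t, X <= t -> s * re (bt a (s * t)) <= N / t.
Lemma power_bounded_decaying a s : decaying a s -> power_bounded a s.
Proof. intros (e & X & ep & X1 & H). exists 0, X. split; [lra|split; auto]. intros t ht. specialize (H t ht). lra. Qed.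
Lemma power_bounded_neutral a s : (forall x, mx a x <> C0) -> s * s = 1 -> kn3 a = 0 -> kn2 a = 0 -> (kd2 a = 0 -> kn1 a = 0 /\ kn0 a = 0) -> power_bounded a s.
Proof.
  intros m0 hs E3 E2 H. destruct (d2_facts a) as (p2 & p0 & p1).
  assert (W : exists N X, 0 <= N /\ 1 <= X /\ forall t, X <= t -> t * (kn1 a * t + s * kn0 a) <= N * (kd2 a * t ^ 2 + s * kd1 a * t + kd0 a)).
  { destruct (Req_dec (kd2 a) 0) as [h|h].
    - exists 0, 1. split; [lra|split; [lra|]]. intros t ht. nra.
    - set (N := (Rabs (kn1 a) + 1) / kd2 a). assert (0 <= N) by (apply Rdiv_le_0_compat; pose proof (Rabs_pos (kn1 a)); lra).
      destruct (cubic_ev 0 (N * kd2 a - kn1 a) (N * (s * kd1 a) - s * kn0 a) (N * kd0 a)) as (X & X1 & HX).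
      { right; left. split; auto. unfold N. replace ((Rabs (kn1 a) + 1) / kd2 a * kd2 a) with (Rabs (kn1 a) + 1) by (field; lra).
        pose proof (Rle_abs (kn1 a)). lra. }
      exists N, X. split; [auto|split; auto]. intros t ht. specialize (HX t ht). lra. }
  destruct W as (N & X & N0 & X1 & HX). exists N, X. split; [auto|split; auto]. intros t ht. specialize (HX t ht).
  pose proof (den_pos a s t m0 hs) as P. pose proof (re_bt a s t m0 hs) as E.
  rewrite E3, E2 in E. set (D := kd2 a * t ^ 2 + s * kd1 a * t + kd0 a) in *. apply Rmult_le_reg_r with (t * D); [apply Rmult_lt_0_compat; lra|].
  replace (N / t * (t * D)) with (N * D) by (field; lra). nra.
Qed.
Lemma inv_mx_bounded a : (forall x, mx a x <> C0) -> exists A, forall x, Cmod (Cinv (mx a x)) <= A.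
Proof.
  intros m0. destruct (d2_facts a) as (p2 & p0 & p1). assert (exists e, 0 < e /\ forall x, e <= kd2 a * x ^ 2 + 1 * kd1 a * x + kd0 a) as (e & ep & He).
  { destruct (Req_dec (kd2 a) 0) as [h|h].
    - exists (kd0 a). pose proof (den_pos a 1 0 m0 ltac:(lra)) as P. split; [lra|]. intros x. nra.
    - exists (kd2 a * (- kd1 a / (2 * kd2 a)) ^ 2 + 1 * kd1 a * (- kd1 a / (2 * kd2 a)) + kd0 a). split; [apply den_pos; [auto|lra]|]. intros x.
      replace (kd2 a * x ^ 2 + 1 * kd1 a * x + kd0 a) with (kd2 a * (- kd1 a / (2 * kd2 a)) ^ 2 + 1 * kd1 a * (- kd1 a / (2 * kd2 a)) + kd0 a + kd2 a * (x + kd1 a / (2 * kd2 a)) ^ 2) by (field; lra).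
      pose proof (pow2_ge_0 (x + kd1 a / (2 * kd2 a))). nra. }
  exists (/ sqrt e). intros x. rewrite Cmod_inv by auto. apply Rinv_le_contravar; [apply sqrt_lt_R0; auto|]. apply sqrt_le_1_alt. eapply Rle_trans; [apply (He x)|].
  right. unfold kd2, kd1, kd0, mx. cbn. ring.
Qed.
Lemma tr_mx a x : mx (tr a) x = (- mx a x)%cx.
Proof. unfold mx, tr. ring. Qed.
(** The leading numerator coefficient decides. Odd degrees have the same outward sign at both ends
    and even degrees opposite signs, which produces the mixed case. Transposition negates the
    coefficients up to terms in [d2] and [d1], which vanish where the lower ones matter. *)
Lemma ends_cases a : (forall x, mx a x <> C0) ->
  (growing a 1 /\ growing a (-1) /\ decaying (tr a) 1 /\ decaying (tr a) (-1)) \/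
  (exists s, s * s = 1 /\ growing a s /\ decaying a (- s) /\ decaying (tr a) s /\ growing (tr a) (- s)) \/
  (power_bounded a 1 /\ power_bounded a (-1)).
Proof.
  intros m0. assert (m0' : forall x, mx (tr a) x <> C0).
  { intros x E. apply (m0 x). rewrite tr_mx in E. transitivity (- (- mx a x))%cx; [ring|rewrite E; ring]. }
  pose proof (fun s => growing_lead a s m0) as G. pose proof (fun s => decaying_lead a s m0) as D.
  pose proof (fun s => growing_lead (tr a) s m0') as G'. pose proof (fun s => decaying_lead (tr a) s m0') as D'.
  pose proof (fun s => power_bounded_neutral a s m0) as N. pose proof (power_bounded_decaying a) as PD. destruct (d2_facts a) as (p2 & _ & p1).
  unfold kn3, kn2, kn1, kn0, kd2, kd1 in *. cbn [tr] in *.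
  set (n3 := im (a 0%nat 2%nat * Cconj (a 1%nat 1%nat))%cx) in *.
  set (n2 := im (a 0%nat 2%nat * Cconj (a 1%nat 0%nat) + a 0%nat 1%nat * Cconj (a 1%nat 1%nat))%cx) in *.
  set (n1 := im (a 0%nat 1%nat * Cconj (a 1%nat 0%nat) + a 0%nat 0%nat * Cconj (a 1%nat 1%nat))%cx) in *.
  set (n0 := im (a 0%nat 0%nat * Cconj (a 1%nat 0%nat))%cx) in *.
  set (d2 := re (a 1%nat 1%nat * Cconj (a 1%nat 1%nat))%cx) in *.
  set (d1 := re (a 1%nat 1%nat * Cconj (a 1%nat 0%nat))%cx) in *.
  assert (T3 : im (a 0%nat 2%nat * Cconj (- a 1%nat 1%nat))%cx = - n3) by (unfold n3; cbn; ring).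
  assert (T2 : im (a 0%nat 2%nat * Cconj (- a 1%nat 0%nat) + a 0%nat 1%nat * Cconj (- a 1%nat 1%nat))%cx = - n2) by (unfold n2; cbn; ring).
  assert (T1 : im (a 0%nat 1%nat * Cconj (- a 1%nat 0%nat) + (a 0%nat 0%nat + Ci * a 1%nat 1%nat) * Cconj (- a 1%nat 1%nat))%cx = - n1 - d2) by (unfold n1, d2; cbn; ring).
  assert (T0 : im ((a 0%nat 0%nat + Ci * a 1%nat 1%nat) * Cconj (- a 1%nat 0%nat))%cx = - n0 - d1) by (unfold n0, d1; cbn; ring).
  assert (Td : re (- a 1%nat 1%nat * Cconj (- a 1%nat 1%nat))%cx = d2) by (unfold d2; cbn; ring).
  rewrite T3, T2, T1, T0, Td in *.
  assert (mixed : forall s, s * s = 1 -> n3 = 0 -> (0 < s * n2 \/ (d2 = 0 /\ n2 = 0 /\ n1 = 0 /\ 0 < s * n0)) ->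
    exists s, s * s = 1 /\ growing a s /\ decaying a (- s) /\ decaying (tr a) s /\ growing (tr a) (- s)).
  { intros s hs E H. assert (hs' : - s * - s = 1) by lra. exists s. split; auto. destruct H as [h|(e2 & e1 & e0 & h)].
    - repeat split; [apply G|apply D|apply D'|apply G']; auto; right; left; split; lra.
    - assert (d1 = 0) by lra. rewrite e2, e1, e0, H in *. repeat split; [apply G|apply D|apply D'|apply G']; auto; right; right; repeat split; try lra; right; lra. }
  assert (sg : forall z, z <> 0 -> exists s, s * s = 1 /\ 0 < s * z).
  { intros z hz. destruct (Rtotal_order 0 z) as [h|[h|h]]; [exists 1|congruence|exists (-1)]; lra. }
  assert (o1 : 1 * 1 = 1) by lra. assert (o2 : -1 * -1 = 1) by lra.
  destruct (Rtotal_order 0 n3) as [h|[h|h]].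
  - left. repeat split; [apply G|apply G|apply D'|apply D']; auto; left; lra.
  - symmetry in h. destruct (Req_dec n2 0) as [e2|e2].
    + destruct (Req_dec d2 0) as [ed|ed].
      * destruct (Rtotal_order 0 n1) as [k|[k|k]].
        -- left. repeat split; [apply G|apply G|apply D'|apply D']; auto; right; right; repeat split; try lra; left; lra.
        -- destruct (Req_dec n0 0) as [e0|e0].
           ++ nn.
           ++ right; left. destruct (sg n0 e0) as (s & hs & h0). apply (mixed s hs h). auto.
        -- right; right. split; apply PD, D; auto; right; right; repeat split; try lra; left; lra.
      * right; right. split; apply N; auto; intros; contradiction.
    + right; left. destruct (sg n2 e2) as (s & hs & h0). apply (mixed s hs h). auto.
  - right; right. split; apply PD, D; auto; left; lra.
Qed.

(** * Variation of constants *)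

Definition CPr (f : R -> Cx) (x : R) : Cx := mkC (Pr (fun s => re (f s)) x) (Pr (fun s => im (f s)) x).
Lemma cder_CPr f : (forall x, ccont f x) -> forall x, cder (CPr f) x (f x).
Proof. intros H x. split; cbn [re im CPr]; [apply (Pr_derive (fun s => re (f s)))|apply (Pr_derive (fun s => im (f s)))]; intros; apply H. Qed.
Lemma moder_gx a : moder (gx a).
Proof. unfold gx. moders. Qed.
Lemma cder_inv_mx a x : (forall x, mx a x <> C0) -> cder (fun x => Cinv (mx a x)) x (- a 1%nat 1%nat * (Cinv (mx a x) * Cinv (mx a x)))%cx.
Proof.
  intros H. eapply cder_eq; [apply (cder_inv (mx a) x (a 1%nat 1%nat)); auto|ring].
  eapply cder_eq; [apply cder_add; [apply cder_scal, cder_id|apply cder_const]|ring].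
Qed.
Lemma ccont_bt a : (forall x, mx a x <> C0) -> forall x, ccont (bt a) x.
Proof.
  intros H x. apply ccont_opp, ccont_mul; [apply ccont_const|]. apply ccont_mul; [apply moder_gx|]. eapply cder_ccont, cder_inv_mx; auto.
Qed.
Definition Wf a (x : R) : Cx := cexp (CPr (bt a) x).
Lemma cder_Wf a x : (forall x, mx a x <> C0) -> cder (Wf a) x (bt a x * Wf a x)%cx.
Proof. intros H. apply cder_cexp, cder_CPr, ccont_bt; auto. Qed.
Lemma Cmod_Wf a x : Cmod (Wf a x) = exp (Pr (fun s => re (bt a s)) x).
Proof. apply Cmod_cexp. Qed.
Lemma reflect_derive (f : R -> R) s t l : is_derive f (s * t) l -> is_derive (fun t => f (s * t)) t (s * l).
Proof.
  intros H. eapply is_derive_eq; [exact (is_derive_comp f (fun t => s * t) t l s H ltac:(auto_derive; [trivial|ring]))|reflexivity].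
Qed.
Lemma sq1_Rabs s : s * s = 1 -> Rabs s = 1.
Proof. intros H. unfold Rabs. destruct (Rcase_abs s); nra. Qed.

Lemma young e u v : 0 < e -> 2 * (u * v) <= e * u ^ 2 + v ^ 2 / e.
Proof.
  intros h. replace (e * u ^ 2 + v ^ 2 / e) with (2 * (u * v) + / e * (e * u - v) ^ 2) by (field; lra).
  assert (0 <= / e * (e * u - v) ^ 2) by nn. lra.
Qed.
(** The squared modulus [V] satisfies a linear equation with rate [2 * (s * re (bt a (s * t)))] and
    a cross term. Young's inequality spends half of the damping or growth on the cross term and
    leaves a rapidly small error. *)
Lemma end_rapid a y h s : (forall x, cder y x (bt a x * y x + h x)%cx) -> rapidf h -> s * s = 1 ->
  decaying a s \/ (growing a s /\ exists A X, forall t, X <= t -> Cmod (y (s * t)) <= A) ->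
  exists X, 1 <= X /\ forall j, exists C, forall t, X <= t -> t ^ j * Cmod (y (s * t)) <= C.
Proof.
  intros Hy Hh hs H. set (V := fun t => Cmod (y (s * t)) ^ 2).
  assert (EV : forall t, V t = re (y (s * t)) ^ 2 + im (y (s * t)) ^ 2) by (intros; apply Cmod_sq).
  set (x1 := fun t => 2 * (s * (re (h (s * t)) * re (y (s * t)) + im (h (s * t)) * im (y (s * t))))).
  set (dV := fun t => 2 * (s * re (bt a (s * t))) * V t + x1 t).
  assert (HD : forall t, is_derive V t (dV t)).
  { intros t. destruct (Hy (s * t)) as [a1 a2]. apply (reflect_derive (fun t => re (y t))) in a1. apply (reflect_derive (fun t => im (y t))) in a2.
    apply (is_derive_ext (fun t => re (y (s * t)) * re (y (s * t)) + im (y (s * t)) * im (y (s * t)))); [intros; rewrite EV; cbn; ring|].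
    eapply is_derive_eq; [exact (is_derive_plus (V := R_NormedModule) _ _ t _ _ (is_derive_mult_R _ _ _ _ _ a1 a1) (is_derive_mult_R _ _ _ _ _ a2 a2))|]. unfold dV, x1. rewrite EV. cbn. ring. }
  assert (hx : forall e t, 0 < e -> Rabs (x1 t) <= e * V t + Cmod (h (s * t)) ^ 2 / e).
  { intros e t he. unfold x1. rewrite EV, Cmod_sq. set (b1 := re (h _)). set (b2 := im (h _)). set (c1 := re (y _)). set (c2 := im (y _)).
    rewrite !Rabs_mult, (sq1_Rabs s hs), (Rabs_right 2), Rmult_1_l by lra.
    eapply Rle_trans; [apply Rmult_le_compat_l; [lra|apply Rabs_triang]|]. rewrite !Rabs_mult.
    pose proof (young e (Rabs c1) (Rabs b1) he). pose proof (young e (Rabs c2) (Rabs b2) he). rewrite !pow2_abs in *. lra. }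
  assert (HC : forall j, exists C, forall t, 1 <= t -> t ^ j * Cmod (h (s * t)) ^ 2 <= C).
  { intros j. destruct (Hh j) as [C HC]. destruct (Hh 0%nat) as [D HD']. exists (C * D). intros t ht. specialize (HC (s * t)). specialize (HD' (s * t)).
    rewrite Rabs_mult, (sq1_Rabs s hs), Rmult_1_l, Rabs_right in HC by lra. rewrite Rmult_1_l in HD'.
    replace (t ^ j * Cmod (h (s * t)) ^ 2) with (t ^ j * Cmod (h (s * t)) * Cmod (h (s * t))) by lra.
    apply Rmult_le_compat; auto using Cmod_ge0. nn. }
  assert (V0 : forall t, 0 <= V t) by (intros; apply pow2_ge_0).
  assert (K : exists X, 1 <= X /\ forall j, exists C, forall t, X <= t -> t ^ j * V t <= C).
  { destruct H as [(e & X & ep & X1 & H)|[(e & X & ep & X1 & H) (A & Y & HA)]].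
    - exists X. split; auto. apply (decay_of_damping V dV e X ep X1); auto.
      intros j. destruct (HC j) as [C HCj]. exists (C / e). intros t ht. specialize (HCj t ltac:(lra)). specialize (H t ht). specialize (hx e t ep).
      specialize (V0 t).
      pose proof (Rle_abs (x1 t)). assert (0 <= t ^ j) by nn.
      apply Rle_trans with (t ^ j * (Cmod (h (s * t)) ^ 2 / e)); [|unfold Rdiv; rewrite <- Rmult_assoc; apply Rmult_le_compat_r; auto; left; apply Rinv_0_lt_compat; auto].
      apply Rmult_le_compat_l; auto. unfold dV. nra.
    - exists (Rmax X Y). pose proof (Rmax_l X Y). pose proof (Rmax_r X Y). split; [lra|]. apply (decay_of_growth V dV e (Rmax X Y) (A ^ 2) 0 ep); auto; [lra| |].
      + intros j. destruct (HC j) as [C HCj]. exists (C / e). intros t ht. specialize (HCj t ltac:(lra)). specialize (H t ltac:(lra)).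
        specialize (hx e t ep). specialize (V0 t).
        pose proof (Rle_abs (- x1 t)) as r. rewrite Rabs_Ropp in r. assert (0 <= t ^ j) by nn.
        apply Rle_trans with (t ^ j * (Cmod (h (s * t)) ^ 2 / e)); [|unfold Rdiv; rewrite <- Rmult_assoc; apply Rmult_le_compat_r; auto; left; apply Rinv_0_lt_compat; auto].
        apply Rmult_le_compat_l; auto. unfold dV. nra.
      + intros t ht. rewrite Rmult_1_r. apply (pow_incr _ _ 2). nn. }
  (* [V] is the square of the modulus, so the exponent [2 j] is used; [C + 1] bounds a number whose
     square is at most [C]. *)
  destruct K as (X & X1 & K). exists X. split; auto. intros j. destruct (K (2 * j)%nat) as [C HCj]. exists (C + 1). intros t ht. specialize (HCj t ht).
  replace (2 * j)%nat with (j * 2)%nat in HCj by lia. rewrite pow_mult in HCj. unfold V in HCj. nra.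
Qed.
Lemma ccont_bounded y X : (forall x, ccont y x) -> exists A, forall x, Rabs x <= X -> Cmod (y x) <= A.
Proof.
  intros H. destruct (Rle_dec 0 X) as [h|h]; [|exists 0; intros x hx; pose proof (Rabs_pos x); lra].
  assert (B : forall f : R -> R, (forall x, continuous f x) -> exists A, forall x, Rabs x <= X -> Rabs (f x) <= A).
  { intros f Hf. assert (Q : forall g : R -> R, (forall x, continuous g x) -> exists A, forall x, Rabs x <= X -> g x <= A).
    { intros g Hg. destruct (continuity_ab_maj g (- X) X) as (m & Hm & _); [lra|intros; apply continuity_pt_filterlim, Hg|].
      exists (g m). intros x hx. apply Hm. apply Rabs_le_between; auto. }
    destruct (Q f Hf) as [A1 H1]. destruct (Q (fun x => - f x)) as [A2 H2]. { intros; apply (continuous_opp (V := R_NormedModule)); auto. }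
    exists (Rabs A1 + Rabs A2). intros x hx. specialize (H1 x hx). specialize (H2 x hx). pose proof (Rle_abs A1). pose proof (Rle_abs A2).
    pose proof (Rabs_pos A1). pose proof (Rabs_pos A2). apply Rabs_le. lra. }
  destruct (B (fun x => re (y x))) as [A1 H1]; [intros; apply H|]. destruct (B (fun x => im (y x))) as [A2 H2]; [intros; apply H|].
  exists (A1 + A2). intros x hx. eapply Rle_trans; [apply Cmod_le_re_im|]. specialize (H1 x hx). specialize (H2 x hx). lra.
Qed.
Lemma rapidf_of_ends y : (forall x, ccont y x) ->
  (forall s, s * s = 1 -> exists X, 1 <= X /\ forall j, exists C, forall t, X <= t -> t ^ j * Cmod (y (s * t)) <= C) -> rapidf y.
Proof.
  intros Hc H j. destruct (H 1 ltac:(lra)) as (X1 & x1 & B1). destruct (H (-1) ltac:(lra)) as (X2 & x2 & B2). destruct (B1 j) as [D1 E1]. destruct (B2 j) as [D2 E2].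
  set (X := Rmax X1 X2). pose proof (Rmax_l X1 X2). pose proof (Rmax_r X1 X2). fold X in H0, H1. destruct (ccont_bounded y X Hc) as [A HA].
  assert (A0 : 0 <= A) by (eapply Rle_trans; [apply Cmod_ge0|apply (HA 0); rewrite Rabs_R0; lra]). assert (0 <= X ^ j * A) by nn.
  exists (X ^ j * A + Rabs D1 + Rabs D2). intros x. pose proof (Rle_abs D1). pose proof (Rle_abs D2). pose proof (Rabs_pos D1). pose proof (Rabs_pos D2).
  destruct (Rle_dec (Rabs x) X) as [g|g].
  - assert (Rabs x ^ j * Cmod (y x) <= X ^ j * A); [|lra]. apply Rmult_le_compat; auto using Cmod_ge0; [apply pow_le, Rabs_pos|]. apply pow_incr. nn.
  - apply Rnot_le_lt in g. rewrite <- (Rabs_Ropp x) in g |- *.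
    destruct (Rle_dec x 0) as [r|r]; [|apply Rnot_le_lt in r; rewrite Rabs_Ropp in g |- *]; rewrite Rabs_right in g |- * by lra.
    + specialize (E2 (- x) ltac:(lra)). replace (-1 * - x) with x in E2 by ring. lra.
    + specialize (E1 x ltac:(lra)). rewrite Rmult_1_l in E1. lra.
Qed.

Lemma pfam_first_order a F x : a 2%nat 0%nat = C0 -> pfam a F 0%nat x = (gx a x * F 0%nat x + mx a x * (- Ci * F 1%nat x))%cx.
Proof. intros E. unfold pfam, gx, mx, tM1, tD1. rewrite E. cbn [pred INR]. change (RtoC 0) with C0. ring. Qed.
Lemma inv_mx_l a x : (forall x, mx a x <> C0) -> (mx a x * Cinv (mx a x))%cx = C1.
Proof. intros H. rewrite <- (Cinv_l _ (H x)). ring. Qed.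
(** The equation expresses the derivative of [y] through [y], [F] and the reciprocal of [mx], so the
    class generated by [y] and the derivatives of [F] is closed under differentiation, and decay of
    [y] itself suffices. *)
Lemma ode_schwartz a F y : a 2%nat 0%nat = C0 -> (forall x, mx a x <> C0) -> schwartz1 F -> rapidf y ->
  (forall x, cder y x (bt a x * y x + Ci * (F 0%nat x * Cinv (mx a x)))%cx) ->
  exists Y, schwartz1 Y /\ Y 0%nat = y /\ pfam a Y = F.
Proof.
  intros E m0 HF Hr Hy. destruct (inv_mx_bounded a m0) as [A HA]. set (v := fun x => Cinv (mx a x)).
  set (B := fun f : R -> Cx => f = y \/ exists n, f = F n).
  assert (By : cls B v y) by (apply cls_base; left; auto). assert (BF : forall n, cls B v (F n)) by (intros n; apply cls_base; right; eauto).
  destruct (cls_schwartz B v A (- a 1%nat 1%nat)%cx) with (f := y) as (Y & SY & EY); auto.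
  { intros x. apply cder_inv_mx; auto. }
  { intros f [->|[n ->]].
    - split; auto. exists (fun x => v x * (- Ci * (a 0%nat 0%nat * y x + (a 0%nat 1%nat * (RtoC x * y x) + a 0%nat 2%nat * (RtoC x * (RtoC x * y x)))) + Ci * F 0%nat x))%cx. split.
      + apply cls_v, cls_add; [|apply cls_scal; auto]. apply cls_scal, cls_add; [apply cls_scal; auto|]. apply cls_add; apply cls_scal; repeat apply cls_x; auto.
      + intros x. eapply cder_eq; [apply Hy|]. unfold bt, gx, v. ring.
    - split; [apply rapidf_schwartz; auto|]. exists (F (S n)). split; auto. intros x. apply schwartz1_cder; auto. }
  exists Y. split; auto. split; auto. apply schwartz1_unique; auto using schwartz1_pfam. intros x. rewrite pfam_first_order by auto.
  assert (D : Y 1%nat x = (bt a x * y x + Ci * (F 0%nat x * Cinv (mx a x)))%cx).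
  { eapply cder_unique; [apply (schwartz1_cder Y SY)|]. rewrite EY. auto. }
  rewrite D, EY. unfold bt. pose proof (inv_mx_l a x m0) as I1. set (u := Cinv (mx a x)) in *. set (m := mx a x) in *.
  transitivity (gx a x * y x + (m * u) * (Ci * Ci) * (gx a x * y x - F 0%nat x))%cx; [ring|]. rewrite I1, Ci2. ring.
Qed.

(** The integrand of variation of constants: [Wf] times a constant plus its primitive solves the
    inhomogeneous equation. *)
Definition kf a (f : R -> Cx) (x : R) : Cx := (Ci * (f x * (Cinv (mx a x) * cexp (- CPr (bt a) x))))%cx.
Lemma ccont_kf a F x : (forall x, mx a x <> C0) -> schwartz1 F -> ccont (kf a (F 0%nat)) x.
Proof.
  intros m0 HF. apply ccont_mul; [apply ccont_const|]. apply ccont_mul; [apply schwartz1_ccont; auto|]. apply ccont_mul; [eapply cder_ccont, cder_inv_mx; auto|].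
  eapply cder_ccont. apply cder_cexp, cder_opp, cder_CPr, ccont_bt; auto.
Qed.
(** At a decaying end every constant [C] works; at a growing end boundedness of the solution is
    enough, because [end_rapid] upgrades it to rapid decay. *)
Lemma solve_with a F C : a 2%nat 0%nat = C0 -> (forall x, mx a x <> C0) -> schwartz1 F ->
  (forall s, s * s = 1 -> decaying a s \/ (growing a s /\ exists A X, forall t, X <= t -> Cmod (Wf a (s * t) * (C + CPr (kf a (F 0%nat)) (s * t))) <= A)) ->
  exists Y, schwartz1 Y /\ pfam a Y = F.
Proof.
  intros E m0 HF H. set (y := fun x => (Wf a x * (C + CPr (kf a (F 0%nat)) x))%cx).
  assert (Hy : forall x, cder y x (bt a x * y x + Ci * (F 0%nat x * Cinv (mx a x)))%cx).
  { intros x. eapply cder_eq; [apply cder_mul; [apply cder_Wf; auto|apply cder_add; [apply cder_const|apply cder_CPr; intros; apply ccont_kf; auto]]|].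
    unfold y. set (K := CPr (kf a (F 0%nat)) x). unfold kf, Wf. pose proof (cexp_neg (CPr (bt a) x)) as I1. set (e := cexp (- _)) in *.
    set (w := cexp (CPr (bt a) x)) in *.
    transitivity (bt a x * (w * (C + K)) + (e * w) * (Ci * (F 0%nat x * Cinv (mx a x))))%cx; [ring|]. rewrite I1. ring. }
  destruct (inv_mx_bounded a m0) as [A HA].
  assert (Hh : rapidf (fun x => Ci * (F 0%nat x * Cinv (mx a x)))%cx).
  { apply (rapidf_bmul (fun _ => Ci) _ 1); [intros; rewrite Cmod_Ci; lra|]. intros j.
    destruct (rapidf_bmul _ _ A HA (rapidf_schwartz F 0 HF) j) as [D HD]. exists D. intros x.
    replace (F 0%nat x * Cinv (mx a x))%cx with (Cinv (mx a x) * F 0%nat x)%cx by ring. auto. }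
  destruct (ode_schwartz a F y) as (Y & S1 & _ & S2); auto; [|exists Y; auto].
  apply rapidf_of_ends; [intros x; eapply cder_ccont, Hy|]. intros s hs. apply (end_rapid a y _ s Hy Hh hs). auto.
Qed.
(** The modulus of [Wf] increases towards the end, so it can be moved inside the tail integral of
    [kf], where it cancels the exponential and leaves the integrable quotient of [F] by [mx]. A
    bounded solution needs the constant [- L]. *)
Lemma growth_limit a F s : (forall x, mx a x <> C0) -> schwartz1 F -> s * s = 1 -> growing a s ->
  exists L, limp (fun t => re (CPr (kf a (F 0%nat)) (s * t))) (re L) /\ limp (fun t => im (CPr (kf a (F 0%nat)) (s * t))) (im L) /\
    exists A X, forall t, X <= t -> Cmod (Wf a (s * t) * (- L + CPr (kf a (F 0%nat)) (s * t))) <= A.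
Proof.
  intros m0 HF hs (e & X & ep & X1 & HG). set (k := kf a (F 0%nat)). assert (Hk : forall x, cder (CPr k) x (k x)) by (apply cder_CPr; intros; apply ccont_kf; auto).
  set (E := fun t => Cmod (Wf a (s * t))). assert (Ep : forall t, 0 < E t) by (intros; unfold E; rewrite Cmod_Wf; apply exp_pos).
  assert (Em : forall t r, X <= t <= r -> E t <= E r).
  { intros t r htr. unfold E. rewrite !Cmod_Wf. set (P := Pr (fun s => re (bt a s))). assert (P (s * t) <= P (s * r)).
    { pose proof (derive_compare (fun _ => 0) (fun u => P (s * u)) (fun _ => 0) (fun u => s * re (bt a (s * u))) t r ltac:(lra)) as T.
      assert (0 - 0 <= P (s * r) - P (s * t)); [|lra]. apply T.
      - intros u _; exact (is_derive_const (K := R_AbsRing) (V := R_NormedModule) 0 u).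
      - intros u _. apply reflect_derive, (Pr_derive (fun s => re (bt a s))). intros; apply (proj1 (ccont_bt a m0 _)).
      - intros u hu. specialize (HG u ltac:(lra)). lra. }
    destruct (Req_dec (P (s * t)) (P (s * r))) as [->|]; [lra|left; apply exp_increasing; lra]. }
  destruct (inv_mx_bounded a m0) as [A HA]. destruct (rapidf_schwartz F 0 HF 2%nat) as [D HD].
  assert (kb : forall t r, X <= t <= r -> E t * (Cmod (k (s * r)) * r ^ 2) <= A * D).
  { intros t r htr. unfold k, kf. rewrite !Cmod_mul, Cmod_Ci, Rmult_1_l, Cmod_cexp. specialize (HD (s * r)). specialize (HA (s * r)).
    rewrite Rabs_mult, (sq1_Rabs s hs), Rmult_1_l, pow2_abs in HD. assert (Er : E r * exp (re (- CPr (bt a) (s * r))%cx) = 1).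
    { unfold E. rewrite Cmod_Wf, <- exp_plus. rewrite Rplus_opp_r. apply exp_0. }
    set (x := exp _) in *. set (f := Cmod (F 0%nat (s * r))) in *. set (v := Cmod (Cinv _)) in *. assert (0 < x) by apply exp_pos.
    assert (0 <= v) by apply Cmod_ge0. assert (0 <= f) by apply Cmod_ge0. 
    assert (0 <= r ^ 2 * f) by nra.
    apply Rle_trans with (E r * x * (v * (r ^ 2 * f))); [|rewrite Er, Rmult_1_l; apply Rmult_le_compat; auto].
    replace (E t * (f * (v * x) * r ^ 2)) with (E t * (x * (v * (r ^ 2 * f)))) by ring. rewrite (Rmult_assoc (E r)). apply Rmult_le_compat_r; auto.
    nn. }
  assert (sub : forall c : Cx -> R, (forall z, Rabs (c z) <= Cmod z) -> (forall x, is_derive (fun t => c (CPr k t)) x (c (k x))) ->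
     exists L, limp (fun t => c (CPr k (s * t))) L /\ forall t, X <= t -> E t * Rabs (L - c (CPr k (s * t))) <= A * D).
  { intros c Hc Hd. apply (lim_at_infty _ (fun t => s * c (k (s * t))) E X); auto.
    - intros t _. apply (reflect_derive (fun t => c (CPr k t))). auto.
    - intros t r htr. rewrite Rabs_mult, (sq1_Rabs s hs), Rmult_1_l. eapply Rle_trans; [|apply (kb t r htr)].
      apply Rmult_le_compat_l; [left; auto|]. apply Rmult_le_compat_r; [apply pow2_ge_0|auto]. }
  destruct (sub re re_le_Cmod) as (l1 & lim1 & b1); [intros; apply Hk|]. destruct (sub im im_le_Cmod) as (l2 & lim2 & b2); [intros; apply Hk|].
  exists (mkC l1 l2). split; auto. split; auto. exists (A * D + A * D), X. intros t ht. rewrite Cmod_mul. fold (E t).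
  specialize (b1 t ht). specialize (b2 t ht). eapply Rle_trans; [apply Rmult_le_compat_l; [left; auto|apply Cmod_le_re_im]|]. cbn [re im Cadd Copp].
  rewrite <- (Rabs_Ropp (- l1 + _)), <- (Rabs_Ropp (- l2 + _)), !Ropp_plus_distr, !Ropp_involutive. unfold Rminus in *. lra.
Qed.

(** * Solvability and duality *)

Definition surj a : Prop := forall F, schwartz1 F -> exists Y, schwartz1 Y /\ pfam a Y = F.
Lemma pfam_tr_tr a F : pfam (tr (tr a)) F = pfam a F.
Proof. do 2 (apply functional_extensionality; intros). unfold pfam, tr. ring. Qed.
(** A Schwartz solution of the same equation differs from [w] by a kernel element. *)
Lemma GR_of_surj a : K0s a -> surj a -> GRs a.
Proof.
  intros K S w Hw Hr. destruct (S (recon (P1 a w)) (schwartz1_recon _ Hr)) as (Y & SY & EY).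
  apply rap_ext with (cf Y); [|apply rap_cf; auto]. intros n. assert (H : forall n, (w n + (- C1) * cf Y n)%cx = C0).
  { apply K; [apply tmp_add; auto; apply tmp_scal, rap_tmp, rap_cf; auto|]. intros i.
    rewrite (P1_ext a _ (fun n => C1 * w n + (- C1) * cf Y n)%cx) by (intros; ring). rewrite P1_lin, <- cf_pfam, EY, cf_recon by auto. ring.
    } transitivity (w n - (w n + (- C1) * cf Y n))%cx; [ring|rewrite H; ring].
Qed.
(** Every Hermite function is in the range of the transpose, and a kernel element pairs to 0 with
    that range. *)
Lemma K0_of_surj a : surj (tr a) -> K0s a.
Proof.
  intros S w Hw H n. destruct (S (hfam n) (schwartz1_hfam n)) as (Y & SY & EY).
  rewrite <- (pair_hfam w n), <- EY, pair_pfam by auto. transitivity (CSeries (fun _ => C0 * C0)%cx); [apply CSeries_ext; intros; rewrite H; ring|].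
  rewrite (CSeries_ext _ (fun m => if Nat.eqb m 0 then C0 else C0)); [apply (CSeries_delta 0 (fun _ => C0))|]. intros i. destruct (Nat.eqb i 0); ring.
Qed.
Lemma surj_tr_tr a : surj a -> surj (tr (tr a)).
Proof. intros S F HF. destruct (S F HF) as (Y & SY & EY). exists Y. rewrite pfam_tr_tr. auto. Qed.

(** The homogeneous solution [Wf] is then of polynomial growth and nowhere zero: a tempered kernel
    element. *)
Lemma power_bounded_not_K0 a : a 2%nat 0%nat = C0 -> (forall x, mx a x <> C0) -> power_bounded a 1 -> power_bounded a (-1) -> ~ K0s a.
Proof.
  intros E m0 H1 H2 K.
  assert (Wc : forall x, ccont (Wf a) x) by (intros; eapply cder_ccont, cder_Wf; auto).
  assert (one : forall s, s * s = 1 -> power_bounded a s -> exists N C X, 1 <= X /\ forall t, X <= t -> Cmod (Wf a (s * t)) <= C * (1 + t ^ 2) ^ N).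
  { intros s hs (N & X & N0 & X1 & H). destruct (INR_unbounded N) as (n & hn). set (P := Pr (fun s => re (bt a s))).
    exists n, (exp (P (s * X))), X. split; auto. intros t ht. rewrite Cmod_Wf. fold P.
    assert (P (s * t) - P (s * X) <= INR n * ln t - INR n * ln X).
    { apply (derive_compare (fun t => P (s * t)) (fun t => INR n * ln t) (fun t => s * re (bt a (s * t))) (fun t => INR n * / t)); auto.
      - intros u _. apply reflect_derive, (Pr_derive (fun s => re (bt a s))). intros; apply (proj1 (ccont_bt a m0 _)).
      - intros u hu. auto_derive; [lra|ring].
      - intros u hu. eapply Rle_trans; [apply H; lra|]. apply Rmult_le_compat_r; [left; apply Rinv_0_lt_compat; lra|lra]. }
    assert (0 <= ln X). { rewrite <- ln_1. destruct (Req_dec 1 X) as [->|]; [lra|left; apply ln_increasing; lra]. }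
    assert (0 <= INR n * ln X) by nra.
    apply Rle_trans with (exp (P (s * X) + INR n * ln t)).
    { destruct (Req_dec (P (s * t)) (P (s * X) + INR n * ln t)) as [->|]; [lra|left; apply exp_increasing; lra]. }
    rewrite exp_plus. apply Rmult_le_compat_l; [left; apply exp_pos|]. fold (Rpower t (INR n)). rewrite Rpower_pow by lra. apply pow_incr. nra. }
  destruct (one 1 ltac:(lra) H1) as (N1 & D1 & X1 & x1 & B1). destruct (one (-1) ltac:(lra) H2) as (N2 & D2 & X2 & x2 & B2).
  destruct (ccont_bounded (Wf a) (X1 + X2) Wc) as [A HA].
  assert (MW : moder (Wf a)).
  { split; auto. exists (Rabs A + Rabs D1 + Rabs D2), (N1 + N2)%nat. pose proof (Rle_abs A). pose proof (Rle_abs D1). pose proof (Rle_abs D2).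
    pose proof (Rabs_pos A). pose proof (Rabs_pos D1). pose proof (Rabs_pos D2).
    split; [lra|]. intros x. pose proof (sq_pow_ge1 x N1). pose proof (sq_pow_ge1 x N2). rewrite pow_add. set (p1 := (1 + x ^ 2) ^ N1) in *.
    set (p2 := (1 + x ^ 2) ^ N2) in *.
    assert (p12 : p1 <= p1 * p2 /\ p2 <= p1 * p2) by nra.
    assert (T : forall z D p, z <= D * p -> 1 <= p <= p1 * p2 -> D <= Rabs A + Rabs D1 + Rabs D2 -> z <= (Rabs A + Rabs D1 + Rabs D2) * (p1 * p2)).
    { intros z D p h1 h2 h3. nra. }
    destruct (Rle_dec (Rabs x) (X1 + X2)) as [g|g].
    - apply (T _ A 1); [rewrite Rmult_1_r; auto|lra|lra].
    - apply Rnot_le_lt in g. unfold Rabs in g. destruct (Rcase_abs x).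
      + apply (T _ D2 p2); [|lra|lra]. specialize (B2 (- x) ltac:(lra)). replace (-1 * - x) with x in B2 by ring.
        replace ((- x) ^ 2) with (x ^ 2) in B2 by ring. auto.
      + apply (T _ D1 p1); [|lra|lra]. specialize (B1 x ltac:(lra)). rewrite Rmult_1_l in B1. auto. }
  assert (HN : forall n, fs (Wf a) n = C0).
  { apply K; [apply tmp_fs; auto|]. intros n.
    rewrite (fs_P1 a (Wf a) (fun x => a 1%nat 1%nat * Wf a x + (- Ci) * (gx a x * Wf a x))%cx); auto.
    - transitivity (CI (fun x => C0 * hfam n 0 x)%cx); [|rewrite CI_scal by (apply schwartz1_nice, schwartz1_hfam); ring].
      apply CI_ext. intros x. transitivity ((gx a x * Wf a x + (Ci * Ci) * (gx a x * Wf a x)) * hfam n 0 x)%cx; [unfold gx; ring|]. rewrite Ci2. ring.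
    - pose proof (moder_gx a). moders; auto.
    - intros x. eapply cder_eq.
      + apply cder_mul; [|apply cder_Wf; auto]. apply cder_add; [apply cder_scal, cder_id|apply cder_const].
      + pose proof (inv_mx_l a x m0) as I1. cbv beta. fold (mx a x). unfold bt.
        transitivity (a 1%nat 1%nat * Wf a x + (mx a x * Cinv (mx a x)) * (- Ci * (gx a x * Wf a x)))%cx; [ring|]. rewrite I1. ring. }
  apply (cexp_neq0 (CPr (bt a) 0)). apply (moder_null (Wf a) MW).
  intros F HF. rewrite <- pair_fs by auto. replace (fs (Wf a)) with (fun _ : nat => C0 * C0)%cx by (apply functional_extensionality; intros; rewrite HN; ring).
  rewrite pair_scal_l by (auto using rap_cf; exists 0%nat, 0; intros; rewrite Cmod_C0; cbn; lra). ring.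
Qed.

Lemma mx_tr_neq0 a : (forall x, mx a x <> C0) -> forall x, mx (tr a) x <> C0.
Proof. intros m0 x E. apply (m0 x). rewrite tr_mx in E. transitivity (- (- mx a x))%cx; [ring|rewrite E; ring]. Qed.
Lemma solve_mixed a s : a 2%nat 0%nat = C0 -> (forall x, mx a x <> C0) -> s * s = 1 -> growing a s -> decaying a (- s) -> surj a.
Proof.
  intros E m0 hs HG HD F HF. destruct (growth_limit a F s m0 HF hs HG) as (L & _ & _ & HL).
  apply (solve_with a F (- L)%cx E m0 HF). intros r hr. destruct (Req_dec r s) as [->|h]; [right; auto|]. replace r with (- s); auto. nra.
Qed.
(** The homogeneous solution of the transposed equation: the reciprocal of [Wf], divided by the
    leading coefficient. *)
Definition Vf a (x : R) : Cx := (Cinv (mx a x) * cexp (- CPr (bt a) x))%cx.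
Lemma kernel_schwartz a : a 2%nat 0%nat = C0 -> (forall x, mx a x <> C0) -> decaying (tr a) 1 -> decaying (tr a) (-1) ->
  exists V, schwartz1 V /\ V 0%nat = Vf a /\ pfam (tr a) V = fam1_zero.
Proof.
  intros E m0 H1 H2. pose proof (mx_tr_neq0 a m0) as m0'.
  assert (D : forall x, cder (Vf a) x (bt (tr a) x * Vf a x + C0)%cx).
  { intros x. eapply cder_eq; [apply cder_mul; [apply cder_inv_mx; auto|apply cder_cexp, cder_opp, cder_CPr, ccont_bt; auto]|]. unfold Vf, bt.
    set (e := cexp _). assert (I : Cinv (mx (tr a) x) = (- Cinv (mx a x))%cx).
    { rewrite tr_mx. pose proof (inv_mx_l a x m0) as q. pose proof (m0' x) as nz. rewrite tr_mx in nz. pose proof (Cinv_l _ nz) as q2.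
      set (u := Cinv (- _)) in *. set (v := Cinv _) in *.
      transitivity (u * (mx a x * v))%cx; [rewrite q; ring|]. transitivity (- ((u * - mx a x) * v))%cx; [ring|]. rewrite q2. ring. }
    rewrite I. unfold tr, gx. set (v := Cinv _). set (g := (_ + _ * (RtoC x * RtoC x))%cx).
    transitivity (Ci * g * v * v * e + (Ci * Ci) * (a 1%nat 1%nat * v * v * e))%cx; [rewrite Ci2|unfold g]; ring. }
  apply ode_schwartz; auto using schwartz1_zero.
  - apply rapidf_of_ends; [intros x; eapply cder_ccont, D|]. intros s hs. apply (end_rapid (tr a) (Vf a) (fun _ => C0) s D); auto.
    + intros j. exists 0. intros. rewrite Cmod_C0. lra.
    + assert (Q : (s - 1) * (s + 1) = 0) by lra. apply Rmult_integral in Q. destruct Q; [replace s with 1 by lra|replace s with (-1) by lra]; auto.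
  - intros x. eapply cder_eq; [apply D|]. unfold fam1_zero. ring.
Qed.
(** Both ends force the constant of integration; the two values agree when [F] is orthogonal to [Vf]. *)
Lemma solve_growing a F : a 2%nat 0%nat = C0 -> (forall x, mx a x <> C0) -> growing a 1 -> growing a (-1) -> schwartz1 F ->
  CI (fun x => Vf a x * F 0%nat x)%cx = C0 -> (exists V, schwartz1 V /\ V 0%nat = Vf a) -> exists Y, schwartz1 Y /\ pfam a Y = F.
Proof.
  intros E m0 H1 H2 HF Z (V & SV & EV). destruct (growth_limit a F 1 m0 HF ltac:(lra) H1) as (L & r1 & i1 & B1).
  destruct (growth_limit a F (-1) m0 HF ltac:(lra) H2) as (M & r2 & i2 & B2). set (k := kf a (F 0%nat)) in *.
  assert (Hk : forall x, cder (CPr k) x (k x)) by (apply cder_CPr; intros; apply ccont_kf; auto).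
  assert (Zk : CI k = C0).
  { transitivity (Ci * CI (fun x => Vf a x * F 0%nat x))%cx; [|rewrite Z; ring]. rewrite <- CI_scal.
    - apply CI_ext. intros x. unfold k, kf, Vf. ring.
    - rewrite <- EV. apply schwartz1_mul2_nice; auto. }
  assert (EL : L = M).
  { apply Cx_ext.
    - apply Rminus_diag_uniq. rewrite <- (I_char (fun x => re (CPr k x)) (fun x => re (k x)) (re L) (re M)).
      + apply (f_equal re) in Zk. auto.
      + intros x; apply (proj1 (ccont_kf a F x m0 HF)). + intros; apply Hk.
      + eapply limp_ext; [|exact r1]. intros; cbv beta; rewrite Rmult_1_l; reflexivity.
      + eapply limp_ext; [|exact r2]. intros x; cbv beta. replace (-1 * x) with (- x) by ring. auto.
    - apply Rminus_diag_uniq. rewrite <- (I_char (fun x => im (CPr k x)) (fun x => im (k x)) (im L) (im M)).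
      + apply (f_equal im) in Zk. auto.
      + intros x; apply (proj2 (ccont_kf a F x m0 HF)). + intros; apply Hk.
      + eapply limp_ext; [|exact i1]. intros; cbv beta; rewrite Rmult_1_l; reflexivity.
      + eapply limp_ext; [|exact i2]. intros x; cbv beta. replace (-1 * x) with (- x) by ring. auto. }
  subst M. apply (solve_with a F (- L)%cx E m0 HF). intros s hs. assert (Q : (s - 1) * (s + 1) = 0) by lra. apply Rmult_integral in Q.
  destruct Q; [replace s with 1 by lra|replace s with (-1) by lra]; auto.
Qed.
Lemma pair_zero_l k : pair (fun _ => C0) k = C0.
Proof.
  unfold pair. rewrite (CSeries_ext _ (fun m => if Nat.eqb m 0 then C0 else C0)); [apply (CSeries_delta 0 (fun _ => C0))|].
  intros i. destruct (Nat.eqb i 0); ring.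
Qed.
(** Growth at both ends leaves one solvability condition, orthogonality to [V], which every [P1 a w]
    meets because [V] is in the kernel of the transpose. With mixed ends both operators are onto. In
    the remaining case injectivity fails. *)
Lemma nonvanishing_dichotomy a : a 2%nat 0%nat = C0 -> (forall x, mx a x <> C0) -> dichotomy a.
Proof.
  intros E m0 K. pose proof (mx_tr_neq0 a m0) as m0'. assert (E' : tr a 2%nat 0%nat = C0) by exact E.
  destruct (ends_cases a m0) as [(g1 & g2 & d1 & d2)|[(s & hs & g & d & d' & g')|(b1 & b2)]].
  - left. destruct (kernel_schwartz a E m0 d1 d2) as (V & SV & EV & PV).
    assert (sol : forall F, schwartz1 F -> CI (fun x => V 0%nat x * F 0%nat x)%cx = C0 -> exists Y, schwartz1 Y /\ pfam a Y = F).
    { intros F HF Z. rewrite EV in Z. apply solve_growing; auto. exists V; auto. }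
    split.
    + intros w Hw Hr. destruct (sol (recon (P1 a w)) (schwartz1_recon _ Hr)) as (Y & SY & EY).
      * rewrite (CI_ext _ (fun x => recon (P1 a w) 0%nat x * V 0%nat x)%cx) by (intros; ring). rewrite CI_recon by auto.
        rewrite <- pair_pfam, PV by auto. replace (cf fam1_zero) with (fun _ : nat => C0 * C0)%cx.
        -- rewrite pair_scal_r by (auto; intros K0; exists 0; intros n; rewrite Cmod_C0; lra). ring.
        -- apply functional_extensionality. intros n. pose proof (cf_scal C0 (hfam 0) n (schwartz1_hfam 0)) as q.
           transitivity (cf (fam1_scal C0 (hfam 0)) n); [rewrite q; ring|]. apply CI_ext. intros x. unfold fam1_scal, fam1_zero. ring.
      * apply rap_ext with (cf Y); [|apply rap_cf; auto]. intros n.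
        assert (H : forall n, (C1 * w n + (- C1) * cf Y n)%cx = C0).
        { apply K; [apply tmp_add; apply tmp_scal; auto; apply rap_tmp, rap_cf; auto|]. intros i. rewrite P1_lin, <- cf_pfam, EY, cf_recon by auto.
          ring. } transitivity (w n - (C1 * w n + (- C1) * cf Y n))%cx; [ring|rewrite H; ring].
    (* A test function that is not orthogonal to [V]: subtracting a multiple of it makes any test
       function solvable. *)
    + assert (exists F0, schwartz1 F0 /\ CI (fun x => V 0%nat x * F0 0%nat x)%cx <> C0) as (F0 & SF0 & nz).
      { apply NNPP. intros N. assert (V0 : forall x, V 0%nat x = C0).
        { apply moder_null; [apply moder_schwartz; auto|]. intros F HF. apply NNPP. intros h. apply N. eauto. }
        specialize (V0 0). rewrite EV in V0. apply Cmul_eq0 in V0. destruct V0 as [V0|V0]; [|apply (cexp_neq0 _ V0)].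
        pose proof (inv_mx_l a 0 m0) as q. rewrite V0 in q. apply (f_equal re) in q. cbn in q. lra. }
      set (J := CI _) in nz.
      (* Kernel elements of the transpose are multiples of [V], since they vanish on the range of
         the operator, which has codimension one. *)
      assert (kr : forall v, tmp v -> (forall n, P1 (tr a) v n = C0) -> forall n, v n = (pair v (cf F0) * Cinv J * cf V n)%cx).
      { intros v Hv Pv n. set (F := fam1_add (hfam n) (fam1_scal (- (cf V n * Cinv J))%cx F0)). assert (Sh : schwartz1 (hfam n)) by apply schwartz1_hfam.
        assert (SF : schwartz1 F) by (apply schwartz1_add; auto; apply schwartz1_scal; auto).
        assert (IJ : (Cinv J * J)%cx = C1) by (apply Cinv_l; auto).
        destruct (sol F SF) as (Y & SY & EY).
        { rewrite (CI_ext _ (fun x => hfam n 0 x * V 0%nat x + (- (cf V n * Cinv J)) * (V 0%nat x * F0 0%nat x))%cx) by (intros; unfold F, fam1_add, fam1_scal; ring).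
          assert (N1 : cnice (fun x => hfam n 0 x * V 0%nat x)%cx) by (apply schwartz1_mul2_nice; auto).
          assert (N2 : cnice (fun x => V 0%nat x * F0 0%nat x)%cx) by (apply schwartz1_mul2_nice; auto).
          rewrite (CI_add _ _ N1 (cnice_scal _ _ N2)), (CI_scal _ _ N2). fold (cf V n). fold J.
          transitivity (cf V n - cf V n * (Cinv J * J))%cx; [ring|]. rewrite IJ. ring. }
        assert (Z : pair v (cf F) = C0).
        { rewrite <- EY, <- pfam_tr_tr, pair_pfam by auto.
          replace (P1 (tr a) v) with (fun _ : nat => C0) by (apply functional_extensionality; intros; rewrite Pv; reflexivity). apply pair_zero_l. }
        assert (X : pair v (cf F) = (v n + (- (cf V n * Cinv J)) * pair v (cf F0))%cx).
        { rewrite <- (pair_hfam v n), <- pair_scal_r, <- pair_add_r by (auto using rap_cf; apply rap_scal, rap_cf; auto). f_equal.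
          apply functional_extensionality. intros i.
          unfold F. rewrite cf_add, cf_scal by (auto; apply schwartz1_scal; auto). auto. }
        rewrite Z in X. transitivity (v n + (- (cf V n * Cinv J)) * pair v (cf F0) + pair v (cf F0) * Cinv J * cf V n)%cx; [ring|]. rewrite <- X. ring. }
      intros w Hw Hr. assert (D : forall s, s * s = 1 -> decaying (tr a) s).
      { intros s hs. assert (Q : (s - 1) * (s + 1) = 0) by lra. apply Rmult_integral in Q. destruct Q; [replace s with 1 by lra|replace s with (-1) by lra]; auto. }
      (* Both ends of the transposed equation are decaying, so any constant will do, here [C0]. *)
      destruct (solve_with (tr a) (recon (P1 (tr a) w)) C0 E' m0' (schwartz1_recon _ Hr)) as (Y & SY & EY); [intros; left; auto|].
      set (v := fun n => (C1 * w n + (- C1) * cf Y n)%cx).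
      assert (Hv : tmp v) by (apply tmp_add; apply tmp_scal; auto; apply rap_tmp, rap_cf; auto).
      assert (Pv : forall n, P1 (tr a) v n = C0) by (intros n; unfold v; rewrite P1_lin, <- cf_pfam, EY, cf_recon by auto; ring).
      apply rap_ext with (fun n => pair v (cf F0) * Cinv J * cf V n + cf Y n)%cx.
      * intros n. rewrite <- kr by auto. unfold v. ring.
      * apply rap_add; [apply rap_scal|]; apply rap_cf; auto.
  - left. assert (S1 : surj a) by (apply (solve_mixed a s); auto).
    assert (S2 : surj (tr a)) by (apply (solve_mixed (tr a) (- s)); auto; [lra|rewrite Ropp_involutive; auto]).
    split; [apply GR_of_surj; auto|]. apply GR_of_surj; auto. apply K0_of_surj, surj_tr_tr; auto.
  - exfalso. apply (power_bounded_not_K0 a E m0 b1 b2 K).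
Qed.

(** * Multiplication operators *)

Lemma divide_schwartz F z : im z <> 0 -> schwartz1 F -> exists Y, schwartz1 Y /\ forall x, ((RtoC x - z) * Y 0%nat x)%cx = F 0%nat x.
Proof.
  intros hz HF.
  (* An auxiliary operator with leading coefficient [x - z], to reuse the bounds on the reciprocal
     of [mx]. *)
  set (b := fun k j : nat => match k, j with 1%nat, 1%nat => C1 | 1%nat, O => (- z)%cx | _, _ => C0 end).
  assert (m0 : forall x, mx b x <> C0).
  { intros x h. apply (f_equal im) in h. cbn in h. lra. }
  destruct (inv_mx_bounded b m0) as [A HA]. set (v := fun x => Cinv (mx b x)).
  destruct (cls_schwartz (fun f => exists n, f = F n) v A (- C1)%cx) with (f := fun x => (v x * F 0%nat x)%cx) as (Y & SY & EY); auto.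
  - intros x. apply (cder_inv_mx b x m0).
  - intros f [n ->]. split; [apply rapidf_schwartz; auto|]. exists (F (S n)). split; [apply cls_base; eauto|intros; apply schwartz1_cder; auto].
  - apply cls_v, cls_base; eauto.
  - exists Y. split; auto. intros x. rewrite EY. pose proof (inv_mx_l b x m0) as q. unfold v.
    transitivity ((mx b x * Cinv (mx b x)) * F 0%nat x)%cx; [unfold mx, b; ring|]. rewrite q. ring.
Qed.
(** By duality: every test function is [x - z] times another one, and moving that factor onto [w]
    leaves the data, whose quotient by [x - z] is Schwartz. *)
Lemma mult_regular z w : im z <> 0 -> tmp w -> rap (fun n => sM w n + (- z) * w n)%cx -> rap w.
Proof.
  intros hz Hw Hr. set (g := fun n => (sM w n + (- z) * w n)%cx) in *.
  destruct (divide_schwartz (recon g) z hz (schwartz1_recon _ Hr)) as (y & Sy & Ey).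
  apply rap_of_repr with y; auto. intros F HF. destruct (divide_schwartz F z hz HF) as (Y & SY & EY).
  assert (EF : cf F = fun n => (sM (cf Y) n + (- z) * cf Y n)%cx).
  { apply functional_extensionality. intros n. rewrite <- cf_tM, <- cf_scal, <- cf_add by (auto using schwartz1_tM, schwartz1_scal).
    apply CI_ext. intros x. rewrite <- EY. unfold fam1_add, fam1_scal, tM1. cbn [INR pred]. change (RtoC 0) with C0. ring. }
  rewrite EF, pair_add_r, pair_scal_r, <- pair_sM by (auto using rap_cf, rap_sM; apply rap_scal, rap_cf; auto).
  rewrite <- pair_scal_l, <- pair_add_l by (auto using rap_cf, tmp_sM, tmp_scal). fold g.
  rewrite <- (CI_recon g Y Hr SY). apply CI_ext. intros x. rewrite <- Ey, <- EY. ring.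
Qed.
Lemma hx_neq0 x : hx 0 x 0%nat <> C0.
Proof. intros E. apply (f_equal re) in E. cbn in E. pose proof (hr00_pos x). cbn in H. lra. Qed.
(** The delta function at a real zero of the multiplier would be in the kernel, so injectivity
    leaves only non-real zeros, and at most two divisions by linear factors conclude. *)
Lemma multiplication_dichotomy a : a 2%nat 0%nat = C0 -> a 1%nat 1%nat = C0 -> a 1%nat 0%nat = C0 -> dichotomy a.
Proof.
  intros E2 E1 E0 K.
  assert (Et : forall w n, P1 (tr a) w n = P1 a w n).
  { intros. apply P1_coef_ext; cbn [tr]; try reflexivity; rewrite ?E1, ?E0; ring. }
  destruct (P1_op_ext _ _ Et) as (G & _). enough (GRs a) by (left; split; auto; apply G; auto).
  assert (HP : forall w n, P1 a w n = (a 0%nat 0%nat * w n + a 0%nat 1%nat * sM w n + a 0%nat 2%nat * sM (sM w) n)%cx).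
  { intros. unfold P1, pol. rewrite E0, E1, E2. ring. }
  assert (nr : forall x : R, gx a x <> C0).
  { intros x h. apply (hx_neq0 x). apply K; [apply tmp_hx|]. intros n. rewrite HP.
    replace (sM (hx 0 x)) with (fun n => RtoC x * hx 0 x n)%cx by (apply functional_extensionality; intros; symmetry; apply sM_hx0).
    rewrite (functional_extensionality (fun n => RtoC x * hx 0 x n)%cx (fun n => RtoC x * hx 0 x n + C0 * hx 0 x n)%cx) by (intros; ring). rewrite sM_lin, !sM_hx0.
    transitivity (gx a x * hx 0 x n)%cx; [unfold gx; ring|]. rewrite h. ring. }
  assert (lin : forall b c w, b <> C0 -> (forall x : R, (b * RtoC x + c)%cx <> C0) -> tmp w -> rap (fun n => b * sM w n + c * w n)%cx -> rap w).
  { intros b c w hb hn Hw Hr. pose proof (Cinv_l b hb) as q. apply (mult_regular (- (Cinv b * c))%cx); auto.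
    - intros h. apply (hn (re (- (Cinv b * c)))%cx). replace (RtoC (re (- (Cinv b * c)))%cx) with (- (Cinv b * c))%cx by (apply Cx_ext; cbn [re im RtoC]; auto).
      transitivity (c - (Cinv b * b) * c)%cx; [ring|]. rewrite q. ring.
    - apply rap_ext with (fun n => Cinv b * (b * sM w n + c * w n))%cx; [|apply rap_scal; auto]. intros n.
      transitivity ((Cinv b * b) * sM w n + Cinv b * c * w n)%cx; [ring|]. rewrite q. ring. }
  intros w Hw Hr. destruct (classic (a 0%nat 2%nat = C0)) as [h2|h2].
  - destruct (classic (a 0%nat 1%nat = C0)) as [h1|h1].
    + assert (h0 : a 0%nat 0%nat <> C0). { intros h. apply (nr 0). unfold gx. rewrite h, h1, h2. ring. }
      apply rap_ext with (fun n => Cinv (a 0%nat 0%nat) * P1 a w n)%cx; [|apply rap_scal; auto]. intros n. rewrite HP, h1, h2. pose proof (Cinv_l _ h0) as q.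
      transitivity ((Cinv (a 0%nat 0%nat) * a 0%nat 0%nat) * w n)%cx; [ring|rewrite q; ring].
    + apply (lin (a 0%nat 1%nat) (a 0%nat 0%nat)); auto.
      * intros x h. apply (nr x). unfold gx. rewrite h2. eapply eq_trans; [|exact h]. ring.
      * apply rap_ext with (P1 a w); auto. intros n. rewrite HP, h2. ring.
  - set (r := a 0%nat 2%nat) in *. set (s := a 0%nat 1%nat) in *. set (t := a 0%nat 0%nat) in *.
    destruct (Cx_sqrt_ex (s * s - (C1 + C1 + C1 + C1) * r * t)%cx) as (d & Hd).
    (* [r g = (r x + (s + d) / 2) (r x + (s - d) / 2)] *)
    set (hf := RtoC (/ 2)). assert (H2 : (hf + hf)%cx = C1) by (apply Cx_ext; cbn; lra).
    assert (H4 : (hf * hf * (C1 + C1 + C1 + C1))%cx = C1) by (apply Cx_ext; cbn; lra).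
    set (c1 := (hf * (s + d))%cx). set (c2 := (hf * (s - d))%cx).
    assert (Es : (c1 + c2)%cx = s) by (unfold c1, c2; transitivity ((hf + hf) * s)%cx; [ring|rewrite H2; ring]).
    assert (Ep : (c1 * c2)%cx = (r * t)%cx).
    { unfold c1, c2. transitivity (hf * hf * (s * s - d * d))%cx; [ring|]. rewrite Hd.
      transitivity ((hf * hf * (C1 + C1 + C1 + C1)) * (r * t))%cx; [ring|rewrite H4; ring]. }
    assert (fac : forall x : R, ((r * RtoC x + c1) * (r * RtoC x + c2))%cx = (r * gx a x)%cx).
    { intros x. transitivity (r * (r * (RtoC x * RtoC x)) + r * RtoC x * (c1 + c2) + c1 * c2)%cx; [ring|]. rewrite Es, Ep. unfold gx. fold r s t. ring. }
    assert (nz : forall x : R, (r * RtoC x + c1)%cx <> C0 /\ (r * RtoC x + c2)%cx <> C0).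
    { intros x. specialize (fac x).
      split; intros h; rewrite h in fac; symmetry in fac; (apply (nr x)); (assert (q : (r * gx a x)%cx = C0) by (rewrite fac; ring)); apply Cmul_eq0 in q; destruct q; auto; contradiction. }
    apply (lin r c1); auto; [apply nz|]. apply (lin r c2); auto; [apply nz|apply tmp_add; apply tmp_scal; auto; apply tmp_sM; auto|].
    apply rap_ext with (fun n => r * P1 a w n)%cx; [|apply rap_scal; auto]. intros n. rewrite sM_lin, HP.
    transitivity (r * (r * sM (sM w) n) + r * (c1 + c2) * sM w n + (c1 * c2) * w n)%cx; [rewrite Es, Ep|]; ring.
Qed.

(** * A real zero of the leading coefficient *)

(** Coefficients of the operator [(x - c) (D + r (x - c) + s) + t], expanded. With a scalar factor
    these are all the operators with [a 2 0 = 0] and a leading coefficient that vanishes at [c]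
    only. *)
Definition nrm (c : R) (r s t : Cx) (k j : nat) : Cx :=
  match k, j with
  | 1%nat, 1%nat => C1 | 1%nat, O => RtoC (- c) | O, 2%nat => r
  | O, 1%nat => (s - (C1 + C1) * RtoC c * r)%cx | O, O => (t - s * RtoC c + r * (RtoC c * RtoC c))%cx
  | _, _ => C0
  end.
Definition Zs (c : R) (w : nat -> Cx) : nat -> Cx := fun n => (C1 * sM w n + RtoC (- c) * w n)%cx.
Definition dl (c : R) (r s : Cx) (w : nat -> Cx) : nat -> Cx := fun n =>
  (C1 * sD w n + C1 * (fun n => r * sM w n + (s - r * RtoC c) * w n) n)%cx.
Lemma RtoC_opp x : RtoC (- x) = (- RtoC x)%cx.
Proof. apply Cx_ext; cbn; ring. Qed.
Lemma P1_nrm c r s t w n : P1 (nrm c r s t) w n = (Zs c (dl c r s w) n + t * w n)%cx.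
Proof. unfold P1, pol, nrm, Zs, dl. rewrite !sM_lin, RtoC_opp. ring. Qed.
(** Hence a failure of regularity for the parameter [t] propagates to [t - i]. *)
Lemma dl_P1 c r s t w n : dl c r s (P1 (nrm c r s t) w) n = P1 (nrm c r s (t - Ci)) (dl c r s w) n.
Proof.
  rewrite P1_nrm. assert (E : P1 (nrm c r s t) w = fun n => (C1 * Zs c (dl c r s w) n + t * w n)%cx).
  { apply functional_extensionality. intros. rewrite P1_nrm. ring. }
  rewrite E. set (v := dl c r s w). unfold dl at 1. rewrite sD_lin, sM_lin. unfold Zs at 1 2. rewrite sD_lin, sM_lin, sD_sM_comm.
  assert (Ev : forall i, v i = (C1 * sD w i + C1 * (r * sM w i + (s - r * RtoC c) * w i))%cx) by reflexivity.
  unfold Zs. unfold dl at 1. rewrite !sM_lin. unfold dl. rewrite Ev, RtoC_opp. ring.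
Qed.
(** [Q] will be [null] or [rap], so that bad kernel elements and failures of regularity are treated
    by one argument. *)
Definition bad (Q : (nat -> Cx) -> Prop) c r s t : Prop := exists w, tmp w /\ Q (P1 (nrm c r s t) w) /\ ~ rap w.
Lemma tmp_dl c r s w : tmp w -> tmp (dl c r s w).
Proof. intros H. apply tmp_add; apply tmp_scal; [tmps|]. apply tmp_add; tmps. Qed.
Lemma rap_Zs c w : rap w -> rap (Zs c w).
Proof. intros H. raps. Qed.
(** The image of [w] under [dl] stays irregular, because [t * w] is recovered from the data and
    [Zs c] of that image; hence [t <> C0]. *)
Lemma bad_step Q c r s t : (forall w, Q w -> rap w) -> (forall w, Q w -> Q (dl c r s w)) -> t <> C0 ->
  bad Q c r s t -> bad Q c r s (t - Ci)%cx.
Proof.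
  intros Q1 Q2 ht (w & Hw & HQ & Hn). exists (dl c r s w). split; [apply tmp_dl; auto|]. split.
  - rewrite <- (functional_extensionality _ _ (dl_P1 c r s t w)). auto.
  - intros Hd. apply Hn. apply rap_ext with (fun n => Cinv t * (P1 (nrm c r s t) w n + (- C1) * Zs c (dl c r s w) n))%cx.
    + intros n. rewrite P1_nrm. pose proof (Cinv_l t ht) as q. transitivity ((Cinv t * t) * w n)%cx; [ring|rewrite q; ring].
    + apply rap_scal, rap_add; auto. apply rap_scal, rap_Zs; auto.
Qed.
Lemma bad_steps Q c r s t k : (forall w, Q w -> rap w) -> (forall w, Q w -> Q (dl c r s w)) ->
  (forall l, (l < k)%nat -> (t - RtoC (INR l) * Ci)%cx <> C0) -> bad Q c r s t -> bad Q c r s (t - RtoC (INR k) * Ci)%cx.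
Proof.
  intros Q1 Q2 H B. induction k as [|k IH].
  - replace (t - RtoC (INR 0) * Ci)%cx with t by (apply Cx_ext; cbn; ring). auto.
  - replace (t - RtoC (INR (S k)) * Ci)%cx with (t - RtoC (INR k) * Ci - Ci)%cx by (rewrite S_INR; apply Cx_ext; cbn; ring).
    apply bad_step; auto.
Qed.
(** Each [t] is reached from the upper half plane by steps of [- Ci] unless the way leaves from 0,
    where the step fails. This excludes only the negative integer multiples of [Ci], which are
    reached from [- Ci]. *)
Lemma bad_all Q c r s : (forall w, Q w -> rap w) -> (forall w, Q w -> Q (dl c r s w)) ->
  bad Q c r s (- Ci)%cx -> (forall t, 0 < im t -> bad Q c r s t) -> forall t, bad Q c r s t.
Proof.
  intros Q1 Q2 Hd Hp t. destruct (classic (exists j, t = (- RtoC (INR (S j)) * Ci)%cx)) as [[j ->]|N].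
  - replace (- RtoC (INR (S j)) * Ci)%cx with (- Ci - RtoC (INR j) * Ci)%cx by (rewrite S_INR; apply Cx_ext; cbn; ring).
    apply bad_steps; auto. intros l _ h. apply (f_equal im) in h. cbn in h. pose proof (pos_INR l). lra.
  - destruct (INR_unbounded (Rabs (im t))) as (k & hk). pose proof (Rle_abs (- im t)) as h. rewrite Rabs_Ropp in h.
    replace t with (t + RtoC (INR k) * Ci - RtoC (INR k) * Ci)%cx by ring. apply bad_steps; auto.
    + intros l hl E. apply N. exists (k - l - 1)%nat. replace (S (k - l - 1)) with (k - l)%nat by lia. rewrite minus_INR by lia.
      transitivity (t + RtoC (INR k) * Ci - RtoC (INR l) * Ci - (RtoC (INR k) - RtoC (INR l)) * Ci)%cx; [ring|]. rewrite E. apply Cx_ext; cbn; ring.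
    + apply Hp. cbn. lra.
Qed.

Lemma vanish_at_end f c : ccont f c -> (forall x, x < c -> f x = C0) -> f c = C0.
Proof.
  intros [H1 H2] H.
  assert (K : forall g : R -> R, continuous g c -> (forall x, x < c -> g x = 0) -> g c = 0).
  { intros g Hg Z. apply NNPP. intros N. assert (h : 0 < Rabs (g c)) by (apply Rabs_pos_lt; auto).
    destruct (proj1 (filterlim_locally _ _) Hg (mkposreal _ h)) as [[d dp] D].
    assert (B : Rabs (g (c - d / 2) - g c) < Rabs (g c)). { apply D. change (Rabs (c - d / 2 - c) < d).
    replace (c - d / 2 - c) with (- (d / 2)) by ring. rewrite Rabs_Ropp, Rabs_right; lra. }
    rewrite Z in B by lra. rewrite Rminus_0_l, Rabs_Ropp in B. lra. }
  apply Cx_ext; [apply (K (fun x => re (f x)))|apply (K (fun x => im (f x)))]; auto; intros x hx; rewrite H; auto.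
Qed.
Lemma vanishing_divides F c n : schwartz1 F -> (forall x, x < c -> F 0%nat x = C0) ->
  exists G, schwartz1 G /\ (forall x, x < c -> G 0%nat x = C0) /\ forall x, F 0%nat x = (RtoC ((x - c) ^ n) * G 0%nat x)%cx.
Proof.
  intros HF H. induction n as [|n (G & SG & ZG & EG)].
  - exists F. split; auto. split; auto. intros x. cbn [pow]. change (RtoC 1) with C1. ring.
  - destruct (hadamard G c SG) as (K & SK & EK); [apply vanish_at_end; auto; apply schwartz1_ccont; auto|].
    exists K. split; auto. split.
    + intros x hx. specialize (EK x). rewrite ZG in EK by auto. symmetry in EK. apply Cmul_eq0 in EK. destruct EK as [E|E]; auto.
      apply (f_equal re) in E. cbn in E. lra.
    + intros x. rewrite EG, EK. cbn [pow]. rewrite (Rmult_comm (x - c)), RtoC_mul. ring.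
Qed.
Lemma cder_shift_mul f c : ccont f c -> cder (fun x => RtoC (x - c) * f x)%cx c (f c).
Proof.
  assert (K : forall g : R -> R, continuous g c -> is_derive (fun x => (x - c) * g x) c (g c)).
  { intros g Hg. apply is_derive_Reals. intros eps he. destruct (proj1 (filterlim_locally _ _) Hg (mkposreal eps he)) as [[d dp] D].
    exists (mkposreal d dp). intros h h0 hd. replace (((c + h - c) * g (c + h) - (c - c) * g c) / h - g c) with (g (c + h) - g c) by (field; lra).
    apply D. change (Rabs (c + h - c) < d). replace (c + h - c) with h by ring. auto. }
  intros [H1 H2]. split; cbn [re im Cmul RtoC].
  - eapply is_derive_ext; [|exact (K _ H1)]. intros; cbn; ring.
  - eapply is_derive_ext; [|exact (K _ H2)]. intros; cbn; ring.
Qed.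

Definition null (w : nat -> Cx) : Prop := forall n, w n = C0.
Lemma null_rap w : null w -> rap w.
Proof. intros H K. exists 0. intros n. rewrite H, Cmod_C0. lra. Qed.
Lemma null_dl c r s w : null w -> null (dl c r s w).
Proof. intros H n. unfold dl, sD, sM, sA, sB. rewrite !H. ring. Qed.
Lemma rap_dl c r s w : rap w -> rap (dl c r s w).
Proof. intros H. apply rap_add; apply rap_scal; [raps|]. apply rap_add; raps. Qed.
(** [hx 0 c] holds the coefficients of the delta function at [c]: multiplication by [x - c] kills it
    and maps its image under D to [Ci] times it, which [t = - Ci] cancels. *)
Lemma delta_bad c r s : bad null c r s (- Ci)%cx.
Proof.
  exists (hx 0 c). set (w := hx 0 c). assert (Hw : tmp w) by apply tmp_hx.
  assert (EM : sM w = fun n => (RtoC c * w n + C0 * w n)%cx) by (apply functional_extensionality; intros; unfold w; rewrite sM_hx0; ring).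
  split; auto. split.
  - intros n. rewrite P1_nrm. unfold Zs. unfold dl at 1. rewrite sM_lin. pose proof (sD_sM_comm w n) as Q. rewrite EM in Q. rewrite sD_lin in Q.
    rewrite sM_lin. unfold dl. rewrite EM. rewrite sM_lin, EM, RtoC_opp.
    transitivity (sM (sD w) n - Ci * w n - RtoC c * sD w n)%cx; [ring|]. rewrite <- Q. ring.
  - intros Hr. set (G := recon w). assert (SG : schwartz1 G) by (apply schwartz1_recon; auto).
    assert (Z : forall x, (RtoC (x - c) * G 0%nat x)%cx = C0).
    { intros x. unfold G, recon. rewrite <- pair_scal_l by (auto; apply tmp_hx).
      transitivity (pair (fun n => sM (hx 0 x) n + (- RtoC c) * hx 0 x n)%cx w).
      - f_equal. apply functional_extensionality. intros n. rewrite sM_hx0. replace (RtoC (x - c)) with (RtoC x - RtoC c)%cx by (apply Cx_ext; cbn; ring). ring.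
      - rewrite pair_add_l, pair_scal_l, pair_sM by (auto using tmp_hx, tmp_sM, tmp_scal).
        rewrite EM, pair_add_r, !pair_scal_r by (auto using tmp_hx; apply rap_scal; auto). ring. }
    assert (Zl : forall x, x <> c -> G 0%nat x = C0).
    { intros x hx. specialize (Z x). apply Cmul_eq0 in Z. destruct Z as [Z|Z]; auto. apply (f_equal re) in Z. cbn in Z. lra. }
    assert (Zc : forall x, G 0%nat x = C0).
    { intros x. destruct (Req_dec x c) as [->|h]; auto. apply vanish_at_end; [apply schwartz1_ccont; auto|]. intros; apply Zl; lra. }
    apply (hx_neq0 c). fold w. rewrite <- (cf_recon w 0 Hr). transitivity (CI (fun x => C0 * hfam 0 0 x)%cx); [apply CI_ext; intros; rewrite Zc; ring|].
    rewrite CI_scal by (apply schwartz1_nice, schwartz1_hfam). ring.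
Qed.

(** * Solutions of finite smoothness at the zero *)

Definition hq (r s : Cx) (z : R) : R := im r * z ^ 2 / 2 + im s * z.
(** The homogeneous solution to the right of [c], with [z = x - c]: a complex power of [z] times the
    exponential of a quadratic, whose modulus is [exp] of [hq]. *)
Definition Wz (r s t : Cx) (z : R) : Cx := cexp (- Ci * t * RtoC (ln z) - Ci * (r * RtoC (z ^ 2 / 2) + s * RtoC z))%cx.
Lemma Cmod_Wz r s t z : Cmod (Wz r s t z) = exp (im t * ln z + hq r s z).
Proof. unfold Wz. rewrite Cmod_cexp. f_equal. unfold hq. cbn. field. Qed.
Lemma cder_Wz r s t z : 0 < z -> cder (Wz r s t) z ((- Ci * t * RtoC (/ z) - Ci * (r * RtoC z + s)) * Wz r s t z)%cx.
Proof.
  intros hz. eapply cder_eq; [apply cder_cexp|]; [|reflexivity]. eapply cder_eq.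
  - apply cder_sub; [apply cder_scal, cder_RtoC|apply cder_scal, cder_add; apply cder_scal, cder_RtoC].
    + instantiate (1 := / z). auto_derive; [lra|field; lra].
    + instantiate (1 := z). auto_derive; [trivial|field].
    + instantiate (1 := 1). auto_derive; [trivial|ring].
  - change (RtoC 1) with C1. ring.
Qed.

(** [chi] times the homogeneous solution, extended by 0 to the left of [c]. It is continuous as
    [0 < im t], but not smooth: near [c] it is at least of order [z] to the power [im t], while a
    smooth function that vanishes on the left vanishes to infinite order. *)
Lemma singular_solution c r s t (chi eta : R -> R) A b (F : fam1) : 0 < im t ->
  (forall z, 0 < z -> is_derive chi z (- eta z)) -> (forall z, 0 < z -> Rabs (chi z) * exp (hq r s z) <= A) ->
  0 < b -> (forall z, 0 < z <= 1 -> b <= chi z) ->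
  schwartz1 F -> (forall x, F 0%nat x = ext0 c (fun z => Ci * (RtoC (eta z * z) * Wz r s t z))%cx x) ->
  exists w, tmp w /\ (forall n, P1 (nrm c r s t) w n = cf F n) /\ ~ rap w.
Proof.
  intros ht Hchi HA hb Hb HF EF. set (rho := im t) in *. set (Y := ext0 c (fun z => RtoC (chi z) * Wz r s t z)%cx).
  assert (A0 : 0 <= A). { eapply Rle_trans; [|apply (HA 1); lra]. nn. }
  assert (YB : forall z, 0 < z -> Cmod (Y (z + c)%R) <= A * exp (rho * ln z)).
  { intros z hz. unfold Y. rewrite ext0_gt by lra. replace (z + c - c) with z by ring. rewrite Cmod_mul, Cmod_RtoC, Cmod_Wz, exp_plus. fold rho.
    specialize (HA z hz). pose proof (exp_pos (rho * ln z)). nra. }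
  assert (YZ : forall x, x <= c -> Y x = C0) by (intros; apply ext0_le; auto).
  assert (Yd : forall x, c < x -> cder Y x (let z := (x - c)%R in - RtoC (eta z) * Wz r s t z + RtoC (chi z) * ((- Ci * t * RtoC (/ z) - Ci * (r * RtoC z + s)) * Wz r s t z))%cx).
  { intros x hx. apply cder_ext0; auto. eapply cder_eq; [apply cder_mul; [apply cder_RtoC, Hchi; lra|apply cder_Wz; lra]|]. cbv zeta beta. rewrite RtoC_opp. ring. }
  assert (Yc : forall x, ccont Y x).
  { intros x. destruct (Rtotal_order x c) as [h|[->|h]].
    - eapply cder_ccont, (cder_vanishing Y c); auto.
    - apply ccont_small; [apply YZ; lra|]. intros eps he. set (q := ln (eps / (A + 1)) / rho). exists (exp q). split; [apply exp_pos|]. intros x hx.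
      destruct (Rle_dec x c) as [g|g]; [rewrite YZ, Cmod_C0 by auto; auto|]. apply Rnot_le_lt in g. rewrite Rabs_right in hx by lra.
      set (z := x - c) in *. assert (hz : 0 < z) by (unfold z; lra). specialize (YB z hz). replace (z + c) with x in YB by (unfold z; ring).
      assert (l : ln z < q) by (rewrite <- (ln_exp q); apply ln_increasing; auto). assert (0 < eps / (A + 1)) by nn.
      assert (e : exp (rho * ln z) < eps / (A + 1)).
      { rewrite <- (exp_ln (eps / (A + 1))) by auto. apply exp_increasing. replace (ln (eps / (A + 1))) with (rho * q) by (unfold q; field; lra). nra. }
      eapply Rle_lt_trans; [exact YB|]. apply Rle_lt_trans with (A * (eps / (A + 1))); [apply Rmult_le_compat_l; lra|].
      replace eps with ((A + 1) * (eps / (A + 1))) at 2 by (field; lra). lra.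
    - eapply cder_ccont, Yd; auto. }
  assert (MY : moder Y).
  { split; auto. destruct (INR_unbounded rho) as (N & HN). exists (A * (1 + (2 * (1 + c ^ 2)) ^ N)), N.
    assert (K : 0 <= (2 * (1 + c ^ 2)) ^ N) by nn. split; [apply Rmult_le_pos; lra|]. intros x. pose proof (sq_pow_ge1 x N).
    destruct (Rle_dec x c) as [g|g]; [rewrite YZ, Cmod_C0 by auto; apply Rmult_le_pos; [apply Rmult_le_pos|]; lra|]. apply Rnot_le_lt in g.
    specialize (YB (x - c) ltac:(lra)). replace (x - c + c) with x in YB by ring. eapply Rle_trans; [exact YB|]. rewrite Rmult_assoc. apply Rmult_le_compat_l; auto.
    set (z := x - c) in *. assert (hz : 0 < z) by (unfold z; lra).
    destruct (Rle_dec z 1) as [h|h].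
    - assert (ln z <= 0). { rewrite <- ln_1. destruct (Req_dec z 1) as [->|]; [lra|left; apply ln_increasing; lra]. }
      assert (exp (rho * ln z) <= 1) by (rewrite <- exp_0; apply exp_le; nra). nra.
    - apply Rnot_le_lt in h. assert (0 <= ln z) by (rewrite <- ln_1; left; apply ln_increasing; lra).
      assert (exp (rho * ln z) <= z ^ N) by (rewrite <- exp_ln_pow by auto; apply exp_le, Rmult_le_compat_r; lra).
      assert (z ^ N <= (2 * (1 + c ^ 2)) ^ N * (1 + x ^ 2) ^ N); [|lra]. rewrite <- Rpow_mult_distr. apply pow_incr. split; [lra|].
      assert (z <= z ^ 2) by nra. assert (z ^ 2 <= 2 * (1 + c ^ 2) * (1 + x ^ 2)); [|lra].
      unfold z. nra. }
  set (a := nrm c r s t). set (dG := fun x => (Y x + (Ci * F 0%nat x + (- Ci) * (gx a x * Y x)))%cx).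
  assert (Eg : forall x, gx a x = (r * RtoC ((x - c) ^ 2) + s * RtoC (x - c) + t)%cx) by (intros x; unfold gx, a, nrm; apply Cx_ext; cbn; ring).
  assert (HD : forall x, cder (fun x => (a 1%nat 1%nat * RtoC x + a 1%nat 0%nat) * Y x)%cx x (dG x)).
  { intros x. apply (cder_ext (fun x => RtoC (x - c) * Y x)%cx); [intros u; unfold a, nrm; f_equal; apply Cx_ext; cbn; ring|].
    destruct (Rtotal_order x c) as [h|[->|h]].
    - eapply cder_eq; [apply (cder_vanishing _ c); auto; intros u hu; rewrite YZ by auto; ring|]. unfold dG. rewrite YZ, EF, ext0_le by lra. ring.
    - eapply cder_eq; [apply cder_shift_mul; auto|]. unfold dG. rewrite YZ, EF, ext0_le by lra. ring.
    - eapply cder_eq.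
      + apply cder_mul; [apply (cder_RtoC (fun x => x - c) x 1); auto_derive; [trivial|ring]|apply Yd; auto].
      + unfold dG. rewrite Eg, EF. unfold Y. rewrite !ext0_gt by auto. set (z := x - c) in *. assert (zn : z <> 0) by (unfold z; lra). set (W := Wz r s t z).
        assert (iz : (RtoC z * RtoC (/ z))%cx = C1) by (rewrite <- RtoC_mul, Rinv_r by auto; reflexivity). rewrite RtoC_mul.
        replace (RtoC (z ^ 2)) with (RtoC z * RtoC z)%cx by (apply Cx_ext; cbn; ring).
        change (RtoC 1) with C1. set (k := RtoC (chi z)). set (e := RtoC (eta z)). set (Z := RtoC z) in *. set (i := RtoC (/ z)) in *.
        transitivity (k * W + (- (C1) * (e * Z * W) - Ci * (r * (Z * Z) + s * Z) * (k * W) - (Z * i) * (Ci * t * k * W)))%cx; [ring|]. rewrite iz.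
        transitivity (k * W + ((Ci * Ci) * (e * Z * W) - Ci * (r * (Z * Z) + s * Z + t) * (k * W)))%cx; [rewrite Ci2|]; ring. }
  exists (fs Y). split; [apply tmp_fs; auto|]. split.
  - intros n. rewrite (fs_P1 a Y dG); auto.
    + rewrite <- fs_schwartz by auto. f_equal. apply functional_extensionality. intros x. fold (gx a x). unfold dG. change (a 1%nat 1%nat) with C1.
      transitivity (- (Ci * Ci) * F 0%nat x + (Ci * Ci) * (gx a x * Y x) + gx a x * Y x)%cx; [|rewrite Ci2]; ring.
    + unfold dG. pose proof (moder_gx a). pose proof (moder_schwartz F 0 HF). moders; auto.
  - intros Hr. set (G := recon (fs Y)). assert (SG : schwartz1 G) by (apply schwartz1_recon; auto).
    assert (E : forall x, (Y x + (- C1) * G 0%nat x)%cx = C0).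
    { pose proof (moder_schwartz G 0 SG) as MG. apply moder_null; [moders; auto|]. intros K HK.
      rewrite (CI_ext _ (fun x => Y x * K 0%nat x + (- C1) * (G 0%nat x * K 0%nat x))%cx) by (intros; ring).
      pose proof (moder_cnice Y K 0 MY HK) as N1. pose proof (moder_cnice _ K 0 MG HK) as N2. rewrite (CI_add _ _ N1 (cnice_scal _ _ N2)), (CI_scal _ _ N2).
      unfold G. rewrite CI_recon, pair_fs by auto. ring. }
    assert (EY : forall x, Y x = G 0%nat x). { intros x. transitivity (Y x + (- C1) * G 0%nat x + G 0%nat x)%cx; [ring|rewrite E; ring]. }
    (* [N] exceeds the order [rho] of [Y] at [c], so divisibility by [(x - c) ^ (N + 1)] contradicts
       the lower bound for small [z]. *)
    destruct (INR_unbounded rho) as (N & HN). destruct (vanishing_divides G c (S N) SG) as (K & SK & _ & EK); [intros x hx; rewrite <- EY; apply YZ; lra|].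
    destruct (schwartz1_bd K SK 0) as [B HB]. assert (B0 : 0 <= B) by (apply (bd1_nonneg _ _ _ HB)).
    set (m := exp (- (Rabs (im r) + Rabs (im s)))). assert (mp : 0 < m) by apply exp_pos.
    assert (low : forall z, 0 < z <= 1 -> b * m <= B * z).
    { intros z hz. assert (L : b * (z ^ N * m) <= Cmod (Y (z + c)%R)).
      { unfold Y. rewrite ext0_gt by lra. replace (z + c - c) with z by ring. specialize (Hb z hz).
        rewrite Cmod_mul, Cmod_RtoC, Cmod_Wz, Rabs_right by lra. fold rho. rewrite exp_plus.
        assert (ln z <= 0). { rewrite <- ln_1. destruct (Req_dec z 1) as [->|]; [lra|left; apply ln_increasing; lra]. }
        assert (z ^ N <= exp (rho * ln z)) by (rewrite <- exp_ln_pow by lra; apply exp_le; nra).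
        assert (m <= exp (hq r s z)).
        { apply exp_le. unfold hq. pose proof (Rle_abs (- im r)) as q1. pose proof (Rle_abs (- im s)) as q2. rewrite Rabs_Ropp in q1, q2.
          pose proof (Rabs_pos (im r)). pose proof (Rabs_pos (im s)).
          assert (z2 : 0 <= z ^ 2 <= 1) by nra. nra. }
        pose proof (pow_lt z N ltac:(lra)). apply Rmult_le_compat; try lra; [apply Rmult_le_pos; lra|]. nra. }
      rewrite EY, EK, Cmod_mul, Cmod_RtoC in L. replace (z + c - c) with z in L by ring. pose proof (pow_lt z N ltac:(lra)). rewrite Rabs_right in L by nn.
      specialize (HB 0%nat 0%nat (z + c) ltac:(lia) ltac:(lia)). cbn [pow] in HB, L. rewrite Rmult_1_l in HB.
      apply Rmult_le_reg_l with (z ^ N); auto. apply Rle_trans with (z * z ^ N * Cmod (K 0%nat (z + c))); [lra|].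
      replace (z ^ N * (B * z)) with (z * z ^ N * B) by ring. apply Rmult_le_compat_l; auto. nra. } set (z := Rmin 1 (b * m / (2 * (B + 1)))).
    assert (0 < b * m / (2 * (B + 1))) by nn. assert (z0 : 0 < z <= 1) by (split; [apply Rmin_pos; lra|apply Rmin_l]).
    specialize (low z z0). assert (z <= b * m / (2 * (B + 1))) by apply Rmin_r.
    assert ((2 * (B + 1)) * (b * m / (2 * (B + 1))) = b * m) by (field; lra). nra.
Qed.

(** With [hq] bounded above the homogeneous solution is itself tempered: [chi] is constant and the
    data vanish. *)
Lemma kernel_bad c r s H : (forall z, 0 < z -> hq r s z <= H) -> forall t, bad null c r s t.
Proof.
  intros Hh. apply bad_all; auto using null_rap, null_dl, delta_bad.
  intros t ht. destruct (singular_solution c r s t (fun _ => 1) (fun _ => 0) (exp H) 1 fam1_zero ht) as (w & Hw & E & N).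
  - intros z _. eapply is_derive_eq; [exact (is_derive_const (K := R_AbsRing) (V := R_NormedModule) 1 z)|]. change (0 = - 0). ring.
  - intros z hz. rewrite Rabs_R1, Rmult_1_l. apply exp_le; auto.
  - lra.
  - nn.
  - apply schwartz1_zero.
  - intros x. unfold fam1_zero, ext0. destruct (Rlt_dec c x); auto. rewrite Rmult_0_l. change (RtoC 0) with C0. ring.
  - exists w. split; auto. split; auto. intros n. rewrite E. transitivity (CI (fun x => C0 * hfam n 0 x)%cx); [apply CI_ext; intros; unfold fam1_zero; ring|].
    rewrite CI_scal by (apply schwartz1_nice, schwartz1_hfam). ring.
Qed.
(** The homogeneous solution may grow too fast to be tempered, so [chi] is the tail integral of a
    positive [eta] that is flat at 0 and of size at most [exp (- z ^ 2 - hq r s z)]. The product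
    then grows polynomially, and the data [eta z * z * Wz] are Schwartz. *)
Lemma growing_bad c r s X H : 1 <= X -> (forall y z, X <= y <= z -> hq r s y <= hq r s z) -> (forall z, 0 < z -> - hq r s z <= H) ->
  forall t, bad rap c r s t.
Proof.
  intros X1 Hm Hh. apply bad_all; auto using rap_dl.
  { destruct (delta_bad c r s) as (w & h1 & h2 & h3). exists w. auto using null_rap. }
  intros t ht.
  (* [eta] extended by 0 to a Schwartz function, so that its primitive on the whole line is
     available. *)
  destruct (flat_family 0 C0 (- RtoC (im s))%cx (- RtoC (im r / 2))%cx H) as (E & SE & EE).
  { intros z hz. specialize (Hh z hz). unfold hq in Hh. cbn. lra. }
  set (eta := fun v => exp (- / v - v ^ 2 - hq r s v)). set (et := fun v => re (E 0%nat v)).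
  assert (Ee : forall v, 0 < v -> et v = eta v).
  { intros v hv. unfold et. rewrite EE, ext0_gt by auto. unfold eta, phase, cexp. cbn.
    match goal with |- exp ?u * cos ?w = exp ?q => replace w with 0 by ring; replace u with q by (unfold hq; cbn; field; lra) end. rewrite cos_0. ring. }
  assert (E0 : forall v, v <= 0 -> et v = 0) by (intros v hv; unfold et; rewrite EE, ext0_le by auto; reflexivity).
  assert (Ep : forall v, 0 <= et v). { intros v. destruct (Rle_dec v 0) as [h|h]; [rewrite E0 by auto; lra|]. rewrite Ee by lra. left; apply exp_pos. }
  assert (Ec : forall v, continuous et v) by (intros; apply (schwartz1_ccont E SE)).
  pose proof (Pr_derive et Ec) as PD. set (P := Pr et) in *.
  assert (mono : forall u v, u <= v -> P u <= P v).
  { intros u v huv. pose proof (derive_compare (fun _ => 0) P (fun _ => 0) et u v huv) as T. assert (0 - 0 <= P v - P u); [|lra]. apply T; auto.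
    intros x _. exact (is_derive_const (K := R_AbsRing) (V := R_NormedModule) 0 x). }
  destruct (lim_at_infty P et (fun z => exp (hq r s z)) X 1 X1) as (L & HL & BL).
  { auto. } { nn. }
  { intros y z hyz. rewrite Ee, Rabs_right by (try lra; left; apply exp_pos). specialize (Hm y z hyz). pose proof (Rinv_0_lt_compat z ltac:(lra)).
    assert (exp (- / z - z ^ 2 - hq r s z) <= exp (- hq r s y) * exp (- z ^ 2)) by (rewrite <- exp_plus; apply exp_le; lra).
    assert (Z : exp (- z ^ 2) * z ^ 2 <= 1).
    { rewrite exp_Ropp. pose proof (exp_ineq1_le (z ^ 2)). pose proof (exp_pos (z ^ 2)). apply Rmult_le_reg_l with (exp (z ^ 2)); auto.
      rewrite <- Rmult_assoc, Rinv_r by lra. lra. }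
    pose proof (exp_pos (hq r s y)) as e1. pose proof (pow2_ge_0 z).
    apply Rle_trans with (exp (hq r s y) * (exp (- hq r s y) * exp (- z ^ 2) * z ^ 2)); [apply Rmult_le_compat_l; [lra|apply Rmult_le_compat_r; auto]|].
    replace (exp (hq r s y) * (exp (- hq r s y) * exp (- z ^ 2) * z ^ 2)) with (exp (hq r s y) * exp (- hq r s y) * (exp (- z ^ 2) * z ^ 2)) by ring.
    rewrite <- exp_plus, Rplus_opp_r, exp_0. lra. }
  assert (PL : forall z, P z <= L).
  { intros z. apply le_epsilon. intros e he. destruct (HL e he) as [T HT]. specialize (HT (Rmax T z) (Rmax_l _ _)).
    pose proof (mono z (Rmax T z) (Rmax_r _ _)). apply Rabs_def2 in HT. lra. }
  set (chi := fun z => L - P z). 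
  assert (b0 : 0 < chi 1).
  { unfold chi. destruct (MVT_ex P et 1 2 ltac:(lra)) as (q & hq' & e); [intros; apply PD|]. rewrite Ee in e by lra.
    pose proof (exp_pos (- / q - q ^ 2 - hq r s q)) as ep. fold (eta q) in ep. specialize (PL 2). lra. }
  destruct (ccont_bounded (fun z => RtoC (exp (hq r s z))) X) as [A HA].
  { intros x. apply ccont_RtoC. eapply is_derive_continuous. unfold hq. auto_derive; [trivial|reflexivity]. }
  (* The exponents of [eta z * z * Wz]: the contribution of [- hq] cancels the growth of [Wz], so
     the real part of the linear and quadratic terms is 0. *)
  destruct (flat_family c (C1 - Ci * t)%cx (- RtoC (im s) - Ci * s)%cx (- RtoC (im r / 2) - Ci * r * RtoC (/ 2))%cx 0) as (F & SF & EF).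
  { intros z _. cbn. lra. }
  assert (chp : forall z, 0 <= chi z) by (intros z; unfold chi; specialize (PL z); lra).
  destruct (singular_solution c r s t chi eta (1 + (L - P 0) * A) (chi 1) (fam1_scal Ci F) ht) as (w & Hw & Ew & N).
  - intros z hz. rewrite <- Ee by auto.
    eapply is_derive_eq; [exact (is_derive_minus (V := R_NormedModule) _ _ z _ _ (is_derive_const (V := R_NormedModule) L z) (PD z))|].
    change (0 - et z = - et z). ring.
  - intros z hz. rewrite Rabs_right by nn. pose proof (exp_pos (hq r s z)).
    assert (A1 : 0 <= A). { eapply Rle_trans; [apply Cmod_ge0|apply (HA 0); rewrite Rabs_R0; lra]. } specialize (PL 0) as P0.
    assert (0 <= (L - P 0) * A) by nra. destruct (Rle_dec X z) as [g|g].
    + specialize (BL z g). rewrite Rabs_right in BL by (apply Rle_ge; apply chp). unfold chi. lra.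
    + apply Rnot_le_lt in g. specialize (HA z ltac:(rewrite Rabs_right; lra)). rewrite Cmod_RtoC, Rabs_right in HA by lra.
      assert (chi z <= L - P 0) by (unfold chi; pose proof (mono 0 z ltac:(lra)); lra). nra.
  - auto.
  - intros z hz. unfold chi. pose proof (mono z 1 ltac:(lra)). lra.
  - apply schwartz1_scal; auto.
  - intros x. unfold fam1_scal. rewrite EF. unfold ext0. destruct (Rlt_dec c x) as [h|h]; [|ring]. set (z := x - c). assert (hz : 0 < z) by (unfold z; lra).
    f_equal. assert (Ez : eta z * z = exp (- / z - z ^ 2 - hq r s z + ln z)) by (rewrite exp_plus, exp_ln by auto; reflexivity). rewrite Ez. apply Cx_ext; cbn.
    + match goal with |- exp ?p * cos ?q = ?e * (exp ?u * cos ?v) - 0 * _ => transitivity (e * exp u * cos v); [|ring]; rewrite <- exp_plus; replace v with q by lra end. f_equal. f_equal. unfold hq. lra.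
    + match goal with |- exp ?p * sin ?q = ?e * (exp ?u * sin ?v) + 0 * _ => transitivity (e * exp u * sin v); [|ring]; rewrite <- exp_plus; replace v with q by lra end. f_equal. f_equal. unfold hq. lra.
  - exists w. split; auto. split; auto. rewrite (functional_extensionality _ _ Ew). apply rap_cf, schwartz1_scal; auto.
Qed.

Lemma quadratic_bounded al be : al < 0 \/ (al = 0 /\ be <= 0) -> exists H, forall z, 0 < z -> al * z ^ 2 / 2 + be * z <= H.
Proof.
  intros [h|[-> h]].
  - exists (be ^ 2 / (- 2 * al)). intros z _.
    replace (al * z ^ 2 / 2 + be * z) with (be ^ 2 / (- 2 * al) - (- al) * (z + be / al) ^ 2 / 2) by (field; lra).
    pose proof (pow2_ge_0 (z + be / al)). nra.
  - exists 0. intros z hz. nra.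
Qed.
(** In normal form the transpose has the parameters [- r], [- s] and [- t - Ci], so [hq] changes
    sign. If [hq] is bounded above, there is a kernel, against injectivity; otherwise [- hq] is, so
    the operator is irregular and its transpose has a kernel element that is not Schwartz. *)
Lemma real_root_dichotomy a c : a 2%nat 0%nat = C0 -> a 1%nat 1%nat <> C0 -> a 1%nat 0%nat = (- (a 1%nat 1%nat * RtoC c))%cx -> dichotomy a.
Proof.
  intros E2 hp E0 K. set (p := a 1%nat 1%nat) in *. set (v := Cinv p). assert (iv : (p * v)%cx = C1) by (rewrite <- (Cinv_l p hp); unfold v; ring).
  set (r := (v * a 0%nat 2%nat)%cx). set (s := (v * (a 0%nat 1%nat + (C1 + C1) * RtoC c * a 0%nat 2%nat))%cx).
  set (t := (v * (a 0%nat 0%nat + a 0%nat 1%nat * RtoC c + a 0%nat 2%nat * (RtoC c * RtoC c)))%cx).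
  assert (pr : (p * r)%cx = a 0%nat 2%nat) by (unfold r; transitivity ((p * v) * a 0%nat 2%nat)%cx; [ring|rewrite iv; ring]).
  assert (ps : (p * s)%cx = (a 0%nat 1%nat + (C1 + C1) * RtoC c * a 0%nat 2%nat)%cx).
  { unfold s. transitivity ((p * v) * (a 0%nat 1%nat + (C1 + C1) * RtoC c * a 0%nat 2%nat))%cx; [ring|rewrite iv; ring]. }
  assert (pt : (p * t)%cx = (a 0%nat 0%nat + a 0%nat 1%nat * RtoC c + a 0%nat 2%nat * (RtoC c * RtoC c))%cx).
  { unfold t. transitivity ((p * v) * (a 0%nat 0%nat + a 0%nat 1%nat * RtoC c + a 0%nat 2%nat * (RtoC c * RtoC c)))%cx; [ring|rewrite iv; ring]. }
  assert (EP : forall w n, P1 a w n = (p * P1 (nrm c r s t) w n)%cx).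
  { intros w n. unfold P1, pol, nrm. rewrite E2, E0, RtoC_opp. fold p. set (x0 := w n). set (x1 := sM w n). set (x2 := sM (sM w) n).
    set (y1 := sD w n). set (y2 := sM (sD w) n).
    transitivity ((p * t - p * s * RtoC c + p * r * (RtoC c * RtoC c)) * x0 + (p * s - (C1 + C1) * RtoC c * (p * r)) * x1 + (p * r) * x2 - p * RtoC c * y1 + p * y2)%cx; [rewrite pr, ps, pt|]; ring. }
  assert (EPt : forall w n, P1 (tr a) w n = (- p * P1 (nrm c (- r) (- s) (- t - Ci)) w n)%cx).
  { intros w n. unfold P1, pol, nrm. cbn [tr]. rewrite E2, E0, RtoC_opp. fold p. set (x0 := w n). set (x1 := sM w n). set (x2 := sM (sM w) n).
    set (y1 := sD w n). set (y2 := sM (sD w) n).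
    transitivity ((p * t - p * s * RtoC c + p * r * (RtoC c * RtoC c) + Ci * p) * x0 + (p * s - (C1 + C1) * RtoC c * (p * r)) * x1 + (p * r) * x2 + p * RtoC c * y1 - p * y2)%cx; [rewrite pr, ps, pt|]; ring. }
  assert (NK : forall H, (forall z, 0 < z -> hq r s z <= H) -> False).
  { intros H hH. destruct (kernel_bad c r s H hH t) as (w & Hw & Pw & N). apply N. apply null_rap. intros i. apply (K w Hw). intros n. rewrite EP, Pw. ring. }
  assert (hneg : forall z, hq (- r) (- s) z = - hq r s z) by (intros; unfold hq; cbn [im Copp]; lra).
  assert (sg : (im r < 0 \/ (im r = 0 /\ im s <= 0)) \/ (0 < im r \/ (im r = 0 /\ 0 < im s))) by lra.
  destruct sg as [g|g]; [destruct (quadratic_bounded _ _ g) as [H hH]; exfalso; apply (NK H hH)|].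
  right. destruct (quadratic_bounded (im (- r)) (im (- s))) as [H hH]; [cbn [im Copp]; lra|]. split.
  (* When [im r] is positive, the quadratic [hq] increases beyond [- im s / im r]; otherwise
     [im r = 0] and it is increasing throughout. *)
  - intros G. destruct (growing_bad c r s (if Rlt_dec 0 (im r) then Rmax 1 (- im s / im r) else 1) H) with t as (w & Hw & Pw & N).
    + destruct (Rlt_dec 0 (im r)); [apply Rmax_l|lra].
    + intros y z hyz. assert (Q : 0 <= (z - y) * (im r * ((y + z) / 2) + im s)).
      { apply Rmult_le_pos; [lra|]. destruct (Rlt_dec 0 (im r)) as [h|h].
        - pose proof (Rmax_r 1 (- im s / im r)). assert (im r * (- im s / im r) = - im s) by (field; lra). nra.
        - nra. }
      unfold hq. lra.
    + intros z hz. rewrite <- hneg. apply hH; auto.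
    + apply N. apply G; auto. apply rap_ext with (fun n => p * P1 (nrm c r s t) w n)%cx; [intros; symmetry; apply EP|apply rap_scal; auto].
  - intros G. destruct (kernel_bad c (- r)%cx (- s)%cx H hH (- t - Ci)%cx) as (w & Hw & Pw & N). apply N. apply G; auto. intros n. rewrite EPt, Pw. ring.
Qed.
Lemma first_order_dichotomy a : a 2%nat 0%nat = C0 -> dichotomy a.
Proof.
  intros E2. destruct (classic (a 1%nat 1%nat = C0)) as [h1|h1].
  - destruct (classic (a 1%nat 0%nat = C0)) as [h0|h0]; [apply multiplication_dichotomy; auto|].
    apply nonvanishing_dichotomy; auto. intros x h. apply h0. unfold mx in h. rewrite h1 in h. eapply eq_trans; [|exact h]. ring.
  - set (p := a 1%nat 1%nat) in *. set (z := (- (Cinv p * a 1%nat 0%nat))%cx). pose proof (Cinv_l p h1) as iv.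
    assert (Ez : a 1%nat 0%nat = (- (p * z))%cx) by (unfold z; transitivity ((Cinv p * p) * a 1%nat 0%nat)%cx; [rewrite iv|]; ring).
    destruct (Req_dec (im z) 0) as [hz|hz].
    + apply (real_root_dichotomy a (re z)); auto. replace (RtoC (re z)) with z by (apply Cx_ext; cbn; auto). auto.
    + apply nonvanishing_dichotomy; auto. intros x h. unfold mx in h. fold p in h. rewrite Ez in h.
      assert (q : (p * (RtoC x - z))%cx = C0) by (eapply eq_trans; [|exact h]; ring). apply Cmul_eq0 in q. destruct q as [q|q]; [contradiction|].
      apply (f_equal im) in q. cbn [im Csub Cadd Copp RtoC C0] in q. lra.
Qed.
Lemma dichotomy_all a : dichotomy a.
Proof. apply dichotomy_of_first_order, first_order_dichotomy. Qed.

Theorem theorem4p1 (al be ga de : R) (a : nat -> nat -> Cx)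
  (Hdet : al * de - be * ga = 1) (Hbd : be * de <> 0)
  (Hord : Cmod (a 2%nat 0%nat) + Cmod (a 1%nat 1%nat) + Cmod (a 0%nat 2%nat) <> 0) :
  (glob_reg2 (twisted 2 a al be ga de) <->
     (ker_zero1 (source 2 a) /\ glob_reg1 (source 2 a))) /\
  (glob_reg2 (twisted 2 a al be ga de) <->
     (ker_zero1 (source 2 a) /\ glob_reg1 (source_t 2 a))) /\
  (glob_reg2 (twisted 2 a al be ga de) <->
     (ker_zero1 (source 2 a) /\ ker_in_S1 (source_t 2 a))).
Proof.
  assert (hb : be <> 0) by (intros ->; apply Hbd; ring).
  assert (E1 : glob_reg2 (twisted 2 a al be ga de) <-> K0s a /\ GRs a).
  { rewrite glob_reg2_iff, GR2_iff, (canon_GR _ _ _ _ _ (canon_twisted al be ga de Hdet hb)).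
    split; [intros G; split; [apply GR2s_ker|apply GR2s_GRs]; auto|intros [K G]; apply GR2s_of_1d; auto]. }
  rewrite E1, (ker_zero1_iff _ _ (source_pol a)), (glob_reg1_iff _ _ (source_pol a)), (glob_reg1_iff _ _ (source_t_pol a)), (ker_in_S1_iff _ _ (source_t_pol a)).
  (* The zero sequence is rapidly decreasing, so regularity of the transpose puts its kernel in the
     Schwartz space; with the dichotomy the rest is propositional. *)
  assert (GK : GRs (tr a) -> KSs (tr a)) by (intros G w Hw Hn; apply G; auto; apply null_rap; auto).
  pose proof (dichotomy_all a) as D. unfold dichotomy in D. tauto.
Qed.
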